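(* Let $(b_k)_{k\ge1}$ be i.i.d. real random variables with $\mathbb E b_1^2<\infty$. Let $(a_{k,N})_{1\le k\le N,\,N\ge1}$ be real random variables forming an independent family, independent of $(b_k)_{k\ge1}$, with $\frac1N\sum_{k=1}^N\mathbb E|a_{k,N}|^2\to0$ as $N\to\infty$. Let $(\sigma_{k,N})_{1\le k\le N,\,N\ge1}$ be a deterministic real triangular array such that, for some probability measure $\mu_T$ on $\mathbb R$, $$\eta_N:=\frac1{N-1}\sum_{k=1}^{N-1}\delta_{(\sigma_{k,N},\sigma_{k+1,N})}\Rightarrow\mathcal L(T,T)\quad(N\to\infty),\qquad T\sim\mu_T .$$ Let $X_N^\sigma$ be the $N\times N$ real symmetric tridiagonal matrix with $X_N^\sigma(i,i)=a_{N+1-i,N}$ for $1\le i\le N$ and $X_N^\sigma(N-k,N-k+1)=X_N^\sigma(N-k+1,N-k)=\sigma_{k,N}b_k$ for $1\le k\le N-1$. Then there is a probability measure $\mu_b$ on $\mathbb R$, depending only on the law of $b_1$, such that the following hold. (i) For $z\in\mathbb C$ with $\Im z>\sqrt{\mathbb E b_1^2}$, the law $\mu_b$ is characterized by $$S_{\mu_b}(z)=\mathbb E\left[\frac1{z-b_1^2S_1(z)-b_2^2S_2(z)}\right],$$ where $b_1,b_2$ are i.i.d. copies of a variable $b$ with the common law of the off-diagonal variables, $S_1(z),S_2(z)$ are i.i.d. random variables with values in the closed lower half-plane, all four variables are independent, and $$S_j(z)\stackrel d=\frac1{z-b^2S_j(z)},\qquad j=1,2,$$ where in each equation $b$ is a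 fresh copy of the off-diagonal variable, independent of $S_j(z)$. On the remainder of $\mathbb C^+=\{\Im z>0\}$, $S_{\mu_b}$ is the unique analytic continuation of this expression. (ii) The empirical spectral distribution $\mu_{X_N^\sigma}$ converges weakly almost surely to $\mu_{T,b}:=\mathcal L(TX)$, where $T\sim\mu_T$ and $X\sim\mu_b$ are independent. In particular $S_{\mu_{T,b}}(z)=\int_{\mathbb R^2}\frac{1}{z-tx}\,d\mu_T(t)\,d\mu_b(x)$ for $z\in\mathbb C^+$. (iii) If, in addition, $\mathbb E T^2<\infty$ and $W_2(\overline\nu_N,\mu_T)\to0$, where $\overline\nu_N:=\frac1{N-1}\sum_{k=1}^{N-1}\delta_{\sigma_{k,N}}$, then $W_2(\mu_{X_N^\sigma},\mu_{T,b})\to0$ in probability.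
   Context: The empirical spectral distribution of an $N\times N$ Hermitian matrix $A$ with eigenvalues $\lambda_1,\dots,\lambda_N$ (with multiplicity) is $\mu_A=\frac1N\sum_{i=1}^N\delta_{\lambda_i}$. The Stieltjes transform of a probability measure $\mu$ on $\mathbb R$ is $S_\mu(z)=\int_{\mathbb R}\frac{1}{z-x}\,d\mu(x)$ for $z\in\mathbb C^+$. $\mathcal L(Y)$ is the law of $Y$, $\stackrel d=$ is equality in distribution, $\Rightarrow$ is weak convergence of probability measures. $W_2$ is the 2-Wasserstein distance on probability measures on $\mathbb R$ with finite second moment: $W_2(\mu,\nu)=\inf_{\pi}\left(\int|x-y|^2\,d\pi(x,y)\right)^{1/2}$ over couplings $\pi$ of $\mu$ and $\nu$. *)

(* Defs.v *)
From HB Require Import structures.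
From mathcomp Require Import all_boot all_order all_algebra.
From mathcomp Require Import complex finmap.
From mathcomp Require Import all_classical all_reals all_analysis.
From mathcomp Require Import measurable_realfun giry.

Set Implicit Arguments.
Unset Strict Implicit.
Unset Printing Implicit Defensive.

Import Order.TTheory GRing.Theory Num.Theory.
Import numFieldNormedType.Exports.

Local Open Scope classical_set_scope.
Local Open Scope ring_scope.
Local Open Scope complex_scope.

(* R[i] with its Borel sigma-algebra; R[i]^o carries the norm topology. *)
Definition borelC (R : realType) := g_sigma_algebraType (@open R[i]^o).

(* Only the indices in D are involved. *)
Definition mutually_independent d (Omega : measurableType d) (R : realType)
    (P : probability Omega R) (I : choiceType) (D : set I)
    (X : I -> {RV P >-> R}) :=
  forall (J : {fset I}) (A : I -> set R),
    (forall i, i \in J -> D i) -> (forall i, measurable (A i)) ->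
    P (\bigcap_(i in [set` J]) (X i @^-1` A i)) =
    (\prod_(i <- J) P (X i @^-1` A i))%E.

Definition Cintegral d (T : measurableType d) (R : realType)
    (mu : {measure set T -> \bar R}) (f : T -> R[i]) : R[i] :=
  (\int[mu]_x complex.Re (f x)) +i* (\int[mu]_x complex.Im (f x)).

Definition stieltjes (R : realType) (mu : {measure set R -> \bar R})
    (z : R[i]) : R[i] :=
  Cintegral mu (fun x : R => (z - x%:C)^-1).

Definition analytic_on (R : realType) (U : set R[i]) (f : R[i] -> R[i]) :=
  forall z, U z -> derivable (f : R[i]^o -> R[i]^o) z 1.

Definition upper_half_plane (R : realType) : set R[i] :=
  [set z | 0 < complex.Im z].

(* With multiplicity; this is the zero measure when s is empty. *)
Definition empirical_measure d (T : measurableType d) (R : realType)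
    (s : seq T) : {measure set T -> \bar R} :=
  mscale ((size s)%:R^-1)%:nng (msum (fun i => \d_(nth point s i)) (size s)).

(* For a Hermitian A the entries of [spectral_diag A] are the eigenvalues of A
   with multiplicity and they are real (orthomx_spectralP,
   hermitian_spectral_diag_real). *)
Definition eigenvalues (R : realType) n (A : 'M[R[i]]_n) : seq R :=
  [seq complex.Re (spectral_diag A ord0 i) | i <- enum 'I_n].

Definition esd (R : realType) n (A : 'M[R[i]]_n) : {measure set R -> \bar R} :=
  empirical_measure R (eigenvalues A).

Definition weak_cvg (R : realType) (mu_ : nat -> {measure set R -> \bar R})
    (mu : {measure set R -> \bar R}) :=
  forall f : R -> R, continuous f -> (exists M, forall x, `|f x| <= M) ->
    (fun n => \int[mu_ n]_x f x) @ \oo --> \int[mu]_x f x.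

Definition weak_cvg2 (R : realType)
    (mu_ : nat -> {measure set (R * R) -> \bar R})
    (mu : {measure set (R * R) -> \bar R}) :=
  forall f : R * R -> R, continuous f -> (exists M, forall x, `|f x| <= M) ->
    (fun n => \int[mu_ n]_x f x) @ \oo --> \int[mu]_x f x.

Definition coupling (R : realType) (mu nu : {measure set R -> \bar R})
    (pi : probability (R * R)%type R) :=
  forall A : set R, measurable A ->
    pi (A `*` setT) = mu A /\ pi (setT `*` A) = nu A.

Definition W2 (R : realType) (mu nu : {measure set R -> \bar R}) : \bar R :=
  ereal_inf [set ((\int[pi]_p (`|p.1 - p.2| ^+ 2)%:E) `^ 2^-1)%E
            | pi in coupling mu nu].

Definition cvg_in_probability0 d (Omega : measurableType d) (R : realType)
    (P : probability Omega R) (Y : nat -> Omega -> \bar R) :=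
  forall eps : R, 0 < eps ->
    (fun n => P [set w | (eps%:E < `|Y n w|)%E]) @ \oo --> 0%E.

Section laws.
Context {R : realType}.

Definition diagR (t : R) : R * R := (t, t).
Definition prodR (p : R * R) : R := p.1 * p.2.

Lemma measurable_diagR : measurable_fun setT diagR.
Proof. by apply: measurable_fun_pair; exact: measurable_id. Qed.

Lemma measurable_prodR : measurable_fun setT prodR.
Proof. by apply: measurable_funM; [exact: measurable_fst|exact: measurable_snd]. Qed.

HB.instance Definition _ :=
  isMeasurableFun.Build _ _ _ _ diagR measurable_diagR.
HB.instance Definition _ :=
  isMeasurableFun.Build _ _ _ _ prodR measurable_prodR.

(* The law of (T, T) for T ~ mu. *)
Definition law_diag (mu : probability R R) : probability (R * R)%type R :=
  distribution mu diagR.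

(* The law of T * X for independent T ~ mu and X ~ nu. *)
Definition law_mul (mu nu : probability R R) : probability R R :=
  distribution (mu \x nu)%E prodR.

End laws.

(* The law of a pair of independent copies of mu. *)
Definition iid2 d (T : measurableType d) (R : realType) (mu : probability T R) :
    probability (T * T)%type R :=
  (mu \x mu)%E.

Section rde.
Context {R : realType}.
Variables (beta : probability R R) (z : R[i]).

(* L is the law of a random variable S with values in the closed lower
   half-plane such that S has the law of 1 / (z - b^2 S), where b ~ beta is
   independent of S, so that (b, S) has law beta \x L. *)
Definition rde_solution (L : probability (borelC R) R) :=
  L [set s | complex.Im s <= 0] = 1%E /\
  forall A : set (borelC R), measurable A ->
    L A = pushforward (beta \x L)%E
            (fun p : R * borelC R => (z - (p.1 ^+ 2)%:C * p.2)^-1 : borelC R) A.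

(* E [1 / (z - b1^2 S1 - b2^2 S2)] for independent b1, b2 ~ beta and
   S1, S2 ~ L. *)
Definition rde_expectation (L : probability (borelC R) R) : R[i] :=
  Cintegral (iid2 beta \x iid2 L)%E
    (fun p : (R * R) * (borelC R * borelC R) =>
       (z - (p.1.1 ^+ 2)%:C * p.2.1 - (p.1.2 ^+ 2)%:C * p.2.2)^-1).

End rde.

(* Row and column i : 'I_N stand for i + 1, so that the 1-based entry
   (N - k, N - k + 1) is here (i, j) with k = N - j and j = i + 1. *)
Definition tridiag (R : realType) (N : nat) (a : nat -> R) (c : nat -> R) :
    'M[R]_N :=
  \matrix_(i, j) if i == j then a (N - i)%N
                 else if i.+1 == j :> nat then c (N - j)%N
                 else if j.+1 == i :> nat then c (N - i)%N
                 else 0.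

Section model.
Context d (Omega : measurableType d) (R : realType) (P : probability Omega R).
Variables (b : nat -> {RV P >-> R}) (a : nat -> nat -> {RV P >-> R}).
Variable sigma : nat -> nat -> R.

(* The arrays are indexed from 1; their values at the other indices are neither
   constrained nor used. *)
Definition coef_family (i : nat + nat * nat) : {RV P >-> R} :=
  match i with inl k => b k | inr (k, N) => a k N end.

Definition coef_index : set (nat + nat * nat)%type :=
  [set i | match i with
           | inl k => (1 <= k)%N
           | inr (k, N) => (1 <= k <= N)%N
           end].

Definition Xmat (N : nat) (w : Omega) : 'M[R[i]]_N :=
  map_mx (@real_complex R)
    (tridiag N (fun k => a k N w) (fun k => sigma k N * b k w)).

Definition sigma_pairs (N : nat) : {measure set (R * R) -> \bar R} :=
  empirical_measure R [seq (sigma k N, sigma k.+1 N) | k <- index_iota 1 N].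

Definition sigma_marginal (N : nat) : {measure set R -> \bar R} :=
  empirical_measure R [seq sigma k N | k <- index_iota 1 N].

End model.

(* Main.v *)
(* Two deterministic facts control the spectrum of a symmetric tridiagonal matrix: changing one row
   and the corresponding column moves every eigenvalue count by at most one, and the squared overlaps of the eigenvectors of two Hermitian matrices
   couple their spectra at the cost of the Hilbert-Schmidt distance.

   The first fact makes n |-> E sum_i f (lambda_i) additive up to 1 for monotone f when the diagonal
   vanishes and the off-diagonal entries are i.i.d., so that the averages converge; the limit is
   the integral of f against mu_b.  The diagonal entries of the resolvent are two-sided continued
   fractions in the squares of the entries.  When E b^2 < (Im z)^2 the map s |-> 1 / (z - b^2 s)
   contracts the Kantorovich distance, so that the continued fractions converge to the unique
   solution S of the recursive equation, and the Stieltjes transform of mu_b is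
   E [1 / (z - b1^2 S1 - b2^2 S2)].  An identity theorem for holomorphic functions and Stieltjes
   inversion show that these values determine mu_b.

   In (ii), the bounded differences inequality and Borel-Cantelli reduce the claim to
   expectations, and the second fact removes the diagonal.  The matrix is cut into blocks of fixed
   length L, the weights of a block are replaced by one of them, which costs the integral of
   min (1, |x - y|) against the law of consecutive weights, and then L tends to infinity.

   In (iii), the quantile coupling bounds W2 by finitely many statistics of (ii) and by the tails of
   the second moments; the latter are small in expectation because the second fact compares the
   matrix with its truncation. *)

Require Import Defs.
From HB Require Import structures.
From mathcomp Require Import all_boot all_order all_algebra.
From mathcomp Require Import complex finmap ring lra zify.
From mathcomp Require Import all_classical all_reals all_analysis.
From mathcomp Require Import measurable_realfun giry.

Set Implicit Arguments.
Unset Strict Implicit.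
Unset Printing Implicit Defensive.

Import Order.TTheory GRing.Theory Num.Theory.
Import numFieldNormedType.Exports.

Local Open Scope classical_set_scope.
Local Open Scope ring_scope.
Local Open Scope complex_scope.
Import ComplexField.Normc.

(** * Spectra of Hermitian and tridiagonal matrices *)

(** The measure [mu_b] has to exist before any probability space is given, so an i.i.d. sequence is
    built from [beta] alone; statements on [Omega] are then transported to its law [B], since a law
    with independent coordinates is determined by its marginals. Weak convergence is tested on the
    functions [ramp q j m], which meet three demands at once: they are monotone, so that a change of
    one row costs at most 1 whatever the size of the entries; they are Lipschitz, so that the
    Hilbert-Schmidt distance controls them; and they are countably many, so that the exceptional
    null sets can be united. The error of near additivity is [1 / n] uniformly in the threshold, and
    this replaces tightness in the construction of [mu_b]. The recursion map is under control only
    on the closed lower half-plane; composing it with a projection makes it Lipschitz on the whole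
    plane. Analyticity means mere complex differentiability, so the identity theorem goes through
    Goursat and applies a maximum principle to a primitive, which has second-order expansions,
    instead of to the function itself. *)

Section unitary_diagonalization.
Variable R : realType.
Local Notation C := R[i].
Local Notation "A ^h" := (map_mx Num.conj (A^T)) (at level 2, format "A ^h").

Definition udiag n (A U : 'M[C]_n) (d : 'I_n -> R) :=
  U \is unitarymx /\ A = U^h *m diag_mx (\row_i (d i)%:C) *m U.

Definition eig n (A : 'M[C]_n) (i : 'I_n) : R := complex.Re (spectral_diag A ord0 i).

Lemma hermitian_udiag n (A : 'M[C]_n) : A \is hermsymmx ->
  udiag A (spectralmx A) (eig A).
Proof.
move=> hA; split; first exact: spectral_unitarymx.
have Ph : invmx (spectralmx A) = (spectralmx A)^h.
  exact: invmx_unitary (spectral_unitarymx A).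
have E : A = (spectralmx A)^h *m diag_mx (spectral_diag A) *m spectralmx A.
  by rewrite -Ph; exact/orthomx_spectralP/hermitian_normalmx.
apply: (etrans E); apply: (congr1 (fun D => _ *m D *m _)).
congr diag_mx; apply/rowP => i; rewrite !mxE /eig.
have /mxOverP/(_ ord0 i) := hermitian_spectral_diag_real hA.
by move/RRe_real => ->; rewrite [ord0]ord1.
Qed.

Lemma sqr_normcE (x : C) : ((normc x) ^+ 2)%:C = x * x^*%C.
Proof. by rewrite -sqr_normc normc_def rmorphXn; case: x => a b /=. Qed.

Definition frob2 m n (A : 'M[C]_(m, n)) : R := \sum_i \sum_j normc (A i j) ^+ 2.

Lemma frob2E m n (A : 'M[C]_(m, n)) : (frob2 A)%:C = \tr (A *m A^h).
Proof.
rewrite rmorph_sum; apply: eq_bigr => i _; rewrite mxE rmorph_sum /=.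
by apply: eq_bigr => j _; rewrite /= sqr_normcE !mxE.
Qed.

Lemma ctrM m n p (A : 'M[C]_(m, n)) (B : 'M[C]_(n, p)) :
  (A *m B)^h = B^h *m A^h.
Proof. by rewrite trmx_mul map_mxM. Qed.

Lemma ctrK m n (A : 'M[C]_(m, n)) : (A^h)^h = A.
Proof. by apply/matrixP => i j; rewrite !mxE conjCK. Qed.

Lemma unitary_mulh n (U : 'M[C]_n) : U \is unitarymx -> U *m U^h = 1%:M.
Proof. by move/unitarymxP. Qed.

Lemma unitary_hmul n (U : 'M[C]_n) : U \is unitarymx -> U^h *m U = 1%:M.
Proof. by move=> hU; apply: mulmx1C; exact: unitary_mulh. Qed.

Lemma frob2_unitary n (U V A : 'M[C]_n) : U \is unitarymx -> V \is unitarymx ->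
  frob2 (U *m A *m V^h) = frob2 A.
Proof.
move=> hU hV; apply: complexI; rewrite !frob2E !ctrM ctrK.
rewrite -!mulmxA (mulmxA V^h) (unitary_hmul hV) mul1mx.
by rewrite mxtrace_mulC -!mulmxA (unitary_hmul hU) mulmx1.
Qed.

Definition overlap n (U V : 'M[C]_n) (i j : 'I_n) : R :=
  normc ((U *m V^h) i j) ^+ 2.

Lemma overlap_ge0 n (U V : 'M[C]_n) i j : 0 <= overlap U V i j.
Proof. exact: sqr_ge0. Qed.

Lemma overlap_row n (U V : 'M[C]_n) i : U \is unitarymx -> V \is unitarymx ->
  \sum_j overlap U V i j = 1.
Proof.
move=> hU hV; apply: complexI; rewrite rmorph_sum rmorph1 /=.
have : ((U *m V^h) *m (U *m V^h)^h) i i = 1.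
  rewrite ctrM ctrK -mulmxA (mulmxA V^h) unitary_hmul// mul1mx.
  by rewrite unitary_mulh// mxE eqxx.
move=> h; rewrite -[RHS]h mxE; apply: eq_bigr => j _; rewrite /overlap sqr_normcE.
by congr (_ * _); rewrite [RHS]mxE [in RHS]mxE.
Qed.

Lemma overlapC n (U V : 'M[C]_n) i j : overlap U V i j = overlap V U j i.
Proof.
rewrite /overlap; apply: complexI; rewrite !sqr_normcE.
have -> : (V *m U^h) j i = ((U *m V^h) i j)^*%C.
  by rewrite -[V *m _]ctrK ctrM ctrK !mxE.
by rewrite conjcK mulrC.
Qed.

Lemma overlap_col n (U V : 'M[C]_n) j : U \is unitarymx -> V \is unitarymx ->
  \sum_i overlap U V i j = 1.
Proof.
move=> hU hV; under eq_bigr do rewrite overlapC.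
exact: overlap_row.
Qed.

(** With [D_a] and [D_b] the diagonal matrices of the eigenvalues, [U *m A = D_a *m U] and
    [B *m V^h = V^h *m D_b]. The coupling of two spectra and the independence of the diagonalization
    both come from this identity. *)
Lemma udiag_intertwine n (A B U V : 'M[C]_n) a b i j :
  udiag A U a -> udiag B V b ->
  (U *m (A - B) *m V^h) i j = (a i - b j)%:C * (U *m V^h) i j.
Proof.
move=> [hU ->] [hV ->]; rewrite mulmxBr mulmxBl.
rewrite !mulmxA (unitary_mulh hU) mul1mx.
rewrite -(mulmxA _ V) (unitary_mulh hV) mulmx1 -mulmxA.
set W := U *m _; rewrite mul_diag_mx mul_mx_diag.
rewrite [LHS]mxE [X in X + _]mxE [X in _ + X]mxE [X in _ - X]mxE !mxE.
rewrite (rmorphB (real_complex R)) mulrBl; congr (_ - _).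
by rewrite mulrC.
Qed.

(* The overlaps form a doubly stochastic matrix, so this is the cost of a coupling of the spectra. *)
Lemma overlap_frob2 n (A B U V : 'M[C]_n) a b : udiag A U a -> udiag B V b ->
  \sum_i \sum_j (a i - b j) ^+ 2 * overlap U V i j = frob2 (A - B).
Proof.
move=> hA hB; have [hU _] := hA; have [hV _] := hB.
rewrite -(frob2_unitary (A - B) hU hV); apply: eq_bigr => i _; apply: eq_bigr => j _.
rewrite (udiag_intertwine _ _ hA hB) normcM exprMn; congr (_ * _).
by rewrite /normc /= expr0n addr0 sqr_sqrtr// sqr_ge0.
Qed.

Lemma overlap_sum n (U V : 'M[C]_n) (a b : 'I_n -> R) (f : R -> R) :
  U \is unitarymx -> V \is unitarymx ->
  \sum_i f (a i) - \sum_j f (b j) =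
  \sum_i \sum_j (f (a i) - f (b j)) * overlap U V i j.
Proof.
move=> hU hV.
under [RHS]eq_bigr do (under eq_bigr do rewrite mulrBl; rewrite sumrB).
rewrite sumrB; congr (_ - _).
  by apply: eq_bigr => i _; rewrite -mulr_sumr overlap_row// mulr1.
by rewrite exchange_big; apply: eq_bigr => j _; rewrite -mulr_sumr overlap_col// mulr1.
Qed.

(** For equal matrices the intertwining identity says that distinct eigenvalues have zero overlap,
    so every term of [overlap_sum] vanishes. *)
Lemma udiag_sum n (A U V : 'M[C]_n) a b (f : R -> R) :
  udiag A U a -> udiag A V b -> \sum_i f (a i) = \sum_j f (b j).
Proof.
move=> hA hB; have [hU _] := hA; have [hV _] := hB.
apply/eqP; rewrite -subr_eq0 (overlap_sum a b f hU hV).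
apply/eqP; rewrite big1// => i _; rewrite big1// => j _.
have := udiag_intertwine i j hA hB; rewrite subrr mulmx0 mul0mx mxE.
move/esym/eqP; rewrite mulf_eq0 => /orP[/eqP h|/eqP h].
  have -> : a i = b j by apply/eqP; rewrite -subr_eq0; apply/eqP; apply: complexI.
  by rewrite subrr mul0r.
by rewrite /overlap h normc0 expr0n mulr0.
Qed.

(** The overlaps give total weight [n] to the pairs of eigenvalues. Cauchy-Schwarz for these weights
    passes from the weighted sum of the distances to that of their squares, which is
    [frob2 (A - B)]. *)
Lemma lipschitz_eig n (A B U V : 'M[C]_n) a b (f : R -> R) (K : R) :
  0 <= K -> (forall x y, `|f x - f y| <= K * `|x - y|) ->
  udiag A U a -> udiag B V b ->
  `|\sum_i f (a i) - \sum_j f (b j)| <= K * Num.sqrt (n%:R * frob2 (A - B)).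
Proof.
move=> K0 hf hA hB; have [hU _] := hA; have [hV _] := hB.
rewrite (overlap_sum a b f hU hV).
set w := overlap U V.
have w0 i j : 0 <= w i j by exact: overlap_ge0.
apply: (@le_trans _ _ (K * \sum_i \sum_j `|a i - b j| * w i j)).
  apply: le_trans (ler_norm_sum _ _ _) _; rewrite mulr_sumr; apply: ler_sum => i _.
  apply: le_trans (ler_norm_sum _ _ _) _; rewrite mulr_sumr; apply: ler_sum => j _.
  rewrite normrM (ger0_norm (w0 i j)) [leRHS]mulrA.
  exact: ler_wpM2r.
apply: ler_wpM2l => //.
set s := \sum_i _.
have s0 : 0 <= s by apply: sumr_ge0 => i _; apply: sumr_ge0 => j _; apply: mulr_ge0.
have F0 : 0 <= frob2 (A - B).
  by apply: sumr_ge0 => i _; apply: sumr_ge0 => j _; exact: sqr_ge0.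
rewrite -[s]ger0_norm// -sqrtr_sqr ler_wsqrtr//.
have sw : \sum_i \sum_j w i j = n%:R.
  under eq_bigr do rewrite overlap_row//.
  by rewrite sumr_const card_ord.
(* discriminant of the nonnegative quadratic t |-> sum (|a - b| - t)^2 w *)
have q (t : R) : 0 <= frob2 (A - B) - 2 * t * s + t ^+ 2 * n%:R.
  have -> : frob2 (A - B) - 2 * t * s + t ^+ 2 * n%:R =
      \sum_i \sum_j (`|a i - b j| - t) ^+ 2 * w i j.
    rewrite -sw -(overlap_frob2 hA hB) /s !mulr_sumr -sumrB -big_split /=.
    apply: eq_bigr => i _; rewrite !mulr_sumr -sumrB -big_split /=.
    by apply: eq_bigr => j _; rewrite -(real_normK (num_real (a i - b j))) -/w; ring.
  by apply: sumr_ge0 => i _; apply: sumr_ge0 => j _; rewrite mulr_ge0// sqr_ge0.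
case: n => [|n] in A B U V a b hA hB hU hV w w0 s s0 F0 sw q *.
  by rewrite /s big_ord0 expr0n mul0r.
have np : 0 < n.+1%:R :> R by [].
(* The quadratic is evaluated at its minimum. *)
have := q (s / n.+1%:R); rewrite expr_div_n.
have -> : frob2 (A - B) - 2 * (s / n.+1%:R) * s + s ^+ 2 / n.+1%:R ^+ 2 * n.+1%:R
  = (n.+1%:R * frob2 (A - B) - s ^+ 2) / n.+1%:R by field.
by rewrite pmulr_lge0 ?invr_gt0// subr_ge0.
Qed.

End unitary_diagonalization.

(** Once both sequences are sorted, the hypothesis on the counts says that the entry of rank [i] of
    [t] is at most the entry of rank [i + 1] of [s]. The sums are compared after this shift by one;
    the unmatched terms are the value of [f] at the least entry of [s], at most 1, and at the
    greatest entry of [t], at least 0. *)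
Lemma sum_nonincreasing_count (R : realType) (f : R -> R) (s t : seq R) :
  {homo f : x y /~ x <= y} -> (forall x, 0 <= f x <= 1) ->
  size s = size t ->
  (forall x, count (<= x) s <= (count (<= x) t).+1)%N ->
  \sum_(x <- s) f x <= \sum_(x <- t) f x + 1.
Proof.
move=> fni f01 sz hc.
have f0 x : 0 <= f x by have /andP[] := f01 x.
have f1 x : f x <= 1 by have /andP[] := f01 x.
rewrite -(perm_big _ (permEl (perm_sort <=%O s))) /=.
rewrite -(perm_big _ (permEl (perm_sort <=%O t))) /=.
set s' := sort _ s; set t' := sort _ t.
have ss : sorted <=%O s' by exact/sort_sorted/le_total.
have st : sorted <=%O t' by exact/sort_sorted/le_total.
have hc' x : (count (<= x)%O s' <= (count (<= x)%O t').+1)%N.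
  have := hc x.
  by rewrite -(permP (permEl (perm_sort <=%O s)))
             -(permP (permEl (perm_sort <=%O t))).
have sz' : size s' = size t' by rewrite !size_sort.
rewrite (big_nth 0) [in leRHS](big_nth 0) -sz'.
case E : (size s') => [|n].
  by rewrite !big_geq// add0r.
rewrite big_nat_recl// [in leRHS]big_nat_recr//= addrC.
apply: lerD => //.
apply: ler_wpDr => //.
rewrite big_nat [leRHS]big_nat; apply: ler_sum => i /andP[_ iN].
apply: fni; set x := nth 0 s' i.+1.
have h : (i.+1 < count (<= x)%O s')%N.
  rewrite ltnNge; apply/negP => h.
  have := @nth_count_gt _ _ x 0 s' i.+1 ss.
  by rewrite h E ltnS iN ltxx => /(_ isT).
by apply: nth_count_le => //; have := leq_trans h (hc' x); rewrite ltnS.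
Qed.

(** * Interlacing for matrices that agree off one row and column *)

Section interlacing.
Variable R : realType.
Local Notation C := R[i].
Local Notation "A ^h" := (map_mx Num.conj (A^T)) (at level 2, format "A ^h").

(** On a span of eigenvectors the quadratic form is diagonal in the coordinates [c]. Applied to
    [1%:M] it gives the norm of the vector in the same coordinates. *)
Lemma udiag_rowsub_form n k (A U : 'M[C]_n) a (g : 'I_k -> 'I_n) (c : 'rV[C]_k) :
  injective g -> udiag A U a ->
  ((c *m rowsub g U) *m A *m (c *m rowsub g U)^h) ord0 ord0 =
  (\sum_i a (g i) * normc (c ord0 i) ^+ 2)%:C.
Proof.
move=> ig [hU ->]; rewrite ctrM.
have e1 : rowsub g U *m U^h = rowsub g 1%:M.
  by rewrite mul_rowsub_mx unitary_mulh.
have e2 : U *m (rowsub g U)^h = (rowsub g 1%:M)^h.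
  by rewrite -e1 ctrM ctrK.
rewrite -!mulmxA (mulmxA U) e2 (mulmxA (rowsub g U)) e1.
have e3 : rowsub g 1%:M *m (diag_mx (\row_i (a i)%:C) *m (rowsub g 1%:M)^h) =
    diag_mx (\row_i (a (g i))%:C) :> 'M[C]_k.
  have -> : (rowsub g 1%:M)^h = colsub g 1%:M :> 'M[C]_(n, k).
    by apply/matrixP => i j; rewrite !mxE rmorph_nat eq_sym.
  rewrite mulmx_colsub mulmx1 mul_rowsub_mx mul1mx.
  by apply/matrixP => i j; rewrite !mxE (inj_eq ig).
rewrite (mulmxA (rowsub g _)) (mulmxA (rowsub g _ *m _)) -(mulmxA (rowsub g _)) e3.
rewrite mxE rmorph_sum /=; apply: eq_bigr => i _.
rewrite (rmorphM (real_complex R)) /= sqr_normcE [RHS]mulrCA; congr (_ * _).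
by rewrite mul_diag_mx !mxE.
Qed.

Lemma rowsub_unitary n k (U : 'M[C]_n) (g : 'I_k -> 'I_n) :
  injective g -> U \is unitarymx -> rowsub g U \is unitarymx.
Proof.
move=> ig hU; apply/unitarymxP; apply/matrixP => i j.
have -> : (rowsub g U *m (rowsub g U)^h) i j = (U *m U^h) (g i) (g j).
  by rewrite !mxE; apply: eq_bigr => l _; rewrite !mxE.
by rewrite unitary_mulh// !mxE (inj_eq ig).
Qed.

Lemma form_eq_off n (A B : 'M[C]_n) (i0 : 'I_n) (v : 'rV[C]_n) :
  (forall i j, i != i0 -> j != i0 -> A i j = B i j) -> v ord0 i0 = 0 ->
  v *m A *m v^h = v *m B *m v^h.
Proof.
move=> AB v0; apply/matrixP => a b; rewrite !ord1 !mxE; apply: eq_bigr => j _.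
rewrite !mxE; have [->|ji] := eqVneq j i0; first by rewrite v0 rmorph0 !mulr0.
congr (_ * _); apply: eq_bigr => i _.
by have [->|ii] := eqVneq i i0; [rewrite v0 !mul0r|rewrite AB].
Qed.

(* If A had two eigenvalues more than B below x, the two eigenspaces and the hyperplane v_i0 = 0
   would meet by a count of dimensions, and A and B define the same quadratic form there. *)
Lemma count_interlace n (A B U V : 'M[C]_n) a b (i0 : 'I_n) (x : R) :
  udiag A U a -> udiag B V b ->
  (forall i j, i != i0 -> j != i0 -> A i j = B i j) ->
  (#|[pred i | (a i <= x)%R]| <= #|[pred i | (b i <= x)%R]|.+1)%N.
Proof.
move=> hA hB AB; have [hU _] := hA; have [hV _] := hB.
pose I := [pred i | a i <= x]; pose J := [pred j | ~~ (b j <= x)].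
have cJ : (#|[pred i | (b i <= x)%R]| + #|J| = n)%N.
  by rewrite -[RHS]card_ord -(cardC [pred i | b i <= x]).
rewrite leqNgt; apply/negP => hlt.
have hIJ : (n.+1 < #|I| + #|J|)%N.
  move: hlt cJ; rewrite -/I; move: #|_| #|_| #|_| => p q r; lia.
pose UI := rowsub (@enum_val _ I) U; pose VJ := rowsub (@enum_val _ J) V.
have rU : \rank UI = #|I|.
  by apply: mxrank_unitary; apply: rowsub_unitary => //; exact: enum_val_inj.
have rV : \rank VJ = #|J|.
  by apply: mxrank_unitary; apply: rowsub_unitary => //; exact: enum_val_inj.
pose H : 'M[C]_n := kermx (col i0 (1%:M : 'M[C]_n)).
have rH : (n.-1 <= \rank H)%N.
  by rewrite mxrank_ker -subn1 leq_sub2l// rank_leq_col.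
have : (0 < \rank (UI :&: VJ :&: H))%N.
  have h1 := mxrank_sum_cap UI VJ.
  have h2 := mxrank_sum_cap (UI :&: VJ)%MS H.
  have h3 : (\rank (UI + VJ)%MS <= n)%N by exact: rank_leq_col.
  have h4 : (\rank (UI :&: VJ + H)%MS <= n)%N by exact: rank_leq_col.
  have n0 : (0 < n)%N by exact: leq_ltn_trans (leq0n i0) (ltn_ord i0).
  move: h1 h2; rewrite rU rV; move: rH hIJ n0 h3 h4; clear.
  move: (\rank (UI + VJ)%MS) (\rank (UI :&: VJ + H)%MS) (\rank (UI :&: VJ)%MS) (\rank H).
  move: (\rank (UI :&: VJ :&: H)%MS).
  move: #|I| #|J|.
  move=> *; lia.
rewrite lt0n mxrank_eq0 -nz_row_eq0.
set v := nz_row _ => v0.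
have : (v <= UI :&: VJ :&: H)%MS by exact: nz_row_sub.
rewrite !sub_capmx => /andP[/andP[/submxP[c vc] /submxP[e ve]] vH].
have vi0 : v ord0 i0 = 0.
  move/sub_kermxP: vH; rewrite colE mul1mx -colE.
  by move/matrixP/(_ ord0 ord0); rewrite !mxE.
(* The identity is diagonalized by both bases, so that the norm of [v] is known in the coordinates
   [c] and in the coordinates [e]. *)
have h1 : udiag 1%:M U (fun=> 1).
  split=> //; have -> : (\row_(_ < n) (1 : R)%:C) = const_mx 1 by apply/rowP=> i; rewrite !mxE.
  by rewrite diag_const_mx mulmx1 unitary_hmul.
have h2 : udiag 1%:M V (fun=> 1).
  split=> //; have -> : (\row_(_ < n) (1 : R)%:C) = const_mx 1 by apply/rowP=> i; rewrite !mxE.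
  by rewrite diag_const_mx mulmx1 unitary_hmul.
have qA := udiag_rowsub_form c (@enum_val_inj _ I) hA.
have q1 := udiag_rowsub_form c (@enum_val_inj _ I) h1.
have qB := udiag_rowsub_form e (@enum_val_inj _ J) hB.
have q2 := udiag_rowsub_form e (@enum_val_inj _ J) h2.
rewrite -vc in qA q1; rewrite -ve in qB q2.
rewrite (form_eq_off AB vi0) in qA.
have /complexI E1 := etrans (esym qA) qB.
have /complexI E2 := etrans (esym q1) q2.
have le1 : \sum_i a (enum_val i) * normc (c ord0 i) ^+ 2 <=
           x * \sum_i 1 * normc (c ord0 i) ^+ 2.
  rewrite mulr_sumr; apply: ler_sum => i _; rewrite mul1r ler_wpM2r ?sqr_ge0//.
  by have := enum_valP i.
rewrite E1 E2 in le1.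
have e0 : e != 0 by apply: contraNneq v0 => e0; rewrite ve e0 mul0mx.
have [j ej] : exists j, e ord0 j != 0.
  apply/existsP; rewrite -negb_forall; apply: contra e0 => /forallP h.
  by apply/eqP/rowP => j; rewrite mxE; apply/eqP.
(* The eigenvalues kept in [J] exceed [x], and the coordinate [j] of [e] is nonzero: this makes the
   opposite inequality strict. *)
move: le1; rewrite leNgt => /negP; apply.
rewrite mulr_sumr (bigD1 j)//= [in ltRHS](bigD1 j)//= mul1r.
apply: ltr_leD.
  rewrite ltr_pM2r; first by have : ~~ (b (enum_val j) <= x) := enum_valP j; rewrite -ltNge.
  rewrite exprn_gt0// lt_def; apply/andP; split.
    by apply: contra ej => /eqP/eq0_normc ->.
  by case: (e ord0 j) => p q; exact: sqrtr_ge0.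
apply: ler_sum => k _; rewrite mul1r ler_wpM2r ?sqr_ge0//.
by have : ~~ (b (enum_val k) <= x) := enum_valP k; rewrite -ltNge => /ltW.
Qed.

Lemma sum_interlace n (A B U V : 'M[C]_n) a b (i0 : 'I_n) (f : R -> R) :
  udiag A U a -> udiag B V b ->
  (forall i j, i != i0 -> j != i0 -> A i j = B i j) ->
  {homo f : x y /~ x <= y} -> (forall x, 0 <= f x <= 1) ->
  `|\sum_i f (a i) - \sum_i f (b i)| <= 1.
Proof.
have main A' B' U' V' a' b' : udiag A' U' a' -> udiag B' V' b' ->
  (forall i j, i != i0 -> j != i0 -> A' i j = B' i j) ->
  {homo f : x y /~ x <= y} -> (forall x, 0 <= f x <= 1) ->
  \sum_i f (a' i) <= \sum_i f (b' i) + 1.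
  move=> hA hB AB fni f01.
  rewrite -(big_map a' xpredT f) -(big_map b' xpredT f).
  apply: sum_nonincreasing_count => //; first by rewrite !size_map.
  move=> x; rewrite !count_map -!sum1_count !sum1_card.
  exact: count_interlace hA hB AB.
move=> hA hB AB fni f01; rewrite ler_norml lerBlDl lerNl opprB lerBlDl.
by rewrite (main _ _ _ _ _ _ hA hB)// (main _ _ _ _ _ _ hB hA)// => i j ii jj; rewrite AB.
Qed.

End interlacing.

(** * Linear statistics of tridiagonal matrices *)

Section tridiagonal.
Variable R : realType.
Local Notation C := R[i].
Local Notation "A ^h" := (map_mx Num.conj (A^T)) (at level 2, format "A ^h").

Definition tri n (a c : nat -> R) : 'M[C]_n := map_mx (real_complex R) (tridiag n a c).

Lemma tri_herm n a c : tri n a c \is hermsymmx.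
Proof.
apply: realsym_hermsym.
  apply/is_hermitianmxP; rewrite expr0 scale1r; apply/matrixP => i j; rewrite !mxE.
  congr (_ %:C); rewrite eq_sym; case: eqVneq => [->//|_].
  have [e1|_] := eqVneq; have [e2|_] := eqVneq => //.
  by have := congr1 S e2; rewrite e1 => /eqP; rewrite -[X in _ == X]addn0 -2!addn1 -addnA eqn_add2l.
by apply/mxOverP => i j; rewrite !mxE; apply/complex_realP; eexists.
Qed.

Definition tsum (f : R -> R) n a c : R := \sum_i f (eig (tri n a c) i).

Lemma tri_udiag n a c : udiag (tri n a c) (spectralmx (tri n a c)) (eig (tri n a c)).
Proof. exact/hermitian_udiag/tri_herm. Qed.

Lemma tsum_udiag f n a c (U : 'M[C]_n) d : udiag (tri n a c) U d ->
  tsum f n a c = \sum_i f (d i).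
Proof. by move=> h; exact: udiag_sum (tri_udiag _ _ _) h. Qed.

Lemma eq_tri n a c a' c' :
  (forall j, (1 <= j <= n)%N -> a j = a' j) ->
  (forall j, (1 <= j < n)%N -> c j = c' j) -> tri n a c = tri n a' c'.
Proof.
move=> ha hc; apply/matrixP => i j; rewrite !mxE; congr (_ %:C).
case: eqVneq => _; first by apply: ha; have := ltn_ord i; lia.
case: eqVneq => [e|_]; first by apply: hc; have := ltn_ord j; lia.
by case: eqVneq => [e|//]; apply: hc; have := ltn_ord i; lia.
Qed.

Lemma eq_tsum f n a c a' c' :
  (forall j, (1 <= j <= n)%N -> a j = a' j) ->
  (forall j, (1 <= j < n)%N -> c j = c' j) -> tsum f n a c = tsum f n a' c'.
Proof. by move=> ha hc; rewrite /tsum (eq_tri ha hc). Qed.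

(** The entries [a k] and [c k] both lie in the row and the column of index [n - k], so a change of
    the whole pair counts as one change of row and column. For [k] outside of [1 .. n] the matrix
    does not move. *)
Lemma tsum_change1 f n a c a' c' k :
  {homo f : x y /~ x <= y} -> (forall x, 0 <= f x <= 1) ->
  (forall j, j != k -> a j = a' j) -> (forall j, j != k -> c j = c' j) ->
  `|tsum f n a c - tsum f n a' c'| <= 1.
Proof.
move=> fni f01 ha hc; have [kn|kn] := boolP (1 <= k <= n)%N; last first.
  rewrite (@eq_tsum f n a c a' c') ?subrr ?normr0// => j jn.
    by apply: ha; apply: contraNneq kn => <-.
  by apply: hc; apply: contraNneq kn => <-; lia.
have kn' : (n - k < n)%N by lia.
apply: (@sum_interlace _ _ _ _ _ _ _ _ (Ordinal kn') _
  (tri_udiag _ _ _) (tri_udiag _ _ _)) => //.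
move=> i j; rewrite -!val_eqE /= => hi hj; rewrite !mxE; congr (_ %:C).
case: eqVneq => _; first by apply: ha; have := ltn_ord i; lia.
case: eqVneq => [e|_]; first by apply: hc; have := ltn_ord j; lia.
by case: eqVneq => [e|//]; apply: hc; have := ltn_ord i; lia.
Qed.

(** Coefficients are numbered from the bottom right corner, so it is the upper left block that
    carries the shifted coefficients. *)
Lemma tri_block m k a c : c k = 0 ->
  tri (m + k) a c = block_mx (tri m (fun j => a (j + k)%N) (fun j => c (j + k)%N)) 0
                             0 (tri k a c).
Proof.
move=> ck; apply/matrixP => i j; rewrite !mxE.
have -> : (i == j) = ((i : nat) == (j : nat)) by [].
case: splitP => i' ei; rewrite !mxE; case: splitP => j' ej; rewrite !mxE ei ej /=.
- congr (_ %:C); have -> : (i' == j') = ((i' : nat) == (j' : nat)) by [].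
  have := ltn_ord i'; have := ltn_ord j'; move=> hj hi.
  case: eqP => [_|_]; first by congr a; lia.
  case: eqP => [_|_]; first by congr c; lia.
  by case: eqP => // _; congr c; lia.
- have := ltn_ord i'; have := ltn_ord j'; move=> hj hi.
  case: eqP => [?|_]; first lia.
  case: eqP => [e|_].
    have -> : (m + k - (m + j') = k)%N by lia.
    by rewrite ck rmorph0.
  by case: eqP => [?|_//]; lia.
- have := ltn_ord i'; have := ltn_ord j'; move=> hj hi.
  case: eqP => [?|_]; first lia.
  case: eqP => [?|_]; first lia.
  case: eqP => [e|_//].
  have -> : (m + k - (m + i') = k)%N by lia.
  by rewrite ck rmorph0.
by congr (_ %:C); rewrite -!addnS !eqn_add2l !subnDl.
Qed.

Lemma tsum_block f m k a c : c k = 0 ->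
  tsum f (m + k) a c =
  tsum f m (fun j => a (j + k)%N) (fun j => c (j + k)%N) + tsum f k a c.
Proof.
move=> ck; have := tri_udiag m (fun j => a (j + k)%N) (fun j => c (j + k)%N).
have := tri_udiag k a c.
rewrite /tsum; set A := tri m _ _; set B := tri k _ _.
move: (spectralmx A) (spectralmx B) (eig A) (eig B) => U V d e [hV eB] [hU eA].
pose W : 'M[C]_(m + k) := block_mx U 0 0 V.
pose de (i : 'I_(m + k)) := match fintype.split i with inl i => d i | inr i => e i end.
have hW : udiag (tri (m + k) a c) W de.
  have Wh : W^h = block_mx U^h 0 0 V^h.
    by rewrite tr_block_mx map_block_mx !trmx0 !map_mx0.
  split.
    apply/unitarymxP; rewrite Wh mulmx_block !mulmx0 !mul0mx !addr0 !add0r.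
    by rewrite !unitary_mulh// -scalar_mx_block.
  rewrite tri_block// -/A -/B Wh.
  have -> : \row_i (de i)%:C = row_mx (\row_i (d i)%:C) (\row_i (e i)%:C).
    by apply/rowP => i; rewrite !mxE /de; case: fintype.split => j; rewrite mxE.
  rewrite diag_mx_row !mulmx_block !mulmx0 !mul0mx !addr0 !add0r.
  by rewrite !mul0mx -eA -eB.

rewrite -/(tsum f (m + k) a c) (tsum_udiag f hW) big_split_ord /=; congr (_ + _).
  apply: eq_bigr => i _; rewrite /de; case: splitP => j /= ej.
    by congr (f (d _)); exact/val_inj.
  by have := ltn_ord i; rewrite ej; lia.
apply: eq_bigr => i _; rewrite /de; case: splitP => j /= ej.
  by have := ltn_ord j; rewrite -ej; lia.
by congr (f (e _)); apply/val_inj; move/addnI: ej.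
Qed.

(** Setting the single coefficient [c k] to zero decouples the two blocks, and this is one change in
    the sense of [tsum_change1]. *)
Lemma tsum_cut f m k a c :
  {homo f : x y /~ x <= y} -> (forall x, 0 <= f x <= 1) ->
  `|tsum f (m + k) a c -
    (tsum f m (fun j => a (j + k)%N) (fun j => c (j + k)%N) + tsum f k a c)| <= 1.
Proof.
move=> fni f01; pose c' j := if j == k then 0 else c j.
have -> : tsum f m (fun j => a (j + k)%N) (fun j => c (j + k)%N) + tsum f k a c =
  tsum f (m + k) a c'.
  rewrite [RHS]tsum_block ?/c' ?eqxx//; congr (_ + _); apply: eq_tsum => // j hj.
    by case: eqP => // ?; lia.
  by case: eqP => // ?; lia.
apply: (@tsum_change1 _ _ _ _ _ _ k) => // j jk.
by rewrite /c' (negbTE jk).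
Qed.

Lemma tsum_scale f n (t : R) a c :
  tsum f n (fun k => t * a k) (fun k => t * c k) = tsum (fun x => f (t * x)) n a c.
Proof.
have := tri_udiag n a c; rewrite [in RHS]/tsum.
have E : tri n (fun k => t * a k) (fun k => t * c k) = t%:C *: tri n a c.
  apply/matrixP => i j; rewrite !mxE -(rmorphM (real_complex R)); congr (_ %:C).
  by do 3 (case: ifP => // _); rewrite mulr0.
move: (spectralmx _) (eig (tri n a c)) => U d [hU e].
have h : udiag (tri n (fun k => t * a k) (fun k => t * c k)) U (fun i => t * d i).
  split; first exact: hU.
  rewrite E e (scalemxAl _ (_ *m _) U) (scalemxAr _ (U^h)).
  apply: (congr1 (fun D => _ *m D *m _)).
  by apply/matrixP => i j; rewrite !mxE mulrnAr -(rmorphM (real_complex R)).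
by rewrite (tsum_udiag f h).
Qed.

Lemma frob2_tri n a c : frob2 (tri n a c) =
  \sum_(1 <= k < n.+1) a k ^+ 2 + 2 * \sum_(1 <= k < n) c k ^+ 2.
Proof.
have rev1 (F : nat -> R) : \sum_(i < n) F (n - i)%N = \sum_(1 <= k < n.+1) F k.
  rewrite big_add1 big_mkord /= (reindex_inj rev_ord_inj) /=.
  by apply: eq_bigr => i _; congr F; have := ltn_ord i; lia.
have e (i j : 'I_n) : normc (tri n a c i j) ^+ 2 =
    (if i == j then a (n - i)%N ^+ 2 else 0) +
    ((if i.+1 == j then c (n - j)%N ^+ 2 else 0) +
     (if j.+1 == i then c (n - i)%N ^+ 2 else 0)).
  have N (x : R) : normc x%:C ^+ 2 = x ^+ 2 by rewrite /= expr0n addr0 sqr_sqrtr ?sqr_ge0.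
  rewrite mxE N mxE; case: eqVneq => [->|_].
    by rewrite !ifF ?addr0//; apply/negbTE/eqP; lia.
  rewrite add0r; case: eqVneq => [e|_].
    by rewrite ifF ?addr0//; apply/negbTE/eqP; lia.
  by rewrite add0r; case: ifP => // _; rewrite expr0n.
rewrite /frob2; under eq_bigr do under eq_bigr do rewrite e.
under eq_bigr do rewrite 2!big_split.
rewrite 2!big_split /=; congr (_ + _).
  rewrite -rev1; apply: eq_bigr => i _.
  by rewrite -big_mkcond /= (big_pred1 i)// => j; rewrite eq_sym.
have off : \sum_(i < n) \sum_(j < n) (if i.+1 == j then c (n - j)%N ^+ 2 else 0) =
    \sum_(1 <= k < n) c k ^+ 2.
  rewrite exchange_big /=.
  have -> : \sum_(1 <= k < n) c k ^+ 2 =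
      \sum_(1 <= k < n.+1) (if (k < n)%N then c k ^+ 2 else 0).
    have [n0|n0] := posnP n; first by rewrite !big_geq ?n0.
    rewrite [RHS]big_nat_recr//= ltnn addr0 big_nat [RHS]big_nat.
    by apply: eq_bigr => k /andP[_ ->].
  rewrite -(rev1 (fun k => if (k < n)%N then c k ^+ 2 else 0)).
  apply: eq_bigr => j _; rewrite -big_mkcond /=.
  case: ltnP => jn; last first.
    rewrite big_pred0// => i; apply/eqP => h.
    by have := ltn_ord j; lia.
  have hj := ltn_ord j.
  have j1 : (j.-1 < n)%N by lia.
  rewrite (big_pred1 (Ordinal j1))// => i /=; apply/eqP/eqP => [h|->].
    by apply/val_inj => /=; lia.
  by rewrite /=; lia.
rewrite off exchange_big /= off.
by rewrite mulr_natl mulr2n.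
Qed.

Lemma tri_sub n a c a' c' :
  tri n a c - tri n a' c' = tri n (fun k => a k - a' k) (fun k => c k - c' k).
Proof.
apply/matrixP => i j; rewrite !mxE -(rmorphB (real_complex R)); congr (_ %:C).
by do 3 (case: ifP => // _); rewrite subrr.
Qed.

Lemma tsum_lipschitz f n a c a' c' K :
  0 <= K -> (forall x y, `|f x - f y| <= K * `|x - y|) ->
  `|tsum f n a c - tsum f n a' c'| <=
   K * Num.sqrt (n%:R * (\sum_(1 <= k < n.+1) (a k - a' k) ^+ 2 +
                    2 * \sum_(1 <= k < n) (c k - c' k) ^+ 2)).
Proof.
move=> K0 hf.
have := lipschitz_eig K0 hf (tri_udiag n a c) (tri_udiag n a' c').
by rewrite tri_sub frob2_tri.
Qed.

End tridiagonal.

(** * Resolvents of tridiagonal matrices as continued fractions *)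

Section resolvent.
Variable R : realType.
Local Notation C := R[i].
Local Notation "A ^h" := (map_mx Num.conj (A^T)) (at level 2, format "A ^h").
Implicit Types z s : C.

Lemma Im_neq0 z : complex.Im z != 0 -> z != 0.
Proof. by apply: contraNneq => ->. Qed.

Lemma trace_resolvent n (A U G : 'M[C]_n) d z :
  complex.Im z != 0 -> udiag A U d -> (z%:M - A) *m G = 1%:M ->
  \tr G = \sum_i (z - (d i)%:C)^-1.
Proof.
move=> z0 [hU eA] hG.
have UV := unitary_mulh hU; have VU := unitary_hmul hU.
move: (U^h) eA UV VU => V eA UV VU; set D := diag_mx _ in eA.
have e : U *m (z%:M - A) = (z%:M - D) *m U.
  rewrite mulmxBr mulmxBl eA !mulmxA UV mul1mx.
  by rewrite mul_mx_scalar mul_scalar_mx.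
have h : (z%:M - D) *m (U *m G *m V) = 1%:M.
  by rewrite !mulmxA -e -(mulmxA U) hG mulmx1.
transitivity (\tr (U *m G *m V)).
  by rewrite mxtrace_mulC mulmxA VU mul1mx.
apply: eq_bigr => i _.
have zd : z - (d i)%:C != 0 by apply: Im_neq0; rewrite raddfB /= subr0.
apply: (mulfI zd); rewrite divff//.
have := congr1 (fun M : 'M[C]_n => M i i) h.
by rewrite mulmxBl mul_scalar_mx mul_diag_mx !mxE eqxx mulrBl.
Qed.

Lemma resolvent_exists n (A U : 'M[C]_n) d z :
  complex.Im z != 0 -> udiag A U d -> exists G, (z%:M - A) *m G = 1%:M.
Proof.
move=> z0 [hU ->].
have UV := unitary_mulh hU; have VU := unitary_hmul hU.
move: (U^h) UV VU => V UV VU; set D := diag_mx _.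
pose E : 'M[C]_n := diag_mx (\row_i (z - (d i)%:C)^-1).
have DE : (z%:M - D) *m E = 1%:M.
  apply/matrixP => i j; rewrite mulmxBl mul_scalar_mx mul_diag_mx !mxE.
  case: eqVneq => [->|_]; last by rewrite !mulr0n !mulr0 subrr.
  rewrite !mulr1n -mulrBl divff//.
  by apply: Im_neq0; rewrite raddfB /= subr0.
exists (V *m E *m U).
have e : (z%:M - V *m D *m U) *m V = V *m (z%:M - D).
  rewrite mulmxBr mulmxBl -!mulmxA UV mulmx1.
  by rewrite mul_mx_scalar mul_scalar_mx.
by rewrite !mulmxA e -(mulmxA V) DE mulmx1.
Qed.

(** Gershgorin's argument: the equation of a row eigenvector is read at the coordinate [j0] where
    its modulus is largest. *)
Lemma eig_bound n (A U : 'M[C]_n) d M : udiag A U d ->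
  (forall j, \sum_i normc (A i j) <= M) -> forall i, `|d i| <= M.
Proof.
move=> [hU eA] hM i.
have hu : row i U *m A = (d i)%:C *: row i U.
  rewrite eA -!row_mul mulmxA mulmxA (unitary_mulh hU) mul1mx.
  by apply/rowP => j; rewrite mxE mul_diag_mx !mxE.
have ge0 (x : C) : 0 <= normc x by case: x => p q; exact: sqrtr_ge0.
have [j0 _ hj] := arg_maxP (fun j => normc (U i j)) (isT : xpredT i).
have pos : 0 < normc (U i j0).
  rewrite lt_neqAle ge0 andbT eq_sym; apply/eqP => u0.
  have : (U *m U^h) i i = 0.
    rewrite mxE big1// => j _; rewrite (_ : U i j = 0) ?mul0r//.
    by apply: eq0_normc; apply/eqP; rewrite eq_le ge0 andbT -u0; exact: hj.
  by rewrite (unitary_mulh hU) mxE eqxx => /eqP; rewrite oner_eq0.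
have E : (d i)%:C * U i j0 = \sum_k U i k * A k j0.
  by have := congr1 (fun v : 'rV[C]_n => v ord0 j0) hu; rewrite !mxE => <-; apply: eq_bigr => k _; rewrite mxE.
rewrite -(ler_pM2r pos).
have -> : `|d i| * normc (U i j0) = normc ((d i)%:C * U i j0).
  by rewrite normcM /= expr0n addr0 sqrtr_sqr.
have nsum (I : finType) (F : I -> C) : normc (\sum_k F k) <= \sum_k normc (F k).
  elim/big_ind2 : _ => [|x1 x2 y1 y2 h1 h2|//]; first by rewrite normc0.
  by apply: le_trans (le_normcD _ _) _; exact: lerD.
rewrite E; apply: le_trans (nsum _ _) _.
apply: le_trans (_ : (\sum_k normc (A k j0)) * normc (U i j0) <= _); last first.
  by rewrite ler_wpM2r.
rewrite mulr_suml; apply: ler_sum => k _; rewrite normcM mulrC.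
by rewrite ler_wpM2l//; exact: hj.
Qed.

(** This is the corner entry of the resolvent of the [n] by [n] tridiagonal matrix with zero
    diagonal and off-diagonal entries [s 0], [s 1] and so on, the empty matrix contributing [0]. *)
Fixpoint cfrac z (s : nat -> R) n : C :=
  if n is n'.+1 then (z - ((s 0%N) ^+ 2)%:C * cfrac z (fun k => s k.+1) n')^-1 else 0.

Lemma Im_inv_le0 z : 0 <= complex.Im z -> complex.Im z^-1 <= 0.
Proof.
case: z => a b /= b0; rewrite oppr_le0 divr_ge0//.
by rewrite addr_ge0 ?sqr_ge0.
Qed.

Lemma Im_cfrac_den z (t : R) s : complex.Im s <= 0 ->
  complex.Im z <= complex.Im (z - (t ^+ 2)%:C * s).
Proof.
case: z s => a b [p q] /= q0; rewrite mul0r addr0 lerDl oppr_ge0.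
by rewrite mulr_ge0_le0// sqr_ge0.
Qed.

Lemma Im_cfrac z u n : 0 < complex.Im z -> complex.Im (cfrac z u n) <= 0.
Proof.
move=> z0; elim: n u => [|n IH] u //=.
by apply: Im_inv_le0; apply: le_trans (ltW z0) _; apply: Im_cfrac_den; exact: IH.
Qed.

Lemma cfrac_den_neq0 z u t n : 0 < complex.Im z ->
  z - (t ^+ 2)%:C * cfrac z u n != 0.
Proof.
move=> z0; apply: Im_neq0; rewrite gt_eqF//.
by apply: (lt_le_trans z0); apply: Im_cfrac_den; exact: Im_cfrac z0.
Qed.

Lemma tri_mul N (c : nat -> R) (y : nat -> C) (x : 'cV[C]_N) (i : 'I_N) :
  (forall j : 'I_N, x j ord0 = y (N - j)%N) -> y 0%N = 0 -> y N.+1 = 0 ->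
  (tri N (fun=> 0) c *m x) i ord0 =
  (c (N - i)%N)%:C * y (N - i).+1 + (c (N - i).-1)%:C * y (N - i).-1.
Proof.
move=> xy y0 yN; rewrite mxE.
have e (j : 'I_N) : tri N (fun=> 0) c i j * x j ord0 =
   (if i.+1 == j then (c (N - j)%N)%:C * y (N - j)%N else 0) +
   (if j.+1 == i then (c (N - i)%N)%:C * y (N - j)%N else 0).
  rewrite !mxE xy; case: eqVneq => [<-|_].
    by rewrite !ifF ?rmorph0 ?mul0r ?addr0//; apply/negbTE/eqP; lia.
  case: eqVneq => [ij|_]; first by rewrite ifF ?addr0//; apply/negbTE/eqP; lia.
  by rewrite add0r; case: eqVneq => // _; rewrite rmorph0 mul0r.
have hi := ltn_ord i.
rewrite (eq_bigr _ (fun j _ => e j)) big_split /= addrC; congr (_ + _).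
  rewrite -big_mkcond /=; have [i0|i0] := posnP i.
    rewrite i0 subn0 yN mulr0 big_pred0// => j.
  have i1 : (i.-1 < N)%N by lia.
  rewrite (big_pred1 (Ordinal i1)) => [|j /=]; last first.
    apply/eqP/eqP => [h|->]; first by apply/val_inj => /=; lia.
    by rewrite /=; lia.
  by congr (_ * y _) => /=; lia.
rewrite -big_mkcond /=; have [i1|i1] := ltnP i.+1 N; last first.
  have -> : (N - i).-1 = 0%N by lia.
  rewrite y0 mulr0 big_pred0// => j; apply/eqP => h.
  by have := ltn_ord j; lia.
rewrite (big_pred1 (Ordinal i1)) => [|j /=].
  by congr ((c _)%:C * y _) => /=; lia.
apply/eqP/eqP => [h|->//]; by apply/val_inj.
Qed.

(** A column of the resolvent solves a three-term recurrence with a source at [k]. Elimination from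
    either end expresses the neighbours of [y k] through [y k], with ratios that are continued
    fractions; the equation at [k] itself then gives the entry. *)
Lemma resolvent_tri_diag N (c : nat -> R) z G (k : nat) (hk : (N - k < N)%N) :
  0 < complex.Im z -> (1 <= k <= N)%N ->
  (z%:M - tri N (fun=> 0) c) *m G = 1%:M ->
  G (Ordinal hk) (Ordinal hk) =
  (z - ((c k.-1) ^+ 2)%:C * cfrac z (fun j => c (k.-1 - j.+1)%N) k.-1
     - ((c k) ^+ 2)%:C * cfrac z (fun j => c (k + j.+1)%N) (N - k))^-1.
Proof.
move=> z0 /andP[k1 kN] hG; set i0 := Ordinal hk.
pose x := col i0 G.
(* The column is renumbered like the coefficients and extended by zero at [0] and [N + 1], so that
   the recurrence has the same form at the boundary. *)
pose y j : C := if (1 <= j <= N)%N then (if insub (N - j)%N is Some i then x i ord0 else 0) else 0.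
have xy (j : 'I_N) : x j ord0 = y (N - j)%N.
  rewrite /y ifT; last by have := ltn_ord j; lia.
  have -> : (N - (N - j) = j)%N by have := ltn_ord j; lia.
  by rewrite valK.
have y0 : y 0%N = 0 by [].
have yN : y N.+1 = 0 by rewrite /y ifF//; lia.
have main j : (1 <= j <= N)%N ->
    z * y j - ((c j)%:C * y j.+1 + (c j.-1)%:C * y j.-1) = (j == k)%:R.
  move=> hj; have hi : (N - j < N)%N by lia.
  have ej : (N - (N - j) = j)%N by lia.
  have := tri_mul c (Ordinal hi) xy y0 yN; rewrite /= ej => <-.
  have -> : y j = x (Ordinal hi) ord0 by rewrite xy /= ej.
  have := congr1 (fun M : 'M[C]_N => col i0 M (Ordinal hi) ord0) hG.
  rewrite colE -mulmxA -colE -/x mulmxBl mul_scalar_mx.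
  rewrite [LHS]mxE [X in X + _]mxE [X in _ + X]mxE => ->.
  rewrite !mxE; congr ((nat_of_bool _)%:R); apply/eqP/eqP => [/(congr1 val) /= |jk]; first by lia.
  by apply/val_inj; rewrite /= jk.
have den t u n : z - (t ^+ 2)%:C * cfrac z u n != 0 by exact: cfrac_den_neq0.
have left j : (j < k)%N ->
  y j = cfrac z (fun i => c (j - i.+1)%N) j * ((c j)%:C * y j.+1).
  elim: j => [|j IH] jk; first by rewrite y0 mul0r.
  have := main j.+1; rewrite (_ : (1 <= j.+1 <= N)%N) ?(ltn_eqF jk); last by lia.
  move=> /(_ isT) /eqP; rewrite subr_eq0 => /eqP h; rewrite /= in h.
  rewrite IH in h; last by lia.
  have -> : cfrac z (fun i => c (j.+1 - i.+1)%N) j.+1 =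
    (z - (c j ^+ 2)%:C * cfrac z (fun i => c (j - i.+1)%N) j)^-1.
    by rewrite /= subn1.
  apply: (mulfI (den (c j) (fun i => c (j - i.+1)%N) j)).
  by rewrite mulVKf ?den// mulrBl h rmorphXn /=; ring.
(* Here [m = N + 1 - j] is the distance to the far end, where [y] vanishes. *)
have right m : forall j, (k < j)%N -> (j + m = N.+1)%N ->
  y j = cfrac z (fun i => c (j + i)%N) m * ((c j.-1)%:C * y j.-1).
  elim: m => [|m IH] j jk jm.
    have -> : j = N.+1 by lia.
    by rewrite yN mul0r.
  have := main j; rewrite (_ : (1 <= j <= N)%N) ?(gtn_eqF jk); last by lia.
  move=> /(_ isT) /eqP; rewrite subr_eq0 => /eqP h; rewrite /= in h.
  have := IH j.+1; rewrite (_ : (k < j.+1)%N); last by lia.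
  rewrite (_ : (j.+1 + m = N.+1)%N); last by lia.
  move=> /(_ isT erefl) h2; rewrite /= in h2; rewrite h2 in h.
  have e : (fun i => c (j.+1 + i)%N) = (fun i => c (j + i.+1)%N).
    by apply/funext => i; congr c; lia.
  rewrite e in h.
  have -> : cfrac z (fun i => c (j + i)%N) m.+1 =
    (z - (c j ^+ 2)%:C * cfrac z (fun i => c (j + i.+1)%N) m)^-1.
    by rewrite /= addn0.
  apply: (mulfI (den (c j) (fun i => c (j + i.+1)%N) m)).
  by rewrite mulVKf ?den// mulrBl h rmorphXn /=; ring.
have -> : G i0 i0 = y k.
  have -> : y k = x i0 ord0 by rewrite xy /=; congr y; lia.
  by rewrite mxE.
have h := main k; rewrite k1 kN eqxx in h.
have l : (k.-1 < k)%N by lia.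
have {l} := left _ l; rewrite prednK// => l.
have r := right (N - k)%N k.+1 (ltnSn _).
rewrite (_ : (k.+1 + (N - k) = N.+1)%N) in r; last by lia.
have {h} := h isT; rewrite l (r erefl) /=.
have -> : (fun i => c (k.+1 + i)%N) = (fun i => c (k + i.+1)%N).
  by apply/funext => i; congr c; lia.
set Q := cfrac _ _ _; set L := cfrac _ _ _ => h.
have dd : z - ((c k.-1) ^+ 2)%:C * L - ((c k) ^+ 2)%:C * Q != 0.
  apply: Im_neq0; rewrite gt_eqF//; apply: (lt_le_trans z0).
  apply: (le_trans (Im_cfrac_den z (c k.-1) (Im_cfrac _ _ z0))).
  by apply: Im_cfrac_den; exact: Im_cfrac z0.
by apply: (mulfI dd); rewrite divff// -[RHS]h !rmorphXn /=; ring.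
Qed.

End resolvent.

Section esd_integral.
Variable R : realType.

Lemma integral_empirical d (T : measurableType d) (s : seq T) (f : T -> \bar R) :
  measurable_fun setT f -> (forall x, 0%E <= f x)%E ->
  (\int[empirical_measure R s]_x f x = ((size s)%:R^-1)%:E * \sum_(x <- s) f x)%E.
Proof.
move=> mf f0; rewrite ge0_integral_mscale//= ge0_integral_measure_sum//.
rewrite (big_nth point) big_mkord; congr (_ * _)%E; apply: eq_bigr => i _.
by rewrite integral_dirac// diracT mul1e.
Qed.

End esd_integral.

(** * Expectations and sequences of independent variables *)

Section bounded_expectation.
Context d (T : measurableType d) (R : realType).
Implicit Types (mu : probability T R) (f g : T -> R).

(** Such functions are integrable for every probability measure, so the real-valued integral is
    linear, monotone and subject to Fubini without further conditions. Moments that may be infinite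
    are handled in [\bar R] instead. *)
Definition bdm f := measurable_fun setT f /\ exists M : R, forall x, `|f x| <= M.

Lemma bdm_cst (c : R) : bdm (fun=> c).
Proof. by split; [exact: measurable_cst|exists `|c|]. Qed.

Lemma bdmD f g : bdm f -> bdm g -> bdm (fun x => f x + g x).
Proof.
move=> [mf [M hM]] [mg [M' hM']]; split; first exact: measurable_funD.
exists (M + M') => x; apply: le_trans (ler_normD _ _) _.
by apply: lerD; [exact: hM|exact: hM'].
Qed.

Lemma bdmN f : bdm f -> bdm (fun x => - f x).
Proof.
move=> [mf [M hM]]; split; first exact: measurableT_comp.
by exists M => x; rewrite normrN.
Qed.

Lemma bdmB f g : bdm f -> bdm g -> bdm (fun x => f x - g x).
Proof. by move=> bf bg; apply: bdmD => //; exact: bdmN. Qed.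

Lemma bdmM f g : bdm f -> bdm g -> bdm (fun x => f x * g x).
Proof.
move=> [mf [M hM]] [mg [M' hM']]; split; first exact: measurable_funM.
exists (M * M') => x; rewrite normrM.
by apply: ler_pM.
Qed.

Lemma bdm_sum (I : Type) (s : seq I) (F : I -> T -> R) :
  (forall i, bdm (F i)) -> bdm (fun x => \sum_(i <- s) F i x).
Proof.
move=> h; elim: s => [|i s IH].
  by under eq_fun do rewrite big_nil; exact: bdm_cst.
by under eq_fun do rewrite big_cons; exact: bdmD.
Qed.

Lemma bdm_norm f : bdm f -> bdm (fun x => `|f x|).
Proof.
move=> [mf [M hM]]; split; first exact: measurableT_comp.
by exists M => x; rewrite normr_id.
Qed.

Lemma bdm_integrable mu f : bdm f -> mu.-integrable setT (EFin \o f).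
Proof.
move=> [mf [M hM]]; apply: measurable_bounded_integrable => //.
  exact: le_lt_trans (probability_le1 mu measurableT) (ltry _).
exists M; split; first exact: num_real.
by move=> x xM y _; apply: le_trans (hM y) (ltW xM).
Qed.

Lemma EbD mu f g : bdm f -> bdm g ->
  \int[mu]_x (f x + g x) = \int[mu]_x f x + \int[mu]_x g x.
Proof. by move=> bf bg; rewrite RintegralD//; exact: bdm_integrable. Qed.

Lemma EbB mu f g : bdm f -> bdm g ->
  \int[mu]_x (f x - g x) = \int[mu]_x f x - \int[mu]_x g x.
Proof. by move=> bf bg; rewrite RintegralB//; exact: bdm_integrable. Qed.

Lemma EbZ mu c f : bdm f -> \int[mu]_x (c * f x) = c * \int[mu]_x f x.
Proof. by move=> bf; rewrite RintegralZl//; exact: bdm_integrable. Qed.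

Lemma EbC mu (c : R) : \int[mu]_x c = c.
Proof.
have h : fine (mu setT) = 1 := congr1 fine (probability_setT mu).
by apply: (etrans (Rintegral_cst mu measurableT c)); rewrite h mulr1.
Qed.

Lemma Eb_le mu f g : bdm f -> bdm g -> (forall x, f x <= g x) ->
  \int[mu]_x f x <= \int[mu]_x g x.
Proof. by move=> bf bg fg; apply: le_Rintegral => //; exact: bdm_integrable. Qed.

Lemma Eb_sum mu (I : Type) (s : seq I) (F : I -> T -> R) :
  (forall i, bdm (F i)) ->
  \int[mu]_x (\sum_(i <- s) F i x) = \sum_(i <- s) \int[mu]_x F i x.
Proof.
move=> h; elim: s => [|i s IH].
  by rewrite big_nil; under eq_Rintegral do rewrite big_nil; exact: EbC.
rewrite big_cons -IH; under eq_Rintegral do rewrite big_cons.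
by rewrite EbD//; exact: bdm_sum.
Qed.

Lemma Eb_norm_le mu f g : bdm f -> bdm g -> (forall x, `|f x| <= g x) ->
  `|\int[mu]_x f x| <= \int[mu]_x g x.
Proof.
move=> bf bg fg; apply: le_trans (le_normr_Rintegral measurableT (bdm_integrable mu bf)) _.
by apply: Eb_le => //; exact: bdm_norm.
Qed.

Lemma Eb_bound mu f (M : R) : bdm f -> (forall x, `|f x| <= M) ->
  `|\int[mu]_x f x| <= M.
Proof. by move=> bf fM; rewrite -[leRHS](EbC mu); apply: Eb_norm_le => //; exact: bdm_cst. Qed.

Lemma Eb_measure_eq (mu nu : {measure set T -> \bar R}) f : measurable_fun setT f ->
  (forall A, measurable A -> mu A = nu A) ->
  \int[mu]_x f x = \int[nu]_x f x.
Proof.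
move=> mf h; rewrite /Rintegral; congr fine.
by apply: eq_measure_integral => A mA _; exact: h.
Qed.

End bounded_expectation.

Section law.
Context d1 d2 (T1 : measurableType d1) (T2 : measurableType d2) (R : realType).
Implicit Types (P : probability T1 R) (X : T1 -> T2).

Definition mkmfun X (mX : measurable_fun setT X) : {mfun T1 >-> T2} :=
  HB.pack X (isMeasurableFun.Build _ _ _ _ X mX).

Definition law P X (mX : measurable_fun setT X) : probability T2 R :=
  distribution P (mkmfun mX).

Lemma lawE P X (mX : measurable_fun setT X) A : law P mX A = P (X @^-1` A).
Proof. by []. Qed.

Lemma bdm_comp (f : T2 -> R) X : bdm f -> measurable_fun setT X -> bdm (fun x => f (X x)).
Proof.
move=> [mf [M hM]] mX; split; first exact: measurableT_comp.
by exists M => x.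
Qed.

Lemma Eb_law P X (mX : measurable_fun setT X) (f : T2 -> R) : bdm f ->
  \int[law P mX]_y f y = \int[P]_x f (X x).
Proof.
move=> bf; rewrite /Rintegral; congr fine.
rewrite integral_distribution//; first by case: bf => mf _; exact/measurable_EFinP.
exact: (bdm_integrable P (bdm_comp bf mX)).
Qed.

Lemma ge0_law P X (mX : measurable_fun setT X) (f : T2 -> \bar R) :
  measurable_fun setT f -> (forall y, 0 <= f y)%E ->
  (\int[law P mX]_y f y = \int[P]_x f (X x))%E.
Proof. by move=> mf f0; rewrite ge0_integral_distribution. Qed.

End law.

Section fubini_bounded.
Context d1 d2 (T1 : measurableType d1) (T2 : measurableType d2) (R : realType).
Variables (m1 : probability T1 R) (m2 : probability T2 R).

Lemma bdm_slice (f : T1 * T2 -> R) x : bdm f -> bdm (fun y => f (x, y)).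
Proof.
move=> [mf [M hM]]; split; last by exists M.
by apply: measurableT_comp => //; exact: measurable_pair1.
Qed.

Lemma bdm_inner (f : T1 * T2 -> R) : bdm f -> bdm (fun x => \int[m2]_y f (x, y)).
Proof.
move=> bf; split; last first.
  case: (bf) => mf [M hM]; exists M => x; apply: Eb_bound => //; exact: bdm_slice.
apply/measurable_EFinP.
rewrite (_ : _ \o _ = fubini_F m2 (EFin \o f)).
  by apply: (measurable_fubini_F (m1 := m1)); exact: (bdm_integrable (m1 \x m2)%E bf).
apply/funext => x; rewrite /fubini_F /= /Rintegral fineK//.
apply: integrable_fin_num => //.
exact: (bdm_integrable m2 (bdm_slice x bf)).
Qed.

Lemma Eb_fubini (f : T1 * T2 -> R) : bdm f ->
  \int[(m1 \x m2)%E]_p f p = \int[m1]_x \int[m2]_y f (x, y).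
Proof.
move=> bf; rewrite /Rintegral; congr fine.
rewrite -(integral12_prod_meas1 (bdm_integrable (m1 \x m2)%E bf)).
apply: eq_integral => x _; rewrite /fubini_F /Rintegral fineK//.
apply: integrable_fin_num => //.
exact: (bdm_integrable m2 (bdm_slice x bf)).
Qed.

End fubini_bounded.

(** * Laws of sequences with independent coordinates *)

Section sequence_space.
Variable R : realType.

Definition cyl (J : {fset nat}) (A : nat -> set R) : set (nat -> R) :=
  [set s | forall i, i \in J -> A i (s i)].

Definition cylinders : set (set (nat -> R)) :=
  [set C | exists J A, (forall i, measurable (A i)) /\ C = cyl J A].

(** The generating cylinders are stable under intersection, so two laws that agree on them are
    equal; this is how every identity in law between sequences is obtained. *)
Definition seqS := g_sigma_algebraType cylinders.

Lemma cyl_measurable J A : (forall i, measurable (A i)) ->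
  measurable (cyl J A : set seqS).
Proof. by move=> mA; apply: sub_sigma_algebra; exists J, A. Qed.

Lemma cylindersI : setI_closed cylinders.
Proof.
move=> _ _ [J [A [mA ->]]] [K [B [mB ->]]].
exists (J `|` K)%fset, (fun i => (if i \in J then A i else setT) `&`
                            (if i \in K then B i else setT)); split.
  by move=> i; apply: measurableI; case: ifP.
apply/seteqP; split => [s [hJ hK] i iJK|s h]; rewrite /cyl /=.
  by split; case: ifPn => // ?; [exact: hJ|exact: hK].
split=> i iJ; have /h : i \in (J `|` K)%fset by rewrite in_fsetU iJ ?orbT.
  by rewrite iJ => -[].
by rewrite iJ => -[].
Qed.

Lemma measurable_coord i : measurable_fun setT (fun s : seqS => s i).
Proof.
move=> _ Y mY; rewrite setTI.
rewrite (_ : _ @^-1` _ = cyl [fset i]%fset (fun=> Y)); first exact: cyl_measurable.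
apply/seteqP; split => s /=; first by move=> Ys j; rewrite in_fset1 => /eqP ->.
by apply; rewrite in_fset1.
Qed.

Lemma measurable_seq d (T : measurableType d) (f : T -> seqS) :
  (forall i, measurable_fun setT (fun x => f x i)) -> measurable_fun setT f.
Proof.
move=> mf; apply: (@measurability _ _ T seqS setT f cylinders erefl).
move=> _ [_ [J [A [mA ->]]] <-]; rewrite setTI.
rewrite (_ : _ @^-1` _ = \bigcap_i (if i \in J then (fun x => f x i) @^-1` A i else setT)).
  apply: bigcapT_measurable => i; case: ifP => // _.
  by rewrite -[X in measurable X]setTI; exact: mf.
apply/seteqP; split => x /= h.
  by move=> i _; case: ifPn => // iJ; exact: h.
by move=> i iJ; have := h i I; rewrite iJ.
Qed.

Definition indlaw (mu : nat -> probability R R) (B : probability seqS R) :=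
  forall J A, (forall i, measurable (A i)) ->
    B (cyl J A) = (\prod_(i <- J) mu i (A i))%E.

Lemma indlaw_unique mu B B' : indlaw mu B -> indlaw mu B' ->
  forall A, measurable A -> B A = B' A.
Proof.
move=> hB hB'; apply: (@measure_unique _ R seqS cylinders (fun=> setT) erefl cylindersI) => //.
- move=> _; exists fset0, (fun=> setT); split=> //.
  by apply/seteqP; split.
- by rewrite bigcup_const.
- by move=> _ [J [A [mA ->]]]; exact: etrans (hB J A mA) (esym (hB' J A mA)).
- by move=> _; exact: le_lt_trans (probability_le1 B measurableT) (ltry _).
Qed.

Lemma eq_indlaw mu mu' B : (forall i, mu i = mu' i) -> indlaw mu B -> indlaw mu' B.
Proof. by move=> e h J A mA; rewrite h//; apply: eq_bigr => i _; rewrite e. Qed.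

(** A cylinder over [J] becomes a condition on a prefix once the absent coordinates are constrained
    by [setT]. Prefixes are what an induction on the length produces. *)
Lemma indlaw_prefix (mu : nat -> probability R R) (B : probability seqS R) :
  (forall n A, (forall i, measurable (A i)) ->
    B [set s | forall i, (i < n)%N -> A i (s i)] = (\prod_(i < n) mu i (A i))%E) ->
  indlaw mu B.
Proof.
move=> h J A mA.
pose n := (\max_(i <- J) i).+1.
have Jn i : i \in J -> (i < n)%N by move=> iJ; rewrite ltnS; exact: leq_bigmax_seq.
pose A' i := if i \in J then A i else setT.
have mA' i : measurable (A' i) by rewrite /A'; case: ifP.
have -> : cyl J A = [set s | forall i, (i < n)%N -> A' i (s i)].
  apply/seteqP; split => s /= hs i.
    by move=> _; rewrite /A'; case: ifPn => // iJ; exact: hs.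
  by move=> iJ; have := hs i (Jn _ iJ); rewrite /A' iJ.
rewrite h// -(big_mkord xpredT (fun i => mu i (A' i))) /index_iota subn0.
have -> : (\prod_(i <- iota 0 n) mu i (A' i) =
           \prod_(i <- iota 0 n) if i \in J then mu i (A i) else 1)%E.
  apply: eq_bigr => i _; rewrite /A'; case: ifP => // _; exact: probability_setT.
rewrite -big_mkcond -big_filter; apply: perm_big.
apply: uniq_perm => [||i]; rewrite ?filter_uniq ?iota_uniq ?fset_uniq//.
rewrite mem_filter mem_iota add0n /=; case: (boolP (i \in J)) => //= iJ.
by rewrite Jn.
Qed.

(** Each output coordinate is read from one of two independent sequences, as told by [g]. Shifting,
    gluing, interleaving, prepending a coordinate and reversing a prefix are all of this form, and
    injectivity of [g] keeps the coordinates independent. *)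
Definition splice (g : nat -> nat + nat) (p : seqS * seqS) : seqS :=
  fun i => match g i with inl j => p.1 j | inr j => p.2 j end.

Lemma measurable_splice g : measurable_fun setT (splice g).
Proof.
apply: measurable_seq => i; rewrite /splice; case: (g i) => j.
  apply: (@measurableT_comp _ _ _ _ _ _ (fun s : seqS => s j)) => //.
  exact: measurable_coord.
apply: (@measurableT_comp _ _ _ _ _ _ (fun s : seqS => s j)) => //.
exact: measurable_coord.
Qed.

(** The preimage of a cylinder is a rectangle of two cylinders, indexed by the coordinates sent to
    the left and to the right; the two products recombine into one over [J]. *)
Lemma splice_indlaw g mu1 mu2 (B1 B2 : probability seqS R) : injective g ->
  indlaw mu1 B1 -> indlaw mu2 B2 ->
  indlaw (fun i => match g i with inl j => mu1 j | inr j => mu2 j end)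
    (law (B1 \x B2)%E (measurable_splice g)).
Proof.
move=> ig h1 h2 J A mA.
pose ginv x := xget 0%N [set i | g i = x].
have giK i : ginv (g i) = i.
  by rewrite /ginv; case: xgetP => [j _ /= /ig//|/(_ i)/=].
pose p1 i := if g i is inl j then Some j else None.
pose p2 i := if g i is inr j then Some j else None.
pose J1 := seq_fset tt (pmap p1 J); pose J2 := seq_fset tt (pmap p2 J).
pose A1 j := A (ginv (inl j)); pose A2 j := A (ginv (inr j)).
rewrite lawE.
have -> : splice g @^-1` cyl J A = (cyl J1 A1 : set seqS) `*` (cyl J2 A2 : set seqS).
  apply/seteqP; split => -[s t] /=.
    move=> h; split => j /=; rewrite seq_fsetE mem_pmap => /mapP[i iJ].
      rewrite /p1; case E : (g i) => [k|k]// [->].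
      by rewrite /A1 -E giK; have := h i iJ; rewrite /splice E.
    rewrite /p2; case E : (g i) => [k|k]// [->].
    by rewrite /A2 -E giK; have := h i iJ; rewrite /splice E.
  move=> [hs ht] i iJ; rewrite /splice; case E : (g i) => [j|j] /=.
    have := hs j; rewrite /A1 -E giK; apply.
    by rewrite seq_fsetE mem_pmap; apply/mapP; exists i => //; rewrite /p1 E.
  have := ht j; rewrite /A2 -E giK; apply.
  by rewrite seq_fsetE mem_pmap; apply/mapP; exists i => //; rewrite /p2 E.
have mA1 : measurable (cyl J1 A1 : set seqS) by apply: cyl_measurable => j; exact: mA.
have mA2 : measurable (cyl J2 A2 : set seqS) by apply: cyl_measurable => j; exact: mA.
apply: (etrans (product_measure1E B1 B2 mA1 mA2)).
have E1 : B1 (cyl J1 A1) = (\prod_(j <- J1) mu1 j (A1 j))%E by apply: h1 => j; exact: mA.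
have E2 : B2 (cyl J2 A2) = (\prod_(j <- J2) mu2 j (A2 j))%E by apply: h2 => j; exact: mA.
apply: (etrans (congr2 mule E1 E2)).
have u1 : uniq (pmap p1 J).
  rewrite (pmap_uniq (g := fun j => ginv (inl j))) ?fset_uniq// => i.
  by rewrite /p1; case E : (g i) => //=; rewrite -E giK.
have u2 : uniq (pmap p2 J).
  rewrite (pmap_uniq (g := fun j => ginv (inr j))) ?fset_uniq// => i.
  by rewrite /p2; case E : (g i) => //=; rewrite -E giK.
have e1 : (\prod_(j <- J1) mu1 j (A1 j) =
    \prod_(i <- J) if g i is inl j then mu1 j (A i) else 1)%E.
  rewrite (perm_big (pmap p1 J)); last first.
    by apply: uniq_perm => // [|i]; rewrite ?fset_uniq// seq_fsetE.
  rewrite big_pmap; apply: eq_bigr => i _; rewrite /p1 /A1.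
  by case E : (g i) => [j|j]//=; rewrite -E giK.
have e2 : (\prod_(j <- J2) mu2 j (A2 j) =
    \prod_(i <- J) if g i is inr j then mu2 j (A i) else 1)%E.
  rewrite (perm_big (pmap p2 J)); last first.
    by apply: uniq_perm => // [|i]; rewrite ?fset_uniq// seq_fsetE.
  rewrite big_pmap; apply: eq_bigr => i _; rewrite /p2 /A2.
  by case E : (g i) => [j|j]//=; rewrite -E giK.
rewrite e1 e2 -big_split /=; apply: eq_bigr => i _.
by case: (g i) => j; rewrite ?mule1 ?mul1e.
Qed.

End sequence_space.

(** * An i.i.d. sequence with a prescribed law, from one uniform variable *)

Section real_laws.
Variable R : realType.

Lemma probR_unique (mu nu : probability R R) :
  (forall x : R, mu `]x, +oo[%classic = nu `]x, +oo[%classic) ->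
  forall A, measurable A -> mu A = nu A.
Proof.
move=> h; apply: (@measure_unique _ R R (@RGenOInfty.G R) (fun n => `]- n%:R, +oo[%classic)).
- exact: RGenOInfty.measurableE.
- move=> _ _ [x ->] [y ->]; exists (Num.max x y).
  by apply/seteqP; split => z /=; rewrite !in_itv /= !andbT gt_max => /andP.
- by move=> n; eexists.
- apply/seteqP; split => // x _; exists (Num.truncn `|x|).+1 => //=.
  rewrite in_itv /= andbT ltrNl; apply: le_lt_trans (truncnS_gt _).
  by rewrite -normrN ler_norm.
- by move=> _ [x ->]; exact: h.
- by move=> n; exact: le_lt_trans (probability_le1 mu (measurable_itv _)) (ltry _).
Qed.

(** The interval is half-open because the doubling map [bit_shift] sends [[0, 1[] to itself. *)
Definition leb01_fun := mrestr (@lebesgue_measure R) (measurable_itv (`[0%R, 1%R[ : interval R)).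

HB.instance Definition _ := Measure.on leb01_fun.

Lemma leb01_setT : leb01_fun setT = 1%E.
Proof.
rewrite /leb01_fun /mrestr setTI.
by rewrite lebesgue_measure_itv /= lte_fin ltr01 sube0.
Qed.

HB.instance Definition _ := @Measure_isProbability.Build _ _ _ leb01_fun leb01_setT.

Lemma measurable_idR : measurable_fun setT (fun x : measurableTypeR R => (x : R)).
Proof. exact: measurable_id. Qed.

Definition leb01 : probability R R := law (leb01_fun : probability (measurableTypeR R) R) measurable_idR.

Lemma leb01E A : leb01 A = lebesgue_measure (A `&` `[0%R, 1%R[%classic).
Proof. by []. Qed.

(** Twice the image measure has the right mass on the intervals []a, b]], and this characterizes
    Lebesgue measure. *)
Lemma lebesgue_double (e : R) (A : set R) : measurable A ->
  lebesgue_measure A = (2%:E * lebesgue_measure [set u : R | A (2 * u - e)%R])%E.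
Proof.
move=> mA.
pose f (u : measurableTypeR R) : measurableTypeR R := 2 * u - e.
have mf : measurable_fun setT f.
  apply: measurable_funB => //; exact: measurable_funM.
have [nu hnu] : exists nu : {measure set (measurableTypeR R) -> \bar R},
    forall B, nu B = (2%:E * lebesgue_measure (f @^-1` B))%E.
  by exists (mscale (NngNum (ler0n R 2))
    (measure_function_pushforward__canonical__measure_function_Measure lebesgue_measure mf)).
rewrite -hnu (@lebesgue_measure_unique _ nu _ A mA)//.
move=> _ [[a b] /= _ <-]; rewrite hnu.
rewrite (_ : _ @^-1` _ = `](a + e) / 2, (b + e) / 2]%classic); last first.
  have E (u : R) : (a < 2 * u - e <= b) = ((a + e) / 2 < u <= (b + e) / 2).
    by apply/andP/andP => -[h1 h2]; split; lra.
  by apply/seteqP; split => u; rewrite /= !in_itv /= E.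
rewrite !lebesgue_measure_itv /= !lte_fin ltr_pM2r ?invr_gt0// ltrD2r.
case: ifP => _; last by rewrite mule0.
by rewrite -!EFinB -EFinM; congr EFin; field.
Qed.

Definition bit (u : R) : R := if 2^-1 <= u then 1 else 0.
Definition bit_shift (u : R) : R := 2 * u - bit u.

Lemma measurable_bit : measurable_fun setT bit.
Proof.
apply: measurable_fun_ifT => //.
by apply: measurable_fun_ler.
Qed.

Lemma measurable_bit_shift : measurable_fun setT bit_shift.
Proof.
apply: measurable_funB; last exact: measurable_bit.
exact: measurable_funM.
Qed.

(** On each half of [[0, 1[] the bit is constant and the shift is affine of slope 2 onto [[0, 1[].
    Hence the first bit is independent of the remaining number, which is again uniform. *)
Lemma bit_shift_law (A E : set R) : measurable A -> measurable E ->
  leb01 [set u | A (bit u) /\ E (bit_shift u)] = (leb01 (bit @^-1` A) * leb01 E)%E.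
Proof.
move=> mA mE.
have half (e : R) (F : set R) : measurable F ->
    lebesgue_measure [set u : R | F (2 * u - e)%R /\ 0 <= 2 * u - e < 1] = ((2^-1)%:E * leb01 F)%E.
  move=> mF; have mFI : measurable (F `&` `[0%R, 1%R[%classic) by exact: measurableI.
  rewrite leb01E (@lebesgue_double e _ mFI).
  rewrite muleA -EFinM mulVf// mul1e; congr lebesgue_measure.
have main (F : set R) : measurable F ->
    leb01 [set u | A (bit u) /\ F (bit_shift u)] =
    (((if 0 \in A then 2^-1 else 0) + (if 1 \in A then 2^-1 else 0))%:E * leb01 F)%E.
  move=> mF; rewrite leb01E.
  pose F0 := if 0 \in A then F else set0; pose F1 := if 1 \in A then F else set0.
  have mF0 : measurable F0 by rewrite /F0; case: ifP.
  have mF1 : measurable F1 by rewrite /F1; case: ifP.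
  pose S (e : R) (G : set R) := [set u : R | G (2 * u - e)%R /\ 0 <= 2 * u - e < 1].
  have mS e G : measurable G -> measurable (S e G).
    move=> mG; rewrite (_ : S e G = (fun u : R => 2 * u - e) @^-1` (G `&` `[0, 1[%classic)); last first.
      by apply/seteqP; split => u /=; rewrite in_itv.
    rewrite -[X in measurable X]setTI.
    have : measurable_fun setT (fun u : R => 2 * u - e).
      apply: measurable_funB => //; exact: measurable_funM.
    by apply => //; exact: measurableI.
  have -> : [set u | A (bit u) /\ F (bit_shift u)] `&` `[0, 1[%classic = S 0 F0 `|` S 1 F1.
    apply/seteqP; split => u /=; rewrite !in_itv /= /S /F0 /F1 /bit_shift /bit.
      case: ifPn => hu [[hA hF] /andP[u0 u1]].
        by right => /=; rewrite (mem_set hA); split => //; lra.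
      left => /=; rewrite (mem_set hA) subr0; split; last by move: hu; rewrite -ltNge => ?; lra.
      by move: hF; rewrite subr0.
    case=> -[]; case: ifPn => // hA hF hu.
      by rewrite ifF ?subr0; [split; [split; [exact: set_mem|rewrite subr0 in hF]|lra]|apply/negbTE; rewrite -ltNge; lra].
    by rewrite ifT; [split; [split; [exact: set_mem|]|lra]|lra].
  rewrite measureU; [|exact: mS|exact: mS|]; last first.
    by apply/seteqP; split => u //=; rewrite /S /= => -[[_ h1] [_ h2]]; lra.
  apply: (etrans (congr2 adde (half 0 F0 mF0) (half 1 F1 mF1))).
  rewrite EFinD ge0_muleDl; [|by rewrite lee_fin; case: ifP..].
  rewrite /F0 /F1; congr (_ + _)%E; case: ifP => _ //; rewrite mul0e leb01E set0I measure0 mule0//.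
rewrite main//; congr (_ * _)%E.
have := main setT measurableT.
rewrite (_ : [set u | _ /\ _] = bit @^-1` A); last by apply/seteqP; split => u //= [].
by move=> ->; rewrite (@probability_setT _ _ _ leb01) mule1.
Qed.

Definition bits (u : R) : seqS R := fun n => bit (iter n bit_shift u).

Lemma measurable_iter_shift n : measurable_fun setT (iter n bit_shift).
Proof.
elim: n => [|n IH] /=; first exact: measurable_id.
by apply: measurableT_comp => //; exact: measurable_bit_shift.
Qed.

Lemma measurable_bits : measurable_fun setT bits.
Proof.
apply: measurable_seq => i; apply: measurableT_comp; first exact: measurable_bit.
exact: measurable_iter_shift.
Qed.

Definition bitlaw : probability R R := law leb01 measurable_bit.
Definition bitslaw : probability (seqS R) R := law leb01 measurable_bits.

Lemma prefix_measurable n (A : nat -> set R) : (forall i, measurable (A i)) ->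
  measurable ([set s | forall i, (i < n)%N -> A i (s i)] : set (seqS R)).
Proof.
move=> mA; have [J hJ] : exists J : {fset nat}, forall i, (i \in J) = (i < n)%N.
  by exists (seq_fset tt (iota 0 n)) => i; rewrite seq_fsetE mem_iota.
rewrite (_ : mkset _ = cyl J A); first exact: cyl_measurable.
by apply/seteqP; split => s /= h i; have := h i; rewrite hJ.
Qed.

Lemma bitslaw_ind : indlaw (fun=> bitlaw) bitslaw.
Proof.
apply: indlaw_prefix => n; elim: n => [|n IH] A mA.
  rewrite big_ord0 (_ : mkset _ = setT) ?probability_setT//.
  by apply/seteqP; split.
rewrite big_ord_recl /=.
have := IH (fun i => A i.+1) (fun i => mA i.+1).
set E := mkset _ => IHE.
rewrite /bump /= -[in RHS]IHE.
have mE : measurable (bits @^-1` E).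
  rewrite -[X in measurable X]setTI; apply: measurable_bits => //.
  by apply: (@prefix_measurable n (fun i => A i.+1)).
apply: etrans (bit_shift_law (mA 0%N) mE).
congr (leb01 _); apply/seteqP; split => u /=.
  move=> h; split; first exact: (h 0%N).
  by move=> i iN; have := h i.+1 iN; rewrite /bits iterSr.
by move=> [h0 h] [|i] iN //; have := h i iN; rewrite /bits iterSr.
Qed.

Definition evens (s : seqS R) : seqS R := fun i => s i.*2.
Definition odds (s : seqS R) : seqS R := fun i => s i.*2.+1.

Lemma measurable_evens : measurable_fun setT evens.
Proof. by apply: measurable_seq => i; exact: measurable_coord. Qed.

Lemma measurable_odds : measurable_fun setT odds.
Proof. by apply: measurable_seq => i; exact: measurable_coord. Qed.

(** Interleaving two independent bit sequences gives the law of one bit sequence, and [evens] and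
    [odds] undo the interleaving. *)
Lemma evens_odds_law (C D : set (seqS R)) : measurable C -> measurable D ->
  bitslaw [set s | C (evens s) /\ D (odds s)] = (bitslaw C * bitslaw D)%E.
Proof.
move=> mC mD.
pose g n : nat + nat := if odd n then inr n./2 else inl n./2.
have ig : injective g.
  move=> m n; rewrite /g => h; rewrite -(odd_double_half m) -(odd_double_half n).
  by move: h; case: (odd m); case: (odd n) => // -[->].
have mE : measurable [set s | C (evens s) /\ D (odds s)].
  apply: measurableI.
    by rewrite -[X in measurable X]setTI; exact: measurable_evens.
  by rewrite -[X in measurable X]setTI; exact: measurable_odds.
have h := splice_indlaw ig bitslaw_ind bitslaw_ind.
have h' : indlaw (fun=> bitlaw) (law (bitslaw \x bitslaw)%E (measurable_splice g)).
  by apply: eq_indlaw h => i; case: (g i).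
rewrite (indlaw_unique bitslaw_ind h' mE) lawE.
have -> : splice g @^-1` [set s | C (evens s) /\ D (odds s)] = C `*` D.
  have ev p : evens (splice g p) = p.1.
    by apply/funext => i; rewrite /evens /splice /g odd_double doubleK.
  have od p : odds (splice g p) = p.2.
    by apply/funext => i; rewrite /odds /splice /g /= odd_double /= uphalf_double.
  by apply/seteqP; split => -[s t] /=; rewrite ev od.
exact: product_measure1E.
Qed.

(** The digit is a test on [s i] rather than [s i] itself, so that the partial sums increase and
    stay below 1 for every real sequence. *)
Definition binary_sum (s : seqS R) : nat -> R :=
  fun n => \sum_(i < n) 2^-1 ^+ i.+1 * (if s i == 1 then 1 else 0).

Definition of_bits (s : seqS R) : R := limn (binary_sum s).

Lemma binary_sum_cvg s : cvgn (binary_sum s).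
Proof.
apply: nondecreasing_is_cvgn.
  apply/nondecreasing_seqP => n; rewrite /binary_sum big_ord_recr /= lerDl.
  by rewrite mulr_ge0 ?exprn_ge0 ?invr_ge0//; case: ifP.
exists 1 => _ [n _ <-].
apply: (@le_trans _ _ (\sum_(i < n) 2^-1 ^+ i.+1)).
  apply: ler_sum => i _; case: ifP => _; rewrite ?mulr1// mulr0.
  by rewrite exprn_ge0 ?invr_ge0.
have -> : \sum_(i < n) 2^-1 ^+ i.+1 = 1 - 2^-1 ^+ n :> R.
  elim: n => [|n IH]; first by rewrite big_ord0 expr0 subrr.
  by rewrite big_ord_recr /= IH exprS; field.
by rewrite gerBl exprn_ge0 ?invr_ge0.
Qed.

Lemma measurable_of_bits : measurable_fun setT of_bits.
Proof.
apply: (@measurable_fun_cvg _ _ _ _ (fun n s => binary_sum s n)); last first.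
  by move=> s _; exact: binary_sum_cvg.
move=> n; apply: measurable_sum => i; apply: measurable_funM => //.
apply: measurable_fun_ifT => //.
have : measurable_fun setT (fun s : seqS R => s i) by exact: measurable_coord.
by move=> mi; apply: measurable_fun_eqr.
Qed.

(** The error after [n] digits is exactly [2^-1 ^+ n] times the [n]-th iterate of the shift, which
    stays in [[0, 1[]. *)
Lemma of_bitsK u : 0 <= u < 1 -> of_bits (bits u) = u.
Proof.
move=> hu; have hs n : 0 <= iter n bit_shift u < 1.
  elim: n => //= n; rewrite /bit_shift /bit; move: (iter n bit_shift u) => v hv.
  by case: ifPn => [|]; rewrite -?ltNge => h; lra.
have e n : binary_sum (bits u) n = u - 2^-1 ^+ n * iter n bit_shift u.
  elim: n => [|n IH]; first by rewrite /binary_sum big_ord0 expr0 mul1r subrr.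
  rewrite /binary_sum big_ord_recr /= -/(binary_sum _ _) IH exprS.
  have -> : (if bits u n == 1 then 1 else 0) = bit (iter n bit_shift u).
    have -> : bits u n = bit (iter n bit_shift u) by [].
    rewrite /bit; case: (_ <= _); rewrite ?eqxx//.
    by rewrite eq_sym oner_eq0.
  by rewrite /bit_shift; field.
apply: cvg_lim => //.
rewrite (_ : binary_sum (bits u) = fun n => u - 2^-1 ^+ n * iter n bit_shift u); last exact/funext.
rewrite -[X in _ --> X]subr0; apply: cvgB; first exact: cvg_cst.
apply: (@squeeze_cvgr _ _ _ _ (fun=> 0) (fun n => 2^-1 ^+ n)).
- apply: nearW => n; have /andP[h0 h1] := hs n.
  have p : 0 <= 2^-1 ^+ n :> R by rewrite exprn_ge0 ?invr_ge0.
  by rewrite mulr_ge0//= ler_piMr// ltW.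
- exact: cvg_cst.
by apply: cvg_expr; rewrite ger0_norm ?invr_ge0// invf_lt1 ?ltr1n.
Qed.

Lemma of_bits_law A : measurable A -> bitslaw (of_bits @^-1` A) = leb01 A.
Proof.
move=> mA; rewrite lawE !leb01E; congr lebesgue_measure.
by apply/seteqP; split => u [/= h]; rewrite in_itv /= => hu; move: h; rewrite /= of_bitsK.
Qed.

Variable beta : probability R R.

Let F (x : R) : R := fine (beta `]-oo, x]%classic).

Lemma quantile_cdf_nd : nondecreasing F.
Proof.
move=> x y xy; rewrite /F fine_le ?fin_num_measure//.
by rewrite le_measure ?inE//; exact: subitvPr.
Qed.

Definition quantile (u : R) : R := if 0 < u < 1 then sup [set x | F x < u] else 0.

(** The Galois connection between a distribution function and its generalized inverse; the passage
    from left to right rests on right continuity. *)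
Lemma quantile_le u x : 0 < u < 1 -> (quantile u <= x) = (u <= F x).
Proof.
move=> hu; rewrite /quantile hu; have /andP[u0 u1] := hu.
pose X := mkmfun (@measurable_id _ R setT).
have cdfE r : cdf (X : {RV beta >-> R}) r = (F r)%:E by rewrite /F fineK ?fin_num_measure.
have [a Fa] : exists a, F a < u.
  have : F r @[r --> -oo] --> (0 : R).
    apply: (@fine_cvg _ _ _ _ (cdf (X : {RV beta >-> R}))); exact: cvg_cdfNy0.
  move/cvgrPdist_lt => /(_ u u0)[M [_ hM]].
  exists (M - 1); have := hM (M - 1); rewrite sub0r normrN => /(_ _)/ltr_normlW; apply.
  by rewrite ltrBlDr ltrDl.
have [c Fc] : exists c, u <= F c.
  have : F r @[r --> +oo] --> (1 : R).
    apply: (@fine_cvg _ _ _ _ (cdf (X : {RV beta >-> R}))); exact: cvg_cdfy1.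
  move/cvgrPdist_lt => /(_ (1 - u)); rewrite subr_gt0 => /(_ u1)[M [_ hM]].
  exists (M + 1); have := hM (M + 1); rewrite ltrDl => /(_ ltr01)/ltr_normlW.
  by move=> h; lra.
have ub y : F y < u -> y <= c.
  by move=> h; rewrite leNgt; apply/negP => /ltW/quantile_cdf_nd; lra.
have hs : has_sup [set x | F x < u] by split; [exists a|exists c => y; exact: ub].
apply/idP/idP => h; last first.
  apply: sup_le_ub; first by exists a.
  by move=> y /= Fy; rewrite leNgt; apply/negP => /ltW/quantile_cdf_nd; lra.
rewrite leNgt; apply/negP => Fx.
have rc : F r @[r --> x^'+] --> F x.
  have := @cdf_right_continuous _ _ _ beta X x.
  rewrite cdfE => /fine_cvgP[_] /=.
  by apply: cvg_trans; apply: near_eq_cvg; near=> r => /=; rewrite -/(F r).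
move/cvgrPdist_lt : rc => /(_ (u - F x)); rewrite subr_gt0 => /(_ Fx) hn.
have : \forall r \near x^'+, r <= x.
  near=> r; apply: le_trans h; apply: ub_le_sup; first by case: hs.
  rewrite /=; have : `|F x - F r| < u - F x by near: r.
  by rewrite ltr_norml => /andP[h1 h2]; lra.
move=> [e /= e0 he].
have hb : ball_ [eta Num.Def.normr] x e (x + e / 2).
  by rewrite /= opprD addNKr normrN gtr0_norm ?divr_gt0//; lra.
have := he _ hb; rewrite ltrDl divr_gt0// => /(_ isT).
by rewrite gerDl leNgt divr_gt0.
Unshelve. all: by end_near. Qed.

Lemma quantile_preimage x : quantile @^-1` `]x, +oo[%classic `&` `]0%R, 1%R[%classic =
  `]F x, +oo[%classic `&` `]0%R, 1%R[%classic.
Proof.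
apply/seteqP; split => u [/= h]; rewrite in_itv /= => hu; split => //; move: h;
  by rewrite !in_itv /= !andbT !ltNge quantile_le.
Qed.

Lemma measurable_quantile : measurable_fun setT quantile.
Proof.
apply: (@measurability _ _ R R setT quantile (@RGenOInfty.G R)).
  exact: RGenOInfty.measurableE.
move=> _ [_ [x ->] <-]; rewrite setTI.
rewrite -[X in measurable X]setIT -(setUv `]0%R, 1%R[%classic) setIUr.
apply: measurableU; first by rewrite quantile_preimage; exact: measurableI.
case: (ltP x 0) => x0.
  rewrite (_ : _ `&` _ = ~` `]0%R, 1%R[%classic); first exact: measurableC.
  apply/seteqP; split => u /=; first by case.
  move=> h; split => //.
  by move/negP : h; rewrite !in_itv /= andbT /quantile => /negbTE ->.
rewrite (_ : _ `&` _ = set0)//.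
apply/seteqP; split => u //= [] + /negP; rewrite !in_itv /= andbT /quantile => + /negbTE hu.
by rewrite hu ltNge x0.
Qed.

Lemma quantile_law A : measurable A -> leb01 (quantile @^-1` A) = beta A.
Proof.
move=> mA; rewrite -(@probR_unique (law leb01 measurable_quantile) beta)// => x.
rewrite lawE leb01E.
have F0 : 0 <= F x by rewrite fine_ge0.
have F1 : F x <= 1 by rewrite -[leRHS]/(fine 1%E) fine_le ?fin_num_measure// probability_le1.
have -> : beta `]x, +oo[%classic = (1 - F x)%:E.
  rewrite -setCitvl probability_setC// EFinB fineK// fin_num_measure//.
(* The point 0, where [quantile] takes its default value, belongs to [[0, 1[] but is null. *)
have e : lebesgue_measure (`[0%R, 0%R]%classic : set R) = 0%E.
  by rewrite lebesgue_measure_itv /= ltxx.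
apply/eqP; rewrite eq_le; apply/andP; split.
  apply: (@le_trans _ _ (lebesgue_measure ((`]F x, 1%R[%classic : set R) `|` `[0%R, 0%R]%classic))).
    apply: le_measure; rewrite ?inE.
    - apply: measurableI => //; rewrite -[X in measurable X]setTI; exact: measurable_quantile.
    - exact: measurableU.
    - move=> u [/= h]; rewrite in_itv /= => /andP[u0 u1].
      move: u0; rewrite le_eqVlt => /orP[/eqP <-|u0]; first by right; rewrite /= in_itv /= lexx.
      left; have : (quantile @^-1` `]x, +oo[%classic `&` `]0%R, 1%R[%classic) u.
        by split => //=; rewrite in_itv /= u0 u1.
      by rewrite quantile_preimage => -[/=]; rewrite !in_itv /= andbT => -> /andP[_ ->].
  apply: (@le_trans _ _ (lebesgue_measure (`]F x, 1%R[%classic : set R) +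
    lebesgue_measure (`[0%R, 0%R]%classic : set R))%E); first exact: measureU2.
  rewrite e adde0 lebesgue_measure_itv /= lte_fin.
  by case: ifPn => _; rewrite -?EFinB// lee_fin subr_ge0.
rewrite -[leLHS](_ : lebesgue_measure (`]F x, 1%R[%classic : set R) = _); last first.
  rewrite lebesgue_measure_itv /= lte_fin; case: ifPn => [_|]; first by rewrite EFinB.
  by rewrite -leNgt => h; congr EFin; lra.
apply: le_measure; rewrite ?inE//.
  apply: measurableI => //; rewrite -[X in measurable X]setTI; exact: measurable_quantile.
move=> u /=; rewrite in_itv /= => /andP[h1 h2].
have u0 : 0 < u by exact: le_lt_trans h1.
have : (`]F x, +oo[%classic `&` `]0%R, 1%R[%classic) u.
  by split => /=; rewrite in_itv /= ?h1 ?u0.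
rewrite -quantile_preimage => -[/= hq _]; split => //.
by rewrite /= in_itv /= ltW.
Qed.

(* The even bits of a uniform variable give the first sample and the odd ones are kept for the others. *)
Definition sample (s : seqS R) : seqS R :=
  fun n => quantile (of_bits (evens (iter n odds s))).

Lemma measurable_sample0 : measurable_fun setT (fun s => quantile (of_bits (evens s))).
Proof.
apply: measurableT_comp; first exact: measurable_quantile.
apply: measurableT_comp; first exact: measurable_of_bits.
exact: measurable_evens.
Qed.

Lemma measurable_sample : measurable_fun setT sample.
Proof.
apply: measurable_seq => n.
apply: (@measurableT_comp _ _ _ _ _ _ (fun s => quantile (of_bits (evens s)))).
  exact: measurable_sample0.
elim: n => [|n IH] /=; first exact: measurable_id.
by apply: measurableT_comp => //; exact: measurable_odds.
Qed.

(** This is the sequence on which [mu_b] is constructed, [beta] being the only datum. The induction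
    on the prefix consumes the even bits for the first sample and keeps the odd ones, which have the
    law of the whole again. *)
Theorem iid_exists : exists B : probability (seqS R) R, indlaw (fun=> beta) B.
Proof.
exists (law bitslaw measurable_sample).
apply: indlaw_prefix => n; elim: n => [|n IH] A mA.
  rewrite big_ord0 (_ : mkset _ = setT) ?probability_setT//.
  by apply/seteqP; split.
rewrite big_ord_recl /=.
have := IH (fun i => A i.+1) (fun i => mA i.+1).
set E := mkset _ => IHE.
rewrite /bump /= -[in RHS]IHE.
have mE : measurable (sample @^-1` E).
  rewrite -[X in measurable X]setTI; apply: measurable_sample => //.
  by apply: (@prefix_measurable n (fun i => A i.+1)).
have mQ : measurable (quantile @^-1` A 0%N).
  by rewrite -[X in measurable X]setTI; exact: measurable_quantile.
have mC : measurable (of_bits @^-1` (quantile @^-1` A 0%N)).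
  by rewrite -[X in measurable X]setTI; exact: measurable_of_bits.
have e0 : bitslaw (of_bits @^-1` (quantile @^-1` A 0%N)) = beta (A 0%N).
  by rewrite of_bits_law// quantile_law.
rewrite -e0; apply: etrans (evens_odds_law mC mE).
congr (bitslaw _); apply/seteqP; split => s /=.
  move=> h; split; first exact: (h 0%N).
  by move=> i iN; have := h i.+1 iN; rewrite /sample iterSr.
by move=> [h0 h] [|i] iN //; have := h i iN; rewrite /sample iterSr.
Qed.

End real_laws.

(** * The bounded differences inequality *)

Section bounded_differences.
Variable R : realType.

(** From [1 - x / 2 <= expR (- (x / 2))], squared and inverted; the rest is a polynomial
    inequality. *)
Lemma expR_le_quadratic (x : R) : `|x| <= 4^-1 -> expR x <= 1 + x + x ^+ 2.
Proof.
rewrite ler_norml => /andP[h1 h2].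
have p : 0 < 1 - x / 2 by lra.
have h : expR (- (x / 2)) >= 1 - x / 2 by rewrite expR_ge1Dx.
have -> : expR x = (expR (- (x / 2)) ^+ 2)^-1.
  by rewrite -expRM_natl -expRN; congr expR; field.
apply: (@le_trans _ _ ((1 - x / 2) ^+ 2)^-1).
  rewrite lef_pV2 ?posrE ?exprn_gt0 ?expR_gt0//.
  by rewrite ler_pXn2r ?nnegrE//; exact: ltW.
rewrite -[leLHS]mul1r ler_pdivrMr ?exprn_gt0//.
have -> : (1 + x + x ^+ 2) * (1 - x / 2) ^+ 2 =
  1 + (x ^+ 2 * (1 - 3 * x + x ^+ 2)) / 4 by field.
rewrite lerDl divr_ge0// mulr_ge0 ?sqr_ge0//.
have : 0 <= x ^+ 2 by exact: sqr_ge0.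
lra.
Qed.

Lemma bdm_expR d (T : measurableType d) (f : T -> R) : bdm f -> bdm (fun x => expR (f x)).
Proof.
move=> [mf [M hM]]; split; first exact: measurableT_comp.
exists (expR M) => x; rewrite ger0_norm ?expR_ge0// ler_expR.
exact: le_trans (ler_norm _) (hM x).
Qed.

Lemma centered_mgf d (T : measurableType d) (P : probability T R) (D : T -> R) (l c : R) :
  bdm D -> \int[P]_t D t = 0 -> (forall t, `|D t| <= c) -> `|l| * c <= 4^-1 ->
  \int[P]_t expR (l * D t) <= expR (l ^+ 2 * c ^+ 2).
Proof.
move=> bD D0 Dc lc.
have bl : bdm (fun t => l * D t) by apply: bdmM => //; exact: bdm_cst.
have hq t : `|l * D t| <= 4^-1.
  by rewrite normrM; apply: le_trans lc; apply: ler_wpM2l.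
apply: (@le_trans _ _ (\int[P]_t (1 + l * D t + l ^+ 2 * c ^+ 2))).
  apply: Eb_le.
  - exact: bdm_expR.
  - by apply: bdmD; [apply: bdmD => //|]; exact: bdm_cst.
  move=> t; apply: le_trans (expR_le_quadratic (hq t)) _; rewrite lerD2l exprMn.
  rewrite ler_wpM2l ?sqr_ge0// -(real_normK (num_real (D t))).
  by rewrite ler_pXn2r ?nnegrE//; exact: le_trans (Dc t).
rewrite EbD; [|by apply: bdmD => //; exact: bdm_cst|exact: bdm_cst].
rewrite EbD//; [|exact: bdm_cst]; rewrite EbZ// D0 mulr0 addr0 !EbC.
by rewrite expR_ge1Dx.
Qed.

Definition cutg (k i : nat) : nat + nat := if (i < k)%N then inl i else inr i.

Lemma cutg_inj k : injective (cutg k).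
Proof. by move=> i j; rewrite /cutg; case: ifP => _; case: ifP => _ // []. Qed.

Definition glue k (s t : seqS R) : seqS R := fun i => if (i < k)%N then s i else t i.

Lemma glueE k s t : glue k s t = splice (cutg k) (s, t).
Proof. by apply/funext => i; rewrite /glue /splice /cutg; case: ifP. Qed.

Variables (mu : nat -> probability R R) (B : probability (seqS R) R).
Hypothesis hB : indlaw mu B.

Lemma bdm_glue k (h : seqS R -> R) : bdm h -> bdm (fun p => h (glue k p.1 p.2)).
Proof.
move=> bh; rewrite (_ : (fun p => _) = fun p => h (splice (cutg k) p)).
  exact: bdm_comp (measurable_splice _).
by apply/funext => -[s t]; rewrite glueE.
Qed.

(** Resampling the coordinates from [k] on leaves the law unchanged, because gluing is a splice. *)
Lemma glue_fubini k (h : seqS R -> R) : bdm h ->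
  \int[B]_s \int[B]_t h (glue k s t) = \int[B]_s h s.
Proof.
move=> bh; have := Eb_fubini B B (bdm_glue k bh) => /= <-.
have hl : indlaw mu (law (B \x B)%E (measurable_splice (cutg k))).
  by apply: eq_indlaw (splice_indlaw (@cutg_inj k) hB hB) => i; rewrite /cutg; case: ifP.
rewrite (Eb_measure_eq (nu := law (B \x B)%E (measurable_splice (cutg k)))) //; last 2 first.
  by case: bh.
  exact: indlaw_unique hl.
rewrite Eb_law//; apply: eq_Rintegral => -[s t] _; by rewrite glueE.
Qed.

Variables (g : seqS R -> R) (n : nat) (c : R).
Hypothesis bg : bdm g.
Hypothesis g_dep : forall s t, (forall i, (i < n)%N -> s i = t i) -> g s = g t.
Hypothesis g_diff : forall k s t, (forall i, i != k -> s i = t i) -> `|g s - g t| <= c.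

(** Doob's martingale: [G k] is the conditional expectation of [g] given the first [k]
    coordinates. *)
Let G k s := \int[B]_t g (glue k s t).

Let bG k : bdm (G k).
Proof. exact: (bdm_inner B B (bdm_glue k bg)). Qed.

Let bg_glue k s : bdm (fun t => g (glue k s t)).
Proof. exact: (bdm_slice s (bdm_glue k bg)). Qed.

(** Given the first [k] coordinates, the increment from [G k] to [G k.+1] is centered and bounded by
    [c], so that [centered_mgf] applies to it. *)
Let mgf_step l k : `|l| * c <= 4^-1 ->
  \int[B]_s expR (l * G k.+1 s) <= expR (l ^+ 2 * c ^+ 2) * \int[B]_s expR (l * G k s).
Proof.
move=> lc.
have blG j : bdm (fun s => l * G j s) by apply: bdmM => //; exact: bdm_cst.
have blE j := bdm_expR (blG j).
rewrite -(glue_fubini k (blE k.+1)) -EbZ//.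
apply: Eb_le.
- exact: (bdm_inner B B (bdm_glue k (blE k.+1))).
- by apply: bdmM => //; exact: bdm_cst.
move=> s.
have bGg : bdm (fun t => G k.+1 (glue k s t)) by exact: (bdm_slice s (bdm_glue k (bG k.+1))).
have bD : bdm (fun t => G k.+1 (glue k s t) - G k s).
  by apply: bdmB => //; exact: bdm_cst.
have D0 : \int[B]_t (G k.+1 (glue k s t) - G k s) = 0.
  rewrite EbB//; last exact: bdm_cst.
  rewrite EbC /G; apply/eqP; rewrite subr_eq0; apply/eqP.
  (* The tower property: only coordinate [k] is integrated by the outer integral, and both sides
     glue [s] before [k], [t] at [k] and [t'] after [k]. *)
  rewrite -[RHS](glue_fubini k.+1 (bg_glue k s)).
  apply: eq_Rintegral => t _; apply: eq_Rintegral => t' _; congr g.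
  apply/funext => i; rewrite /glue.
  by case: (ltnP i k.+1) => h1; case: (ltnP i k) => h2 //; exfalso; lia.
have Dc t : `|G k.+1 (glue k s t) - G k s| <= c.
  rewrite /G -EbB//; apply: Eb_bound; first exact: bdmB.
  move=> t'; apply: (g_diff (k := k)) => i ik.
  move/eqP : ik => ik; rewrite /glue.
  by case: (ltnP i k.+1) => h1; case: (ltnP i k) => h2 //; exfalso; lia.
have -> : \int[B]_t expR (l * G k.+1 (glue k s t)) =
  expR (l * G k s) * \int[B]_t expR (l * (G k.+1 (glue k s t) - G k s)).
  rewrite -EbZ; last by apply: bdm_expR; apply: bdmM => //; exact: bdm_cst.
  by apply: eq_Rintegral => t _; rewrite -expRD; congr expR; ring.
rewrite mulrC ler_wpM2r ?expR_ge0//.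
exact: centered_mgf.
Qed.

Lemma mgf_bound l : `|l| * c <= 4^-1 ->
  \int[B]_s expR (l * (g s - \int[B]_t g t)) <= expR (n%:R * (l ^+ 2 * c ^+ 2)).
Proof.
move=> lc.
have h k : \int[B]_s expR (l * G k s) <=
    expR (k%:R * (l ^+ 2 * c ^+ 2)) * expR (l * \int[B]_t g t).
  elim: k => [|k IH].
    rewrite mul0r expR0 mul1r -[leRHS](EbC B); rewrite le_eqVlt; apply/orP; left; apply/eqP.
    by apply: eq_Rintegral => s _; congr (expR (_ * _)).
  apply: le_trans (mgf_step k lc) _.
  rewrite -nat1r mulrDl mul1r expRD -mulrA ler_wpM2l ?expR_ge0//.
rewrite (_ : \int[B]_s _ = expR (- (l * \int[B]_t g t)) * \int[B]_s expR (l * G n s)).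
  rewrite expRN ler_pdivrMl ?expR_gt0// mulrC; exact: h.
rewrite -EbZ; last by apply: bdm_expR; apply: bdmM; [exact: bdm_cst|exact: bG].
apply: eq_Rintegral => s _; rewrite -expRD; congr expR.
have -> : G n s = g s.
  rewrite /G -[RHS](EbC B); apply: eq_Rintegral => t _; apply: g_dep => i iN.
  by rewrite /glue iN.
ring.
Qed.

(* The constant is not sharp: the moment generating function of each martingale increment is bounded
   through expR x <= 1 + x + x ^+ 2. *)
Lemma bounded_differences_tail (e : R) (N : nat) : (n <= N.*2)%N -> (0 < N)%N ->
  c = N%:R^-1 -> 0 < e <= 1 ->
  (B [set s | (e <= `|g s - \int[B]_t g t|)%R] <=
    (2 * expR (- (N%:R * e ^+ 2 / 8)))%:E)%E.
Proof.
move=> nN N0 cN /andP[e0 e1].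
have Np : 0 < N%:R :> R by rewrite ltr0n.
set m := \int[B]_t g t.
have bgm : bdm (fun s => g s - m) by apply: bdmB => //; exact: bdm_cst.
have mS : measurable [set s | e <= `|g s - m|].
  rewrite -[X in measurable X]setTI.
  have [mgm _] := bdm_norm bgm.
  rewrite (_ : [set s | _] = (fun s => `|g s - m|) @^-1` `[e, +oo[%classic).
    by apply: mgm.
  by apply/seteqP; split => s /=; rewrite in_itv /= andbT.
set S := [set s | _] in mS *.
have bind : bdm (fun s => (\1_S s : R)).
  split; first exact: measurable_indic.
  by exists 1 => s; rewrite indicE; case: (_ \in _); rewrite ?normr1// normr0.
have -> : B S = (\int[B]_s \1_S s)%:E.
  rewrite /Rintegral fineK; last by apply: integrable_fin_num => //; exact: bdm_integrable.
  by rewrite integral_indic// setIT.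
rewrite lee_fin.
(* With [c = N^-1] and [n <= 2 N] the exponent is [- l e + 2 N (l c)^2]; this [l] gives
   [- N e^2 / 4 + N e^2 / 8], and [l c = e / 4] stays in the range of [expR_le_quadratic]. *)
pose l := N%:R * (e / 4).
have l0 : 0 <= l by rewrite mulr_ge0 ?divr_ge0// ltW.
have lc : l * c <= 4^-1.
  rewrite cN /l mulrAC divff ?gt_eqF// mul1r; lra.
have e4 (x : R) : bdm (fun s => expR (x * (g s - m))).
  by apply: bdm_expR; apply: bdmM => //; exact: bdm_cst.
apply: (@le_trans _ _ (\int[B]_s (expR (- (l * e)) * expR (l * (g s - m)) +
                             expR (- (l * e)) * expR (- l * (g s - m))))).
  apply: Eb_le => //; first by apply: bdmD; apply: bdmM => //; exact: bdm_cst.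
  move=> s; rewrite indicE; case: (boolP (s \in S)) => [/set_mem hs|_]; last first.
    by rewrite addr_ge0// mulr_ge0 ?expR_ge0.
  rewrite -!expRD /=; have [h|h] := leP 0 (g s - m).
    apply: ler_wpDr; first exact: expR_ge0.
    have h' : e <= g s - m by rewrite -[leRHS]ger0_norm.
    have : 0 <= l * (g s - m - e) by rewrite mulr_ge0// subr_ge0.
    by rewrite -expR0 ler_expR; lra.
  apply: ler_wpDl; first exact: expR_ge0.
  have h' : e <= - (g s - m) by rewrite -[leRHS]ltr0_norm.
  have : 0 <= l * (- (g s - m) - e) by rewrite mulr_ge0// subr_ge0.
  by rewrite -expR0 ler_expR; lra.
have ee (x : R) : bdm (fun s => expR (- (l * e)) * expR (x * (g s - m))).
  by apply: bdmM => //; exact: bdm_cst.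
rewrite EbD// !EbZ//.
have key (x : R) : x ^+ 2 = l ^+ 2 -> `|x| = l ->
    expR (- (l * e)) * \int[B]_s expR (x * (g s - m)) <= expR (- (N%:R * e ^+ 2 / 8)).
  move=> x2 xl.
  have : \int[B]_s expR (x * (g s - m)) <= expR (n%:R * (x ^+ 2 * c ^+ 2)).
    by apply: mgf_bound; rewrite xl.
  move=> h; apply: (@le_trans _ _ (expR (- (l * e)) * expR (n%:R * (x ^+ 2 * c ^+ 2)))).
    by rewrite ler_wpM2l ?expR_ge0.
  rewrite -expRD ler_expR x2.
  apply: (@le_trans _ _ (- (l * e) + 2 * N%:R * (l ^+ 2 * c ^+ 2))).
    rewrite lerD2l; apply: ler_wpM2r; first by apply: mulr_ge0; exact: sqr_ge0.
    have -> : 2 * N%:R = (N.*2)%:R :> R by rewrite -mul2n natrM.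
    by rewrite ler_nat.
  rewrite le_eqVlt; apply/orP; left; apply/eqP; rewrite cN /l; field.
  by rewrite gt_eqF.
have k1 := key l erefl (ger0_norm l0).
have k2 := key (- l) (sqrrN _) (etrans (normrN _) (ger0_norm l0)).
by rewrite mulr_natl mulr2n; exact: lerD.
Qed.

End bounded_differences.

(** * Holomorphic functions on the upper half-plane *)

Section goursat.
Variable R : realType.

Lemma is_derive_continuous (f : R -> R) (x d : R) : is_derive x 1 f d -> {for x, continuous f}.
Proof. by move=> h; apply/differentiable_continuous/derivable1_diffP; exact: ex_derive. Qed.

(** The mean value theorem for [F] minus the quadratic primitive of the affine function. It
    integrates a pointwise approximation of [f] along a segment using only a primitive. *)
Lemma mvt_affine (F f : R -> R) (a b c p q e : R) : a <= b ->
  (forall x, a <= x <= b -> is_derive x 1 F (f x)) ->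
  (forall x, a <= x <= b -> `|f x - (p + q * (x - c))| <= e) ->
  `|F b - F a - (p * (b - a) + q * ((b - c) ^+ 2 - (a - c) ^+ 2) / 2)| <= e * (b - a).
Proof.
move=> ab hF hf.
pose r := q / 2; pose G x := F x - (p * x + r * (x - c) ^+ 2).
have hG x : a <= x <= b -> is_derive x 1 G (f x - (p + q * (x - c))).
  move=> hx; have h1 := hF x hx.
  rewrite /G; apply: is_deriveB.
  by apply: is_derive_eq; rewrite /GRing.scale /= /r; field.
have cG : {within `[a, b], continuous G}.
  apply: continuous_in_subspaceT => x; rewrite inE /= in_itv /= => hx.
  exact: is_derive_continuous (hG x hx).
have [|z hz E] := MVT_segment ab _ cG (df := fun x => f x - (p + q * (x - c))).
  move=> x; rewrite in_itv /= => /andP[ax xb]; apply: hG.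
  by rewrite !ltW.
have -> : F b - F a - (p * (b - a) + q * ((b - c) ^+ 2 - (a - c) ^+ 2) / 2) = G b - G a.
  by rewrite /G /r; field.
rewrite E normrM (ger0_norm (x := b - a)) ?subr_ge0//.
rewrite ler_wpM2r ?subr_ge0//; apply: hf.
by move: hz; rewrite in_itv.
Qed.

Lemma antiderivative (f : R -> R) (a : R) : (forall x, a <= x -> {for x, continuous f}) ->
  exists F, forall x, a < x -> is_derive x 1 F (f x).
Proof.
move=> cf.
exists (fun x => \int[lebesgue_measure]_(t in [set` `[a, x]]) f t) => x ax.
have xx : x < x + 1 by rewrite ltrDl.
have int : lebesgue_measure.-integrable (`[a, x + 1]%classic : set R) (EFin \o f).
  apply: continuous_compact_integrable; first exact: segment_compact.
  apply: continuous_in_subspaceT => y; rewrite inE /= in_itv /= => /andP[ay _].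
  exact: cf.
have [dF Ff] := continuous_FTC1_closed xx int ax (cf x (ltW ax)).
by rewrite -Ff derive1E; split.
Qed.

(* The differential form P dx + Q dy is closed at (x, y), no continuity of the
   partial derivatives being required. *)
Definition closed_at (P Q : R -> R -> R) (x y : R) :=
  exists p c q : R, forall e : R, 0 < e -> exists2 dl : R, 0 < dl &
    forall h k, `|h| < dl -> `|k| < dl ->
      `|P (x + h) (y + k) - P x y - (p * h + c * k)| <= e * (`|h| + `|k|) /\
      `|Q (x + h) (y + k) - Q x y - (c * h + q * k)| <= e * (`|h| + `|k|).

Variables (P Q A B : R -> R -> R) (x0 y0 : R).
Hypothesis hPQ : forall x y, x0 < x -> y0 < y -> closed_at P Q x y.
Hypothesis hA : forall x y, x0 < x -> y0 < y -> is_derive x 1 (A y) (P x y).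
Hypothesis hB : forall x y, x0 < x -> y0 < y -> is_derive y 1 (B x) (Q x y).

(** The integral of [P dx + Q dy] around the rectangle with sides [[a, b]] and [[c, d]], each edge
    being evaluated by a primitive. *)
Definition circ a b c d :=
  (A c b - A c a) + (B b d - B b c) - (A d b - A d a) - (B a d - B a c).

Lemma circ_split a c w h : circ a (a + w) c (c + h) =
  circ a (a + w / 2) c (c + h / 2) + circ (a + w / 2) (a + w / 2 + w / 2) c (c + h / 2) +
  circ a (a + w / 2) (c + h / 2) (c + h / 2 + h / 2) +
  circ (a + w / 2) (a + w / 2 + w / 2) (c + h / 2) (c + h / 2 + h / 2).
Proof.
have e1 : a + w / 2 + w / 2 = a + w by field.
have e2 : c + h / 2 + h / 2 = c + h by field.
by rewrite e1 e2 /circ; ring.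
Qed.

Let quarter (w h M : R) (p : R * R) : M <= `|circ p.1 (p.1 + w) p.2 (p.2 + h)| ->
  exists p', M / 4 <= `|circ p'.1 (p'.1 + w / 2) p'.2 (p'.2 + h / 2)| /\
    (p'.1 = p.1 \/ p'.1 = p.1 + w / 2) /\ (p'.2 = p.2 \/ p'.2 = p.2 + h / 2).
Proof.
move=> hM; rewrite circ_split in hM.
have pigeon (u1 u2 u3 u4 : R) : M <= `|u1 + u2 + u3 + u4| ->
  [\/ M / 4 <= `|u1|, M / 4 <= `|u2|, M / 4 <= `|u3| | M / 4 <= `|u4|].
  move=> hu; have : M <= `|u1| + `|u2| + `|u3| + `|u4|.
    apply: le_trans hu _; apply: le_trans (ler_normD _ _) _; rewrite lerD2r.
    by apply: le_trans (ler_normD _ _) _; rewrite lerD2r; exact: ler_normD.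
  have [h1|h1] := leP (M / 4) `|u1|; first by constructor 1.
  have [h2|h2] := leP (M / 4) `|u2|; first by constructor 2.
  have [h3|h3] := leP (M / 4) `|u3|; first by constructor 3.
  by move=> hh; constructor 4; lra.
case: (pigeon _ _ _ _ hM) => hc.
- by exists p; split => //; split; left.
- by exists (p.1 + w / 2, p.2); split => //; split; [right|left].
- by exists (p.1, p.2 + h / 2); split => //; split; [left|right].
- by exists (p.1 + w / 2, p.2 + h / 2); split => //; split; right.
Qed.

Let nested_limit (a : nat -> R) (w : R) : 0 <= w ->
  (forall n, a n.+1 = a n \/ a n.+1 = a n + w / 2 ^+ n / 2) ->
  exists l, forall n, a n <= l <= a n + w / 2 ^+ n.
Proof.
move=> w0 ha.
have p2 n : 0 < 2 ^+ n :> R by rewrite exprn_gt0.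
have nd : nondecreasing_seq a.
  apply/nondecreasing_seqP => n; case: (ha n) => ->//.
  by rewrite lerDl !divr_ge0// ltW.
have ni : nonincreasing_seq (fun n => a n + w / 2 ^+ n).
  apply/nonincreasing_seqP => n.
  have E : w / 2 ^+ n.+1 = w / 2 ^+ n / 2 by rewrite exprS; field; rewrite gt_eqF.
  have : 0 <= w / 2 ^+ n by rewrite divr_ge0// ltW.
  by case: (ha n) => ->; rewrite E; lra.
have ub m n : a m <= a n + w / 2 ^+ n.
  case: (leqP m n) => mn.
    apply: le_trans (nd _ _ mn) _.
    by rewrite lerDl divr_ge0// ltW.
  apply: le_trans (ni _ _ (ltnW mn)).
  by rewrite lerDl divr_ge0// ltW.
exists (sup (range a)) => n; apply/andP; split.
  apply: ub_le_sup; last by exists n.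
  by exists (a 0%N + w / 2 ^+ 0) => _ [m _ <-]; exact: ub.
apply: sup_le_ub; first by exists (a 0%N), 0%N.
by move=> _ [m _ <-]; exact: ub.
Qed.

(** Quadrisection: if the circulation had modulus [M > 0], some rectangle of generation [n] would
    carry at least [M / 4^n]. The rectangles shrink to a point where both coefficients have
    first-order expansions; the affine parts have zero circulation because the coefficient [c] of
    [closed_at] is shared, and the remainders are too small. *)
Lemma goursat a b c d : x0 < a -> a <= b -> y0 < c -> c <= d -> circ a b c d = 0.
Proof.
move=> xa ab yc cd; apply/eqP; apply: contraT; rewrite -normr_gt0 => I0.
pose w := b - a; pose h := d - c.
have w0 : 0 <= w by rewrite subr_ge0.
have h0 : 0 <= h by rewrite subr_ge0.
have p2 n : 0 < 2 ^+ n :> R by rewrite exprn_gt0.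
set M := `|circ a b c d| in I0.
(* An implication, so that a successor exists for every rectangle, also for one that violates the
   lower bound. *)
pose Rel (np : nat * (R * R)) (p' : R * R) :=
    M / 4 ^+ np.1 <= `|circ np.2.1 (np.2.1 + w / 2 ^+ np.1) np.2.2 (np.2.2 + h / 2 ^+ np.1)| ->
    M / 4 ^+ np.1 / 4 <= `|circ p'.1 (p'.1 + w / 2 ^+ np.1 / 2) p'.2 (p'.2 + h / 2 ^+ np.1 / 2)| /\
    (p'.1 = np.2.1 \/ p'.1 = np.2.1 + w / 2 ^+ np.1 / 2) /\
    (p'.2 = np.2.2 \/ p'.2 = np.2.2 + h / 2 ^+ np.1 / 2).
pose st np := xget np.2 [set p' | Rel np p'].
have hst np : Rel np (st np).
  rewrite /st; case: np => n p; apply: (xgetPex p); rewrite /Rel /=.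
  have [hM|hM] := leP (M / 4 ^+ n) `|circ p.1 (p.1 + w / 2 ^+ n) p.2 (p.2 + h / 2 ^+ n)|.
    by have [p' hp'] := quarter hM; exists p'.
  by exists p.
pose s := fix s n := if n is n'.+1 then st (n', s n') else (a, c).
have hs n : M / 4 ^+ n <= `|circ (s n).1 ((s n).1 + w / 2 ^+ n) (s n).2 ((s n).2 + h / 2 ^+ n)|.
  elim: n => [|n IH].
    by rewrite /= !expr0 !divr1 /w /h !(addrC _ (_ - _)) !subrK.
  have [+ _] := hst (n, s n) IH.
  have E (v : R) : v / 2 ^+ n.+1 = v / 2 ^+ n / 2 by rewrite exprS; field; rewrite gt_eqF.
  rewrite !E /=; congr (_ <= _).
  by rewrite exprS; field; rewrite gt_eqF// exprn_gt0.
have hs' n : ((s n.+1).1 = (s n).1 \/ (s n.+1).1 = (s n).1 + w / 2 ^+ n / 2) /\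
             ((s n.+1).2 = (s n).2 \/ (s n.+1).2 = (s n).2 + h / 2 ^+ n / 2).
  by have [_] := hst (n, s n) (hs n).
have [px hx] := nested_limit w0 (fun n => (hs' n).1).
have [py hy] := nested_limit h0 (fun n => (hs' n).2).
have inx n : a <= (s n).1.
  elim: n => //= n IH; case: (hs' n).1 => /= ->//.
  by apply: le_trans IH _; rewrite lerDl !divr_ge0// ltW.
have iny n : c <= (s n).2.
  elim: n => //= n IH; case: (hs' n).2 => /= ->//.
  by apply: le_trans IH _; rewrite lerDl !divr_ge0// ltW.
have [/= hx0 _] := andP (hx 0%N); have [/= hy0 _] := andP (hy 0%N).
have S0 : 0 < w + h.
  rewrite lt_neqAle addr_ge0// andbT eq_sym; apply/eqP => S0.
  have [w00 h00] : w = 0 /\ h = 0 by split; lra.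
  have ba : b = a by rewrite /w in w00; lra.
  have dc : d = c by rewrite /h in h00; lra.
  by move: I0; rewrite /M ba dc /circ !(subrr, subr0, addr0) normr0 ltxx.
have [p [g [q hpq]]] := hPQ (lt_le_trans xa hx0) (lt_le_trans yc hy0).
(* The four edges of generation [n] together cost [2 e (w + h)^2 / 4^n]; with this [e] that is half
   of the lower bound [M / 4^n]. *)
have e0 : 0 < M / (4 * (w + h) ^+ 2) by rewrite divr_gt0// mulr_gt0// exprn_gt0.
have [dl dl0 hd] := hpq _ e0; set e := M / _ in e0 hd.
have [n hn] : exists n, (w + h) / 2 ^+ n < dl.
  have : (w + h) * 2^-1 ^+ n @[n --> \oo] --> ((w + h) * 0 : R).
    apply: cvgMr; apply: cvg_expr; rewrite ger0_norm ?invr_ge0// invf_lt1 ?ltr1n//.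
  rewrite mulr0 => /cvgr0Pnorm_lt /(_ _ dl0) [n _ hn]; exists n.
  have := hn n (leqnn n); rewrite /= ger0_norm ?exprVn//.
  by rewrite mulr_ge0 ?invr_ge0 ?exprn_ge0// ltW.
have := hs n; move: (s n) (hx n) (hy n) (inx n) (iny n) => [u v] /=.
set wn := w / 2 ^+ n; set hn' := h / 2 ^+ n => /andP[ux1 ux2] /andP[vy1 vy2] au cv.
have wn0 : 0 <= wn by rewrite divr_ge0// ltW.
have hn0 : 0 <= hn' by rewrite divr_ge0// ltW.
have whn : wn + hn' < dl by rewrite /wn /hn' -mulrDl.
have est x y : u <= x <= u + wn -> v <= y <= v + hn' ->
   `|P x y - (P px py + g * (y - py) + p * (x - px))| <= e * (wn + hn') /\
   `|Q x y - (Q px py + g * (x - px) + q * (y - py))| <= e * (wn + hn').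
  move=> /andP[x1 x2] /andP[y1 y2].
  have ax : `|x - px| <= wn by rewrite ler_norml; apply/andP; split; lra.
  have ay : `|y - py| <= hn' by rewrite ler_norml; apply/andP; split; lra.
  have [||] := hd (x - px) (y - py).
  - by apply: le_lt_trans ax _; lra.
  - by apply: le_lt_trans ay _; lra.
  rewrite !(addrC _ (_ - _)) !subrK => b1 b2.
  have bb : e * (`|x - px| + `|y - py|) <= e * (wn + hn').
    by apply: ler_wpM2l; [exact: ltW|exact: lerD].
  have E1 : P x y - (P px py + g * (y - py) + p * (x - px)) =
            P x y - P px py - (p * (x - px) + g * (y - py)) by ring.
  have E2 : Q x y - (Q px py + g * (x - px) + q * (y - py)) =
            Q x y - Q px py - (g * (x - px) + q * (y - py)) by ring.
  by rewrite E1 E2; split; [exact: le_trans b1 bb|exact: le_trans b2 bb].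
have xu x : u <= x -> x0 < x by move=> hh; apply: lt_le_trans xa _; exact: le_trans au hh.
have yv y : v <= y -> y0 < y by move=> hh; apply: lt_le_trans yc _; exact: le_trans cv hh.
have uu : u <= u + wn by rewrite lerDl.
have vv : v <= v + hn' by rewrite lerDl.
have I1 := @mvt_affine (A v) (fun x => P x v) u (u + wn) px (P px py + g * (v - py)) p
  (e * (wn + hn')) uu _ _.
have I2 := @mvt_affine (A (v + hn')) (fun x => P x (v + hn')) u (u + wn) px
  (P px py + g * (v + hn' - py)) p (e * (wn + hn')) uu _ _.
have I3 := @mvt_affine (B u) (Q u) v (v + hn') py (Q px py + g * (u - px)) q
  (e * (wn + hn')) vv _ _.
have I4 := @mvt_affine (B (u + wn)) (Q (u + wn)) v (v + hn') py
  (Q px py + g * (u + wn - px)) q (e * (wn + hn')) vv _ _.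
have {}I1 := I1 (fun x hx => hA (xu _ (andP hx).1) (yv _ (lexx v)))
  (fun x hx => (est x v hx (introT andP (conj (lexx v) vv))).1).
have {}I2 := I2 (fun x hx => hA (xu _ (andP hx).1) (yv _ vv))
  (fun x hx => (est x _ hx (introT andP (conj vv (lexx _)))).1).
have {}I3 := I3 (fun y hy => hB (xu _ (lexx u)) (yv _ (andP hy).1))
  (fun y hy => (est u y (introT andP (conj (lexx u) uu)) hy).2).
have {}I4 := I4 (fun y hy => hB (xu _ uu) (yv _ (andP hy).1))
  (fun y hy => (est _ y (introT andP (conj uu (lexx _))) hy).2).
have EM : e * (wn + hn') * (wn + hn') * 4 = M / 4 ^+ n.
  rewrite /wn /hn' -mulrDl /e.
  have -> : 4 ^+ n = 2 ^+ n * 2 ^+ n :> R by rewrite -exprMn -natrM.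
  by field; rewrite !gt_eqF.
rewrite -EM /circ.
move: I1 I2 I3 I4; rewrite !ler_norml => /andP[a1 a2] /andP[b1 b2] /andP[c1 c2] /andP[d1 d2].
rewrite leNgt => /negP; case.
have T0 : 0 < e * (wn + hn') * (wn + hn').
  have wh0 : 0 < wn + hn' by rewrite /wn /hn' -mulrDl divr_gt0.
  exact: (mulr_gt0 (mulr_gt0 e0 wh0) wh0).
rewrite ltr_norml; apply/andP; split; nra.
Qed.

End goursat.

(** * Potentials of closed forms and their second-order expansions *)

Section potential.
Variable R : realType.

Lemma continuous_eps (f : R -> R) (x : R) :
  (forall e : R, 0 < e -> exists2 dl : R, 0 < dl &
     forall h, `|h| < dl -> `|f (x + h) - f x| <= e) -> {for x, continuous f}.
Proof.
move=> hf; apply/cvgrPdist_le => e e0; have [dl dl0 hd] := hf e e0.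
exists dl => //= y; rewrite /ball_ /= => xy.
by rewrite distrC -[y in f y](subrK x) [_ - x + x]addrC; apply: hd; rewrite distrC.
Qed.

Lemma continuous2_eps (w : R * R -> R) (x y : R) :
  (forall e : R, 0 < e -> exists2 dl : R, 0 < dl &
     forall h k, `|h| < dl -> `|k| < dl -> `|w (x + h, y + k) - w (x, y)| <= e) ->
  {for (x, y), continuous w}.
Proof.
move=> hf; apply/cvgrPdist_le => e e0; have [dl dl0 hd] := hf e e0.
exists (ball x dl, ball y dl); first by split; exact: nbhsx_ballx.
move=> [a b] [/= xa yb]; rewrite distrC -[a](subrK x) -[b](subrK y).
rewrite [_ - x + x]addrC [_ - y + y]addrC.
by apply: hd; rewrite distrC.
Qed.

Lemma closed_at_continuous (P Q : R -> R -> R) (x y : R) : closed_at P Q x y ->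
  {for x, continuous (fun x => P x y)} /\ {for y, continuous (Q x)}.
Proof.
move=> [p [c [q h]]]; have [dl dl0 hd] := h 1 ltr01.
have d00 : `|0 : R| < dl by rewrite normr0.
have bnd (s K e : R) : 0 <= K -> 0 < e -> `|s| < Num.min dl (e / (K + 1)) -> (K + 1) * `|s| <= e.
  move=> K0 e0; rewrite lt_min => /andP[_ /ltW].
  by rewrite ler_pdivlMr ?ltr_pwDr// mulrC.
have pos (K e : R) : 0 <= K -> 0 < e -> 0 < Num.min dl (e / (K + 1)).
  by move=> K0 e0; rewrite lt_min dl0 divr_gt0// ltr_pwDr.
split; apply: continuous_eps => e e0.
  exists (Num.min dl (e / (`|p| + 1))); first exact: pos.
  move=> s hs; have sd : `|s| < dl by apply: lt_le_trans hs _; rewrite ge_min lexx.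
  have [+ _] := hd s 0 sd d00; rewrite normr0 !addr0 mulr0 addr0 mul1r => hP.
  apply: le_trans (bnd _ _ _ (normr_ge0 p) e0 hs).
  rewrite -[P (x + s) y - P x y](subrK (p * s)).
  apply: le_trans (ler_normD _ _) _; rewrite mulrDl mul1r addrC normrM.
  by rewrite lerD2l.
exists (Num.min dl (e / (`|q| + 1))); first exact: pos.
move=> s hs; have sd : `|s| < dl by apply: lt_le_trans hs _; rewrite ge_min lexx.
have [_] := hd 0 s d00 sd; rewrite normr0 !addr0 mulr0 !add0r mul1r => hP.
apply: le_trans (bnd _ _ _ (normr_ge0 q) e0 hs).
rewrite -[Q x (y + s) - Q x y](subrK (q * s)).
apply: le_trans (ler_normD _ _) _; rewrite mulrDl mul1r addrC normrM.
by rewrite lerD2l.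
Qed.

Lemma mvt_affine_sym (F f : R -> R) (x h p q e : R) :
  (forall t, `|t| <= `|h| -> is_derive (x + t) 1 F (f (x + t))) ->
  (forall t, `|t| <= `|h| -> `|f (x + t) - (p + q * t)| <= e) ->
  `|F (x + h) - F x - (p * h + q * h ^+ 2 / 2)| <= e * `|h|.
Proof.
move=> hF hf; have [h0|h0] := leP 0 h.
  have := @mvt_affine _ F f x (x + h) x p q e; rewrite lerDl h0 => /(_ isT).
  rewrite (ger0_norm h0) in hF hf *.
  have -> : p * (x + h - x) + q * ((x + h - x) ^+ 2 - (x - x) ^+ 2) / 2 =
            p * h + q * h ^+ 2 / 2 by field.
  have -> : x + h - x = h by ring.
  apply.
    move=> z /andP[z1 z2]; have := hF (z - x); rewrite [x + _]addrC subrK; apply.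
    by rewrite ger0_norm; lra.
  move=> z /andP[z1 z2]; have := hf (z - x); rewrite [x + _]addrC subrK; apply.
  by rewrite ger0_norm; lra.
have := @mvt_affine _ F f (x + h) x x p q e; rewrite gerDl (ltW h0) => /(_ isT).
rewrite (ltr0_norm h0) in hF hf *.
have -> : F x - F (x + h) - (p * (x - (x + h)) + q * ((x - x) ^+ 2 - (x + h - x) ^+ 2) / 2) =
          - (F (x + h) - F x - (p * h + q * h ^+ 2 / 2)) by field.
have -> : x - (x + h) = - h by ring.
rewrite normrN; apply.
  move=> z /andP[z1 z2]; have := hF (z - x); rewrite [x + _]addrC subrK; apply.
  by rewrite ler0_norm; lra.
move=> z /andP[z1 z2]; have := hf (z - x); rewrite [x + _]addrC subrK; apply.
by rewrite ler0_norm; lra.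
Qed.

(** The potential integrates along the horizontal line at height [y1] and then vertically, which
    makes the derivative in [y] immediate. By Goursat the other path gives the same value up to a
    constant, hence the derivative in [x]. *)
Lemma potential (P Q : R -> R -> R) (x0 y0 : R) :
  (forall x y, x0 <= x -> y0 <= y -> closed_at P Q x y) ->
  exists F : R -> R -> R, forall x y, x0 < x -> y0 < y ->
    is_derive x 1 (fun x => F x y) (P x y) /\ is_derive y 1 (F x) (Q x y).
Proof.
move=> hPQ.
pose A y := xget (fun=> 0 : R) [set F : R -> R | forall x, x0 < x -> is_derive x 1 F (P x y)].
pose B x := xget (fun=> 0 : R) [set F : R -> R | forall y, y0 < y -> is_derive y 1 F (Q x y)].
have hA x y : x0 < x -> y0 < y -> is_derive x 1 (A y) (P x y).
  move=> x0x y0y.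
  have : [set F : R -> R | forall x, x0 < x -> is_derive x 1 F (P x y)] (A y); last exact.
  apply: xgetPex; apply: antiderivative => z xz.
  exact: (closed_at_continuous (hPQ z y xz (ltW y0y))).1.
have hB x y : x0 < x -> y0 < y -> is_derive y 1 (B x) (Q x y).
  move=> x0x y0y.
  have : [set F : R -> R | forall y, y0 < y -> is_derive y 1 F (Q x y)] (B x); last exact.
  apply: xgetPex; apply: antiderivative => z yz.
  exact: (closed_at_continuous (hPQ x z (ltW x0x) yz)).2.
have hPQ' x y : x0 < x -> y0 < y -> closed_at P Q x y.
  by move=> /ltW h1 /ltW h2; exact: hPQ.
have G a b c d : x0 < a -> x0 < b -> y0 < c -> y0 < d -> circ A B a b c d = 0.
  have sx u v w z : circ A B u v w z = - circ A B v u w z by rewrite /circ; ring.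
  have sy u v w z : circ A B u v w z = - circ A B u v z w by rewrite /circ; ring.
  move=> xa xb yc yd.
  have [ab|/ltW ba] := leP a b; have [cd|/ltW dc] := leP c d.
  - exact: (goursat hPQ' hA hB xa ab yc cd).
  - by rewrite sy (goursat hPQ' hA hB) ?oppr0.
  - by rewrite sx (goursat hPQ' hA hB) ?oppr0.
  - by rewrite sy sx (goursat hPQ' hA hB) ?oppr0.
pose x1 := x0 + 1; pose y1 := y0 + 1.
have xx1 : x0 < x1 by rewrite ltrDl.
have yy1 : y0 < y1 by rewrite ltrDl.
exists (fun x y => (A y1 x - A y1 x1) + (B x y - B x y1)) => x y x0x y0y; split.
  have D : is_derive x 1 (fun x => (B x1 y - B x1 y1 - A y x1) + A y x) (P x y).
    rewrite -[P x y]add0r; apply: is_deriveD.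
    exact: hA.
  apply: near_eq_is_derive D => //.
  near=> z.
  have xz : x0 < z by near: z; exact: lt_nbhsr.
  by have := G x1 z y1 y xx1 xz yy1 y0y; rewrite /circ; lra.
rewrite -[Q x y]subr0 -[_ - 0]add0r; apply: is_deriveD; apply: is_deriveB.
exact: hB.
Unshelve. all: by end_near. Qed.

(** A potential gains one order: first-order expansions of [P] and [Q] are integrated along a
    horizontal and then a vertical segment, so no continuity of second derivatives enters. *)
Lemma potential_jet (F P Q : R -> R -> R) (x y rho : R) : 0 < rho ->
  (forall h k, `|h| < rho -> `|k| < rho ->
     is_derive (x + h) 1 (fun x => F x (y + k)) (P (x + h) (y + k)) /\
     is_derive (y + k) 1 (F (x + h)) (Q (x + h) (y + k))) ->
  forall p c q : R, (forall e : R, 0 < e -> exists2 dl : R, 0 < dl &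
    forall h k, `|h| < dl -> `|k| < dl ->
      `|P (x + h) (y + k) - P x y - (p * h + c * k)| <= e * (`|h| + `|k|) /\
      `|Q (x + h) (y + k) - Q x y - (c * h + q * k)| <= e * (`|h| + `|k|)) ->
  forall e : R, 0 < e -> exists2 dl : R, 0 < dl & forall h k, `|h| < dl -> `|k| < dl ->
    `|F (x + h) (y + k) - F x y - (P x y * h + Q x y * k)
       - (p * h ^+ 2 / 2 + c * h * k + q * k ^+ 2 / 2)| <= e * (`|h| + `|k|) ^+ 2.
Proof.
move=> rho0 hF p c q hPQ e e0; have [dl dl0 hd] := hPQ e e0.
exists (Num.min dl rho); first by rewrite lt_min dl0.
move=> h k; rewrite !lt_min => /andP[h1 h2] /andP[k1 k2].
have H1 : `|F (x + h) y - F x y - (P x y * h + p * h ^+ 2 / 2)| <= e * `|h| * `|h|.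
  apply: (@mvt_affine_sym (fun x => F x y) (fun x => P x y)) => t th.
    by have [] := hF t 0 (le_lt_trans th h2); rewrite ?normr0// addr0.
  have [|/= + _] := hd t 0 (le_lt_trans th h1); rewrite ?normr0// !addr0 mulr0 addr0 => hh.
  rewrite opprD addrA; apply: le_trans hh _.
  by apply: ler_wpM2l => //; exact: ltW.
have H2 : `|F (x + h) (y + k) - F (x + h) y - ((Q x y + c * h) * k + q * k ^+ 2 / 2)| <=
    e * (`|h| + `|k|) * `|k|.
  apply: (@mvt_affine_sym (F (x + h)) (Q (x + h))) => t tk.
    by have [] := hF h t h2 (le_lt_trans tk k2).
  have [_ hh] := hd h t h1 (le_lt_trans tk k1).
  rewrite (_ : _ - _ = Q (x + h) (y + t) - Q x y - (c * h + q * t)); last by ring.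
  by apply: le_trans hh _; apply: ler_wpM2l; [exact: ltW|rewrite lerD2l].
rewrite (_ : _ - _ - _ - _ = (F (x + h) y - F x y - (P x y * h + p * h ^+ 2 / 2)) +
   (F (x + h) (y + k) - F (x + h) y - ((Q x y + c * h) * k + q * k ^+ 2 / 2))); last by field.
apply: le_trans (ler_normD _ _) _; apply: le_trans (lerD H1 H2) _.
have : 0 <= e * `|h| * `|k| by rewrite !mulr_ge0// ltW.
by rewrite expr2; nra.
Qed.

End potential.

(** * Second-order expansions and the maximum principle *)

Section jets.
Variable R : realType.
Local Notation C := R[i].
Implicit Types (E F f g : C -> C) (l m z h : C).

Lemma normc_ge0 z : 0 <= normc z.
Proof. by case: z => a b; exact: sqrtr_ge0. Qed.

Lemma normc_sub z h : normc (z - h) = normc (h - z).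
Proof. by rewrite -opprB normcN. Qed.

Lemma normcX z n : normc (z ^+ n) = normc z ^+ n.
Proof. by elim: n => [|n IH]; rewrite ?expr0 ?normc1// !exprS normcM IH. Qed.

Lemma normc_real (x : R) : normc x%:C = `|x|.
Proof. by rewrite /= expr0n addr0 sqrtr_sqr. Qed.

Lemma normc_gt0 z : (0 < normc z) = (z != 0).
Proof.
rewrite lt_neqAle normc_ge0 andbT eq_sym; congr (~~ _).
by apply/eqP/eqP => [/eq0_normc//|->]; rewrite normc0.
Qed.

Lemma le_Re_normc z : `|complex.Re z| <= normc z.
Proof.
by case: z => a b /=; rewrite -sqrtr_sqr ler_wsqrtr// lerDl sqr_ge0.
Qed.

Lemma le_Im_normc z : `|complex.Im z| <= normc z.
Proof.
by case: z => a b /=; rewrite -sqrtr_sqr ler_wsqrtr// lerDr sqr_ge0.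
Qed.

Lemma normc_le_ReIm z : normc z <= `|complex.Re z| + `|complex.Im z|.
Proof.
case: z => a b /=; rewrite -[leRHS]ger0_norm ?addr_ge0// -sqrtr_sqr ler_wsqrtr//.
by rewrite sqrrD !real_normK ?num_real// -addrA addrCA lerDr mulrn_wge0// mulr_ge0.
Qed.

Lemma ReIm_le_normc z : `|complex.Re z| + `|complex.Im z| <= 2 * normc z.
Proof. by have := le_Re_normc z; have := le_Im_normc z; lra. Qed.

Definition cts0 E l := forall e : R, 0 < e ->
  exists2 dl : R, 0 < dl & forall h, normc h < dl -> normc (E h - l) <= e.

Lemma cts0_cst l : cts0 (fun=> l) l.
Proof. by move=> e e0; exists 1 => // h _; rewrite subrr normc0 ltW. Qed.

Lemma cts0_id : cts0 id 0.
Proof. by move=> e e0; exists e => // h /ltW; rewrite subr0. Qed.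

Lemma cts0D E F l m : cts0 E l -> cts0 F m -> cts0 (fun h => E h + F h) (l + m).
Proof.
move=> hE hF e e0; have e2 : 0 < e / 2 by rewrite divr_gt0.
have [d1 d10 h1] := hE _ e2; have [d2 d20 h2] := hF _ e2.
exists (Num.min d1 d2); first by rewrite lt_min d10.
move=> h; rewrite lt_min => /andP[hd1 hd2].
rewrite (_ : _ - _ = (E h - l) + (F h - m)); last by ring.
apply: le_trans (le_normcD _ _) _.
by rewrite [leRHS]splitr lerD ?h1 ?h2.
Qed.

Lemma cts0M E F l m : cts0 E l -> cts0 F m -> cts0 (fun h => E h * F h) (l * m).
Proof.
move=> hE hF e e0.
have l0 := normc_ge0 l; have m0 := normc_ge0 m.
have e1 : 0 < e / (normc m + 1) / 2 by rewrite !divr_gt0// ltr_wpDl.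
have e2 : 0 < Num.min 1 (e / (normc l + 1) / 2).
  by rewrite lt_min ltr01 !divr_gt0// ltr_wpDl.
have [d1 d10 h1] := hE _ e1; have [d2 d20 h2] := hF _ e2.
exists (Num.min d1 d2); first by rewrite lt_min d10.
move=> h; rewrite lt_min => /andP[hd1 hd2].
rewrite (_ : _ - _ = (E h - l) * F h + l * (F h - m)); last by ring.
apply: le_trans (le_normcD _ _) _; rewrite !normcM.
have := h2 _ hd2; rewrite le_min => /andP[F1 F2].
have Fh : normc (F h) <= normc m + 1.
  by rewrite -[F h](subrK m) addrC (le_trans (le_normcD _ _))// lerD2l.
rewrite [leRHS]splitr; apply: lerD.
  have -> : e / 2 = e / (normc m + 1) / 2 * (normc m + 1).
    by field; rewrite gt_eqF// ltr_wpDl.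
  by apply: ler_pM; rewrite ?normc_ge0 ?h1.
have -> : e / 2 = (normc l + 1) * (e / (normc l + 1) / 2).
  by field; rewrite gt_eqF// ltr_wpDl.
by apply: ler_pM; rewrite ?normc_ge0// lerDl.
Qed.

Lemma cts0_near E F l : (exists2 dl : R, 0 < dl & forall h, normc h < dl -> E h = F h) ->
  cts0 E l -> cts0 F l.
Proof.
move=> [d d0 hd] hE e e0; have [d1 d10 h1] := hE _ e0.
exists (Num.min d d1); first by rewrite lt_min d0.
by move=> h; rewrite lt_min => /andP[hd1 hd2]; rewrite -hd// h1.
Qed.

Lemma cts0V E l : l != 0 -> cts0 E l -> cts0 (fun h => (E h)^-1) l^-1.
Proof.
move=> l0 hE e e0.
have nl : 0 < normc l by rewrite normc_gt0.
have e1 : 0 < Num.min (normc l / 2) (e * normc l ^+ 2 / 2).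
  by rewrite lt_min !divr_gt0// mulr_gt0// exprn_gt0.
have [d1 d10 h1] := hE _ e1; exists d1 => // h /h1; rewrite le_min => /andP[h2 h3].
have nE : normc l / 2 <= normc (E h).
  have := le_normcD (E h) (l - E h); rewrite addrC subrK normc_sub; lra.
have E0 : E h != 0 by rewrite -normc_gt0; lra.
rewrite (_ : _ - _ = - (E h - l) / (E h * l)); last by field; rewrite ?E0 ?l0.
rewrite normcM normcN normcV normcM -/(_ / _) ler_pdivrMr; last by rewrite mulr_gt0// normc_gt0.
apply: le_trans h3 _.
rewrite (_ : _ / 2 = e * (normc l / 2 * normc l)); last by field.
by rewrite ler_pM2l// ler_wpM2r// ltW.
Qed.

(** Enough regularity for a maximum principle, and stable under products and under inverses of
    [w - z0]. Primitives of complex differentiable functions have it without Cauchy's integral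
    formula. *)
Definition jet2 f z := exists a E l, cts0 E l /\ exists2 dl : R, 0 < dl &
  forall h, normc h < dl -> f (z + h) = f z + a * h + E h * h ^+ 2.

Lemma jet2_cst l z : jet2 (fun=> l) z.
Proof.
exists 0, (fun=> 0), 0; split; first exact: cts0_cst.
by exists 1 => // h _; ring.
Qed.

Lemma jet2M f g z : jet2 f z -> jet2 g z -> jet2 (fun w => f w * g w) z.
Proof.
move=> [a [E [l [hE [d1 d10 h1]]]]] [b [F [m [hF [d2 d20 h2]]]]].
exists (f z * b + a * g z), (fun h => f z * F h + a * b + E h * g z +
   h * (a * F h) + h * (b * E h) + E h * F h * (h * h)),
   (f z * m + a * b + l * g z + 0 * (a * m) + 0 * (b * l) + l * m * (0 * 0)); split.
  by repeat (apply: cts0D || apply: cts0M || apply: cts0_cst || apply: cts0_id || assumption).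
exists (Num.min d1 d2); first by rewrite lt_min d10.
move=> h; rewrite lt_min => /andP[hd1 hd2]; rewrite h1// h2//; ring.
Qed.

Lemma jet2_inv (z0 z : C) : z != z0 -> jet2 (fun w => (w - z0)^-1) z.
Proof.
move=> zz; set w := z - z0; have w0 : w != 0 by rewrite subr_eq0.
exists (- (w * w)^-1), (fun h => (w * w)^-1 * (w + h)^-1), ((w * w)^-1 * (w + 0)^-1); split.
  apply: cts0M; first exact: cts0_cst.
  apply: cts0V; first by rewrite addr0.
  by apply: cts0D; [exact: cts0_cst|exact: cts0_id].
exists (normc w); first by rewrite normc_gt0.
move=> h hw; have wh : w + h != 0.
  by apply: contraTneq hw => /eqP; rewrite addrC addr_eq0 => /eqP ->; rewrite normcN ltxx.
have -> : z + h - z0 = w + h by rewrite /w; ring.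
rewrite -/w; move: w0 wh; clearbody w => w0 wh.
by field; rewrite ?w0 ?wh.
Qed.

Lemma jet2X f z n : jet2 f z -> jet2 (fun w => f w ^+ n) z.
Proof.
move=> hf; elim: n => [|n IH]; first exact: jet2_cst.
have := jet2M hf IH; congr (jet2 _ z); apply/funext => w; exact: esym (exprS _ _).
Qed.

Lemma jet2_cts f z : jet2 f z -> cts0 (fun h => f (z + h)) (f z).
Proof.
move=> [a [E [l [hE [d d0 hd]]]]].
apply: (@cts0_near (fun h => f z + a * h + E h * (h * h))).
  by exists d => // h hh; rewrite hd.
rewrite -[X in cts0 _ X]addr0 -[X in cts0 _ (X + _)]addr0.
rewrite -[X in cts0 _ (_ + X + _)](mulr0 a) -[X in cts0 _ (_ + X)](mulr0 l).
rewrite -[X in cts0 _ (_ + l * X)](mulr0 0).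
by repeat (apply: cts0D || apply: cts0M || apply: cts0_cst || apply: cts0_id || assumption).
Qed.

(* The mean over the four points z + t, z - t, z + i t, z - i t kills the terms
   of degree one and two. *)
Lemma jet2_mean f z : jet2 f z -> forall e : R, 0 < e ->
  exists2 dl : R, 0 < dl & forall t : R, 0 < t -> t < dl ->
    `|complex.Re (f (z + t%:C)) + complex.Re (f (z - t%:C)) + complex.Re (f (z + 'i * t%:C)) +
      complex.Re (f (z - 'i * t%:C)) - 4 * complex.Re (f z)| <= e * t ^+ 2.
Proof.
move=> [a [E [l [hE [d d0 hd]]]]] e e0.
have [d1 d10 h1] := hE (e / 4) (divr_gt0 e0 (ltr0n _ 4)).
exists (Num.min d d1); first by rewrite lt_min d0.
move=> t t0; rewrite lt_min => /andP[td td1].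
have nt : normc t%:C = t by rewrite normc_real gtr0_norm.
have nit : normc ('i * t%:C) = t.
  by rewrite normcM nt /= expr0n expr1n add0r sqrtr1 mul1r.
have i2 : 'i ^+ 2 = -1 :> C := sqr_i R.
rewrite (_ : _ - _ = complex.Re (f (z + t%:C) + f (z - t%:C) + f (z + 'i * t%:C) +
   f (z - 'i * t%:C) - 4%:R * f z)); last first.
  move: (f (z + _)) (f (z - _)) (f (z + _)) (f (z - _)) (f z) => [? ?][? ?][? ?][? ?][? ?] /=.
  by rewrite !(mul0r, subr0, addr0).
apply: le_trans (le_Re_normc _) _.
rewrite !hd ?normcN ?nt ?nit//.
rewrite (_ : _ - _ = ((E t%:C - l) + (E (- t%:C) - l) - (E ('i * t%:C) - l)
   - (E (- ('i * t%:C)) - l)) * t%:C ^+ 2); last by rewrite !sqrrN !exprMn i2; ring.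
rewrite normcM normcX nt ler_wpM2r ?sqr_ge0//.
have -> : e = e / 4 + e / 4 + e / 4 + e / 4 by field.
do 3?[apply: le_trans (le_normcD _ _) _; apply: lerD; rewrite ?normcN].
all: by apply: h1; rewrite ?normcN ?nt ?nit.
Qed.

Section annulus.
Variables (z0 : C) (r0 r1 : R).
Hypothesis r00 : 0 <= r0.

Let pt (p : R * R) : C := p.1 +i* p.2.
Let q (p : R * R) : R := (p.1 - complex.Re z0) ^+ 2 + (p.2 - complex.Im z0) ^+ 2.
Let K := [set p | r0 ^+ 2 <= q p <= r1 ^+ 2].

Let q_normc p : q p = normc (pt p - z0) ^+ 2.
Proof. by rewrite /q /pt; case: z0 => a b /=; rewrite sqr_sqrtr// addr_ge0// sqr_ge0. Qed.

Let cont_pt f p : jet2 f (pt p) -> {for p, continuous (fun p => complex.Re (f (pt p)))}.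
Proof.
case: p => x y /jet2_cts hf; apply: continuous2_eps => e e0.
have [d d0 hd] := hf e e0; exists (d / 2); first by rewrite divr_gt0.
move=> h k hh kk; have hk : normc (h +i* k) < d.
  by apply: le_lt_trans (normc_le_ReIm _) _; rewrite /= [d]splitr ltrD.
have := hd _ hk; rewrite /pt /=; apply: le_trans; apply: le_trans (le_Re_normc _).
by move: (f _) (f _) => [? ?] [? ?].
Qed.

Let q_cont : continuous q.
Proof.
move=> p; rewrite /q; under eq_fun do rewrite !expr2.
by apply: cvgD; apply: cvgM; apply: cvgB; (exact: cvg_cst || exact: cvg_fst || exact: cvg_snd).
Qed.

Let compactK : compact K.
Proof.
pose B := (`[complex.Re z0 - `|r1|, complex.Re z0 + `|r1|]%classic `*`
           `[complex.Im z0 - `|r1|, complex.Im z0 + `|r1|]%classic).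
apply: (@subclosed_compact _ _ B).
- have -> : K = q @^-1` [set` `[r0 ^+ 2, r1 ^+ 2]].
    by apply/seteqP; split => p /=; rewrite in_itv.
  by apply: preimage_closed => //; exact: (@interval_closed _ (BLeft _) (BRight _)).
- by apply: compact_setX; exact: segment_compact.
- move=> [x y] /=; rewrite /K /q /= => /andP[_ hq].
  have h (u v : R) : u ^+ 2 + v ^+ 2 <= r1 ^+ 2 -> `|u| <= `|r1|.
    move=> uv; rewrite -[leLHS]ger0_norm// -[leRHS]ger0_norm//.
    rewrite -ler_sqr ?nnegrE// !real_normK ?num_real//.
    by apply: le_trans uv; rewrite lerDl sqr_ge0.
  have h1 := h _ _ hq; rewrite addrC in hq; have h2 := h _ _ hq.
  by move: h1 h2; rewrite /B /= !in_itv /= !ler_norml => /andP[? ?] /andP[? ?]; split; apply/andP; split; lra.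
Qed.

(** After adding [e |z - z0|^2] the mean over the four points of [jet2_mean] exceeds the central
    value strictly, by at least [3 e t^2] in the sum. A maximum on the compact annulus is therefore
    on the boundary; then [e] tends to 0. *)
Lemma annulus_max f M :
  (forall z, r0 <= normc (z - z0) <= r1 -> jet2 f z) ->
  (forall z, normc (z - z0) = r0 \/ normc (z - z0) = r1 -> complex.Re (f z) <= M) ->
  forall z, r0 <= normc (z - z0) <= r1 -> complex.Re (f z) <= M.
Proof.
move=> hf hM z hz.
have r10 : 0 <= r1 by case/andP: hz => _; exact: le_trans (normc_ge0 _).
have inK p : K p <-> r0 <= normc (pt p - z0) <= r1.
  by rewrite /K /= q_normc !ler_sqr ?nnegrE ?normc_ge0.
have step (e : R) : 0 < e -> complex.Re (f z) <= M + e * r1 ^+ 2.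
  move=> e0; pose v p := complex.Re (f (pt p)) + e * q p.
  have cv : {within K, continuous v}.
    apply: continuous_in_subspaceT => p; rewrite inE => /inK/hf hp.
    apply: cvgD; first exact: cont_pt.
    by apply: cvgMr; exact: q_cont.
  have ptz : pt (complex.Re z, complex.Im z) = z by rewrite /pt; case: (z).
  have Kz : K (complex.Re z, complex.Im z) by apply/inK; rewrite ptz.
  have [p /set_mem Kp pmax0] := compact_EVT_max (ex_intro _ _ Kz) compactK cv.
  have {pmax0}pmax s : K s -> v s <= v p by move=> Ks; apply: pmax0; rewrite inE.
  have zle : complex.Re (f z) <= v p.
    apply: le_trans (pmax _ Kz); rewrite /v ptz lerDl mulr_ge0 ?(ltW e0)//.
    by rewrite /q; rewrite addr_ge0 ?sqr_ge0.
  apply: le_trans zle _.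
  have [/eqP b0|n0] := boolP (normc (pt p - z0) == r0).
    apply: lerD; first by apply: hM; left.
    by rewrite ler_pM2l//; case/andP: Kp.
  have [/eqP b1|n1] := boolP (normc (pt p - z0) == r1).
    apply: lerD; first by apply: hM; right.
    by rewrite ler_pM2l//; case/andP: Kp.
  exfalso.
  have /andP[p0 p1] : r0 < normc (pt p - z0) < r1.
    by move/inK: (Kp) => /andP[a1 a2]; rewrite !lt_neqAle a1 a2 n1 eq_sym n0.
  have [dl dl0 hd] := jet2_mean (hf _ (proj1 (inK p) Kp)) e0.
  (* Small enough for the expansion at [pt p] and for the four points to remain in the annulus. *)
  pose t := Num.min (dl / 2) (Num.min ((normc (pt p - z0) - r0) / 2) ((r1 - normc (pt p - z0)) / 2)).
  have t0 : 0 < t by rewrite !lt_min !divr_gt0// subr_gt0.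
  have td : t < dl by rewrite gt_min; apply/orP; left; lra.
  have t1 : t <= (normc (pt p - z0) - r0) / 2 by rewrite !ge_min lexx orbT.
  have t2 : t <= (r1 - normc (pt p - z0)) / 2 by rewrite !ge_min lexx !orbT.
  have {}hd := hd t t0 td.
  have nb (s : R * R) : normc (pt s - pt p) = t -> v s <= v p.
    move=> st; apply: pmax; apply/inK.
    have s1 := le_normcD (pt s - pt p) (pt p - z0); rewrite addrA subrK st in s1.
    have s2 := le_normcD (pt p - pt s) (pt s - z0); rewrite addrA subrK normc_sub st in s2.
    by apply/andP; split; lra.
  have n1' := nb (p.1 + t, p.2); have n2 := nb (p.1 - t, p.2).
  have n3 := nb (p.1, p.2 + t); have n4 := nb (p.1, p.2 - t).
  move: n1' n2 n3 n4; rewrite /v /q /=.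
  have -> : pt (p.1 + t, p.2) = pt p + t%:C by rewrite /pt /=; simpc.
  have -> : pt (p.1 - t, p.2) = pt p - t%:C by rewrite /pt /=; simpc.
  have -> : pt (p.1, p.2 + t) = pt p + 'i * t%:C by rewrite /pt /=; simpc.
  have -> : pt (p.1, p.2 - t) = pt p - 'i * t%:C by rewrite /pt /=; simpc.
  rewrite ![p.1 + _ - p.1]addrAC ![p.2 + _ - p.2]addrAC !subrr !add0r !sqrrN.
  rewrite expr0n addr0 add0r sqrtr_sqr (gtr0_norm t0).
  move=> /(_ erefl) m1 /(_ erefl) m2 /(_ erefl) m3 /(_ erefl) m4.
  have et : 0 < e * t ^+ 2 by rewrite mulr_gt0// exprn_gt0.
  move: hd; rewrite ler_norml => /andP[hd _].
  by nra.
rewrite leNgt; apply/negP => hlt.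
have r1p : 0 < r1 ^+ 2 + 1 by rewrite ltr_wpDl// sqr_ge0.
have e0 : 0 < (complex.Re (f z) - M) / (r1 ^+ 2 + 1) by rewrite divr_gt0// subr_gt0.
have := step _ e0; rewrite mulrAC -lerBlDl ler_pdivlMr// mulrDr mulr1.
lra.
Qed.

Lemma annulus_bounded f : (forall z, r0 <= normc (z - z0) <= r1 -> jet2 f z) ->
  exists2 M : R, 0 <= M & forall z, r0 <= normc (z - z0) <= r1 -> complex.Re (f z) <= M.
Proof.
move=> hf.
have inK p : 0 <= r1 -> K p <-> r0 <= normc (pt p - z0) <= r1.
  by move=> r10; rewrite /K /= q_normc !ler_sqr ?nnegrE ?normc_ge0.
have [r10|r1n] := leP 0 r1; last first.
  by exists 0 => // z /andP[_ /(le_lt_trans)/(_ r1n)]; rewrite ltNge normc_ge0.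
have cv : {within K, continuous (fun p => complex.Re (f (pt p)))}.
  apply: continuous_in_subspaceT => p; rewrite inE => /(inK _ r10)/hf hp.
  exact: cont_pt.
have [[z hz]|no] := pselect (exists z, r0 <= normc (z - z0) <= r1); last first.
  by exists 0 => // z hz; case: no; exists z.
have pte w : pt (complex.Re w, complex.Im w) = w by rewrite /pt; case: (w).
have Kz w : r0 <= normc (w - z0) <= r1 -> K (complex.Re w, complex.Im w).
  by move=> hw; apply/(inK _ r10); rewrite pte.
have [p _ pmax0] := compact_EVT_max (ex_intro _ _ (Kz _ hz)) compactK cv.
have {pmax0}pmax s : K s -> complex.Re (f (pt s)) <= complex.Re (f (pt p)).
  by move=> Ks; apply: pmax0; rewrite inE.
exists (`|complex.Re (f (pt p))|) => // w /Kz/pmax; rewrite pte => /le_trans; apply.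
exact: ler_norm.
Qed.

End annulus.

(** Divided by [(w - z0)^n], the function vanishes on the inner circle and is at most [M / r1^n] on
    the outer one. The maximum principle gives [|f z| <= M (|z - z0| / r1)^n], which tends to 0. *)
Lemma jet2_disc_zero f z0 (r0 r1 : R) : 0 < r0 ->
  (forall z, normc (z - z0) <= r1 -> jet2 f z) ->
  (forall z, normc (z - z0) <= r0 -> f z = 0) ->
  forall z, normc (z - z0) < r1 -> f z = 0.
Proof.
move=> r00 hf h0 z hz.
have [zr0|zr0] := leP (normc (z - z0)) r0; first exact: h0.
have r1p : 0 < r1 := le_lt_trans (normc_ge0 _) hz.
have jf k n w : r0 <= normc (w - z0) <= r1 -> jet2 (fun w => k * (f w * (w - z0)^-1 ^+ n)) w.
  move=> /andP[w0 w1]; apply: jet2M; first exact: jet2_cst.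
  apply: jet2M; first exact: hf.
  apply: jet2X; apply: jet2_inv; apply: contraTneq w0 => ->.
  by rewrite subrr normc0 -ltNge.
have bd k : exists2 M : R, 0 <= M &
    forall w, r0 <= normc (w - z0) <= r1 -> complex.Re (k * f w) <= M.
  have := @annulus_bounded z0 r0 r1 (ltW r00) (fun w => k * (f w * (w - z0)^-1 ^+ 0)) (jf k 0%N).
  by move=> [M M0 hM]; exists M => // w /hM; rewrite expr0 mulr1.
have [M1 M10 b1] := bd 1; have [M2 M20 b2] := bd (- 1).
have [M3 M30 b3] := bd 'i; have [M4 M40 b4] := bd (- 'i).
pose M := M1 + M2 + (M3 + M4).
have bM w : r0 <= normc (w - z0) <= r1 -> normc (f w) <= M.
  move=> hw; apply: le_trans (normc_le_ReIm _) _.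
  have := b1 _ hw; have := b2 _ hw; have := b3 _ hw; have := b4 _ hw.
  case: (f w) => a b; simpc => /= ? ? ? ?; rewrite /M; apply: lerD; rewrite ler_norml; apply/andP; split; lra.
have key n : normc (f z) <= M * (normc (z - z0) / r1) ^+ n.
  pose c := normc (z - z0).
  have c0 : 0 < c := lt_trans r00 zr0.
  set u := f z * (z - z0)^-1 ^+ n.
  have nu : normc u = normc (f z) / c ^+ n.
    by rewrite /u normcM normcX normcV exprVn.
  (* The maximum principle speaks of real parts; the factor [u^*%C] turns the value at [z] into the
     positive number [|u|^2]. *)
  have := @annulus_max z0 r0 r1 (ltW r00) (fun w => u^*%C * (f w * (w - z0)^-1 ^+ n))
     (normc u * (M / r1 ^+ n)) (jf _ n).
  have nuc : normc u^*%C = normc u by case: (u) => a b /=; rewrite sqrrN.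
  have M0 : 0 <= M by rewrite /M !addr_ge0.
  have hb w : normc (w - z0) = r0 \/ normc (w - z0) = r1 ->
      complex.Re (u^*%C * (f w * (w - z0)^-1 ^+ n)) <= normc u * (M / r1 ^+ n).
    case=> hw.
      rewrite h0 ?hw// mul0r mulr0 /=.
      by rewrite mulr_ge0 ?normc_ge0// divr_ge0// exprn_ge0// ltW.
    apply: le_trans (ler_norm _) _; apply: le_trans (le_Re_normc _) _.
    rewrite normcM nuc ler_wpM2l ?normc_ge0// normcM normcX normcV hw exprVn.
    rewrite ler_wpM2r ?invr_ge0 ?exprn_ge0 ?(ltW r1p)// bM// hw lexx andbT.
    exact: ltW (lt_trans zr0 hz).
  move=> /(_ hb z); rewrite (ltW zr0) (ltW hz) => /(_ isT).
  have -> : complex.Re (u^*%C * (f z * (z - z0)^-1 ^+ n)) = normc u ^+ 2.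
    rewrite -/u; case: (u) => a b /=; rewrite sqr_sqrtr; last by rewrite addr_ge0 ?sqr_ge0.
    by ring.
  have [->|fz0] := eqVneq (f z) 0.
    by move=> _; rewrite normc0 mulr_ge0// exprn_ge0// divr_ge0 ?normc_ge0// ltW.
  have nu0 : 0 < normc u.
    by rewrite nu divr_gt0 ?exprn_gt0// normc_gt0.
  rewrite expr2 ler_pM2l// nu ler_pdivrMr ?exprn_gt0// => hh; apply: le_trans hh _.
  by rewrite expr_div_n mulrAC -mulrA.
have lim0 : M * (normc (z - z0) / r1) ^+ n @[n --> \oo] --> (M * 0 : R).
  apply: cvgMr; apply: cvg_expr; rewrite ger0_norm ?divr_ge0 ?normc_ge0 ?(ltW r1p)//.
  by rewrite ltr_pdivrMr// mul1r.
have : normc (f z) <= M * 0.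
  by apply: cvgr_to_ge lim0 _; near=> n; exact: key.
rewrite mulr0 => hle; apply/eq0_normc/eqP; rewrite eq_le hle; exact: normc_ge0.
Unshelve. all: by end_near. Qed.

End jets.

(** * Primitives of holomorphic functions and the identity theorem *)

Section identity.
Variable R : realType.
Local Notation C := R[i].
Implicit Types (f g : C -> C) (l z h : C).

Definition cderiv f z l := forall e : R, 0 < e -> exists2 dl : R, 0 < dl &
  forall h, normc h < dl -> normc (f (z + h) - f z - l * h) <= e * normc h.

Lemma normC_ltc (z : C) (e : R) : (`|z| < e%:C) = (normc z < e).
Proof. by rewrite normc_def ltcR; case: z. Qed.

Lemma normC_lec (z : C) (e : R) : (`|z| <= e%:C) = (normc z <= e).
Proof. by rewrite normc_def lecR; case: z. Qed.

Lemma posC_real (e : C) : 0 < e -> exists2 r : R, 0 < r & e = r%:C.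
Proof.
by case: e => a b; rewrite ltcE /= => /andP[/eqP -> a0]; exists a.
Qed.

(** The scalars of [C^o] are complex, so derivability in the direction 1 is complex
    differentiability; it is restated with the real-valued norm [normc]. *)
Lemma derivable_cderiv f z : derivable (f : C^o -> C^o) z 1 <-> exists l, cderiv f z l.
Proof.
split.
  move=> /cvg_ex[l /cvgrPdist_le hl]; exists l => e e0.
  have e0' : 0 < e%:C :> C by rewrite ltcR.
  have [d /posC_real[dl dl0 ->] hd] := hl _ e0'.
  exists dl => // h hh; have [->|h0] := eqVneq h 0.
    by rewrite addr0 mulr0 subrr subr0 normc0 mulr0.
  have := hd h; rewrite /ball_ /= sub0r normrN normC_ltc => /(_ hh h0).
  rewrite normC_lec => hn.
  have -> : f (z + h) - f z - l * h = - (l - h^-1 * (f (h * 1 + z) - f z)) * h.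
    by rewrite mulr1 [h + z]addrC; field.
  by rewrite normcM normcN ler_wpM2r ?normc_ge0.
move=> [l hl]; apply/cvg_ex; exists l; apply/cvgrPdist_le => e /posC_real[r r0 ->].
have [dl dl0 hd] := hl _ r0; exists dl%:C; first by rewrite /= ltcR.
move=> h; rewrite /ball_ /= sub0r normrN normC_ltc => hh h0; rewrite normC_lec.
have h1 := hd _ hh; have hn : 0 < normc h by rewrite normc_gt0.
rewrite -(ler_pM2r hn) -normcM; apply: le_trans h1; rewrite -normcN.
rewrite le_eqVlt; apply/orP; left; apply/eqP; congr normc.
have E : h * h^-1 = 1 by rewrite divff.
rewrite mulrBl /GRing.scale /= mulr1 [h + z]addrC.
rewrite [h^-1 * _]mulrC -mulrA [h^-1 * h]mulrC E mulr1; ring.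
Qed.

Let U f (x y : R) := complex.Re (f (x +i* y)).
Let V f (x y : R) := complex.Im (f (x +i* y)).

(** The Cauchy-Riemann equations appear as the coefficients [Re l] and [Im l] shared by the two
    expansions. *)
Lemma cderiv_re_im f (x y : R) l : cderiv f (x +i* y) l -> forall e : R, 0 < e ->
  exists2 dl : R, 0 < dl & forall h k : R, `|h| < dl -> `|k| < dl ->
   `|U f (x + h) (y + k) - U f x y - (complex.Re l * h - complex.Im l * k)| <= e * (`|h| + `|k|) /\
   `|V f (x + h) (y + k) - V f x y - (complex.Im l * h + complex.Re l * k)| <= e * (`|h| + `|k|).
Proof.
move=> hl e e0; have [d d0 hd] := hl e e0.
exists (d / 2); first by rewrite divr_gt0.
move=> h k hh kk; have hk : normc (h +i* k) < d.
  by apply: le_lt_trans (normc_le_ReIm _) _; rewrite /= [d]splitr ltrD.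
have {hd} := hd _ hk; set D := (_ - _ - _) => hD.
have : e * normc (h +i* k) <= e * (`|h| + `|k|).
  by apply: ler_wpM2l; [exact: ltW|exact: normc_le_ReIm].
move=> /(le_trans hD){}hD.
have := le_trans (le_Re_normc D) hD; have := le_trans (le_Im_normc D) hD.
rewrite /D /U /V /=; have -> : (x +i* y) + (h +i* k) = (x + h) +i* (y + k) by [].
move: (f _) (f _) l {D hl hD} => [a b] [a' b'] [c d'] /=.
by rewrite -?opprD => h1 h2; split => //; rewrite [d' * h + _]addrC.
Qed.

(** The real and imaginary parts of [f dz] are [U dx - V dy] and [V dx + U dy], both closed by the
    Cauchy-Riemann equations. Their potentials are the components of [F], and [potential_jet]
    supplies its second-order expansion. *)
Lemma primitive f (x0 y0 : R) :
  (forall x y, x0 <= x -> y0 <= y -> exists l, cderiv f (x +i* y) l) ->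
  exists F : C -> C, forall x y, x0 < x -> y0 < y ->
    [/\ jet2 F (x +i* y), cderiv F (x +i* y) (f (x +i* y)),
        is_derive x 1 (fun x => complex.Re (F (x +i* y))) (U f x y) &
        is_derive x 1 (fun x => complex.Im (F (x +i* y))) (V f x y)] /\
    (is_derive y 1 (fun y => complex.Re (F (x +i* y))) (- V f x y) /\
     is_derive y 1 (fun y => complex.Im (F (x +i* y))) (U f x y)).
Proof.
move=> hf.
have c1 x y : x0 <= x -> y0 <= y -> closed_at (U f) (fun x y => - V f x y) x y.
  move=> hx hy; have [l /cderiv_re_im hl] := hf x y hx hy.
  exists (complex.Re l), (- complex.Im l), (- complex.Re l) => e /hl[d d0 hd].
  exists d => // h k hh kk; have [h1 h2] := hd h k hh kk; split; first by rewrite mulNr.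
  by rewrite -normrN; congr (`|_| <= _): h2; ring.
have c2 x y : x0 <= x -> y0 <= y -> closed_at (V f) (U f) x y.
  move=> hx hy; have [l /cderiv_re_im hl] := hf x y hx hy.
  exists (complex.Im l), (complex.Re l), (- complex.Im l) => e /hl[d d0 hd].
  exists d => // h k hh kk; have [h1 h2] := hd h k hh kk; split; first by [].
  by rewrite mulNr.
have [F1 hF1] := potential c1; have [F2 hF2] := potential c2.
pose F z := F1 (complex.Re z) (complex.Im z) +i* F2 (complex.Re z) (complex.Im z).
exists F => x y hx hy; have [p1 p2] := hF1 x y hx hy; have [q1 q2] := hF2 x y hx hy.
pose rho := Num.min (x - x0) (y - y0).
have rho0 : 0 < rho by rewrite lt_min !subr_gt0 hx.
have near_ok (h k : R) : `|h| < rho -> `|k| < rho -> x0 < x + h /\ y0 < y + k.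
  rewrite !lt_min !ltr_norml => /andP[/andP[? ?] _] /andP[_ /andP[? ?]]; split; lra.
have [l /cderiv_re_im hl] := hf x y (ltW hx) (ltW hy).
have j1 := @potential_jet _ F1 (U f) (fun x y => - V f x y) x y rho rho0
  (fun (h k : R) hh kk => hF1 _ _ (near_ok h k hh kk).1 (near_ok h k hh kk).2)
  (complex.Re l) (- complex.Im l) (- complex.Re l).
have j2 := @potential_jet _ F2 (V f) (U f) x y rho rho0
  (fun (h k : R) hh kk => hF2 _ _ (near_ok h k hh kk).1 (near_ok h k hh kk).2)
  (complex.Im l) (complex.Re l) (- complex.Im l).
have J e : 0 < e -> exists2 dl : R, 0 < dl & forall h, normc h < dl ->
    normc (F (x +i* y + h) - F (x +i* y) - f (x +i* y) * h - l / 2%:R * h ^+ 2) <= e * normc h ^+ 2.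
  (* The factor 8 absorbs [(|h| + |k|)^2 <= 4 |h + i k|^2] and the addition of the two
     components. *)
  move=> e0; have e8 : 0 < e / 8 by rewrite divr_gt0.
  have [d1 d10 h1] : exists2 dl : R, 0 < dl & forall h k : R, `|h| < dl -> `|k| < dl ->
    `|F1 (x + h) (y + k) - F1 x y - (U f x y * h + - V f x y * k)
       - (complex.Re l * h ^+ 2 / 2 + - complex.Im l * h * k + - complex.Re l * k ^+ 2 / 2)|
    <= (e / 8) * (`|h| + `|k|) ^+ 2.
    apply: (j1 _ _ e8) => e' /hl[d d0 hd]; exists d => // h k hh kk.
    have [h1 h2] := hd h k hh kk; split; first by rewrite mulNr.
    by rewrite -normrN; congr (`|_| <= _): h2; ring.
  have [d2 d20 h2] : exists2 dl : R, 0 < dl & forall h k : R, `|h| < dl -> `|k| < dl ->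
    `|F2 (x + h) (y + k) - F2 x y - (V f x y * h + U f x y * k)
       - (complex.Im l * h ^+ 2 / 2 + complex.Re l * h * k + - complex.Im l * k ^+ 2 / 2)|
    <= (e / 8) * (`|h| + `|k|) ^+ 2.
    apply: (j2 _ _ e8) => e' /hl[d d0 hd]; exists d => // h k hh kk.
    have [h1' h2] := hd h k hh kk; split; first by [].
    by rewrite mulNr.
  exists (Num.min d1 d2); first by rewrite lt_min d10.
  case=> h k; rewrite lt_min => /andP[n1 n2].
  have nh := le_Re_normc (h +i* k); have nk := le_Im_normc (h +i* k); rewrite /= -/(normc (h +i* k)) in nh nk.
  have {}h1 := h1 h k (le_lt_trans nh n1) (le_lt_trans nk n1).
  have {}h2 := h2 h k (le_lt_trans nh n2) (le_lt_trans nk n2).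
  apply: le_trans (normc_le_ReIm _) _.
  have bd : (`|h| + `|k|) ^+ 2 <= 4 * normc (h +i* k) ^+ 2.
    have := ReIm_le_normc (h +i* k); rewrite -(@ler_sqr _ (`|h| + `|k|)) ?nnegrE ?addr_ge0//; last first.
      by rewrite mulr_ge0 ?normc_ge0.
    by move=> hh; apply: le_trans hh _; rewrite exprMn -natrX.
  have eb : e * normc (h +i* k) ^+ 2 = (e / 8) * (4 * normc (h +i* k) ^+ 2) + (e / 8) * (4 * normc (h +i* k) ^+ 2).
    by field.
  rewrite eb; apply: lerD.
    apply: le_trans (_ : (e / 8) * (`|h| + `|k|) ^+ 2 <= _); last by rewrite ler_pM2l.
    apply: le_trans h1; rewrite le_eqVlt; apply/orP; left; apply/eqP; congr `|_|.
    rewrite /F /U /V; case: (f _) (l) => [u v] [c c'] /=.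
    by rewrite !expr2; simpc => /=; rewrite ?expr0n; field.
  apply: le_trans (_ : (e / 8) * (`|h| + `|k|) ^+ 2 <= _); last by rewrite ler_pM2l.
  apply: le_trans h2; rewrite le_eqVlt; apply/orP; left; apply/eqP; congr `|_|.
  rewrite /F /U /V; case: (f _) (l) => [u v] [c c'] /=.
  by rewrite !expr2; simpc => /=; rewrite ?expr0n; field.
have jF : jet2 F (x +i* y).
  pose E h := if h == 0 then l / 2%:R else (F (x +i* y + h) - F (x +i* y) - f (x +i* y) * h) / h ^+ 2.
  exists (f (x +i* y)), E, (l / 2%:R); split; last first.
    exists 1 => // h _; rewrite /E; case: eqP => [->|/eqP h0]; first by rewrite addr0; ring.
    by field.
  move=> e e0; have [d d0 hd] := J e e0; exists d => // h /hd; rewrite /E; case: eqP => [_|/eqP h0].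
    by rewrite !subrr normc0; move=> _; apply: ltW.
  have hn : 0 < normc h ^+ 2 by rewrite exprn_gt0// normc_gt0.
  move=> hle; rewrite -(ler_pM2r hn); apply: le_trans hle; rewrite -normcX -normcM.
  rewrite le_eqVlt; apply/orP; left; apply/eqP; congr normc.
  by field.
split; [split|] => //.
have [d d0 hd] := J 1 ltr01.
move=> e e0; have nl0 := normc_ge0 (l / 2%:R).
exists (Num.min d (e / (normc (l / 2%:R) + 1))).
  by rewrite lt_min d0 divr_gt0// ltr_pwDr.
move=> h; rewrite lt_min ltr_pdivlMr ?ltr_pwDr// => /andP[/hd h1 h2].
rewrite -[X in normc X](subrK (l / 2%:R * h ^+ 2)).
apply: le_trans (le_normcD _ _) _; apply: le_trans (lerD h1 (lexx _)) _.
rewrite mul1r normcM normcX; have := normc_ge0 h; move: (normc h) (normc _) h2 nl0 => n m; nra.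
Qed.

(** Only first-order expansions of [f] are known, so [jet2_disc_zero] is applied to a primitive [F].
    It is constant near a point [z0] high above the given one, hence on a disc that reaches the
    given point, where [f] is the derivative of [F]. *)
Lemma identity_theorem f (c : R) :
  analytic_on (@upper_half_plane R) f ->
  (forall z, c < complex.Im z -> f z = 0) ->
  forall z, upper_half_plane z -> f z = 0.
Proof.
move=> hf hc [xp yp]; rewrite /upper_half_plane /= => yp0.
pose Y := Num.max c yp + 1; pose z0 := xp +i* Y.
have cY : c + 1 <= Y by rewrite lerD2r le_max lexx.
have pY : yp + 1 <= Y by rewrite lerD2r le_max lexx orbT.
(* The disc of radius [r1] about [z0] contains the target point, at distance [Y - yp], and stays
   above height [yp / 2], inside the domain of the primitive. *)
pose x0 := xp - Y - 1; pose y0 := yp / 4; pose r1 := Y - yp / 2.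
have [|F hF] := @primitive f x0 y0.
  move=> x y _ hy; apply/derivable_cderiv; apply: hf; rewrite /upper_half_plane /=.
  by apply: lt_le_trans hy; rewrite divr_gt0.
have inD z : normc (z - z0) <= r1 -> x0 < complex.Re z /\ y0 < complex.Im z.
  move=> hz; have := le_trans (le_Re_normc _) hz; have := le_trans (le_Im_normc _) hz.
  case: z hz => x y _ /=; rewrite !ler_norml /x0 /y0 /r1 => /andP[? ?] /andP[? ?]; split; lra.
pose G z := F z - F z0.
have jG z : normc (z - z0) <= r1 -> jet2 G z.
  move=> /inD; case: z => x y /= [hx hy].
  have [[[a [E [l [hE [d d0 hd]]]]] _ _ _] _] := hF x y hx hy.
  exists a, E, l; split => //; exists d => // h /hd hh.
  by rewrite /G hh; ring.
have G0 z : normc (z - z0) <= 1 / 2 -> G z = 0.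
  move=> hz; have hr : normc (z - z0) <= r1 by apply: le_trans hz _; rewrite /r1; lra.
  have [] := inD z hr; have := le_trans (le_Im_normc _) hz.
  case: z {hz hr} => x y /=; rewrite ler_norml => /andP[y1 y2] hx hy.
  have zero x' y' : c < y' -> f (x' +i* y') = 0 by move=> h'; apply: hc.
  have cst (g g' : R -> R) (a b : R) : a <= b -> (forall t, a <= t <= b -> is_derive t 1 g (g' t)) ->
      (forall t, a <= t <= b -> g' t = 0) -> g b = g a.
    move=> ab hg hg'; have := @mvt_affine _ g g' a b 0 0 0 0 ab hg.
    rewrite !mul0r !addr0 subr0 => h'; apply/eqP; rewrite -subr_eq0 -normr_eq0 eq_le normr_ge0 andbT.
    by apply: h' => t ht; rewrite mul0r addr0 subr0 hg'// normr0.
  have cst2 (g g' : R -> R) (a b : R) : (forall t, Num.min a b <= t -> is_derive t 1 g (g' t)) ->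
      (forall t, Num.min a b <= t -> g' t = 0) -> g b = g a.
    move=> hg hg'; have [ab|ba] := leP a b.
      by apply: (cst _ g') => // t /andP[ht _]; [apply: hg|apply: hg']; rewrite (min_idPl ab).
    have ba' := ltW ba.
    by apply/esym/(cst _ g') => // t /andP[ht _]; [apply: hg|apply: hg']; rewrite (min_idPr ba').
  have x0p : x0 < xp by rewrite /x0; lra.
  have y0c t : Num.min Y y <= t -> y0 < t /\ c < t.
    by rewrite ge_min /y0 => /orP[]; split; lra.
  have x0c t : Num.min xp x <= t -> x0 < t.
    by rewrite ge_min => /orP[]; apply: lt_le_trans.
  have mY : Num.min Y y <= Y by rewrite ge_min lexx.
  have [yY0 yYc] := y0c Y mY.
  rewrite /G /z0; apply/eqP; rewrite subr_eq0 eq_complex; apply/andP; split; apply/eqP.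
    transitivity (complex.Re (F (x +i* Y))).
      apply: (cst2 (fun y => complex.Re (F (x +i* y))) (fun t => - V f x t)) => t /y0c[t1 t2].
        exact: (hF x t hx t1).2.1.
      by rewrite /V zero// oppr0.
    apply: (cst2 (fun x => complex.Re (F (x +i* Y))) (fun t => U f t Y)) => t /x0c t1.
      by have [[]] := hF t Y t1 yY0.
    by rewrite /U zero.
  transitivity (complex.Im (F (x +i* Y))).
    apply: (cst2 (fun y => complex.Im (F (x +i* y))) (fun t => U f x t)) => t /y0c[t1 t2].
      exact: (hF x t hx t1).2.2.
    by rewrite /U zero.
  apply: (cst2 (fun x => complex.Im (F (x +i* Y))) (fun t => V f t Y)) => t /x0c t1.
    by have [[]] := hF t Y t1 yY0.
  by rewrite /V zero.
have Gz := jet2_disc_zero (divr_gt0 ltr01 (ltr0n _ 2)) jG G0.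
have np : normc (xp +i* yp - z0) = Y - yp.
  by rewrite /z0 /= subrr expr0n add0r sqrtr_sqr ler0_norm; lra.
have pr : normc (xp +i* yp - z0) < r1 by rewrite np /r1; lra.
have Gp := Gz _ pr.
have x0p : x0 < xp by rewrite /x0; lra.
have y0p : y0 < yp by rewrite /y0; lra.
have [[_ dF _ _] _] := hF xp yp x0p y0p.
apply/eqP; apply: contraT => fp.
have nf : 0 < normc (f (xp +i* yp)) by rewrite normc_gt0.
have [d d0 hd] := dF _ (divr_gt0 nf (ltr0n _ 2)).
pose t := Num.min (d / 2) (yp / 4).
have t0 : 0 < t by rewrite lt_min !divr_gt0.
have td : t < d by rewrite gt_min; apply/orP; left; lra.
have ty : t <= yp / 4 by rewrite ge_min lexx orbT.
have nt : normc t%:C = t by rewrite normc_real gtr0_norm.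
have := hd t%:C; rewrite nt => /(_ td).
have -> : F (xp +i* yp + t%:C) = F (xp +i* yp).
  have Gt : G (xp +i* yp + t%:C) = 0.
    apply: Gz; rewrite addrAC; apply: le_lt_trans (le_normcD _ _) _.
    by rewrite np nt /r1; lra.
  by move: Gt Gp; rewrite /G => /eqP; rewrite subr_eq0 => /eqP -> /eqP; rewrite subr_eq0 => /eqP ->.
rewrite subrr sub0r normcN normcM nt => hle.
by move: hle; rewrite ler_pM2r//; lra.
Qed.

End identity.

(** * Stieltjes transforms *)

Section complex_expectation.
Context d (T : measurableType d) (R : realType).
Local Notation C := R[i].
Implicit Types (mu : probability T R) (f g : T -> C).

Definition mfunC f := measurable_fun setT (fun x => complex.Re (f x)) /\
  measurable_fun setT (fun x => complex.Im (f x)).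

Definition bdmC f := mfunC f /\ exists M : R, forall x, normc (f x) <= M.

Lemma mfunC_cst (c : C) : mfunC (fun=> c).
Proof. by split; exact: measurable_cst. Qed.

Lemma mfunC_real (f : T -> R) : measurable_fun setT f -> mfunC (fun x => (f x)%:C).
Proof. by move=> mf; split => //=; exact: measurable_cst. Qed.

Lemma mfunCD f g : mfunC f -> mfunC g -> mfunC (fun x => f x + g x).
Proof.
move=> [f1 f2] [g1 g2]; split.
  by under eq_fun do rewrite raddfD /=; exact: measurable_funD.
by under eq_fun do rewrite raddfD /=; exact: measurable_funD.
Qed.

Lemma mfunCN f : mfunC f -> mfunC (fun x => - f x).
Proof.
by move=> [f1 f2]; split; under eq_fun do rewrite raddfN /=; exact: measurableT_comp.
Qed.

Lemma mfunCB f g : mfunC f -> mfunC g -> mfunC (fun x => f x - g x).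
Proof. by move=> mf mg; apply: mfunCD => //; exact: mfunCN. Qed.

Lemma ReM (a b : C) : complex.Re (a * b) = complex.Re a * complex.Re b - complex.Im a * complex.Im b.
Proof. by case: a b => [? ?] [? ?]. Qed.

Lemma ImM (a b : C) : complex.Im (a * b) = complex.Re a * complex.Im b + complex.Im a * complex.Re b.
Proof. by case: a b => [? ?] [? ?]. Qed.

Lemma mfunCM f g : mfunC f -> mfunC g -> mfunC (fun x => f x * g x).
Proof.
move=> [f1 f2] [g1 g2]; split.
  by under eq_fun do rewrite ReM; apply: measurable_funB; exact: measurable_funM.
by under eq_fun do rewrite ImM; apply: measurable_funD; exact: measurable_funM.
Qed.

Lemma mfunCV f : mfunC f -> mfunC (fun x => (f x)^-1).
Proof.
move=> [f1 f2].
pose q x := complex.Re (f x) ^+ 2 + complex.Im (f x) ^+ 2.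
have mq : measurable_fun setT (fun x => (q x)^-1).
  have -> : (fun x => (q x)^-1) = (fun x => powR (q x) (-1)).
    by apply/funext => x; rewrite powR_inv1// addr_ge0 ?sqr_ge0.
  apply: (measurableT_comp (f := fun x : R => powR x (-1))); first exact: measurable_powR.
  by apply: measurable_funD; exact: measurable_funX.
split.
  rewrite (_ : (fun x => _) = fun x => complex.Re (f x) * (q x)^-1); first exact: measurable_funM.
  by apply/funext => x; rewrite /q; case: (f x) => a b.
rewrite (_ : (fun x => _) = fun x => - (complex.Im (f x) * (q x)^-1)).
  by apply: measurableT_comp => //; exact: measurable_funM.
by apply/funext => x; rewrite /q; case: (f x) => a b.
Qed.

Lemma bdmC_re f : bdmC f -> bdm (fun x => complex.Re (f x)).
Proof. by move=> [[f1 f2] [M hM]]; split => //; exists M => x; exact: le_trans (le_Re_normc _) _. Qed.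

Lemma bdmC_im f : bdmC f -> bdm (fun x => complex.Im (f x)).
Proof. by move=> [[f1 f2] [M hM]]; split => //; exists M => x; exact: le_trans (le_Im_normc _) _. Qed.

Lemma bdmC_cst (c : C) : bdmC (fun=> c).
Proof. by split; [exact: mfunC_cst|exists (normc c)]. Qed.

Lemma bdmCD f g : bdmC f -> bdmC g -> bdmC (fun x => f x + g x).
Proof.
move=> [mf [M hM]] [mg [M' hM']]; split; first exact: mfunCD.
by exists (M + M') => x; apply: le_trans (le_normcD _ _) _; exact: lerD.
Qed.

Lemma bdmCN f : bdmC f -> bdmC (fun x => - f x).
Proof. by move=> [mf [M hM]]; split; [exact: mfunCN|exists M => x; rewrite normcN]. Qed.

Lemma bdmCB f g : bdmC f -> bdmC g -> bdmC (fun x => f x - g x).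
Proof. by move=> bf bg; apply: bdmCD => //; exact: bdmCN. Qed.

Lemma bdmCM f g : bdmC f -> bdmC g -> bdmC (fun x => f x * g x).
Proof.
move=> [mf [M hM]] [mg [M' hM']]; split; first exact: mfunCM.
by exists (M * M') => x; rewrite normcM; apply: ler_pM; rewrite ?normc_ge0.
Qed.

Lemma bdmCV f (c : R) : mfunC f -> 0 < c -> (forall x, c <= complex.Im (f x)) ->
  bdmC (fun x => (f x)^-1).
Proof.
move=> mf c0 hc; split; first exact: mfunCV.
exists c^-1 => x; rewrite normcV lef_pV2 ?posrE//.
  by apply: le_trans (hc x) _; apply: le_trans (ler_norm _) (le_Im_normc _).
by apply: lt_le_trans c0 _; apply: le_trans (hc x) _; apply: le_trans (ler_norm _) (le_Im_normc _).
Qed.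

Lemma CEbD mu f g : bdmC f -> bdmC g ->
  Cintegral mu (fun x => f x + g x) = Cintegral mu f + Cintegral mu g.
Proof.
move=> bf bg; apply/eqP; rewrite eq_complex /=; apply/andP; split; apply/eqP.
  by rewrite -EbD; [under eq_Rintegral do rewrite raddfD|exact: bdmC_re|exact: bdmC_re].
by rewrite -EbD; [under eq_Rintegral do rewrite raddfD|exact: bdmC_im|exact: bdmC_im].
Qed.

Lemma CEbZ mu (c : C) f : bdmC f -> Cintegral mu (fun x => c * f x) = c * Cintegral mu f.
Proof.
move=> bf; have r := bdmC_re bf; have i := bdmC_im bf.
have bc (k : R) (g : T -> R) : bdm g -> bdm (fun x => k * g x) by move=> bg; apply: bdmM => //; exact: bdm_cst.
case: c => a b; apply/eqP; rewrite eq_complex /=; apply/andP; split; apply/eqP.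
  rewrite -!EbZ// -EbB; [|exact: bc|exact: bc].
  by apply: eq_Rintegral => x _; rewrite ReM.
rewrite -!EbZ// -EbD; [|exact: bc|exact: bc].
by apply: eq_Rintegral => x _; rewrite ImM.
Qed.

Lemma CEbB mu f g : bdmC f -> bdmC g ->
  Cintegral mu (fun x => f x - g x) = Cintegral mu f - Cintegral mu g.
Proof.
move=> bf bg; rewrite CEbD//; last exact: bdmCN.
congr (_ + _); rewrite -mulN1r -CEbZ//; congr Cintegral.
by apply/funext => x; rewrite mulN1r.
Qed.

Lemma CEbC mu (c : C) : Cintegral mu (fun=> c) = c.
Proof. by rewrite /Cintegral !EbC; case: c. Qed.

(* |I|^2 = E Re (conj I * f) for I = E f *)
Lemma CEb_norm_le mu f (g : T -> R) : bdmC f -> bdm g -> (forall x, normc (f x) <= g x) ->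
  normc (Cintegral mu f) <= \int[mu]_x g x.
Proof.
move=> bf bg fg; set I := Cintegral mu f.
have bI : bdmC (fun x => I^*%C * f x) by apply: bdmCM => //; exact: bdmC_cst.
have : normc I ^+ 2 <= normc I * \int[mu]_x g x.
  have -> : normc I ^+ 2 = complex.Re (Cintegral mu (fun x => I^*%C * f x)).
    rewrite CEbZ// -/I; case: (I) => a b /=; rewrite sqr_sqrtr ?addr_ge0 ?sqr_ge0//.
    by ring.
  rewrite /= -EbZ//; apply: Eb_le; [exact: bdmC_re|by apply: bdmM => //; exact: bdm_cst|].
  move=> x; apply: le_trans (ler_norm _) _; apply: le_trans (le_Re_normc _) _.
  rewrite normcM ler_pM ?normc_ge0//.
  by case: (I) => a b /=; rewrite sqrrN.
have [->|nI] := eqVneq (normc I) 0.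
  move=> _; rewrite -[leLHS](EbC mu); apply: Eb_le => //; first exact: bdm_cst.
  by move=> x; apply: le_trans (fg x); exact: normc_ge0.
by rewrite expr2 ler_pM2l// lt_neqAle eq_sym nI normc_ge0.
Qed.

Lemma CEb_bound mu f (M : R) : bdmC f -> (forall x, normc (f x) <= M) ->
  normc (Cintegral mu f) <= M.
Proof. by move=> bf fM; rewrite -[leRHS](EbC mu); apply: CEb_norm_le => //; exact: bdm_cst. Qed.

Lemma CEb_measure_eq (mu nu : {measure set T -> \bar R}) f : mfunC f ->
  (forall A, measurable A -> mu A = nu A) -> Cintegral mu f = Cintegral nu f.
Proof. by move=> [f1 f2] h; congr (_ +i* _); exact: Eb_measure_eq. Qed.

Lemma Eb_cvg mu (f_ : nat -> T -> R) (f : T -> R) (M : R) :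
  (forall n, bdm (f_ n)) -> bdm f -> (forall n x, `|f_ n x| <= M) ->
  (forall x, f_ ^~ x @ \oo --> f x) ->
  \int[mu]_x f_ n x @[n --> \oo] --> \int[mu]_x f x.
Proof.
move=> bf_ bf hM hf.
have i (g : T -> R) : bdm g -> (\int[mu]_x (g x)%:E)%E \is a fin_num.
  by move=> bg; apply: integrable_fin_num => //; exact: bdm_integrable.
apply: fine_cvg; rewrite fineK ?i//.
apply: (@dominated_cvg _ _ _ mu setT measurableT (fun n x => (f_ n x)%:E) (fun x => (f x)%:E)
   (fun=> M%:E)).
- by move=> n; apply/measurable_EFinP; case: (bf_ n).
- by move=> x _; apply: cvg_EFin; [exact: nearW|exact: hf].
- by [].
- have bM : bdm (fun _ : T => M) by exact: bdm_cst.
  by have h := bdm_integrable mu bM; exact: h.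
- by move=> n x _ /=; rewrite lee_fin.
Qed.

End complex_expectation.

Section complex_law.
Context d1 d2 (T1 : measurableType d1) (T2 : measurableType d2) (R : realType).

Lemma bdmC_comp (f : T2 -> R[i]) (X : T1 -> T2) :
  bdmC f -> measurable_fun setT X -> bdmC (fun x => f (X x)).
Proof.
move=> [[f1 f2] [M hM]] mX; split; last by exists M => x.
by split; [exact: (measurableT_comp f1 mX)|exact: (measurableT_comp f2 mX)].
Qed.

Lemma CEb_law (P : probability T1 R) (X : T1 -> T2) (mX : measurable_fun setT X) (f : T2 -> R[i]) :
  bdmC f -> Cintegral (law P mX) f = Cintegral P (fun x => f (X x)).
Proof.
by move=> bf; congr (_ +i* _); apply: Eb_law; [exact: bdmC_re|exact: bdmC_im].
Qed.

Lemma CEb_fubini (m1 : probability T1 R) (m2 : probability T2 R) (f : T1 * T2 -> R[i]) : bdmC f ->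
  Cintegral (m1 \x m2)%E f = Cintegral m1 (fun x => Cintegral m2 (fun y => f (x, y))).
Proof.
by move=> bf; congr (_ +i* _); rewrite Eb_fubini//; [exact: bdmC_re|exact: bdmC_im].
Qed.

End complex_law.

(** * Stieltjes transforms: analyticity and inversion *)

Section stieltjes.
Variable R : realType.
Implicit Types (mu nu : probability R R) (z h : R[i]).

Lemma bdmC_kernel z : 0 < complex.Im z -> bdmC (fun x : R => (z - x%:C)^-1).
Proof.
move=> z0; apply: (bdmCV _ z0).
  by apply: mfunCB; [exact: mfunC_cst|apply: (@mfunC_real _ _ _ (fun x : R => x))].
by move=> x; rewrite raddfB /= subr0.
Qed.

(** Differentiation under the integral with an exact remainder: for [w = z - x] the second-order
    error is [h^2 / (w^2 (w + h))], bounded uniformly in [x]. *)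
Lemma stieltjes_analytic mu : analytic_on (@upper_half_plane R) (stieltjes mu).
Proof.
move=> z; rewrite /upper_half_plane /= => z0; apply/derivable_cderiv.
set y := complex.Im z in z0.
have bz := bdmC_kernel z0; have bz2 := bdmCM bz bz.
exists (- Cintegral mu (fun x : R => (z - x%:C)^-1 * (z - x%:C)^-1)) => e e0.
(* The first bound keeps [z + h] above height [y / 2], so the denominator of the remainder is at
   least [y^3 / 2]; the second bound compares [h] with it. *)
exists (Num.min (y / 2) (e * (y ^+ 3 / 2))).
  by rewrite lt_min !divr_gt0// mulr_gt0// divr_gt0// exprn_gt0.
move=> h; rewrite lt_min => /andP[h1 h2].
have zh0 : y / 2 <= complex.Im (z + h).
  rewrite raddfD /= -/y; have := le_Im_normc h; rewrite ler_norml => /andP[? _]; lra.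
have y20 : 0 < y / 2 by rewrite divr_gt0.
have zh : 0 < complex.Im (z + h) := lt_le_trans y20 zh0.
have bzh := bdmC_kernel zh.
have bh : bdmC (fun x : R => h * ((z - x%:C)^-1 * (z - x%:C)^-1)).
  by apply: bdmCM => //; exact: bdmC_cst.
rewrite /stieltjes mulNr opprK mulrC -CEbZ// -CEbB// -CEbD//; last exact: bdmCB.
have -> : e * normc h = normc h * e by rewrite mulrC.
apply: CEb_bound; first by apply: bdmCD => //; exact: bdmCB.
move=> x.
have nz (w : R[i]) (c : R) : 0 < c -> c <= complex.Im w -> c <= normc (w - x%:C).
  move=> c0 cw; apply: le_trans (le_Im_normc _); rewrite raddfB /= subr0.
  exact: le_trans cw (ler_norm _).
have n1 := nz z y z0 (lexx _); have n2 := nz _ _ y20 zh0.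
set w := z - x%:C in n1 *; have w0 : w != 0 by rewrite -normc_gt0 (lt_le_trans z0).
have ew : z + h - x%:C = w + h by rewrite /w; ring.
rewrite ew in n2 *.
have wh0 : w + h != 0 by rewrite -normc_gt0 (lt_le_trans y20).
have -> : (w + h)^-1 - w^-1 + h * (w^-1 * w^-1) = h * (h * (w * w * (w + h))^-1).
  by move: w0 wh0; clearbody w => w0 wh0; field; rewrite ?w0 ?wh0.
rewrite normcM ler_wpM2l ?normc_ge0// normcM normcV ler_pdivrMr; last first.
  by rewrite !normcM !mulr_gt0 ?normc_gt0.
apply: le_trans (ltW h2) _; rewrite ler_pM2l// !normcM.
have -> : y ^+ 3 / 2 = y * y * (y / 2) by field.
have y0 := ltW z0; have y2 := ltW y20.
by apply: ler_pM => //; [exact: mulr_ge0|apply: ler_pM].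
Qed.

(** The derivative is the Poisson kernel, and the error is uniform in [u], as is needed to
    differentiate under an integral. *)
Lemma atan_jet (u s : R) : `|atan (u + s) - atan u - s / (1 + u ^+ 2)| <= s ^+ 2.
Proof.
have := @mvt_affine_sym _ (@atan R) (fun u => (1 + u ^+ 2)^-1) u s (1 + u ^+ 2)^-1 0 `|s|.
rewrite mul0r mul0r addr0 -expr2 real_normK ?num_real// mulrC; apply => //.
move=> t ts; rewrite mul0r addr0; apply: le_trans ts.
have p (v : R) : 0 < 1 + v ^+ 2 by rewrite ltr_pwDl// sqr_ge0.
have -> : (1 + (u + t) ^+ 2)^-1 - (1 + u ^+ 2)^-1 =
   - (u + (u + t)) * t / ((1 + (u + t) ^+ 2) * (1 + u ^+ 2)).
  by field; rewrite !gt_eqF.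
rewrite normrM normfV (gtr0_norm (mulr_gt0 (p _) (p _))) ler_pdivrMr ?mulr_gt0//.
rewrite normrM normrN mulrC ler_wpM2l//.
have := ler_normD u (u + t); move: (u + t) => v huv; apply: le_trans huv _.
have := real_normK (num_real u); have := real_normK (num_real v).
move: `|u| `|v| (normr_ge0 u) (normr_ge0 v) => a b a0 b0 <- <-.
have := sqr_ge0 (1 - a * b); have := sqr_ge0 (a - 1); have := sqr_ge0 (b - 1).
nra.
Qed.

(** The segment is cut into [n + 1] equal steps; the increments add up to a multiple of
    [(n + 1)^-1]. *)
Lemma cst_of_quadratic (f : R -> R) (c : R) : (forall x s : R, `|f (x + s) - f x| <= c * s ^+ 2) ->
  forall x y : R, f x = f y.
Proof.
move=> hf x y; apply/eqP; rewrite -subr_eq0 -normr_eq0 eq_le normr_ge0 andbT.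
have c0 : 0 <= c by have := hf 0 1; rewrite expr1n mulr1; exact: le_trans.
have key n : `|f x - f y| <= c * (x - y) ^+ 2 * n.+1%:R^-1.
  pose s := (x - y) / n.+1%:R.
  have step k : `|f (y + k%:R * s) - f y| <= k%:R * (c * s ^+ 2).
    elim: k => [|k IH]; first by rewrite !mul0r addr0 subrr normr0.
    have -> : y + k.+1%:R * s = (y + k%:R * s) + s by rewrite -natr1; ring.
    rewrite -natr1 mulrDl mul1r [leRHS]addrC; move: (y + k%:R * s) IH => w IH.
    rewrite (_ : _ - _ = (f (w + s) - f w) + (f w - f y)); last by ring.
    by apply: le_trans (ler_normD _ _) _; apply: lerD.
  have n0 : n.+1%:R != 0 :> R by rewrite pnatr_eq0.
  have := step n.+1; have -> : y + n.+1%:R * s = x by rewrite /s; field.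
  move=> h; apply: le_trans h _; rewrite le_eqVlt; apply/orP; left; apply/eqP; rewrite /s; field.
  by rewrite nat1r.
have lim : c * (x - y) ^+ 2 * n.+1%:R^-1 @[n --> \oo] --> (c * (x - y) ^+ 2 * 0 : R).
  by apply: cvgMr; exact: cvg_harmonic.
rewrite mulr0 in lim; apply: cvgr_to_ge lim _; near=> n; exact: key.
Unshelve. all: by end_near. Qed.

(** Integrals of [atan (y (x - t))] in [t] have a derivative in [x] that is an imaginary part of the
    transform at [x + i / y]. The difference [D] of the integrals for the two measures is thus
    constant in [x], and it is 0 by the limit at minus infinity. Letting [y] grow turns the
    arctangent into a step function. *)
Lemma stieltjes_inj mu nu : (forall z, 0 < complex.Im z -> stieltjes mu z = stieltjes nu z) ->
  forall A, measurable A -> mu A = nu A.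
Proof.
move=> h; apply: probR_unique => x.
have batan (y x' : R) : bdm (fun t : R => atan (y * (x' - t))).
  split.
    apply: continuous_measurable_fun => t.
    apply: (@continuous_comp _ _ _ (fun t : R => y * (x' - t)) (@atan R)); last exact: continuous_atan.
    by apply: cvgMr; apply: cvgB; [exact: cvg_cst|exact: cvg_id].
  exists (pi / 2) => t; rewrite ler_norml; apply/andP; split; apply/ltW.
    exact: atan_gtNpi2.
  exact: atan_ltpi2.
have atan_le (u : R) : `|atan u| <= pi / 2.
  by rewrite ler_norml; apply/andP; split; apply/ltW; [exact: atan_gtNpi2|exact: atan_ltpi2].
pose D y x' := \int[mu]_t atan (y * (x' - t)) - \int[nu]_t atan (y * (x' - t)).
have Dcst y x1 x2 : 0 < y -> D y x1 = D y x2.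
  move=> y0; apply: (@cst_of_quadratic (D y) (2 * y ^+ 2)) => u s.
  pose k t := y * s / (1 + (y * (u - t)) ^+ 2).
  have p (v : R) : 0 < 1 + v ^+ 2 by rewrite ltr_pwDl// sqr_ge0.
  pose z : R[i] := u +i* y^-1.
  have z0 : 0 < complex.Im z by rewrite /= invr_gt0.
  have kE t : k t = - s * complex.Im (z - t%:C)^-1.
    rewrite /k /z /=; rewrite subr0.
    have q0 : (u - t) ^+ 2 + y^-1 ^+ 2 != 0.
      by rewrite gt_eqF// ltr_wpDl ?sqr_ge0// exprn_gt0// invr_gt0.
    have q1 := p (y * (u - t)).
    have -> : 1 + (y * (u - t)) ^+ 2 = y ^+ 2 * ((u - t) ^+ 2 + y^-1 ^+ 2).
      by field; rewrite gt_eqF.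
    move: q0; set q := (_ + y^-1 ^+ 2); clearbody q => q0.
    by field; rewrite ?q0 ?(gt_eqF y0).
  have bk : bdm k.
    rewrite (_ : k = fun t => - s * complex.Im (z - t%:C)^-1); last exact/funext.
    by apply: bdmM; [exact: bdm_cst|exact: (bdmC_im (bdmC_kernel z0))].
  have Ek : \int[mu]_t k t = \int[nu]_t k t.
    under eq_Rintegral do rewrite kE; under [RHS]eq_Rintegral do rewrite kE.
    rewrite !EbZ; try exact: (bdmC_im (bdmC_kernel z0)).
    by congr (_ * _); have /(congr1 (@complex.Im R)) := h z z0.
  have est (m : probability R R) : `|\int[m]_t atan (y * (u + s - t)) - \int[m]_t atan (y * (u - t))
      - \int[m]_t k t| <= y ^+ 2 * s ^+ 2.
    rewrite -!EbB//; last exact: bdmB.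
    apply: Eb_bound; first by apply: bdmB => //; exact: bdmB.
    move=> t; have := atan_jet (y * (u - t)) (y * s).
    have -> : y * (u - t) + y * s = y * (u + s - t) by ring.
    by rewrite [(y * s) ^+ 2]exprMn.
  have := est mu; have := est nu; rewrite /D Ek !ler_norml => /andP[? ?] /andP[? ?].
  by apply/andP; split; lra.
have atan_lim (a : nat -> R) : (forall M, \forall n \near \oo, M <= a n) ->
    atan (a n) @[n --> \oo] --> (pi / 2 : R).
  by move=> ha; apply: (@cvg_comp _ _ _ a (@atan R)); [exact/cvgryPge|exact: cvgy_atan].
have D0 y x' : 0 < y -> D y x' = 0.
  move=> y0.
  have lim (m : probability R R) :
      \int[m]_t atan (y * (- n%:R - t)) @[n --> \oo] --> (- (pi / 2) : R).
    rewrite -[X in _ --> X](EbC m); apply: (@Eb_cvg _ _ _ _ _ _ (pi / 2)) => //; first exact: bdm_cst.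
    move=> t; rewrite (_ : (fun n => _) = fun n => - atan (y * (n%:R + t))); last first.
      by apply/funext => n; rewrite -atanN; congr atan; ring.
    apply: cvgN; apply: atan_lim => M; near=> n.
    have : M / y - t <= n%:R by near: n; exact: nbhs_infty_ger.
    by rewrite lerBlDr ler_pdivrMr// mulrC.
  have l0 : D y (- n%:R) @[n --> \oo] --> (- (pi / 2) - (- (pi / 2)) : R) by apply: cvgB; exact: lim.
  have e : (fun n : nat => D y (- n%:R)) = fun=> D y x' by apply/funext => n; exact: Dcst.
  rewrite subrr e in l0; exact: (cvg_unique (@norm_hausdorff _ R) (cvg_cst (D y x')) l0).
pose g (t : R) : R := if x < t then - (pi / 2) else pi / 2.
have bg : bdm g.
  split; first by apply: measurable_fun_ifT => //; exact: measurable_fun_ltr.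
  exists (pi / 2) => t; rewrite /g; by case: ifP => _; rewrite ?normrN ger0_norm// divr_ge0// pi_ge0.
(* The threshold is shifted right by [(n + 1)^-1] while the slope is [(n + 1)^2], so that [t = x]
   falls on the side of the limit [pi / 2] and the open half-line []x, +oo[] is isolated. *)
pose A n t : R := n.+1%:R ^+ 2 * (x + n.+1%:R^-1 - t).
have limA (m : probability R R) : \int[m]_t atan (A n t) @[n --> \oo] --> \int[m]_t g t.
  apply: (@Eb_cvg _ _ _ _ _ _ (pi / 2)) => // [n|t]; first exact: batan.
  have An n : A n t = n.+1%:R * (n.+1%:R * (x - t) + 1).
    by rewrite /A; field; rewrite nat1r pnatr_eq0.
  rewrite /g; case: ifPn => xt.
    rewrite (_ : (fun n => _) = fun n => - atan (- A n t)); last by apply/funext => n; rewrite atanN opprK.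
    apply: cvgN; apply: atan_lim => M; near=> n.
    have tx : 0 < t - x by rewrite subr_gt0.
    have h1 : 2 / (t - x) <= n%:R by near: n; exact: nbhs_infty_ger.
    have h2 : `|M| <= n%:R by near: n; exact: nbhs_infty_ger.
    rewrite ler_pdivrMr// in h1.
    have nn : n%:R <= n.+1%:R :> R by rewrite ler_nat.
    have n0 : 0 <= n%:R :> R by [].
    apply: le_trans (ler_norm M) _; apply: le_trans h2 _; apply: le_trans nn _.
    rewrite An -mulrN -[leLHS]mulr1 ler_wpM2l// -natr1; nra.
  apply: atan_lim => M; near=> n.
  have h2 : `|M| <= n%:R by near: n; exact: nbhs_infty_ger.
  apply: le_trans (ler_norm M) _; apply: le_trans h2 _.
  have nn : n%:R <= n.+1%:R :> R by rewrite ler_nat.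
  apply: le_trans nn _; rewrite An -[leLHS]mulr1 ler_wpM2l// lerDr mulr_ge0// subr_ge0 leNgt//.
have gE (m : probability R R) : \int[m]_t g t = pi / 2 - pi * fine (m `]x, +oo[%classic).
  have bi : bdm (\1_(`]x, +oo[%classic) : R -> R).
    by split => //; exists 1 => t; rewrite indicE; case: (_ \in _); rewrite ?normr1 ?normr0.
  have -> : fine (m `]x, +oo[%classic) = \int[m]_t \1_(`]x, +oo[%classic) t.
    by rewrite /Rintegral integral_indic// setIT.
  rewrite -EbZ// -[X in X - _](EbC m) -EbB//; first last.
  - by apply: bdmM => //; exact: bdm_cst.
  - exact: bdm_cst.
  apply: eq_Rintegral => t _; rewrite /g indicE mem_setE in_itv /= andbT.
  by case: (x < t); rewrite /=; field.
have gmn : \int[mu]_t g t = \int[nu]_t g t.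
  apply/eqP; rewrite -subr_eq0; apply/eqP.
  have l0 : \int[mu]_t atan (A n t) - \int[nu]_t atan (A n t) @[n --> \oo] -->
    \int[mu]_t g t - \int[nu]_t g t by apply: cvgB.
  have e : (fun n : nat => \int[mu]_t atan (A n t) - \int[nu]_t atan (A n t)) = fun=> 0.
    by apply/funext => n; apply: D0; rewrite exprn_gt0// ltr0n.
  by rewrite e in l0; exact: esym (cvg_unique (@norm_hausdorff _ R) (cvg_cst (0 : R)) l0).
have fm (m : probability R R) : m `]x, +oo[%classic \is a fin_num.
  exact: (fin_num_measure m).
move: gmn; rewrite !gE => e.
have {}e : pi * fine (mu `]x, +oo[%classic) = pi * fine (nu `]x, +oo[%classic) by lra.
have {}e := mulfI (lt0r_neq0 (pi_gt0 R)) e.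
by rewrite -[LHS]fineK ?fm// e fineK ?fm.
Unshelve. all: by end_near. Qed.

End stieltjes.

(** * The limit measure *)

Section ramps.
Variable R : realType.

Definition bcont (f : R -> R) := continuous f /\ exists M : R, forall x, `|f x| <= M.

Definition clip (u : R) : R := Num.min 1 (Num.max 0 u).

Lemma clipE u : clip u = if u <= 0 then 0 else if 1 <= u then 1 else u.
Proof.
rewrite /clip; case: ifPn => [u0|]; first by rewrite (max_idPl u0) (min_idPr _).
rewrite -ltNge => /ltW u0; rewrite (max_idPr u0); case: ifPn => [u1|]; first by rewrite (min_idPl u1).
by rewrite -ltNge => /ltW u1; rewrite (min_idPr u1).
Qed.

(* The nodes (j - m) / q run through all the multiples of 1 / q, j and m being natural. *)
Definition ramp (q j m : nat) (x : R) : R :=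
  clip (j%:R - m%:R + 1 - q%:R * x).

Lemma clip01 u : 0 <= clip u <= 1.
Proof. by rewrite /clip le_min ler01 le_max lexx /= ge_min lexx. Qed.

Lemma clip_nondec u v : u <= v -> clip u <= clip v.
Proof. by move=> uv; rewrite !clipE; do !case: ifPn => ?; lra. Qed.

Lemma clip_lip u v : `|clip u - clip v| <= `|u - v|.
Proof.
rewrite !clipE; have := ler_norm (u - v); have := ler_norm (- (u - v)); rewrite normrN => h1 h2.
by do !case: ifPn => ?; rewrite ler_norml; apply/andP; split; lra.
Qed.

Lemma ramp01 q j m x : 0 <= ramp q j m x <= 1.
Proof. exact: clip01. Qed.

Lemma ramp_noninc q j m : {homo ramp q j m : x y /~ x <= y}.
Proof. by move=> x y xy; apply: clip_nondec; rewrite lerD2l lerN2 ler_wpM2l. Qed.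

Lemma ramp_eq1 q j m x : q%:R * x <= j%:R - m%:R -> ramp q j m x = 1.
Proof. by move=> h; rewrite /ramp clipE; do !case: ifPn => ?; lra. Qed.

Lemma ramp_eq0 q j m x : j%:R - m%:R + 1 <= q%:R * x -> ramp q j m x = 0.
Proof. by move=> h; rewrite /ramp clipE; do !case: ifPn => ?; lra. Qed.

Lemma ramp_lip q j m x y : `|ramp q j m x - ramp q j m y| <= q%:R * `|x - y|.
Proof.
apply: le_trans (clip_lip _ _) _; rewrite -normrN -[q%:R]ger0_norm// -normrM.
by rewrite le_eqVlt; apply/orP; left; apply/eqP; congr `|_|; rewrite ger0_norm//; ring.
Qed.

Lemma lip_continuous (f : R -> R) (K : R) : (forall x y, `|f x - f y| <= K * `|x - y|) -> continuous f.
Proof.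
move=> hf x; apply: continuous_eps => e e0.
have K0 : 0 <= K by have := hf 1 0; rewrite subr0 normr1 mulr1; exact: le_trans.
exists (e / (K + 1)); first by rewrite divr_gt0// ltr_wpDl.
move=> h /ltW; rewrite ler_pdivlMr ?ltr_wpDl// => hh.
apply: le_trans (hf _ _) _; rewrite addrAC subrr add0r.
by apply: le_trans hh; rewrite mulrC ler_wpM2l// lerDl.
Qed.

Lemma bcont_ramp q j m : bcont (ramp q j m).
Proof.
split; first exact: lip_continuous (ramp_lip q j m).
by exists 1 => x; have /andP[? ?] := ramp01 q j m x; rewrite ger0_norm.
Qed.

Lemma bcont_bdm f : bcont f -> bdm f.
Proof. by move=> [cf bf]; split => //; exact: continuous_measurable_fun. Qed.

Lemma bcont_cst (c : R) : bcont (fun=> c).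
Proof. by split; [move=> x; exact: cvg_cst|exists `|c|]. Qed.

Lemma bcontD f g : bcont f -> bcont g -> bcont (fun x => f x + g x).
Proof.
move=> [mf [M hM]] [mg [M' hM']]; split; first by move=> x; apply: cvgD; [exact: mf|exact: mg].
exists (M + M') => x; apply: le_trans (ler_normD _ _) _.
by apply: lerD; [exact: hM|exact: hM'].
Qed.

Lemma bcontM f g : bcont f -> bcont g -> bcont (fun x => f x * g x).
Proof.
move=> [mf [M hM]] [mg [M' hM']]; split; first by move=> x; apply: cvgM; [exact: mf|exact: mg].
by exists (M * M') => x; rewrite normrM; apply: ler_pM.
Qed.

Lemma bcontZ c f : bcont f -> bcont (fun x => c * f x).
Proof. by move=> bf; apply: bcontM => //; exact: bcont_cst. Qed.

Lemma bcontB f g : bcont f -> bcont g -> bcont (fun x => f x - g x).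
Proof.
move=> bf bg; have := bcontD bf (bcontZ (-1) bg).
by congr bcont; apply/funext => x; rewrite mulN1r.
Qed.

Lemma bcont_sum n (F : nat -> R -> R) : (forall i, bcont (F i)) -> bcont (fun x => \sum_(i < n) F i x).
Proof.
move=> h; elim: n => [|n IH].
  by under eq_fun do rewrite big_ord0; exact: bcont_cst.
by under eq_fun do rewrite big_ord_recr /=; exact: bcontD.
Qed.

Lemma cvg_sum_ord n (F : nat -> nat -> R) (l : nat -> R) : (forall i, F i k @[k --> \oo] --> l i) ->
  \sum_(i < n) F i k @[k --> \oo] --> \sum_(i < n) l i.
Proof.
move=> h; elim: n => [|n IH].
  by rewrite big_ord0; under eq_fun do rewrite big_ord0; exact: cvg_cst.
by rewrite big_ord_recr /=; under eq_fun do rewrite big_ord_recr /=; exact: cvgD.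
Qed.

(** Integrals and averaged spectral statistics are treated alike; the latter need not be presented
    as integrals against a measure. *)
Record posfun (I : (R -> R) -> R) : Prop := PosFun {
  posfunD : forall f g, bcont f -> bcont g -> I (fun x => f x + g x) = I f + I g;
  posfunZ : forall c f, bcont f -> I (fun x => c * f x) = c * I f;
  posfun1 : I (fun=> 1) = 1;
  posfun_le : forall f g, bcont f -> bcont g -> (forall x, f x <= g x) -> I f <= I g }.

Lemma posfunB I f g : posfun I -> bcont f -> bcont g -> I (fun x => f x - g x) = I f - I g.
Proof.
move=> pI bf bg; rewrite -[- I g]mulN1r -(posfunZ pI)// -(posfunD pI)//; last exact: bcontZ.
by congr I; apply/funext => x; rewrite mulN1r.
Qed.

Lemma posfun_cst I (c : R) : posfun I -> I (fun=> c) = c.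
Proof.
move=> pI; rewrite -[RHS]mulr1 -(posfun1 pI) -(posfunZ pI); last exact: bcont_cst.
by congr I; apply/funext => x; rewrite mulr1.
Qed.

Lemma posfun_sum I n (F : nat -> R -> R) : posfun I -> (forall i, bcont (F i)) ->
  I (fun x => \sum_(i < n) F i x) = \sum_(i < n) I (F i).
Proof.
move=> pI h; elim: n => [|n IH].
  by rewrite big_ord0; under eq_fun do rewrite big_ord0; exact: posfun_cst.
rewrite big_ord_recr -IH /= -(posfunD pI)//; last exact: bcont_sum.
by congr I; apply/funext => x; rewrite big_ord_recr.
Qed.

Lemma posfun_norm I f g : posfun I -> bcont f -> bcont g -> (forall x, `|f x| <= g x) ->
  `|I f| <= I g.
Proof.
move=> pI bf bg fg; rewrite ler_norml; apply/andP; split.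
  rewrite lerNl -[- I f]mulN1r -(posfunZ pI)//; apply: (posfun_le pI) => //; first exact: bcontZ.
  by move=> x; rewrite mulN1r (le_trans _ (fg x))// -normrN ler_norm.
by apply: (posfun_le pI) => // x; apply: le_trans (fg x); exact: ler_norm.
Qed.

Lemma posfun_integral (mu : probability R R) : posfun (fun f => \int[mu]_x f x).
Proof.
split=> [f g /bcont_bdm bf /bcont_bdm bg|c f /bcont_bdm bf||f g /bcont_bdm bf /bcont_bdm bg fg].
- exact: EbD.
- exact: EbZ.
- exact: EbC.
- exact: Eb_le.
Qed.

(** The test function vanishes on [[- M + 1 / q, M]] and equals 1 outside of [[- M, M + 1 / q]]. It
    is built from ramps, so tightness of the limit passes to the approximants; [q] comes after [M]
    because the mesh is chosen once the range is known. *)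
Definition tight (J : (R -> R) -> R) := forall e : R, 0 < e -> exists M : nat,
  forall q : nat, (0 < q)%N -> J (fun x => 1 - (ramp q (M * q) 0 x - ramp q 0 (M * q) x)) <= e.

Lemma bcont_tail M q : bcont (fun x => 1 - (ramp q (M * q) 0 x - ramp q 0 (M * q) x)).
Proof. by apply: bcontB; [exact: bcont_cst|apply: bcontB; exact: bcont_ramp]. Qed.

Lemma tight_integral (mu : probability R R) : tight (fun f => \int[mu]_x f x).
Proof.
move=> e e0.
pose u (n : nat) (x : R) : R := if (- n%:R + 1 < x) && (x <= n%:R) then 0 else 1.
have bu n : bdm (u n).
  split; last by exists 1 => x; rewrite /u; case: ifP => _; rewrite ?normr0 ?normr1.
  apply: measurable_fun_ifT => //; apply: measurable_and; first exact: measurable_fun_ltr.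
  exact: measurable_fun_ler.
have lim : \int[mu]_x u n x @[n --> \oo] --> \int[mu]_x (0 : R).
  apply: (@Eb_cvg _ _ _ _ _ _ 1) => //; first exact: bdm_cst.
    by move=> n x; rewrite /u; case: ifP => _; rewrite ?normr0 ?normr1.
  move=> x; apply: cvg_near_cst; near=> n.
  have h : `|x| + 2 <= n%:R by near: n; exact: nbhs_infty_ger.
  rewrite /u; case: ifPn => //; have := ler_norm x; have := ler_norm (- x); rewrite normrN.
  by rewrite negb_and -leNgt -ltNge => ? ? /orP[]; lra.
rewrite EbC in lim.
have /cvgr0Pnorm_le/(_ _ e0)[M _ hM] := lim.
exists M => q q0; have q1 : 0 < q%:R :> R by rewrite ltr0n.
have := hM M (leqnn M); apply: le_trans; apply: le_trans (ler_norm _).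
apply: Eb_le => //; first exact: bcont_bdm (bcont_tail _ _).
move=> x; rewrite /u; case: ifPn => [/andP[x1 x2]|_].
  rewrite ramp_eq1; last by rewrite natrM subr0 mulrC ler_wpM2r.
  rewrite ramp_eq0 ?subr0 ?subrr//.
  rewrite sub0r natrM; have : q%:R >= 1 :> R by rewrite ler1n.
  by nra.
have /andP[? ?] := ramp01 q (M * q) 0 x; have /andP[? ?] := ramp01 q 0 (M * q) x.
suff : ramp q 0 (M * q) x <= ramp q (M * q) 0 x by lra.
by apply: clip_nondec; have : 0 <= (M * q)%:R :> R by []; lra.
Unshelve. all: by end_near. Qed.

Lemma uniform_cont (f : R -> R) (M : nat) (e : R) : continuous f -> 0 < e ->
  exists q : nat, (0 < q)%N /\ forall x y, `|x| <= M%:R -> `|x - y| <= q%:R^-1 -> `|f x - f y| <= e.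
Proof.
move=> cf e0; apply: contrapT => hno.
have bad (q : nat) : exists p : R * R, [/\ `|p.1| <= M%:R, `|p.1 - p.2| <= q.+1%:R^-1 & e < `|f p.1 - f p.2|].
  apply: contrapT => hb; apply: hno; exists q.+1; split => // x y xM xy.
  by rewrite leNgt; apply/negP => h; apply: hb; exists (x, y).
pose s q := xget (0 : R, 0 : R) [set p | [/\ `|p.1| <= M%:R, `|p.1 - p.2| <= q.+1%:R^-1 & e < `|f p.1 - f p.2|]].
have hs q : [/\ `|(s q).1| <= M%:R, `|(s q).1 - (s q).2| <= q.+1%:R^-1 & e < `|f (s q).1 - f (s q).2|].
  exact: (xgetPex (0, 0) (bad q)).
have : compact (`[- M%:R, M%:R]%classic : set R) by exact: segment_compact.
move=> /(_ ((fun q => (s q).1) @ \oo) _) [].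
  by exists 0%N => // q _; rewrite /= in_itv /=; have [+ _ _] := hs q; rewrite ler_norml.
move=> x [_ hx].
have e2 : 0 < e / 2 by rewrite divr_gt0.
have /cvgrPdist_lt/(_ _ e2)[d /= d0 hd] := cf x.
have d2 : 0 < d / 2 by rewrite divr_gt0.
have [N _ /(_ N (leqnn N)) /= hN] := nbhs_infty_ger (2 / d).
have [z /= [[n /= Nn <-] hz]] := hx [set (s q).1 | q in [set q | (N <= q)%N]] (ball x (d / 2))
  (ex_intro2 _ _ N I (fun q hq => ex_intro2 _ _ q hq erefl)) (nbhsx_ballx x _ d2).
have [_ h1 h2] := hs n.
have nd : n.+1%:R^-1 <= d / 2.
  have -> : d / 2 = (2 / d)^-1 by rewrite invf_div.
  rewrite lef_pV2 ?posrE ?ltr0n ?divr_gt0//; apply: le_trans hN _.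
  by rewrite ler_nat leqW.
have b1 : `|x - (s n).1| < d by apply: lt_trans hz _; lra.
have b2 : `|x - (s n).2| < d.
  rewrite (_ : x - _ = (x - (s n).1) + ((s n).1 - (s n).2)); last by ring.
  apply: le_lt_trans (ler_normD _ _) _; rewrite [d]splitr; apply: ltr_leD => //.
  exact: le_trans h1 nd.
have := hd _ b1; have := hd _ b2; rewrite distrC => c2 c1.
have := ler_distD (f x) (f (s n).1) (f (s n).2).
rewrite [ `|f (s n).1 - f x|]distrC [ `|f x - f (s n).2|]distrC; lra.
Qed.

(** Differences of consecutive ramps are the hat functions of a grid of mesh [1 / q]. The piecewise
    linear interpolant [g] of [f] is within [e1] of [f] up to [K w], where [1 - w] is the sum of the
    hats and [w] is the tail function of [tight]. *)
Lemma weak_of_ramps (I : nat -> (R -> R) -> R) (J : (R -> R) -> R) :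
  (forall n, posfun (I n)) -> posfun J -> tight J ->
  (forall q j m, I n (ramp q j m) @[n --> \oo] --> J (ramp q j m)) ->
  forall f, bcont f -> I n f @[n --> \oo] --> J f.
Proof.
move=> pI pJ tJ hr f bf; have [cf [K hK]] := bf.
have K0 : 0 <= K by apply: le_trans (hK 0).
have ramps (n : nat) (q : nat) (F : nat -> R) (a b : nat -> nat) :
   forall (I : (R -> R) -> R), posfun I ->
   I (fun x => \sum_(i < n) F i * (ramp q (a i) (b i) x - ramp q (a i) (b i).+1 x)) =
   \sum_(i < n) F i * (I (ramp q (a i) (b i)) - I (ramp q (a i) (b i).+1)).
  move=> I0 p0; rewrite (@posfun_sum I0 n (fun i x => F i * (ramp q (a i) (b i) x - ramp q (a i) (b i).+1 x)))//.
    apply: eq_bigr => i _; rewrite (posfunZ p0); last by apply: bcontB; exact: bcont_ramp.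
    by rewrite posfunB//; exact: bcont_ramp.
  by move=> i; apply: bcontZ; apply: bcontB; exact: bcont_ramp.
apply/cvgrPdist_le => e e0.
(* The errors are [e1 + K e1] for [J], [e1 + 2 K e1] for [I n] and [e1] between the two
   interpolants. *)
pose e1 := e / (4 + 3 * K).
have den0 : 0 < 4 + 3 * K by lra.
have e10 : 0 < e1 by rewrite divr_gt0.
have [M hM] := tJ _ e10.
have [q [q0 hq]] := uniform_cont M.+1 cf e10.
have qp : 0 < q%:R :> R by rewrite ltr0n.
pose m := (M * q)%N.
pose t (i : nat) : R := (i.+1%:R - m%:R) / q%:R.
pose h (i : nat) x : R := ramp q i.+1 m x - ramp q i.+1 m.+1 x.
pose g x := \sum_(i < m.*2) f (t i) * h i x.
pose w x : R := 1 - (ramp q m 0 x - ramp q 0 m x).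
have bh i : bcont (h i) by apply: bcontB; exact: bcont_ramp.
have bg : bcont g by apply: (@bcont_sum _ (fun i x => f (t i) * h i x)) => i; exact: bcontZ.
have bw : bcont w := bcont_tail M q.
have hE (i : nat) x : h i x = ramp q i.+1 m x - ramp q i m x.
  by rewrite /h /ramp -!natr1 (_ : _ + 1 - (m%:R + 1) = i%:R - m%:R)//; ring.
have h0 i x : 0 <= h i x.
  by rewrite hE subr_ge0; apply: clip_nondec; rewrite -natr1; lra.
have hsum x : \sum_(i < m.*2) h i x = 1 - w x.
  rewrite (eq_bigr (fun i : 'I__ => ramp q i.+1 m x - ramp q i m x)); last by move=> i _; rewrite hE.
  rewrite -(big_mkord xpredT (fun i => ramp q i.+1 m x - ramp q i m x)) telescope_sumr//.
  have e1' : ramp q m.*2 m x = ramp q m 0 x.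
    by rewrite /ramp -addnn natrD subr0 addrK.
  by rewrite e1' /w; ring.
have w0 x : 0 <= w x.
  have := hsum x; rewrite /w; have /andP[_ ?] := ramp01 q m 0 x; have /andP[? _] := ramp01 q 0 m x.
  by lra.
have key x : `|f x - g x| <= e1 + K * w x.
  have -> : f x - g x = \sum_(i < m.*2) (f x - f (t i)) * h i x + f x * w x.
    have -> : \sum_(i < m.*2) (f x - f (t i)) * h i x = f x * \sum_(i < m.*2) h i x - g x.
      by rewrite /g mulr_sumr -sumrB; apply: eq_bigr => i _; rewrite mulrBl.
    by rewrite hsum; ring.
  apply: le_trans (ler_normD _ _) _; apply: lerD; last first.
    by rewrite normrM (ger0_norm (w0 x)) ler_wpM2r.
  apply: le_trans (ler_norm_sum _ _ _) _.
  apply: (@le_trans _ _ (\sum_(i < m.*2) e1 * h i x)).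
    apply: ler_sum => i _; rewrite normrM (ger0_norm (h0 i x)).
    have [hi0|hi] := eqVneq (h i x) 0; first by rewrite hi0 !mulr0.
    apply: ler_wpM2r => //.
    have near1 : `|i.+1%:R - m%:R - q%:R * x| <= 1.
      rewrite leNgt; apply: contra_neqN hi; rewrite hE ltr_normr => /orP[hh|hh].
        rewrite !ramp_eq1 ?subrr//; first by rewrite -natr1 in hh; lra.
        by lra.
      rewrite !ramp_eq0 ?subrr//; first by rewrite -natr1 in hh; lra.
      by lra.
    rewrite distrC; apply: hq.
      rewrite /t normrM normfV (gtr0_norm qp) ler_pdivrMr//.
      apply: (@le_trans _ _ (M%:R * q%:R)); last by rewrite ler_wpM2r// ler_nat.
      have := ltn_ord i; rewrite -natrM -/m ler_norml; move: (i : nat) => k.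
      rewrite -addnn => km; have k2 : k.+1%:R <= m%:R + m%:R :> R by rewrite -natrD ler_nat.
      by apply/andP; split; [rewrite lerBrDr addNr|lra].
    have -> : t i - x = (i.+1%:R - m%:R - q%:R * x) / q%:R by rewrite /t; field; rewrite gt_eqF.
    by rewrite normrM normfV (gtr0_norm qp) ler_pdivrMr// mulVf ?gt_eqF.
  rewrite -mulr_sumr hsum -[leRHS]mulr1; apply: ler_wpM2l; [exact: ltW|have := w0 x; lra].
have bkey : bcont (fun x => e1 + K * w x) by apply: bcontD; [exact: bcont_cst|exact: bcontZ].
have est I0 : posfun I0 -> `|I0 f - I0 g| <= e1 + K * I0 w.
  move=> p0; rewrite -posfunB//; apply: le_trans (posfun_norm p0 (bcontB bf bg) bkey key) _.
  by rewrite (posfunD p0 (bcont_cst _) (bcontZ K bw)) (posfunZ p0)// posfun_cst.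
have Jw : J w <= e1 by exact: hM.
have limw : I n w @[n --> \oo] --> J w.
  have ew I0 : posfun I0 -> I0 w = 1 - (I0 (ramp q m 0) - I0 (ramp q 0 m)).
    move=> p0; rewrite /w posfunB//; [|exact: bcont_cst|by apply: bcontB; exact: bcont_ramp].
    by rewrite posfun_cst// posfunB//; exact: bcont_ramp.
  rewrite ew//; under eq_fun do rewrite ew//.
  by apply: cvgB; [exact: cvg_cst|apply: cvgB; exact: hr].
have limg : I n g @[n --> \oo] --> J g.
  rewrite /g /h (ramps m.*2 q (fun i => f (t i)) (fun i => i.+1) (fun=> m) J)//.
  under eq_fun do rewrite (ramps m.*2 q (fun i => f (t i)) (fun i => i.+1) (fun=> m))//.
  apply: (@cvg_sum_ord _ (fun i n => f (t i) * (I n (ramp q i.+1 m) - I n (ramp q i.+1 m.+1)))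
    (fun i => f (t i) * (J (ramp q i.+1 m) - J (ramp q i.+1 m.+1)))) => i.
  by apply: cvgMr; apply: cvgB; exact: hr.
have /cvgrPdist_le/(_ _ e10) nw := limw; have /cvgrPdist_le/(_ _ e10) ng := limg.
near=> n.
have b1 : `|J w - I n w| <= e1 by near: n.
have b2 : `|J g - I n g| <= e1 by near: n.
have b3 := est _ pJ; have b4 := est _ (pI n).
rewrite (_ : _ - _ = (J f - J g) + (J g - I n g) - (I n f - I n g)); last by ring.
apply: le_trans (ler_normB _ _) _; apply: le_trans (lerD (ler_normD _ _) (lexx _)) _.
have Inw : I n w <= 2 * e1 by move: b1; rewrite ler_norml => /andP[? ?]; lra.
have c1 : K * J w <= K * e1 by exact: ler_wpM2l.
have c2 : K * I n w <= K * (2 * e1) by exact: ler_wpM2l.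
have ee : e = 4 * e1 + 3 * K * e1 by rewrite /e1; field; rewrite gt_eqF.
rewrite ee; lra.
Unshelve. all: by end_near. Qed.

End ramps.

(** * Measurability through separate continuity *)

Section measurable_coordinates.
Variable R : realType.
Context d (T : measurableType d).

Lemma floor_approx (m : nat) (x : R) :
  `|(Num.floor (m.+1%:R * x))%:~R / m.+1%:R - x| <= m.+1%:R^-1.
Proof.
have p : 0 < m.+1%:R :> R by rewrite ltr0n.
have h1 := ge_floor (m.+1%:R * x); have h2 := floorD1_gt (m.+1%:R * x).
rewrite intrD in h2.
have -> : (Num.floor (m.+1%:R * x))%:~R / m.+1%:R - x =
  ((Num.floor (m.+1%:R * x))%:~R - m.+1%:R * x) / m.+1%:R by field; rewrite nat1r pnatr_eq0.
rewrite normrM (gtr0_norm (x := _^-1)) ?invr_gt0// -[leRHS]mul1r ler_pM2r ?invr_gt0//.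
by rewrite ler_norml; apply/andP; split; lra.
Qed.

(* x is approximated by (floor (m x)) / m, which takes countably many values. *)
Lemma measurable_comp_continuous (g : R -> T -> R) (x : T -> R) :
  (forall q, measurable_fun setT (g q)) -> (forall t, continuous (g ^~ t)) ->
  measurable_fun setT x -> measurable_fun setT (fun t => g (x t) t).
Proof.
move=> mg cg mx.
pose h (m : nat) t := g ((Num.floor (m.+1%:R * x t))%:~R / m.+1%:R) t.
have mh m : measurable_fun setT (h m).
  move=> _ Y mY; rewrite setTI.
  pose dec n : int := odflt 0 (choice.unpickle n).
  rewrite (_ : _ @^-1` _ = \bigcup_n ((x @^-1` `[(dec n)%:~R / m.+1%:R, ((dec n)%:~R + 1) / m.+1%:R[%classic) `&`
     (g ((dec n)%:~R / m.+1%:R) @^-1` Y))).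
    apply: bigcupT_measurable => n; apply: measurableI.
      by rewrite -[X in measurable X]setTI; exact: mx.
    by rewrite -[X in measurable X]setTI; exact: mg.
  have p : 0 < m.+1%:R :> R by rewrite ltr0n.
  apply/seteqP; split => t /=.
    move=> hY; exists (choice.pickle (Num.floor (m.+1%:R * x t))) => //; rewrite /dec choice.pickleK /=; split=> //.
    rewrite in_itv /= ler_pdivrMr// ltr_pdivlMr// [x t * _]mulrC ge_floor /=.
    by have := floorD1_gt (m.+1%:R * x t); rewrite intrD.
  move=> [n _ /= [+ hY]]; rewrite in_itv /= ler_pdivrMr// ltr_pdivlMr// [x t * _]mulrC => /andP[h1 h2].
  rewrite /h; suff -> : Num.floor (m.+1%:R * x t) = dec n by [].
  by apply: floor_def; rewrite h1 /= intrD.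
apply/measurable_EFinP.
apply: (emeasurable_fun_cvg (fun m t => (h m t)%:E)).
  by move=> m; apply/measurable_EFinP; exact: mh.
move=> t _; apply: cvg_EFin; first exact: nearW.
apply: (@cvg_comp _ _ _ (fun m : nat => (Num.floor (m.+1%:R * x t))%:~R / m.+1%:R) (g ^~ t) _ (nbhs (x t))); last exact: cg.
apply/cvgrPdist_le => e e0; have /cvgrPdist_le/(_ _ e0) := @cvg_harmonic R.
apply: filterS => m; rewrite sub0r normrN ger0_norm ?invr_ge0// => hm.
by rewrite distrC; apply: le_trans (floor_approx _ _) hm.
Qed.

Definition upd (v : nat -> R) (i : nat) (q : R) : nat -> R := fun k => if k == i then q else v k.

(** The random coordinates are substituted one at a time. Spectral statistics are measurable in this
    way without any measurable choice of the eigenvalues. *)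
Lemma measurable_coordinates (G : (nat -> R) -> R) (n : nat) (X : nat -> T -> R) :
  (forall v v', (forall i, (i < n)%N -> v i = v' i) -> G v = G v') ->
  (forall v i, continuous (fun q => G (upd v i q))) ->
  (forall i, measurable_fun setT (X i)) ->
  measurable_fun setT (fun t => G (fun i => X i t)).
Proof.
move=> Gn cG mX.
have key k v : measurable_fun setT (fun t => G (fun i => if (i < k)%N then X i t else v i)).
  elim: k v => [|k IH] v.
    rewrite (_ : (fun t => _) = fun=> G v); first exact: measurable_cst.
    by apply/funext => t; congr G.
  have := @measurable_comp_continuous (fun q t => G (fun i => if (i < k)%N then X i t else upd v k q i)) (X k).
  rewrite (_ : (fun t => G (fun i => if (i < k)%N then X i t else upd v k (X k t) i)) =
    (fun t => G (fun i => if (i < k.+1)%N then X i t else v i))); last first.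
    apply/funext => t; congr G; apply/funext => i; rewrite /upd ltnS.
    by case: ltngtP => // ->.
  move=> H; apply: H => // t.
  rewrite (_ : (fun q => _) = fun q => G (upd (fun i => if (i < k)%N then X i t else v i) k q)).
    exact: cG.
  apply/funext => q; congr G; apply/funext => i; rewrite /upd.
  by case: ltngtP.
rewrite (_ : (fun t => _) = fun t => G (fun i => if (i < n)%N then X i t else 0)); first exact: key.
by apply/funext => t; apply: Gn => i ->.
Qed.

End measurable_coordinates.

Section tsum_measurable.
Variable R : realType.
Context d (T : measurableType d).

Lemma tsum_lip_sup (f : R -> R) n (a c a' c' : nat -> R) (K e : R) : 0 <= K -> 0 <= e ->
  (forall x y, `|f x - f y| <= K * `|x - y|) ->
  (forall k, `|a k - a' k| <= e) -> (forall k, `|c k - c' k| <= e) ->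
  `|tsum f n a c - tsum f n a' c'| <= K * (2 * n%:R * e).
Proof.
move=> K0 e0 hf ha hc; apply: le_trans (tsum_lipschitz n a c a' c' K0 hf) _.
apply: ler_wpM2l => //.
have ne : 0 <= 2 * n%:R * e by rewrite !mulr_ge0.
rewrite -[leRHS]ger0_norm// -sqrtr_sqr ler_wsqrtr//.
have sq (x y : R) : `|x - y| <= e -> (x - y) ^+ 2 <= e ^+ 2.
  by move=> h; rewrite -real_normK ?num_real// ler_sqr ?nnegrE.
have S1 : \sum_(1 <= k < n.+1) (a k - a' k) ^+ 2 <= n%:R * e ^+ 2.
  apply: le_trans (ler_sum _ (fun k _ => sq _ _ (ha k))) _.
  by rewrite sumr_const_nat subn1 /= mulr_natl.
have S2 : \sum_(1 <= k < n) (c k - c' k) ^+ 2 <= n%:R * e ^+ 2.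
  apply: le_trans (ler_sum _ (fun k _ => sq _ _ (hc k))) _.
  rewrite sumr_const_nat -[_ *+ _]mulr_natl ler_wpM2r ?sqr_ge0// ler_nat leq_subr//.
have -> : (2 * n%:R * e) ^+ 2 = n%:R * (n%:R * e ^+ 2 + 3 * (n%:R * e ^+ 2)) by ring.
have e2 := sqr_ge0 e; have ne2 : 0 <= n%:R * e ^+ 2 by rewrite mulr_ge0.
by apply: ler_wpM2l => //; lra.
Qed.

Lemma measurable_tsum_lip (f : R -> R) (K : R) n (a c : nat -> T -> R) : 0 <= K ->
  (forall x y, `|f x - f y| <= K * `|x - y|) ->
  (forall k, measurable_fun setT (a k)) -> (forall k, measurable_fun setT (c k)) ->
  measurable_fun setT (fun t => tsum f n (a ^~ t) (c ^~ t)).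
Proof.
move=> K0 hf ma mc.
(* Even coordinates carry the diagonal, odd ones the off-diagonal entries. *)
pose G (v : nat -> R) := tsum f n (fun k => v k.*2) (fun k => v k.*2.+1).
pose X (i : nat) t := if odd i then c i./2 t else a i./2 t.
rewrite (_ : (fun t => _) = fun t => G (fun i => X i t)); last first.
  by apply/funext => t; apply: eq_tsum => k _; rewrite /X /= odd_double /= ?uphalf_double ?doubleK.
apply: (@measurable_coordinates _ _ _ G n.*2.+2).
- move=> v v' hv; apply: eq_tsum => k /andP[_ kn]; apply: hv; lia.
- move=> v i q; apply: continuous_eps => e e0.
  exists (e / (K * (2 * n%:R) + 1)); first by rewrite divr_gt0// ltr_wpDl// !mulr_ge0.
  move=> h /ltW; rewrite ler_pdivlMr ?ltr_wpDl// ?mulr_ge0// => hh.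
  have up k : `|upd v i (q + h) k - upd v i q k| <= `|h|.
    by rewrite /upd; case: eqP => _; [rewrite addrAC subrr add0r|rewrite subrr normr0].
  apply: le_trans (@tsum_lip_sup f n _ _ _ _ K `|h| K0 (normr_ge0 _) hf (fun k => up _) (fun k => up _)) _.
  apply: le_trans hh; rewrite mulrDr mulr1 [leRHS]addrC.
  by apply: ler_wpDl => //; rewrite le_eqVlt; apply/orP; left; apply/eqP; ring.
- by move=> i; rewrite /X; case: odd.
Qed.

Lemma tsum_bound (f : R -> R) n a c (M : R) : (forall x, `|f x| <= M) -> `|tsum f n a c| <= n%:R * M.
Proof.
move=> hf; apply: le_trans (ler_norm_sum _ _ _) _.
apply: le_trans (ler_sum _ (fun i _ => hf _)) _.
by rewrite sumr_const card_ord mulr_natl.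
Qed.

Lemma bdm_tsum_lip (f : R -> R) (K M : R) n (a c : nat -> T -> R) : 0 <= K ->
  (forall x y, `|f x - f y| <= K * `|x - y|) -> (forall x, `|f x| <= M) ->
  (forall k, measurable_fun setT (a k)) -> (forall k, measurable_fun setT (c k)) ->
  bdm (fun t => tsum f n (a ^~ t) (c ^~ t)).
Proof.
move=> K0 hf hM ma mc; split; first exact: measurable_tsum_lip hf ma mc.
by exists (n%:R * M) => t; exact: tsum_bound.
Qed.

Lemma bdm_tsum_lim (f_ : nat -> R -> R) (f : R -> R) (M : R) n (a c : nat -> T -> R) :
  (forall k, bdm (fun t => tsum (f_ k) n (a ^~ t) (c ^~ t))) ->
  (forall x, f_ ^~ x @ \oo --> f x) -> (forall x, `|f x| <= M) ->
  bdm (fun t => tsum f n (a ^~ t) (c ^~ t)).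
Proof.
move=> hf_ hf hM; split; last by exists (n%:R * M) => t; exact: tsum_bound.
apply/measurable_EFinP.
apply: (emeasurable_fun_cvg (fun k t => (tsum (f_ k) n (a ^~ t) (c ^~ t))%:E)).
  by move=> m; apply/measurable_EFinP; case: (hf_ m).
move=> t _; apply: cvg_EFin; first exact: nearW.
rewrite /tsum; elim: (n) (eig _) => [|k IH] u.
  by rewrite big_ord0; under eq_fun do rewrite big_ord0; exact: cvg_cst.
rewrite big_ord_recr /=; under eq_fun do rewrite big_ord_recr /=.
by apply: cvgD; [exact: (IH (fun i => u (widen_ord (leqnSn k) i)))|exact: hf].
Qed.

Definition below (t x : R) : R := if x <= t then 1 else 0.

Lemma below01 t x : 0 <= below t x <= 1.
Proof. by rewrite /below; case: ifP; rewrite lexx ler01. Qed.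

Lemma below_noninc t : {homo below t : x y /~ x <= y}.
Proof.
move=> x y xy; rewrite /below; case: ifPn => // xt; last by case: ifP.
by rewrite (le_trans xy xt).
Qed.

Lemma bdm_tsum_below (u : R) n (a c : nat -> T -> R) :
  (forall k, measurable_fun setT (a k)) -> (forall k, measurable_fun setT (c k)) ->
  bdm (fun t => tsum (below u) n (a ^~ t) (c ^~ t)).
Proof.
move=> ma mc; apply: (@bdm_tsum_lim (fun m x => clip (1 - m%:R * (x - u))) _ 1).
- move=> m; apply: (@bdm_tsum_lip _ m%:R 1) => // x.
    move=> y; apply: le_trans (clip_lip _ _) _.
    rewrite -[m%:R in leRHS]ger0_norm// -normrM -normrN le_eqVlt; apply/orP; left; apply/eqP.
    by congr `|_|; ring.
  by have /andP[? ?] := clip01 (1 - m%:R * (x - u)); rewrite ger0_norm.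
- move=> x; apply: cvg_near_cst; rewrite /below; case: ifPn => xu.
    apply: nearW => m; rewrite clipE; have : m%:R * (x - u) <= 0 by rewrite mulr_ge0_le0// subr_le0.
    by do 2?case: ifPn => ?; lra.
  near=> m; have h : (x - u)^-1 <= m%:R by near: m; exact: nbhs_infty_ger.
  have xu' : 0 < x - u by rewrite subr_gt0 ltNge.
  have : 1 <= m%:R * (x - u) by rewrite -ler_pdivrMr// div1r.
  by rewrite clipE; case: ifPn => //; lra.
- by move=> x; have /andP[? ?] := below01 u x; rewrite ger0_norm.
Unshelve. all: by end_near. Qed.

End tsum_measurable.

(** * Construction of the limit measure from near additivity *)

Section limit_measure.
Variables (R : realType) (beta : probability R R) (B : probability (seqS R) R).
Hypothesis hB : indlaw (fun=> beta) B.

Definition stsum (f : R -> R) n (s : seqS R) : R := tsum f n (fun=> 0) s.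

Definition Etsum (f : R -> R) n : R := \int[B]_s stsum f n s.

Definition sshift k (s : seqS R) : seqS R := fun j => s (j + k)%N.

Lemma measurable_shift k : measurable_fun setT (sshift k).
Proof. by apply: measurable_seq => i; exact: measurable_coord. Qed.

Lemma shift_law k (h : seqS R -> R) : bdm h -> \int[B]_s h (sshift k s) = \int[B]_s h s.
Proof.
move=> bh; pose g (i : nat) : nat + nat := inl (i + k)%N.
have ig : injective g by move=> i j [] /addIn.
have hs p : splice g p = sshift k p.1 by apply/funext => i.
have bs : bdm (fun p : seqS R * seqS R => h (sshift k p.1)).
  apply: bdm_comp bh _; apply: measurableT_comp; [exact: measurable_shift|exact: measurable_fst].
have e1 : \int[(B \x B)%E]_p h (sshift k p.1) = \int[B]_s h (sshift k s).
  rewrite Eb_fubini//; apply: eq_Rintegral => s _; exact: (EbC B (h (sshift k s))).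
rewrite -e1; have hl := splice_indlaw ig hB hB.
rewrite -(Eb_measure_eq (mu := law (B \x B)%E (measurable_splice g)) (nu := B)).
- by rewrite Eb_law//; apply: eq_Rintegral => p _; rewrite hs.
- by case: bh.
- have hl' : indlaw (fun=> beta) (law (B \x B)%E (measurable_splice g)) by apply: eq_indlaw hl => i.
  exact: (indlaw_unique hl' hB).
Qed.

Definition nice f := [/\ {homo f : x y /~ x <= y}, forall x, 0 <= f x <= 1 &
  forall n, bdm (stsum f n)].

Lemma nice_below t : nice (below t).
Proof.
split; [exact: below_noninc|exact: below01|].
by move=> n; apply: bdm_tsum_below => k; [exact: measurable_cst|exact: measurable_coord].
Qed.

(** The cut costs at most 1, and the shifted block has the law of a block that starts at the
    origin. *)
Lemma Etsum_add f m k : nice f -> `|Etsum f (m + k) - (Etsum f m + Etsum f k)| <= 1.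
Proof.
move=> [fni f01 bf]; have bs : bdm (fun s => stsum f m (sshift k s)).
  by apply: bdm_comp (bf m) _; exact: measurable_shift.
rewrite /Etsum -(shift_law k (bf m)) -EbD// -EbB//; last exact: bdmD.
apply: Eb_bound; first by apply: bdmB => //; exact: bdmD.
by move=> s; exact: tsum_cut.
Qed.

Lemma Etsum_mul f m k : nice f -> `|Etsum f (k * m) - k%:R * Etsum f m| <= k%:R.
Proof.
move=> nf; elim: k => [|k IH].
  rewrite !mul0n mul0r subr0 /Etsum.
  rewrite (_ : \int[B]_s _ = 0) ?normr0//.
  by rewrite -[RHS](EbC B); apply: eq_Rintegral => s _; rewrite /stsum /tsum big_ord0.
rewrite mulSn; have := Etsum_add m (k * m) nf.
have -> : Etsum f (m + k * m) - k.+1%:R * Etsum f m = (Etsum f (m + k * m) -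
  (Etsum f m + Etsum f (k * m))) + (Etsum f (k * m) - k%:R * Etsum f m) by rewrite -natr1; ring.
by move=> h; apply: le_trans (ler_normD _ _) _; rewrite -natr1 addrC lerD.
Qed.

Definition Tavg f n : R := Etsum f n / n%:R.

(** Both averages are compared with the one of size [m * k], which consists of [k] blocks of size
    [m] and of [m] blocks of size [k]. *)
Lemma Tavg_cauchy f m k : nice f -> (0 < m)%N -> (0 < k)%N ->
  Tavg f m - m%:R^-1 <= Tavg f k + k%:R^-1.
Proof.
move=> nf m0 k0.
have mp : 0 < m%:R :> R by rewrite ltr0n.
have kp : 0 < k%:R :> R by rewrite ltr0n.
have h1 := Etsum_mul m k nf; have h2 := Etsum_mul k m nf; rewrite mulnC in h2.
have h : k%:R * Etsum f m - k%:R <= m%:R * Etsum f k + m%:R.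
  by move: h1 h2; rewrite !ler_norml => /andP[? ?] /andP[? ?]; lra.
rewrite -(ler_pM2r (mulr_gt0 mp kp)) /Tavg.
have -> : (Etsum f m / m%:R - m%:R^-1) * (m%:R * k%:R) = k%:R * Etsum f m - k%:R.
  by field; rewrite gt_eqF.
by have -> : (Etsum f k / k%:R + k%:R^-1) * (m%:R * k%:R) = m%:R * Etsum f k + m%:R
  by field; rewrite gt_eqF.
Qed.

(* Near additivity gives Tavg f m - 1 / m <= Tavg f k + 1 / k for all m and k, so the limit of
   Tavg (below t) is a supremum. *)
Definition cdf_b (t : R) : R := sup [set Tavg (below t) n.+1 - n.+1%:R^-1 | n in setT].

Lemma cdf_b_approx t n : (0 < n)%N -> `|Tavg (below t) n - cdf_b t| <= n%:R^-1.
Proof.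
case: n => // n _; have nb := nice_below t.
rewrite distrC ler_norml; apply/andP; split.
  rewrite lerBrDr addrC; apply: ub_le_sup; last by exists n.
  exists (Tavg (below t) 1 + 1%:R^-1) => _ [m _ <-].
  exact: Tavg_cauchy.
rewrite lerBlDr addrC; apply: sup_le_ub; first by exists (Tavg (below t) 1 - 1%:R^-1), 0%N.
by move=> _ [m _ <-]; exact: Tavg_cauchy.
Qed.

Lemma Tavg_le f g n : nice f -> nice g -> (forall x, f x <= g x) -> Tavg f n <= Tavg g n.
Proof.
move=> [_ _ bf] [_ _ bg] fg; rewrite /Tavg ler_wpM2r ?invr_ge0//.
by apply: Eb_le => // s; apply: ler_sum.
Qed.

Lemma Tavg_lim (t : nat -> R) (f : R -> R) n : nice f -> (forall x, below (t k) x @[k --> \oo] --> f x) ->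
  Tavg (below (t k)) n @[k --> \oo] --> Tavg f n.
Proof.
move=> [_ f01 bf] hf; apply: cvgMl; apply: (@Eb_cvg _ _ _ _ _ _ (n%:R * 1)) => //.
- by move=> k; have [_ _] := nice_below (t k).
- move=> k s; apply: tsum_bound => x.
  by have /andP[? ?] := below01 (t k) x; rewrite ger0_norm.
- move=> s; rewrite /stsum /tsum; elim: (n) (eig _) => [|m IH] u.
    by rewrite big_ord0; under eq_fun do rewrite big_ord0; exact: cvg_cst.
  rewrite big_ord_recr /=; under eq_fun do rewrite big_ord_recr /=.
  by apply: cvgD; [exact: (IH (fun i => u (widen_ord (leqnSn m) i)))|exact: hf].
Qed.

Lemma nice_cst (c : R) : 0 <= c <= 1 -> nice (fun=> c).
Proof.
move=> c01; split => // n.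
rewrite (_ : stsum _ _ = fun=> n%:R * c); first exact: bdm_cst.
by apply/funext => s; rewrite /stsum /tsum sumr_const card_ord mulr_natl.
Qed.

Lemma Tavg_cst (c : R) n : (0 < n)%N -> Tavg (fun=> c) n = c.
Proof.
move=> n0; rewrite /Tavg.
have -> : Etsum (fun=> c) n = n%:R * c.
  rewrite -[RHS](EbC B); apply: eq_Rintegral => s _.
  by rewrite /stsum /tsum sumr_const card_ord mulr_natl.
by rewrite mulrAC divff ?mul1r// pnatr_eq0 -lt0n.
Qed.

Lemma small_inv (e : R) : 0 < e -> exists2 n : nat, (0 < n)%N & n%:R^-1 <= e.
Proof.
move=> e0; have [n _ /(_ n (leqnn n)) /= hn] := nbhs_infty_ger (e^-1).
exists n.+1 => //; rewrite -[e]invrK lef_pV2 ?posrE ?invr_gt0 ?ltr0n//.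
by apply: le_trans hn _; rewrite ler_nat.
Qed.

Lemma cdf_b_nd : nondecreasing_fun cdf_b.
Proof.
move=> x y xy; apply/ler_addgt0Pr => e e0.
have [n n0 n2] := small_inv (divr_gt0 e0 (ltr0n _ 2)).
have := cdf_b_approx x n0; have := cdf_b_approx y n0.
have := @Tavg_le (below x) (below y) n (nice_below x) (nice_below y) _.
rewrite !ler_norml => h /andP[? ?] /andP[? ?].
have {}h : Tavg (below x) n <= Tavg (below y) n.
  apply: h => z; rewrite /below; case: ifPn => [zx|_]; first by rewrite (le_trans zx xy).
  by case: ifP.
lra.
Qed.

(** An interchange of limits: [cdf_b_approx] is uniform in the threshold, so [cdf_b] inherits the
    limits of the genuine distribution functions [Tavg (below t) n]. Right continuity and both
    limits at infinity follow without a tightness estimate. *)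
Lemma cdf_b_lim (t : nat -> R) (f : R -> R) (l : R) : nice f ->
  (forall x, below (t k) x @[k --> \oo] --> f x) ->
  (forall n, (0 < n)%N -> `|Tavg f n - l| <= n%:R^-1) -> cdf_b (t k) @[k --> \oo] --> l.
Proof.
move=> nf hf hl; apply/cvgrPdist_le => e e0.
have [n n0 n2] := small_inv (divr_gt0 e0 (ltr0n _ 3)).
have e3 : 0 < e / 3 by rewrite divr_gt0.
have /cvgrPdist_le/(_ _ e3) := Tavg_lim (n := n) nf hf.
apply: filterS => k; have := cdf_b_approx (t k) n0; have := hl n n0.
rewrite !ler_norml => /andP[? ?] /andP[? ?] /andP[? ?].
by apply/andP; split; lra.
Qed.

Lemma cvg_harm0 : (n.+1%:R^-1 : R) @[n --> \oo] --> (0 : R).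
Proof. exact: cvg_harmonic. Qed.

Lemma cdf_b_rc : right_continuous cdf_b.
Proof.
move=> a; apply/cvgrPdist_le => e e0.
have hlim : cdf_b (a + k.+1%:R^-1) @[k --> \oo] --> cdf_b a.
  apply: (@cdf_b_lim _ (below a)); [exact: nice_below| |by move=> n; exact: cdf_b_approx].
  move=> x; apply: cvg_near_cst; rewrite /below; case: (leP x a) => xa.
    by apply: nearW => k; rewrite (le_trans xa)// lerDl.
  have xa' : 0 < x - a by rewrite subr_gt0.
  have /cvgrPdist_lt/(_ _ xa') := cvg_harm0; apply: filterS => k.
  by rewrite sub0r normrN ger0_norm// ltrBrDl leNgt => ->.
have /cvgrPdist_le/(_ _ e0)[k _ /(_ k (leqnn k)) /= hk] := hlim.
have k0 : 0 < k.+1%:R^-1 :> R by rewrite invr_gt0.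
near=> x.
have ax : a < x by near: x; exact: nbhs_right_gt.
have xk : x < a + k.+1%:R^-1 by near: x; apply: nbhs_right_lt; rewrite ltrDl.
have h1 := cdf_b_nd (ltW ax); have h2 := cdf_b_nd (ltW xk).
move: hk; rewrite !ler_norml => /andP[hk1 hk2].
by apply/andP; split; lra.
Unshelve. all: by end_near. Qed.

Lemma cdf_b_y : cdf_b @ +oo --> (1 : R).
Proof.
have hlim : cdf_b k%:R @[k --> \oo] --> (1 : R).
  apply: (@cdf_b_lim _ (fun=> 1)); first by apply: nice_cst; rewrite ler01 lexx.
    move=> x; apply: cvg_near_cst; near=> k; rewrite /below.
    by have -> : x <= k%:R by near: k; exact: nbhs_infty_ger.
  by move=> n n0; rewrite Tavg_cst// subrr normr0 invr_ge0.
have le1 t : cdf_b t <= 1.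
  apply: sup_le_ub; first by exists (Tavg (below t) 1 - 1%:R^-1), 0%N.
  move=> _ [m _ <-]; rewrite lerBlDr.
  apply: le_trans (_ : 1 <= _); last by rewrite lerDl invr_ge0.
  rewrite -[leRHS](@Tavg_cst 1 m.+1)//; apply: Tavg_le; [exact: nice_below|by apply: nice_cst; rewrite ler01 lexx|].
  by move=> x; have /andP[] := below01 t x.
apply/cvgrPdist_le => e e0; have /cvgrPdist_le/(_ _ e0)[k _ /(_ k (leqnn k)) /= hk] := hlim.
near=> x.
have kx : k%:R <= x by near: x; exact: nbhs_pinfty_ge.
have := cdf_b_nd kx; have := le1 x; move: hk; rewrite !ler_norml => /andP[? ?] ? ?.
by apply/andP; split; lra.
Unshelve. all: by end_near. Qed.

Lemma cdf_b_Ny : cdf_b @ -oo --> (0 : R).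
Proof.
have hlim : cdf_b (- k%:R) @[k --> \oo] --> (0 : R).
  apply: (@cdf_b_lim _ (fun=> 0)); first by apply: nice_cst; rewrite ler01 lexx.
    move=> x; apply: cvg_near_cst; near=> k; rewrite /below leNgt.
    suff -> : - k%:R < x by [].
    rewrite ltrNl; near: k; exact: nbhs_infty_gtr.
  by move=> n n0; rewrite Tavg_cst// subrr normr0 invr_ge0.
have ge0 t : 0 <= cdf_b t.
  apply/ler_addgt0Pr => e e0.
  have [n n0 n2] := small_inv e0.
  have := cdf_b_approx t n0.
  have : 0 <= Tavg (below t) n.
    rewrite -[leLHS](@Tavg_cst 0 n)//; apply: Tavg_le; [by apply: nice_cst; rewrite ler01 lexx|exact: nice_below|].
    by move=> x; have /andP[] := below01 t x.
  by rewrite ler_norml => ? /andP[? ?]; lra.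
apply/cvgrPdist_le => e e0; have /cvgrPdist_le/(_ _ e0)[k _ /(_ k (leqnn k)) /= hk] := hlim.
near=> x.
have kx : x <= - k%:R by near: x; exact: nbhs_ninfty_le.
have := cdf_b_nd kx; have := ge0 x; move: hk; rewrite !ler_norml => /andP[? ?] ? ?.
by apply/andP; split; lra.
Unshelve. all: by end_near. Qed.

HB.instance Definition _ := isCumulative.Build R _ R cdf_b cdf_b_nd cdf_b_rc.
HB.instance Definition _ := isCumulativeBounded.Build R 0 1 cdf_b cdf_b_Ny cdf_b_y.

(** Pushing forward by the identity only transports the measure from [measurableTypeR R] to [R]. *)
Definition mu_b : probability R R :=
  law (lebesgue_stieltjes_measure cdf_b : probability _ R) (@measurable_idR R).

Lemma mu_b_below t : \int[mu_b]_x below t x = cdf_b t.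
Proof.
pose I (n : nat) : set R := `](- n%:R), t]%classic.
have mI n : measurable (I n) by exact: measurable_itv.
have bI (A : set R) : measurable A -> bdm (\1_A : R -> R).
  by move=> mA; split => //; exists 1 => x; rewrite indicE; case: (_ \in _); rewrite ?normr1 ?normr0.
have muI n : - n%:R <= t -> \int[mu_b]_x \1_(I n) x = cdf_b t - cdf_b (- n%:R).
  move=> nt; rewrite /Rintegral integral_indic// setIT.
  rewrite /mu_b /law /= /distribution /pushforward /=.
  rewrite /lebesgue_stieltjes_measure /measure_extension measurable_mu_extE/=; last exact: is_ocitv.
  by rewrite wlength_itv_bnd.
have l1 : \int[mu_b]_x \1_(I n) x @[n --> \oo] --> \int[mu_b]_x below t x.
  apply: (@Eb_cvg _ _ _ _ _ _ 1) => //.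
  - by move=> n; apply: bI.
  - split; last by exists 1 => x; have /andP[? ?] := below01 t x; rewrite ger0_norm.
    by apply: measurable_fun_ifT => //; exact: measurable_fun_ler.
  - by move=> n x; rewrite indicE; case: (_ \in _); rewrite ?normr1 ?normr0.
  move=> x; apply: cvg_near_cst; near=> n.
  rewrite /below indicE mem_setE in_itv /=.
  suff -> : - n%:R < x by case: ifP.
  rewrite ltrNl; near: n; exact: nbhs_infty_gtr.
have l2 : \int[mu_b]_x \1_(I n) x @[n --> \oo] --> (cdf_b t - 0 : R).
  apply: (cvg_trans _ (_ : (cdf_b t - cdf_b (- n%:R)) @[n --> \oo] --> (cdf_b t - 0 : R))).
    apply: near_eq_cvg; near=> n; rewrite muI//.
    rewrite lerNl; near: n; exact: nbhs_infty_ger.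
  apply: cvgB; first exact: cvg_cst.
  apply: (cvg_comp (fun n : nat => - n%:R : R) cdf_b); last exact: cdf_b_Ny.
  by apply/cvgrNyPle => A; near=> n; rewrite lerNl; near: n; exact: nbhs_infty_ger.
by rewrite subr0 in l2; exact: (cvg_unique (@norm_hausdorff _ R) l1 l2).
Unshelve. all: by end_near. Qed.

Lemma mu_b_prob_below t n : (0 < n)%N -> `|Tavg (below t) n - \int[mu_b]_x below t x| <= n%:R^-1.
Proof. by rewrite mu_b_below; exact: cdf_b_approx. Qed.

Lemma nice_ramp q j m : nice (ramp q j m).
Proof.
split; [exact: ramp_noninc|exact: ramp01|].
move=> n; apply: (@bdm_tsum_lip _ _ _ _ q%:R 1) => //; first exact: ramp_lip.
- by move=> x; have /andP[? ?] := ramp01 q j m x; rewrite ger0_norm.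
- by move=> k; exact: measurable_coord.
Qed.

Lemma Tavg_posfun n : (0 < n)%N -> (forall f, bcont f -> bdm (stsum f n)) ->
  posfun (fun f => Tavg f n).
Proof.
move=> n0 hb; have np : 0 < n%:R :> R by rewrite ltr0n.
split=> [f g bf bg|c f bf||f g bf bg fg].
- rewrite /Tavg -mulrDl /Etsum -EbD; [|exact: hb|exact: hb].
  congr (_ / _); apply: eq_Rintegral => s _; rewrite /stsum /tsum -big_split.
  by [].
- rewrite /Tavg mulrA /Etsum -EbZ; last exact: hb.
  congr (_ / _); apply: eq_Rintegral => s _; rewrite /stsum /tsum mulr_sumr.
  by [].
- exact: Tavg_cst.
- rewrite /Tavg ler_wpM2r ?invr_ge0//.
  by apply: Eb_le; [exact: hb|exact: hb|move=> s; apply: ler_sum].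
Qed.

(** A layer-cake formula: [clip u] is, up to [1 / K], the proportion of the levels [(i + 1) / K]
    that are at most [u]. It carries the rate [1 / n] from the indicators [below] to the ramps. *)
Lemma ramp_steps q j m K (x : R) : (0 < q)%N -> (0 < K)%N ->
  `|ramp q j m x - K%:R^-1 * \sum_(i < K) below ((j%:R - m%:R + 1 - (i%:R + 1) / K%:R) / q%:R) x| <= K%:R^-1.
Proof.
move=> q0 K0; have qp : 0 < q%:R :> R by rewrite ltr0n.
have Kp : 0 < K%:R :> R by rewrite ltr0n.
rewrite /ramp; set u := j%:R - m%:R + 1 - q%:R * x.
have bE (i : nat) : below ((j%:R - m%:R + 1 - (i%:R + 1) / K%:R) / q%:R) x =
    if i.+1%:R <= K%:R * u then 1 else 0.
  rewrite /below ler_pdivlMr// -natr1 [K%:R * u]mulrC -ler_pdivrMr//; congr (if _ then _ else _).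
  by rewrite /u; apply/idP/idP; lra.
under eq_bigr do rewrite bE.
have S n : \sum_(i < n) (if i.+1%:R <= K%:R * u then 1 else 0 : R) <= Num.max 0 (K%:R * u) /\
    (n%:R <= K%:R * u -> \sum_(i < n) (if i.+1%:R <= K%:R * u then 1 else 0 : R) = n%:R) /\
    (K%:R * u <= n%:R -> K%:R * u - 1 <= \sum_(i < n) (if i.+1%:R <= K%:R * u then 1 else 0 : R)).
  elim: n => [|n [I1 [I2 I3]]].
    by rewrite big_ord0; split; [rewrite le_max lexx|split => // h; lra].
  rewrite big_ord_recr /=; case: ifPn => hn.
    have hn' : n%:R <= K%:R * u by apply: le_trans hn; rewrite ler_nat.
    rewrite (I2 hn') natr1; split; [by rewrite le_max hn orbT|split => // h; lra].
  rewrite addr0 -ltNge in hn *; split => //; split => //.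
  move=> _; have [h|h] := leP (K%:R * u) n%:R; first exact: I3.
  by rewrite (I2 (ltW h)); rewrite -natr1 in hn; lra.
have [S1 [S2 S3]] := S K; move: S1 S2 S3; set s := \sum_(i < K) _ => S1 S2 S3.
have sK : s <= K%:R.
  have -> : K%:R = \sum_(i < K) 1 :> R by rewrite sumr_const card_ord.
  by apply: ler_sum => i _; case: ifP.
have s0 : 0 <= s by apply: sumr_ge0 => i _; case: ifP.
suff h : `|K%:R * clip u - s| <= 1.
  have -> : clip u - K%:R^-1 * s = (K%:R * clip u - s) / K%:R by field; rewrite gt_eqF.
  by rewrite normrM normfV (gtr0_norm Kp) ler_pdivrMr// mulVf ?gt_eqF.
rewrite clipE; case: ifPn => [u0|].
  have h : K%:R * u <= 0 by rewrite mulr_ge0_le0// ltW.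
  rewrite (max_idPl h) in S1.
  have -> : s = 0 by apply/eqP; rewrite eq_le S1 s0.
  by rewrite mulr0 subr0 normr0.
rewrite -ltNge => u0; case: ifPn => [u1|].
  have h : K%:R <= K%:R * u by rewrite ler_peMr// ltW.
  by rewrite S2// mulr1 subrr normr0.
rewrite -ltNge => u1.
have h0 : 0 <= K%:R * u by rewrite mulr_ge0 ?ltW.
have h1 : K%:R * u <= K%:R by rewrite ger_pMr// ltW.
rewrite (max_idPr h0) in S1; have := S3 h1 => S3'.
by rewrite ler_norml; apply/andP; split; lra.
Qed.

Lemma Tavg_ramp q j m n : (0 < n)%N -> (0 < q)%N ->
  `|Tavg (ramp q j m) n - \int[mu_b]_x ramp q j m x| <= n%:R^-1.
Proof.
move=> n0 q0; have np : 0 < n%:R :> R by rewrite ltr0n.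
apply/ler_addgt0Pr => e e0.
have [K K0 hK] := small_inv (divr_gt0 e0 (ltr0n _ 2)).
have Kp : 0 < K%:R :> R by rewrite ltr0n.
pose t (i : nat) := (j%:R - m%:R + 1 - (i%:R + 1) / K%:R) / q%:R : R.
pose g x := K%:R^-1 * \sum_(i < K) below (t i) x.
have bb i : bdm (below (t i) : R -> R).
  split; last by exists 1 => x; have /andP[? ?] := below01 (t i) x; rewrite ger0_norm.
  by apply: measurable_fun_ifT => //; exact: measurable_fun_ler.
have bsb i : bdm (stsum (below (t i)) n) by have [_ _] := nice_below (t i).
have Ig : \int[mu_b]_x g x = K%:R^-1 * \sum_(i < K) \int[mu_b]_x below (t i) x.
  rewrite EbZ; last exact: (bdm_sum _ (fun i : 'I_K => bb i)).
  by congr (_ * _); rewrite (Eb_sum _ _ (fun i : 'I_K => bb i)).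
have bg : bdm g by apply: bdmM; [exact: bdm_cst|exact: (bdm_sum _ (fun i : 'I_K => bb i))].
have sg s : stsum g n s = K%:R^-1 * \sum_(i < K) stsum (below (t i)) n s.
  by rewrite /stsum /tsum /g -mulr_sumr exchange_big.
have bsg : bdm (stsum g n).
  rewrite (_ : stsum g n = fun s => K%:R^-1 * \sum_(i < K) stsum (below (t i)) n s); last exact/funext.
  by apply: bdmM; [exact: bdm_cst|exact: (bdm_sum _ (fun i : 'I_K => bsb i))].
have Tg : Tavg g n = K%:R^-1 * \sum_(i < K) Tavg (below (t i)) n.
  rewrite /Tavg /Etsum; under eq_Rintegral do rewrite sg.
  rewrite EbZ; last exact: (bdm_sum _ (fun i : 'I_K => bsb i)).
  by rewrite (Eb_sum _ _ (fun i : 'I_K => bsb i)) -mulr_suml mulrA.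
have d1 : `|Tavg g n - \int[mu_b]_x g x| <= n%:R^-1.
  rewrite Tg Ig -mulrBr -sumrB normrM ger0_norm ?invr_ge0//.
  rewrite mulrC ler_pdivrMr//; apply: le_trans (ler_norm_sum _ _ _) _.
  apply: (@le_trans _ _ (\sum_(i < K) n%:R^-1)).
    by apply: ler_sum => i _; exact: mu_b_prob_below.
  by rewrite sumr_const card_ord -[_ *+ _]mulr_natr.
have [_ r01 br] := nice_ramp q j m.
have d2 : `|Tavg (ramp q j m) n - Tavg g n| <= e / 2.
  rewrite /Tavg -mulrBl normrM (ger0_norm (x := _^-1)) ?invr_ge0// ler_pdivrMr//.
  rewrite /Etsum -EbB//; apply: Eb_bound; first exact: bdmB.
  move=> s; rewrite /stsum /tsum -sumrB; apply: le_trans (ler_norm_sum _ _ _) _.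
  apply: (@le_trans _ _ (\sum_(i < n) (e / 2))).
    by apply: ler_sum => i _; exact: le_trans (ramp_steps j m _ q0 K0) hK.
  by rewrite sumr_const card_ord -[_ *+ _]mulr_natr.
have d3 : `|\int[mu_b]_x ramp q j m x - \int[mu_b]_x g x| <= e / 2.
  have bR : bdm (ramp q j m) := bcont_bdm (bcont_ramp R q j m).
  rewrite -EbB//; apply: Eb_bound; first exact: bdmB.
  by move=> x; exact: le_trans (ramp_steps j m _ q0 K0) hK.
move: d1 d2 d3; rewrite !ler_norml => /andP[? ?] /andP[? ?] /andP[? ?].
by apply/andP; split; lra.
Qed.

End limit_measure.

Section lipschitz_approximation.
Variable R : realType.

(** Regularization by sup-convolution: the supremum over [y] of [f y - n |x - y|] is [n]-Lipschitz,
    lies between [f] and [K], and converges to [f] where [f] is continuous. *)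
Lemma lip_approx (f : R -> R) (K : R) : continuous f -> (forall x, `|f x| <= K) ->
  exists f_ : nat -> R -> R, [/\ forall n x y, `|f_ n x - f_ n y| <= n%:R * `|x - y|,
    forall n x, `|f_ n x| <= K & forall x, f_ ^~ x @ \oo --> f x].
Proof.
move=> cf hK.
pose S n x := [set f y - n%:R * `|x - y| | y in setT].
have ubS n x : ubound (S n x) K.
  move=> _ [y _ <-]; have := hK y; rewrite ler_norml => /andP[_ fK].
  by rewrite lerBlDr (le_trans fK)// lerDl mulr_ge0.
have inS n x : S n x (f x) by exists x => //; rewrite subrr normr0 mulr0 subr0.
have supS n x : has_sup (S n x) by split; [exists (f x)|exists K].
pose g n x := sup (S n x).
have gf n x : f x <= g n x by apply: ub_le_sup => //; exists K.
have gK n x : g n x <= K by apply: sup_le_ub => //; exists (f x).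
exists g; split.
- have half n x y : g n x - n%:R * `|x - y| <= g n y.
    rewrite lerBlDr; apply: sup_le_ub; first by exists (f x).
    move=> _ [u _ <-]; rewrite -lerBlDr; apply: le_trans (ub_le_sup (ex_intro _ K (ubS n y)) _); last by exists u.
    have := ler_wpM2l (ler0n R n) (ler_distD x y u); rewrite mulrDr [ `|y - x|]distrC; lra.
  move=> n x y; have := half n x y; have := half n y x; rewrite [ `|y - x|]distrC => h1 h2.
  by rewrite ler_norml; apply/andP; split; lra.
- move=> n x; rewrite ler_norml gK andbT; apply: le_trans (gf n x).
  by have := hK x; rewrite ler_norml => /andP[].
- move=> x; apply/cvgrPdist_le => e e0.
  have /cvgrPdist_le/(_ _ e0)[d /= d0 hd] := cf x.
  near=> n.
  have hn : 2 * K / d <= n%:R by near: n; exact: nbhs_infty_ger.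
  rewrite distrC ger0_norm ?subr_ge0// lerBlDr; apply: sup_le_ub; first by exists (f x).
  move=> _ [y _ <-]; have [xy|xy] := ltP `|x - y| d.
    have := hd y xy; rewrite ler_norml => /andP[h _].
    have : 0 <= n%:R * `|x - y| by rewrite mulr_ge0.
    lra.
  have : 2 * K <= n%:R * `|x - y|.
    rewrite ler_pdivrMr// in hn; apply: le_trans hn _.
    by rewrite ler_wpM2l.
  have := hK x; have := hK y; rewrite !ler_norml => /andP[? ?] /andP[? ?]; lra.
Unshelve. all: by end_near. Qed.

Lemma bdm_tsum_bcont d (T : measurableType d) (f : R -> R) n (a c : nat -> T -> R) : bcont f ->
  (forall k, measurable_fun setT (a k)) -> (forall k, measurable_fun setT (c k)) ->
  bdm (fun t => tsum f n (a ^~ t) (c ^~ t)).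
Proof.
move=> [cf [K hK]] ma mc; have [f_ [fl fb fc]] := lip_approx cf hK.
apply: (@bdm_tsum_lim _ _ _ f_ f K) => // k.
exact: bdm_tsum_lip (fl k) (fb k) ma mc.
Qed.

Variables (beta : probability R R) (B : probability (seqS R) R).
Hypothesis hB : indlaw (fun=> beta) B.

Lemma bdm_stsum (f : R -> R) n : bcont f -> bdm (stsum f n).
Proof.
move=> bf; apply: (bdm_tsum_bcont n (a := fun=> fun=> 0)) => // k.
exact: measurable_coord.
Qed.

Lemma Tavg_cvg (f : R -> R) : bcont f ->
  Tavg B f n.+1 @[n --> \oo] --> \int[mu_b hB]_x f x.
Proof.
move=> bf; apply: (@weak_of_ramps _ (fun n f => Tavg B f n.+1) (fun f => \int[mu_b hB]_x f x)) => //.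
- by move=> n; apply: Tavg_posfun => // g bg; exact: bdm_stsum.
- exact: posfun_integral.
- exact: tight_integral.
- move=> q j m.
  (* A ramp of parameter [q = 0] is constant. *)
  have [->|q0] := posnP q; last first.
    apply/cvgrPdist_le => e e0; have /cvgrPdist_le/(_ _ e0) := @cvg_harmonic R.
    apply: filterS => n; rewrite sub0r normrN ger0_norm ?invr_ge0// => hn.
    by rewrite distrC; apply: le_trans hn; exact: Tavg_ramp.
  have e : ramp 0 j m = fun=> clip (j%:R - m%:R + 1 : R).
    by apply/funext => x; rewrite /ramp mul0r subr0.
  rewrite e EbC; under eq_fun do rewrite Tavg_cst//.
  exact: cvg_cst.
Unshelve. all: by end_near. Qed.

End lipschitz_approximation.

(** * The recursive distributional equation *)

Section borel_complex.
Variable R : realType.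
Local Notation C := R[i].

Definition lipC (K : R) (f : C -> R) := forall s t, `|f s - f t| <= K * normc (s - t).

Lemma openC (U : set C) : open (U : set C^o) <->
  forall s, U s -> exists2 r : R, 0 < r & forall t, normc (t - s) < r -> U t.
Proof.
rewrite openE; split=> h s Us.
  have /nbhs_ballP[e /posC_real[r r0 ->] hr] := h s Us.
  exists r => // t st; apply: hr; rewrite /ball /= /ball_.
  by rewrite normC_ltc normc_sub.
have [r r0 hr] := h s Us; apply/nbhs_ballP; exists r%:C; first by rewrite /= ltcR.
move=> t; rewrite /ball /= /ball_ normC_ltc => st; apply: hr.
by rewrite normc_sub.
Qed.

Lemma measurable_open (U : set C) : open (U : set C^o) -> measurable (U : set (borelC R)).
Proof. by move=> oU; exact: sub_sigma_algebra. Qed.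

Lemma measurable_lipC K (f : C -> R) : lipC K f -> measurable_fun setT (f : borelC R -> R).
Proof.
move=> hf; have K0 : 0 <= K.
  have := hf 1 0; rewrite subr0 normc1 mulr1; exact: le_trans.
apply: (@measurability _ _ (borelC R) R setT f (@RGenOInfty.G R)).
  exact: RGenOInfty.measurableE.
move=> _ [_ [a ->] <-]; rewrite setTI; apply: measurable_open; apply/openC => s /=.
rewrite in_itv /= andbT => as_.
have d0 : 0 < f s - a by rewrite subr_gt0.
exists ((f s - a) / (K + 1)); first by rewrite divr_gt0// ltr_wpDl.
have K1 : 0 < K + 1 by rewrite ltr_wpDl.
move=> t; rewrite ltr_pdivlMr// => st; rewrite in_itv /= andbT.
have := hf t s; rewrite ler_norml => /andP[h _].
have := normc_ge0 (t - s); nra.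
Qed.

Lemma lipC_Re : lipC 1 (@complex.Re R).
Proof. by move=> s t; rewrite mul1r -raddfB; exact: le_Re_normc. Qed.

Lemma lipC_Im : lipC 1 (@complex.Im R).
Proof. by move=> s t; rewrite mul1r -raddfB; exact: le_Im_normc. Qed.

Lemma mfunC_id : mfunC (fun s : borelC R => s : C).
Proof. by split; apply: measurable_lipC; [exact: lipC_Re|exact: lipC_Im]. Qed.

Lemma mfunC_comp d d' (T : measurableType d) (T' : measurableType d') (f : T' -> C) (X : T -> T') :
  mfunC f -> measurable_fun setT X -> mfunC (fun x => f (X x)).
Proof. by move=> [f1 f2] mX; split; [exact: (measurableT_comp f1 mX)|exact: (measurableT_comp f2 mX)]. Qed.

(** An open set of the plane is a countable union of squares with rational centers and radii
    [1 / (k + 1)], whose preimages are measured componentwise. *)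
Lemma measurable_borelC d (T : measurableType d) (f : T -> C) :
  mfunC f -> measurable_fun setT (f : T -> borelC R).
Proof.
move=> [f1 f2].
apply: (@measurability _ _ T (borelC R) setT f (@open C^o)) => //.
move=> _ [U oU <-]; rewrite setTI.
pose sq (p : rat * rat * nat) : set C := [set w | `|complex.Re w - ratr p.1.1| < p.2.+1%:R^-1 /\
   `|complex.Im w - ratr p.1.2| < p.2.+1%:R^-1].
pose F (i : nat) : set T := if choice.unpickle i is Some p then
   (if `[< sq p `<=` U >] then f @^-1` sq p else set0) else set0.
have -> : f @^-1` U = \bigcup_i F i.
  apply/seteqP; split => [t /= Ut|t [i _]]; last first.
    by rewrite /F; case: choice.unpickle => // p; case: asboolP => // h /h.
  have [r r0 hr] := (openC U).1 oU _ Ut.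
  have [k k0 hk] := small_inv (divr_gt0 r0 (ltr0n _ 4)).
  case: k k0 hk => // k _ hk.
  have kp : 0 < k.+1%:R^-1 :> R by rewrite invr_gt0.
  have near_rat (x u : R) : 0 < u -> exists q : rat, `|x - ratr q| < u.
    move=> u0; have [|q] := @rat_in_itvoo R (x - u) (x + u); first lra.
    rewrite in_itv /= => /andP[? ?]; exists q; rewrite ltr_norml; apply/andP; split; lra.
  have [q1 h1] := near_rat (complex.Re (f t)) _ kp; have [q2 h2] := near_rat (complex.Im (f t)) _ kp.
  exists (choice.pickle (q1, q2, k)); first exact: I.
  rewrite /F choice.pickleK.
  case: asboolP => [_|]; first by split.
  apply: contra_notP => _; move=> w [/= w1 w2]; apply: hr.
  apply: le_lt_trans (normc_le_ReIm _) _; rewrite !raddfB /=.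
  move: hk h1 h2 w1 w2; move: (k.+1%:R^-1) => u hk; rewrite !ltr_norml => /andP[? ?] /andP[? ?] /andP[? ?] /andP[? ?].
  have r4 : r = r / 4 + r / 4 + (r / 4 + r / 4) by field.
  by rewrite r4; apply: ltrD; rewrite ltr_norml; apply/andP; split; lra.
apply: bigcupT_measurable => i; rewrite /F; case: choice.unpickle => // p; case: asboolP => // _.
have m (g : T -> R) (q : R) : measurable_fun setT g -> measurable (g @^-1` `]q - p.2.+1%:R^-1, q + p.2.+1%:R^-1[%classic).
  by move=> mg; rewrite -[X in measurable X]setTI; exact: mg.
have := measurableI _ _ (m _ (ratr p.1.1) f1) (m _ (ratr p.1.2) f2).
congr measurable; rewrite /sq; move: (p.2.+1%:R^-1) => u; apply/seteqP; split => t /=; rewrite !in_itv /= !ltr_norml.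
  by move=> [/andP[? ?] /andP[? ?]]; split; apply/andP; split; lra.
by move=> [/andP[? ?] /andP[? ?]]; split; apply/andP; split; lra.
Qed.

Lemma bdm_lipC K M (f : C -> R) : lipC K f -> (forall s, `|f s| <= M) -> bdm (f : borelC R -> R).
Proof. by move=> hf hM; split; [exact: measurable_lipC hf|exists M]. Qed.

Lemma lipC_clip (f : C -> R) (n : nat) : lipC 1 f -> lipC n%:R (fun s => clip (n%:R * f s)).
Proof.
move=> hf s t; apply: le_trans (clip_lip _ _) _.
rewrite -mulrBr normrM ger0_norm//; apply: ler_wpM2l => //.
by have := hf s t; rewrite mul1r.
Qed.

(** The functions [clip (n rho)] converge to the indicator of the open set [U], where [rho] is the
    distance to the complement. It is capped at 1 so that the supremum exists also when [U] is the
    whole plane. *)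
Lemma lipC_unique (L L' : probability (borelC R) R) :
  (forall K M (f : C -> R), lipC K f -> (forall s, `|f s| <= M) ->
    \int[L]_s (f : borelC R -> R) s = \int[L']_s (f : borelC R -> R) s) ->
  forall A, measurable A -> L A = L' A.
Proof.
move=> h.
apply: (@measure_unique _ R (borelC R) (@open C^o) (fun=> setT)) => //.
- exact: openI.
- by move=> _; exact: openT.
- by rewrite bigcup_const.
- move=> U oU.
  pose S s := [set r : R | 0 <= r <= 1 /\ forall t, normc (t - s) < r -> U t].
  pose rho s := sup (S s).
  have S0 s : S s 0.
    by split; [rewrite lexx ler01|move=> t; rewrite ltNge normc_ge0].
  have S1 s : ubound (S s) 1 by move=> r [/andP[]].
  have rho0 s : 0 <= rho s by apply: ub_le_sup => //; exists 1.
  have lrho : lipC 1 rho.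
    have half s t : rho s - normc (s - t) <= rho t.
      rewrite lerBlDr; apply: sup_le_ub; first by exists 0.
      move=> r [/andP[r0 r1] hr]; rewrite -lerBlDr.
      have [rn|rn] := leP 0 (r - normc (s - t)); last by apply: le_trans (ltW rn) (rho0 t).
      apply: ub_le_sup; first by exists 1.
      split; first by rewrite rn /=; have := normc_ge0 (s - t); lra.
      move=> u hu; apply: hr; have := le_normcD (u - t) (t - s); rewrite addrA subrK.
      by rewrite [normc (t - s)]normc_sub; lra.
    move=> s t; rewrite mul1r ler_norml; have := half s t; have := half t s.
    by rewrite [normc (t - s)]normc_sub => ? ?; apply/andP; split; lra.
  have rhoU s : U s -> 0 < rho s.
    move=> Us; have [r r0 hr] := (openC U).1 oU _ Us.
    apply: (@lt_le_trans _ _ (Num.min r 1)); first by rewrite lt_min r0 ltr01.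
    apply: ub_le_sup; first by exists 1.
    split; first by rewrite le_min (ltW r0) ler01 /= ge_min lexx orbT.
    by move=> t; rewrite lt_min => /andP[/hr].
  have rhoN s : ~ U s -> rho s = 0.
    move=> Us; apply/eqP; rewrite eq_le rho0 andbT; apply: sup_le_ub; first by exists 0.
    move=> r [/andP[r0 _] hr]; rewrite leNgt; apply/negP => rp; apply: Us; apply: hr.
    by rewrite subrr normc0.
  have lim (m : probability (borelC R) R) :
      \int[m]_s ((fun s => clip (n%:R * rho s)) : borelC R -> R) s @[n --> \oo] --> fine (m U).
    have bU : bdm (\1_U : borelC R -> R).
      split; last by exists 1 => x; rewrite indicE; case: (_ \in _); rewrite ?normr1 ?normr0.
      by apply: measurable_indic; exact: measurable_open.
    have -> : fine (m U) = \int[m]_s \1_U s.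
      by rewrite /Rintegral integral_indic// ?setIT//; exact: measurable_open.
    apply: (@Eb_cvg _ _ _ _ _ _ 1) => //.
    - move=> n; apply: (@bdm_lipC n%:R 1); first exact: lipC_clip.
      by move=> s; have /andP[? ?] := clip01 (n%:R * rho s); rewrite ger0_norm.
    - by move=> n s; have /andP[? ?] := clip01 (n%:R * rho s); rewrite ger0_norm.
    - move=> s; apply: cvg_near_cst; rewrite indicE; case: (boolP (s \in U)) => [/set_mem Us|/negP nU].
        near=> n; have p := rhoU _ Us.
        have hn : (rho s)^-1 <= n%:R by near: n; exact: nbhs_infty_ger.
        have : 1 <= n%:R * rho s by rewrite -ler_pdivrMr// div1r.
        by rewrite clipE; case: ifPn => [|_ ->]//; lra.
      apply: nearW => n; rewrite rhoN; last by move=> Us; apply: nU; exact/mem_set.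
      by rewrite mulr0 clipE lexx.
  have fm (m : probability (borelC R) R) : m U \is a fin_num.
    by apply: fin_num_measure; exact: measurable_open.
  suff : fine (L U) = fine (L' U) by move=> e; rewrite -[LHS]fineK ?fm// e fineK ?fm.
  have l1 := lim L; have := lim L'.
  have -> : (fun n : nat => \int[L']_s ((fun s => clip (n%:R * rho s)) : borelC R -> R) s) =
    (fun n : nat => \int[L]_s ((fun s => clip (n%:R * rho s)) : borelC R -> R) s).
    apply/funext => n; apply/esym; apply: (@h n%:R 1); first exact: lipC_clip.
    by move=> s; have /andP[? ?] := clip01 (n%:R * rho s); rewrite ger0_norm.
  by move=> l2; exact: (cvg_unique (@norm_hausdorff _ R) l1 l2).
- by move=> _; exact: le_lt_trans (probability_le1 L measurableT) (ltry _).
Unshelve. all: by end_near. Qed.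

End borel_complex.

(** * The recursion map and the lower half-plane *)

Section half_plane.
Variable R : realType.
Local Notation C := R[i].
Implicit Types (z s t : C) (b : R).

(** A 1-Lipschitz retraction onto the closed lower half-plane. Composed with it, the recursion map
    has its denominator bounded below everywhere, and a law carried by the half-plane does not
    notice the change. *)
Definition proj_lower (s : C) : C := complex.Re s +i* Num.min (complex.Im s) 0.

Lemma Im_proj_lower s : complex.Im (proj_lower s) <= 0.
Proof. by rewrite /= ge_min lexx orbT. Qed.

Lemma proj_lower_id s : complex.Im s <= 0 -> proj_lower s = s.
Proof. by case: s => x y /= y0; rewrite /proj_lower /= (min_idPl y0). Qed.

Lemma proj_lower_lip s t : normc (proj_lower s - proj_lower t) <= normc (s - t).
Proof.
case: s t => [x y] [u v]; rewrite /= ler_wsqrtr// lerD2l.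
have h : `|Num.min y 0 - Num.min v 0| <= `|y - v|.
  have := ler_norm (y - v); have := ler_norm (- (y - v)); rewrite normrN.
  by case: (leP y 0) => ?; case: (leP v 0) => ? ? ?; rewrite ler_norml; apply/andP; split; lra.
by rewrite -real_normK ?num_real// -[leRHS]real_normK ?num_real// ler_sqr ?nnegrE.
Qed.

Definition rde_map z b s : C := (z - (b ^+ 2)%:C * proj_lower s)^-1.

Lemma Im_rde_den z b s : complex.Im z <= complex.Im (z - (b ^+ 2)%:C * proj_lower s).
Proof. by apply: Im_cfrac_den; exact: Im_proj_lower. Qed.

Lemma le_normc_Im z (y : R) : y <= complex.Im z -> y <= normc z.
Proof. by move=> h; apply: le_trans h _; apply: le_trans (ler_norm _) (le_Im_normc _). Qed.

Lemma inv_lip z s (y : R) : 0 < y -> y <= complex.Im z -> y <= complex.Im s ->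
  normc (z^-1 - s^-1) <= normc (z - s) / y ^+ 2.
Proof.
move=> y0 yz ys.
have nz := le_normc_Im yz; have ns := le_normc_Im ys.
have z0 : z != 0 by rewrite -normc_gt0 (lt_le_trans y0).
have s0 : s != 0 by rewrite -normc_gt0 (lt_le_trans y0).
have -> : z^-1 - s^-1 = - (z - s) * (z * s)^-1 by field; rewrite ?z0 ?s0.
rewrite normcM normcN normcV normcM ler_wpM2l ?normc_ge0// lef_pV2 ?posrE ?mulr_gt0 ?normc_gt0//.
by rewrite expr2; apply: ler_pM => //; exact: ltW.
Qed.

Variable z : C.
Let y := complex.Im z.
Hypothesis y0 : 0 < y.

Lemma normc_rde_map b s : normc (rde_map z b s) <= y^-1.
Proof.
rewrite normcV; have h := le_normc_Im (Im_rde_den z b s); rewrite -/y in h.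
by rewrite lef_pV2 ?posrE// (lt_le_trans y0).
Qed.

Lemma rde_map_lip b s t : normc (rde_map z b s - rde_map z b t) <= b ^+ 2 / y ^+ 2 * normc (s - t).
Proof.
apply: le_trans (inv_lip y0 (Im_rde_den z b s) (Im_rde_den z b t)) _.
rewrite mulrAC ler_wpM2r ?invr_ge0 ?sqr_ge0//.
have -> : z - (b ^+ 2)%:C * proj_lower s - (z - (b ^+ 2)%:C * proj_lower t) =
  - ((b ^+ 2)%:C * (proj_lower s - proj_lower t)) by ring.
rewrite normcN normcM normc_real ger0_norm ?sqr_ge0// ler_wpM2l ?sqr_ge0//.
exact: proj_lower_lip.
Qed.

Lemma cfrac_rde_map (s : nat -> R) n : cfrac z s n.+1 = rde_map z (s 0%N) (cfrac z (fun k => s k.+1) n).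
Proof. by rewrite /rde_map proj_lower_id//; exact: Im_cfrac. Qed.

Lemma mfunC_proj_lower d (T : measurableType d) (f : T -> C) : mfunC f ->
  mfunC (fun x => proj_lower (f x)).
Proof.
move=> [f1 f2]; split => //=.
by apply: measurable_minr => //; exact: measurable_cst.
Qed.

Lemma mfunC_rde_map d (T : measurableType d) (b : T -> R) (f : T -> C) :
  measurable_fun setT b -> mfunC f -> mfunC (fun x => rde_map z (b x) (f x)).
Proof.
move=> mb mf; apply: mfunCV; apply: mfunCB; first exact: mfunC_cst.
apply: mfunCM; last exact: mfunC_proj_lower.
by apply: mfunC_real; exact: measurable_funX.
Qed.

Lemma mfunC_cfrac d (T : measurableType d) (s : nat -> T -> R) n :
  (forall k, measurable_fun setT (s k)) -> mfunC (fun x => cfrac z (s ^~ x) n).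
Proof.
elim: n s => [|n IH] s ms; first exact: mfunC_cst.
rewrite (_ : (fun x => _) = fun x => rde_map z (s 0%N x) (cfrac z (fun k => s k.+1 x) n)).
  by apply: mfunC_rde_map => //; apply: (IH (fun k => s k.+1)) => k.
by apply/funext => x; rewrite cfrac_rde_map.
Qed.

Lemma normc_cfrac (s : nat -> R) n : normc (cfrac z s n) <= y^-1.
Proof.
by case: n => [|n]; [rewrite normc0 invr_ge0 ltW|rewrite cfrac_rde_map normc_rde_map].
Qed.

End half_plane.

Section rde.
Variables (R : realType) (beta : probability R R) (z : R[i]).
Local Notation C := R[i].
Let y := complex.Im z.
Hypothesis y0 : 0 < y.

Lemma rde_supp (L : probability (borelC R) R) : L [set s | complex.Im s <= 0] = 1%E ->
  L [set s | 0 < complex.Im s] = 0%E.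
Proof.
move=> h.
have mI : measurable ([set s | complex.Im s <= 0] : set (borelC R)).
  rewrite (_ : [set s | _] = setT `&` (fun s : borelC R => complex.Im (s : C)) @^-1` `]-oo, 0]%classic).
    by have [_ mIm] := mfunC_id R; exact: mIm.
  by apply/seteqP; split => s /=; rewrite in_itv /=; [split|case].
have -> : [set s : borelC R | 0 < complex.Im s] = ~` [set s | complex.Im s <= 0].
  by apply/seteqP; split => s /=; rewrite ltNge => /negP.
have := probability_setC L mI; rewrite h.
by move=> ->; rewrite subee.
Qed.

Definition rde_step (p : R * borelC R) : borelC R := rde_map z p.1 p.2.

Lemma measurable_rde_step : measurable_fun setT rde_step.
Proof.
apply: measurable_borelC; apply: mfunC_rde_map; first exact: measurable_fst.
by apply: (mfunC_comp (mfunC_id R)); exact: measurable_snd.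
Qed.

Definition rde_raw (p : R * borelC R) : borelC R := (z - (p.1 ^+ 2)%:C * p.2)^-1.

Lemma measurable_rde_raw : measurable_fun setT rde_raw.
Proof.
apply: measurable_borelC; apply: mfunCV; apply: mfunCB; first exact: mfunC_cst.
apply: mfunCM; last by apply: (mfunC_comp (mfunC_id R)); exact: measurable_snd.
by apply: mfunC_real; apply: measurable_funX; exact: measurable_fst.
Qed.

(** The two maps differ only where the second variable has positive imaginary part, which is a null
    set for [beta \x L]. *)
Lemma rde_raw_step (L : probability (borelC R) R) A : L [set s | complex.Im s <= 0] = 1%E ->
  measurable A ->
  (beta \x L)%E (rde_raw @^-1` A) = (beta \x L)%E (rde_step @^-1` A).
Proof.
move=> /rde_supp hL mA.
pose N : set (R * borelC R) := setT `*` [set s | 0 < complex.Im s].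
have mIm : measurable ([set s | 0 < complex.Im s] : set (borelC R)).
  rewrite (_ : [set s | _] = setT `&` (fun s : borelC R => complex.Im (s : C)) @^-1` `]0, +oo[%classic).
    by have [_ mIm] := mfunC_id R; exact: mIm.
  by apply/seteqP; split => s /=; rewrite in_itv /= andbT; [split|case].
have mN : measurable N by exact: measurableX.
have N0 : (beta \x L)%E N = 0%E.
  apply: (etrans (product_measure1E _ _ measurableT mIm)).
  by apply: (etrans (congr1 (fun u => beta setT * u)%E hL)); exact: mule0.
have m1 : measurable (rde_raw @^-1` A) by rewrite -[X in measurable X]setTI; exact: measurable_rde_raw.
have m2 : measurable (rde_step @^-1` A) by rewrite -[X in measurable X]setTI; exact: measurable_rde_step.
have eN p : ~ N p -> rde_raw p = rde_step p.
  move=> nN; rewrite /rde_raw /rde_step /rde_map proj_lower_id//.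
  by rewrite leNgt; apply/negP => h; apply: nN.
have half (X Y : set (R * borelC R)) : measurable X -> measurable Y ->
    (forall p, X p -> ~ N p -> Y p) -> ((beta \x L)%E X <= (beta \x L)%E Y)%E.
  move=> mX mY h; apply: le_trans (_ : _ <= (beta \x L)%E (Y `|` N))%E _.
    apply: le_measure; rewrite ?inE//; first exact: measurableU.
    by move=> p Xp; have [Np|nN] := pselect (N p); [right|left; exact: h].
  apply: le_trans (measureU2 _ mY mN) _.
  by rewrite [X in (_ + X <= _)%E](_ : _ = 0%E) ?adde0//; exact: N0.
apply/eqP; rewrite eq_le; apply/andP; split; apply: half => // p /= Ap nN.
  by rewrite -eN.
by rewrite eN.
Qed.

Lemma rde_solutionP (L : probability (borelC R) R) :
  rde_solution beta z L <-> L [set s | complex.Im s <= 0] = 1%E /\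
    forall A, measurable A -> L A = law (beta \x L)%E measurable_rde_step A.
Proof.
split => -[h1 h2]; split=> // A mA.
  exact: etrans (h2 A mA) (rde_raw_step h1 mA).
exact: etrans (h2 A mA) (esym (rde_raw_step h1 mA)).
Qed.

Lemma rde_solution_Eb (L : probability (borelC R) R) (f : borelC R -> R) : rde_solution beta z L -> bdm f ->
  \int[L]_s f s = \int[beta]_b \int[L]_s f (rde_step (b, s)).
Proof.
move=> /rde_solutionP[_ h] bf.
rewrite (Eb_measure_eq (nu := law (beta \x L)%E measurable_rde_step))//; last by case: bf.
rewrite Eb_law// Eb_fubini//.
by apply: bdm_comp bf _; exact: measurable_rde_step.
Qed.

Hypothesis hb2 : beta.-integrable setT (EFin \o (fun b : R => b ^+ 2)).
Let m2 := \int[beta]_b (b ^+ 2).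
(** The mean of the random Lipschitz constant [b^2 / y^2]. It is below 1 exactly when [Im z] exceeds
    the root of the second moment. *)
Let kappa := m2 / y ^+ 2.

Lemma Eb_le_sq (g : R -> R) (c : R) : bdm g -> (forall b, g b <= c * b ^+ 2) ->
  \int[beta]_b g b <= c * m2.
Proof.
move=> bg hg; rewrite /m2 -RintegralZl//; apply: le_Rintegral => //.
- exact: bdm_integrable.
- have := @integrableZl _ _ _ beta setT measurableT c _ hb2.
  by apply: eq_integrable.
Qed.

Lemma m2_ge0 : 0 <= m2.
Proof. by apply: Rintegral_ge0 => b _; exact: sqr_ge0. Qed.

Lemma kappa_ge0 : 0 <= kappa.
Proof. by rewrite divr_ge0 ?m2_ge0 ?sqr_ge0. Qed.

Variable B : probability (seqS R) R.
Hypothesis hB : indlaw (fun=> beta) B.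

Lemma coord_Eb i (f : R -> R) : bdm f -> \int[B]_s f (s i) = \int[beta]_b f b.
Proof.
move=> bf; have mc : measurable_fun setT (fun s : seqS R => s i) by exact: measurable_coord.
rewrite -(Eb_law B mc bf); apply: Eb_measure_eq; first by case: bf.
move=> A mA; have := hB [fset i]%fset (A := fun=> A) (fun=> mA).
rewrite big_seq_fset1 => h; apply: (etrans _ h); apply: (etrans (lawE B mc A)).
congr (B _); apply/seteqP; split => s /=.
  by move=> As j; rewrite in_fset1 => /eqP ->.
by apply; rewrite in_fset1.
Qed.

Lemma cons_fubini (h : R * seqS R -> R) : bdm h ->
  \int[B]_s h (s 0%N, sshift 1 s) = \int[beta]_b \int[B]_s h (b, s).
Proof.
move=> bh; pose g i : nat + nat := if i is i'.+1 then inr i' else inl 0%N.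
have ig : injective g by move=> [|i] [|j] // [->].
have mh : measurable_fun setT (fun s : seqS R => (s 0%N, sshift 1 s)).
  by apply: measurable_fun_pair; [exact: measurable_coord|exact: measurable_shift].
have bH := bdm_comp bh mh.
have hl := splice_indlaw ig hB hB.
have hl' : indlaw (fun=> beta) (law (B \x B)%E (measurable_splice g)).
  by apply: eq_indlaw hl => -[].
rewrite (Eb_measure_eq (nu := law (B \x B)%E (measurable_splice g))); first last.
- by move=> A mA; apply/esym; exact: (indlaw_unique hl' hB).
- by case: bH.
rewrite Eb_law// Eb_fubini; last by apply: bdm_comp bH (measurable_splice g).
have bc : bdm (fun b => \int[B]_s h (b, s)) by exact: bdm_inner.
rewrite -(coord_Eb 0 bc); apply: eq_Rintegral => s _; apply: eq_Rintegral => t _.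
congr (h (_, _)); apply/funext => i.
by rewrite /sshift /splice /g addn1.
Qed.

Lemma bdm_cfrac K M (f : C -> R) n : lipC K f -> (forall s, `|f s| <= M) ->
  bdm (fun s : seqS R => f (cfrac z s n)).
Proof.
move=> fl fM; apply: (bdm_comp (bdm_lipC fl fM)); apply: measurable_borelC.
by apply: mfunC_cfrac => // k; exact: measurable_coord.
Qed.

Lemma bdm_rde_cfrac K M (f : C -> R) n : lipC K f -> (forall s, `|f s| <= M) ->
  bdm (fun p : R * seqS R => f (rde_map z p.1 (cfrac z p.2 n))).
Proof.
move=> fl fM.
apply: (bdm_comp (bdm_lipC fl fM)); apply: measurable_borelC; apply: mfunC_rde_map; first exact: measurable_fst.
apply: (@mfunC_cfrac _ _ y0 _ _ (fun k (p : R * seqS R) => p.2 k)) => k.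
by apply: (measurableT_comp (measurable_coord k)); exact: measurable_snd.
Qed.

Lemma cfrac_step_Eb K M (f : C -> R) n : lipC K f -> (forall s, `|f s| <= M) ->
  \int[B]_s f (cfrac z s n.+1) = \int[beta]_b \int[B]_s f (rde_map z b (cfrac z s n)).
Proof.
move=> fl fM.
rewrite -(@cons_fubini (fun p => f (rde_map z p.1 (cfrac z p.2 n)))).
  apply: eq_Rintegral => s _; rewrite cfrac_rde_map//=; congr (f (rde_map _ _ (cfrac _ _ _))).
  by apply/funext => k; rewrite /sshift addn1.
exact: bdm_rde_cfrac fl fM.
Qed.

Lemma lipC_rde_map K (f : C -> R) b : 0 <= K -> lipC K f -> lipC (K * (b ^+ 2 / y ^+ 2)) (fun s => f (rde_map z b s)).
Proof.
move=> K0 fl s t; apply: le_trans (fl _ _) _; rewrite -mulrA; apply: ler_wpM2l => //.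
exact: rde_map_lip.
Qed.

Lemma lipC_ge0 K (f : C -> R) : lipC K f -> 0 <= K.
Proof. by move=> /(_ 1 0); rewrite subr0 normc1 mulr1; exact: le_trans. Qed.

Lemma bdm_rde_step K M (f : C -> R) : lipC K f -> (forall s, `|f s| <= M) ->
  bdm (fun p => (f : borelC R -> R) (rde_step p)).
Proof. by move=> fl fM; apply: (bdm_comp (bdm_lipC fl fM)); exact: measurable_rde_step. Qed.

(** Induction on the depth, the outermost coefficient [b] being split off: the test function becomes
    [f (rde_map z b _)], of Lipschitz constant [K b^2 / y^2], and integration in [b] yields one
    factor [kappa]. This is the contraction in Kantorovich distance, in its dual form. *)
Lemma cfrac_cvg_rate (L : probability (borelC R) R) : rde_solution beta z L ->
  forall n K M (f : C -> R), lipC K f -> (forall s, `|f s| <= M) ->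
  `|\int[B]_s f (cfrac z s n) - \int[L]_s (f : borelC R -> R) s| <= K / y * kappa ^+ n.
Proof.
move=> sL; elim=> [|n IH] K M f fl fM; have K0 := lipC_ge0 fl; have bf := bdm_lipC fl fM;
  rewrite (rde_solution_Eb sL bf).
  rewrite -(Eb_fubini beta L (bdm_rde_step fl fM)).
  rewrite /= EbC -[X in X - _](EbC (beta \x L)%E) -EbB; [|exact: bdm_cst|exact: bdm_rde_step fl fM].
  rewrite expr0 mulr1; apply: Eb_bound; first by apply: bdmB; [exact: bdm_cst|exact: bdm_rde_step fl fM].
  move=> p; apply: le_trans (fl _ _) _; apply: ler_wpM2l => //.
  by rewrite sub0r normcN; exact: normc_rde_map.
rewrite (cfrac_step_Eb n fl fM).
have b1 := bdm_inner beta B (bdm_rde_cfrac n fl fM).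
have b2 := bdm_inner beta L (bdm_rde_step fl fM).
rewrite -EbB//.
have h b : `|\int[B]_s f (rde_map z b (cfrac z s n)) - \int[L]_s (f : borelC R -> R) (rde_step (b, s))| <=
    K * (b ^+ 2 / y ^+ 2) / y * kappa ^+ n.
  exact: (IH _ M _ (lipC_rde_map b K0 fl)).
apply: (@le_trans _ _ (\int[beta]_b `|\int[B]_s f (rde_map z b (cfrac z s n)) -
   \int[L]_s (f : borelC R -> R) (rde_step (b, s))|)).
  by apply: Eb_norm_le; [exact: bdmB|exact/bdm_norm/bdmB|].
apply: le_trans (_ : _ <= (K / y ^+ 2 / y * kappa ^+ n) * m2) _.
  apply: Eb_le_sq; first exact/bdm_norm/bdmB.
  move=> b; apply: le_trans (h b) _; rewrite le_eqVlt; apply/orP; left; apply/eqP; ring.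
rewrite le_eqVlt; apply/orP; left; apply/eqP.
have -> : kappa ^+ n.+1 = m2 / y ^+ 2 * kappa ^+ n by rewrite exprS.
by move: (kappa ^+ n) m2 => u v; field; rewrite gt_eqF.
Qed.

Lemma cfrac_cvg (L : probability (borelC R) R) K M (f : C -> R) : kappa < 1 ->
  rde_solution beta z L -> lipC K f -> (forall s, `|f s| <= M) ->
  \int[B]_s f (cfrac z s n) @[n --> \oo] --> \int[L]_s (f : borelC R -> R) s.
Proof.
move=> k1 sL fl fM.
have lim : K / y * kappa ^+ n @[n --> \oo] --> (K / y * 0 : R).
  by apply: cvgMr; apply: cvg_expr; rewrite ger0_norm ?kappa_ge0.
rewrite mulr0 in lim.
apply/cvgrPdist_le => e e0; have /cvgrPdist_le/(_ _ e0) := lim.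
apply: filterS => n; rewrite sub0r normrN => hn; rewrite distrC.
by apply: le_trans (cfrac_cvg_rate sL n fl fM) _; exact: le_trans (ler_norm _) hn.
Qed.

(** Both laws are the limit of the laws of the same continued fractions. *)
Lemma rde_unique (L L' : probability (borelC R) R) : kappa < 1 ->
  rde_solution beta z L -> rde_solution beta z L' -> forall A, measurable A -> L A = L' A.
Proof.
move=> k1 sL sL'; apply: lipC_unique => K M f fl fM.
exact: (cvg_unique (@norm_hausdorff _ R) (cfrac_cvg k1 sL fl fM) (cfrac_cvg k1 sL' fl fM)).
Qed.

End rde.

Section almost_everywhere.
Context d (T : measurableType d) (R : realType) (mu : probability T R).

Lemma Eb_cvg_ae (f_ : nat -> T -> R) (f : T -> R) (M : R) :
  (forall n, bdm (f_ n)) -> bdm f -> (forall n x, `|f_ n x| <= M) ->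
  {ae mu, forall x, f_ ^~ x @ \oo --> f x} ->
  \int[mu]_x f_ n x @[n --> \oo] --> \int[mu]_x f x.
Proof.
move=> bf_ bf hM hf.
have i (g : T -> R) : bdm g -> (\int[mu]_x (g x)%:E)%E \is a fin_num.
  by move=> bg; apply: integrable_fin_num => //; exact: bdm_integrable.
apply: fine_cvg; rewrite fineK ?i//.
have bM : bdm (fun _ : T => M) by exact: bdm_cst.
have iM := bdm_integrable mu bM.
have h1 n : measurable_fun setT (fun x => (f_ n x)%:E).
  by apply/measurable_EFinP; case: (bf_ n).
have h2 : measurable_fun setT (fun x => (f x)%:E) by apply/measurable_EFinP; case: bf.
have h3 : {ae mu, forall x, setT x -> (fun n => (f_ n x)%:E) @ \oo --> (f x)%:E}.
  by apply: filterS hf => x hx _; apply: cvg_EFin; [exact: nearW|exact: hx].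
have h4 : {ae mu, forall x n, setT x -> (`|(f_ n x)%:E| <= M%:E)%E}.
  by apply: aeW => x n _ /=; rewrite lee_fin.
by have [_ _] := dominated_convergence measurableT h1 h2 h3 iM h4.
Qed.

Lemma Rintegral_eq_null (f g : T -> R) (N : set T) : measurable N -> mu N = 0%E ->
  measurable_fun setT f -> measurable_fun setT g -> (forall x, ~ N x -> f x = g x) ->
  \int[mu]_x f x = \int[mu]_x g x.
Proof.
move=> mN N0 mf mg fg; rewrite /Rintegral; congr fine.
apply: ae_eq_integral => //; try exact/measurable_EFinP.
by exists N; split => // x /= h; apply: contrapT => nN; apply: h => _; rewrite (fg _ nN).
Qed.

End almost_everywhere.

(** * Existence of a solution of the recursive equation *)

Section existence.
Variables (R : realType) (beta : probability R R) (z : R[i]).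
Local Notation C := R[i].
Let y := complex.Im z.
Hypothesis y0 : 0 < y.
Hypothesis hb2 : beta.-integrable setT (EFin \o (fun b : R => b ^+ 2)).
Let m2 := \int[beta]_b (b ^+ 2).
Let kappa := m2 / y ^+ 2.
Hypothesis kappa1 : kappa < 1.
Variable B : probability (seqS R) R.
Hypothesis hB : indlaw (fun=> beta) B.

Lemma normc_lip : lipC 1 (@normc R).
Proof.
move=> s t; rewrite mul1r ler_norml; have := le_normcD (s - t) t; have := le_normcD (t - s) s.
by rewrite !subrK [normc (t - s)]normc_sub => ? ?; apply/andP; split; lra.
Qed.

Lemma bdm_normc d (T : measurableType d) (f : T -> C) : bdmC f -> bdm (fun x => normc (f x)).
Proof.
move=> [mf [M hM]]; split; last by exists M => x; rewrite ger0_norm ?normc_ge0.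
apply: (measurableT_comp (f := fun s : borelC R => normc (s : C))).
  exact: measurable_lipC normc_lip.
exact: measurable_borelC.
Qed.

Let bdmC_cf n : bdmC (fun s : seqS R => cfrac z s n).
Proof.
split; last by exists y^-1 => s; exact: normc_cfrac.
by apply: mfunC_cfrac => // k; exact: measurable_coord.
Qed.

Definition cfrac_incr n (s : seqS R) : R := normc (cfrac z s n.+1 - cfrac z s n).

Lemma bdm_cfrac_incr n : bdm (cfrac_incr n).
Proof. by apply: bdm_normc; apply: bdmCB. Qed.

Lemma E_cfrac_incr n : \int[B]_s cfrac_incr n s <= y^-1 * kappa ^+ n.
Proof.
elim: n => [|n IH].
  rewrite expr0 mulr1 -[leRHS](EbC B); apply: Eb_le; [exact: bdm_cfrac_incr|exact: bdm_cst|].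
  by move=> s; rewrite /cfrac_incr /= subr0; exact: (normc_cfrac y0 s 1).
pose h (p : R * seqS R) := normc (rde_map z p.1 (cfrac z p.2 n.+1) - rde_map z p.1 (cfrac z p.2 n)).
have bh : bdm h.
  have hk k : bdmC (fun p : R * seqS R => rde_map z p.1 (cfrac z p.2 k)).
    split; last by exists y^-1 => p; exact: normc_rde_map.
    apply: mfunC_rde_map; first exact: measurable_fst.
    apply: (@mfunC_cfrac _ _ y0 _ _ (fun k (p : R * seqS R) => p.2 k)) => j.
    by apply: (measurableT_comp (measurable_coord j)); exact: measurable_snd.
  by apply: bdm_normc; apply: bdmCB.
have -> : \int[B]_s cfrac_incr n.+1 s = \int[beta]_b \int[B]_s h (b, s).
  rewrite -(cons_fubini hB bh); apply: eq_Rintegral => s _.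
  rewrite /cfrac_incr (cfrac_rde_map y0 s n.+1) (cfrac_rde_map y0 s n) /h.
  by have -> : (fun k : nat => s k.+1) = sshift 1 s by apply/funext => k; rewrite /sshift addn1.
have bb := bdm_inner beta B bh.
apply: le_trans (_ : _ <= (y^-1 * kappa ^+ n / y ^+ 2) * m2) _; last first.
  rewrite le_eqVlt; apply/orP; left; apply/eqP.
  have -> : kappa ^+ n.+1 = m2 / y ^+ 2 * kappa ^+ n by rewrite exprS.
  by move: (kappa ^+ n) m2 => u v; field; rewrite gt_eqF.
apply: Eb_le_sq => // b.
have bi := bdm_cfrac_incr n.
apply: (@le_trans _ _ (\int[B]_s (b ^+ 2 / y ^+ 2 * cfrac_incr n s))).
  apply: Eb_le; [exact: (bdm_slice b bh)|by apply: bdmM => //; exact: bdm_cst|].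
  by move=> s; exact: rde_map_lip.
rewrite EbZ//; apply: le_trans (ler_wpM2l _ IH) _.
  by rewrite divr_ge0 ?sqr_ge0.
by rewrite le_eqVlt; apply/orP; left; apply/eqP; ring.
Qed.

Let kappa0 : 0 <= kappa.
Proof. exact: kappa_ge0. Qed.

Lemma geometric_sum_le (x : R) n : 0 <= x -> x < 1 -> \sum_(i < n) x ^+ i <= (1 - x)^-1.
Proof.
move=> x0 x1; have p : 0 < 1 - x by rewrite subr_gt0.
rewrite -[leRHS]mul1r ler_pdivlMr//.
have := subrX1 x n; have := exprn_ge0 n x0.
move: (\sum_(i < n) x ^+ i) (x ^+ n) => S u; nra.
Qed.

(** By [E_cfrac_incr] the expectations of the increments form a geometric series, so the sum has
    finite mean and is finite almost everywhere. *)
Lemma cfrac_incr_summable : {ae B, forall s, exists M : R, forall n, \sum_(0 <= k < n) cfrac_incr k s <= M}.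
Proof.
have d0 n s : 0 <= cfrac_incr n s := normc_ge0 _.
have mD n : measurable_fun setT (fun s => (cfrac_incr n s)%:E).
  by apply/measurable_EFinP; case: (bdm_cfrac_incr n).
have ED n : (\int[B]_s (cfrac_incr n s)%:E = (\int[B]_s cfrac_incr n s)%:E)%E.
  rewrite /Rintegral fineK//; apply: integrable_fin_num => //.
  by exact: (bdm_integrable B (bdm_cfrac_incr n)).
pose F s : \bar R := (\sum_(k <oo) (cfrac_incr k s)%:E)%E.
have F0 s : (0 <= F s)%E by apply: nneseries_ge0 => k _ _; rewrite lee_fin.
have iF : B.-integrable setT F.
  apply/integrableP; split.
    by apply: ge0_emeasurable_sum => k *; [rewrite lee_fin|exact: mD].
  rewrite (eq_integral (fun s => F s)); last by move=> s _; rewrite gee0_abs.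
  rewrite integral_nneseries//; last by move=> n s _; rewrite lee_fin.
  apply: (@le_lt_trans _ _ (y^-1 * (1 - kappa)^-1)%:E); last exact: ltry.
  apply: lime_le; first by apply: is_cvg_nneseries => n _ _; rewrite ED lee_fin; exact: Rintegral_ge0.
  apply: nearW => n; rewrite (eq_bigr (fun k => (\int[B]_s cfrac_incr k s)%:E))//.
  rewrite sumEFin lee_fin; apply: le_trans (_ : _ <= \sum_(0 <= k < n) y^-1 * kappa ^+ k) _.
    by apply: ler_sum => k _; exact: E_cfrac_incr.
  rewrite -mulr_sumr big_mkord ler_wpM2l ?invr_ge0 ?(ltW y0)//.
  exact: geometric_sum_le.
have := integrable_ae measurableT iF; apply: filterS => s /(_ I) hs.
exists (fine (F s)) => n; rewrite -lee_fin fineK// -sumEFin.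
by apply: nneseries_lim_ge => k _ _; rewrite lee_fin.
Qed.

Lemma cvg_of_incr (u : nat -> R) (v : nat -> R) (M : R) : (forall n, `|u n.+1 - u n| <= v n) ->
  (forall n, \sum_(0 <= k < n) v k <= M) -> cvgn u.
Proof.
move=> uv vM.
have v0 n : 0 <= v n by apply: le_trans (uv n).
have c : cvgn (series (telescope u)).
  apply: normed_cvg; apply: (@series_le_cvg _ _ v) => //=.
  apply: nondecreasing_is_cvgn; first by apply: nondecreasing_series => n _ _; exact: v0.
  by exists M => _ [n _ <-]; exact: vM.
have -> : u = fun n => u 0%N + series (telescope u) n by apply/funext => n; exact: eq_sum_telescope.
by apply: is_cvgD => //; exact: is_cvg_cst.
Qed.

(** Upper limits make the function measurable without restricting to the set of convergence, and the
    projection puts its values in the half-plane everywhere. *)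
Definition cfrac_lim (s : seqS R) : borelC R :=
  proj_lower (limn_sup (fun n => complex.Re (cfrac z s n)) +i*
              limn_sup (fun n => complex.Im (cfrac z s n))).

Lemma measurable_cfrac_lim : measurable_fun setT cfrac_lim.
Proof.
have ub s (g : C -> R) : (forall w, `|g w| <= normc w) ->
    has_ubound (range (fun n => g (cfrac z s n))) /\ has_lbound (range (fun n => g (cfrac z s n))).
  move=> hg; split; [exists y^-1|exists (- y^-1)] => _ [n _ <-].
    by apply: le_trans (ler_norm _) _; apply: le_trans (hg _) _; exact: normc_cfrac.
  rewrite lerNl; apply: le_trans (ler_norm _) _; rewrite normrN.
  by apply: le_trans (hg _) _; exact: normc_cfrac.
apply: measurable_borelC; apply: mfunC_proj_lower; split => /=.
  apply: (@measurable_fun_limn_sup _ _ _ setT (fun n (s : seqS R) => complex.Re (cfrac z s n))).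
  - by move=> s _; exact: (ub s _ (@le_Re_normc R)).1.
  - by move=> s _; exact: (ub s _ (@le_Re_normc R)).2.
  - by move=> n; exact: (bdmC_re (bdmC_cf n)).1.
apply: (@measurable_fun_limn_sup _ _ _ setT (fun n (s : seqS R) => complex.Im (cfrac z s n))).
- by move=> s _; exact: (ub s _ (@le_Im_normc R)).1.
- by move=> s _; exact: (ub s _ (@le_Im_normc R)).2.
- by move=> n; exact: (bdmC_im (bdmC_cf n)).1.
Qed.

Lemma cfrac_lim_cvg K M (f : C -> R) : lipC K f -> (forall s, `|f s| <= M) ->
  \int[B]_s f (cfrac z s n) @[n --> \oo] --> \int[B]_s f (cfrac_lim s).
Proof.
move=> fl fM; have K0 := lipC_ge0 fl; have bf := bdm_lipC fl fM.
apply: (@Eb_cvg_ae _ _ _ _ _ _ M) => //.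
- by move=> n; exact: bdm_cfrac fl fM.
- exact: (bdm_comp bf measurable_cfrac_lim).
apply: filterS cfrac_incr_summable => s [S hS].
have h (g : C -> R) : (forall w, `|g w| <= normc w) -> (forall w w', g (w - w') = g w - g w') ->
    (fun n => g (cfrac z s n)) @ \oo --> limn_sup (fun n => g (cfrac z s n)).
  move=> gn gB.
  have c : cvgn (fun n => g (cfrac z s n)).
    by apply: (@cvg_of_incr _ (cfrac_incr ^~ s) S) => // n; rewrite -gB.
  by rewrite (cvg_limn_supE c).
have hre := h _ (@le_Re_normc R) (fun w w' => raddfB _ w w').
have him := h _ (@le_Im_normc R) (fun w w' => raddfB _ w w').
have Im0 : limn_sup (fun n => complex.Im (cfrac z s n)) <= 0.
  by apply: (cvgr_to_le him); apply: nearW => n; exact: Im_cfrac.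
have eS : cfrac_lim s = limn_sup (fun n => complex.Re (cfrac z s n)) +i*
    limn_sup (fun n => complex.Im (cfrac z s n)) by rewrite /cfrac_lim proj_lower_id.
apply/cvgrPdist_le => e e0.
have e1 : 0 < e / (2 * (K + 1)) by rewrite divr_gt0// mulr_gt0// ltr_wpDl.
have /cvgrPdist_le/(_ _ e1) n1 := hre; have /cvgrPdist_le/(_ _ e1) n2 := him.
near=> n.
have b1 : `|limn_sup (fun n => complex.Re (cfrac z s n)) - complex.Re (cfrac z s n)| <= e / (2 * (K + 1)) by near: n.
have b2 : `|limn_sup (fun n => complex.Im (cfrac z s n)) - complex.Im (cfrac z s n)| <= e / (2 * (K + 1)) by near: n.
apply: le_trans (fl _ _) _; apply: le_trans (ler_wpM2l K0 (normc_le_ReIm _)) _.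
rewrite eS !raddfB /=; apply: le_trans (ler_wpM2l K0 (lerD b1 b2)) _.
have -> : e = (K + 1) * (e / (2 * (K + 1)) + e / (2 * (K + 1))).
  by field; rewrite gt_eqF// ltr_wpDl.
rewrite [X in K * (X / _ + X / _)](_ : _ = e); last by field; rewrite gt_eqF// ltr_wpDl.
by rewrite ler_wpM2r ?addr_ge0 ?(ltW e1)// lerDl.
Unshelve. all: by end_near. Qed.

(** The solution is the law of the almost sure limit of the continued fractions. The one-step
    identity [cfrac_step_Eb], tested on bounded Lipschitz functions, passes to the limit. *)
Lemma rde_exists : exists L, rde_solution beta z L.
Proof.
pose L := law B measurable_cfrac_lim.
exists L; apply/rde_solutionP => //; split.
  rewrite /L; apply: (etrans (lawE B measurable_cfrac_lim _)).
  rewrite (_ : _ @^-1` _ = setT); first exact: probability_setT.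
  by apply/seteqP; split => // s _; exact: Im_proj_lower.
move=> A mA; apply: (lipC_unique (L' := law (beta \x L)%E (measurable_rde_step z))) => // K M f fl fM.
have bf := bdm_lipC fl fM; have K0 := lipC_ge0 fl.
rewrite [RHS]Eb_law// Eb_fubini; last exact: bdm_rde_step fl fM.
have l1 : \int[B]_s f (cfrac z s n.+1) @[n --> \oo] --> \int[L]_s (f : borelC R -> R) s.
  by rewrite Eb_law// (cvg_shiftS (fun n => \int[B]_s f (cfrac z s n))); exact: cfrac_lim_cvg fl fM.
have l2 : \int[B]_s f (cfrac z s n.+1) @[n --> \oo] -->
   \int[beta]_b \int[L]_s (f : borelC R -> R) (rde_step z (b, s)).
  rewrite (_ : (fun n => _) = fun n => \int[beta]_b \int[B]_s f (rde_map z b (cfrac z s n))); last first.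
    by apply/funext => n; exact: cfrac_step_Eb fl fM.
  apply: (@Eb_cvg _ _ _ _ _ _ M).
  - by move=> n; exact: (bdm_inner beta B (bdm_rde_cfrac y0 n fl fM)).
  - exact: (bdm_inner beta L (bdm_rde_step z fl fM)).
  - by move=> n b; apply: Eb_bound => //; exact: (bdm_slice b (bdm_rde_cfrac y0 n fl fM)).
  - move=> b; rewrite Eb_law; last exact: (bdm_slice b (bdm_rde_step z fl fM)).
    by apply: (cfrac_lim_cvg (lipC_rde_map y0 b K0 fl)).
exact: (cvg_unique (@norm_hausdorff _ R) l1 l2).
Qed.

End existence.

Section complex_fubini.
Context d1 d2 (T1 : measurableType d1) (T2 : measurableType d2) (R : realType).
Variables (m1 : probability T1 R) (m2 : probability T2 R).

Lemma Eb_fubini_swap (f : T1 * T2 -> R) : bdm f ->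
  \int[m1]_x \int[m2]_y f (x, y) = \int[m2]_y \int[m1]_x f (x, y).
Proof.
move=> bf; rewrite -Eb_fubini// /Rintegral; congr fine.
rewrite -(integral21_prod_meas1 (bdm_integrable (m1 \x m2)%E bf)).
have bs y : bdm (fun x => f (x, y)).
  case: (bf) => mf [M hM]; split; last by exists M.
  by apply: measurableT_comp => //; exact: measurable_pair2.
apply: eq_integral => y _; rewrite /fubini_G fineK//.
by apply: integrable_fin_num => //; exact: (bdm_integrable m1 (bs y)).
Qed.

Lemma CEb_fubini_swap (f : T1 * T2 -> R[i]) : bdmC f ->
  Cintegral m1 (fun x => Cintegral m2 (fun y => f (x, y))) =
  Cintegral m2 (fun y => Cintegral m1 (fun x => f (x, y))).
Proof.
by move=> bf; congr (_ +i* _);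
  [exact: (Eb_fubini_swap (bdmC_re bf))|exact: (Eb_fubini_swap (bdmC_im bf))].
Qed.

Lemma bdmC_slice (f : T1 * T2 -> R[i]) x : bdmC f -> bdmC (fun y => f (x, y)).
Proof.
move=> bf; have [_ [M hM]] := bf; split; last by exists M.
by split; [exact: (bdm_slice x (bdmC_re bf)).1|exact: (bdm_slice x (bdmC_im bf)).1].
Qed.

Lemma bdmC_inner (f : T1 * T2 -> R[i]) : bdmC f -> bdmC (fun x => Cintegral m2 (fun y => f (x, y))).
Proof.
move=> bf; split.
  by split; [exact: (bdm_inner m1 m2 (bdmC_re bf)).1|exact: (bdm_inner m1 m2 (bdmC_im bf)).1].
have [_ [M hM]] := bf; exists M => x; apply: CEb_bound => //; exact: bdmC_slice.
Qed.

End complex_fubini.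

Lemma eq_Cintegral d (T : measurableType d) (R : realType) (mu : {measure set T -> \bar R})
  (f g : T -> R[i]) : (forall x, f x = g x) -> Cintegral mu f = Cintegral mu g.
Proof. by move=> fg; congr Cintegral; apply/funext. Qed.

Lemma CEb_sum d (T : measurableType d) (R : realType) (mu : probability T R) n (F : nat -> T -> R[i]) :
  (forall i, bdmC (F i)) -> bdmC (fun s => \sum_(i < n) F i s) /\
  Cintegral mu (fun s => \sum_(i < n) F i s) = \sum_(i < n) Cintegral mu (F i).
Proof.
move=> bF; elim: n => [|n [IH1 IH2]].
  have e : (fun s => \sum_(i < 0) F i s) = fun=> 0 by apply/funext => s; rewrite big_ord0.
  by rewrite e big_ord0; split; [exact: bdmC_cst|exact: CEbC].
have e : (fun s => \sum_(i < n.+1) F i s) = fun s => \sum_(i < n) F i s + F n s.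
  by apply/funext => s; rewrite big_ord_recr.
by rewrite e big_ord_recr /= -IH2; split; [exact: bdmCD|exact: CEbD].
Qed.

(** * The Stieltjes transform of the limit measure *)

Section stieltjes_limit.
Variables (R : realType) (beta : probability R R) (z : R[i]).
Local Notation C := R[i].
Let y := complex.Im z.
Hypothesis y0 : 0 < y.
Hypothesis hb2 : beta.-integrable setT (EFin \o (fun b : R => b ^+ 2)).
Let m2 := \int[beta]_b (b ^+ 2).
Let kappa := m2 / y ^+ 2.
Hypothesis kappa1 : kappa < 1.
Variable B : probability (seqS R) R.
Hypothesis hB : indlaw (fun=> beta) B.
Variable L : probability (borelC R) R.
Hypothesis sL : rde_solution beta z L.

(** Averaging over the coefficient next to the fraction gains one more factor [kappa]; the factor 2
    comes from treating real and imaginary parts separately. *)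
Lemma avg_rate (H : R -> C -> C) (M : R) n :
  (forall b s t, normc (H b s - H b t) <= b ^+ 2 / y ^+ 2 * normc (s - t)) ->
  (forall b s, normc (H b s) <= M) -> mfunC (fun p : R * borelC R => H p.1 p.2) ->
  normc (Cintegral B (fun s => H (s 0%N) (cfrac z (sshift 1 s) n)) -
         Cintegral (beta \x L)%E (fun p => H p.1 p.2)) <= 2 * (y^-1 * kappa ^+ n.+1).
Proof.
move=> Hl HM mH.
have part (g : C -> R) : (forall w, `|g w| <= normc w) -> (forall w w', g (w - w') = g w - g w') ->
    measurable_fun setT (fun p : R * borelC R => g (H p.1 p.2)) ->
    `|\int[B]_s g (H (s 0%N) (cfrac z (sshift 1 s) n)) - \int[(beta \x L)%E]_p g (H p.1 p.2)|
    <= y^-1 * kappa ^+ n.+1.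
  move=> gn gB mg.
  have bg : bdm (fun p : R * borelC R => g (H p.1 p.2)).
    by split => //; exists M => p; apply: le_trans (gn _) (HM _ _).
  have mcf : measurable_fun setT (fun p : R * seqS R => (p.1, cfrac z p.2 n) : R * borelC R).
    apply: measurable_fun_pair; first exact: measurable_fst.
    apply: measurable_borelC; apply: (@mfunC_cfrac _ _ y0 _ _ (fun k (p : R * seqS R) => p.2 k)) => j.
    by apply: (measurableT_comp (measurable_coord j)); exact: measurable_snd.
  have bh : bdm (fun p : R * seqS R => g (H p.1 (cfrac z p.2 n))) by exact: (bdm_comp bg mcf).
  rewrite (cons_fubini hB bh) (Eb_fubini beta L bg) /=.
  have b1 := bdm_inner beta B bh; have b2 := bdm_inner beta L bg.
  rewrite -EbB//; apply: le_trans (Eb_norm_le _ (bdmB b1 b2) (bdm_norm (bdmB b1 b2)) (fun _ => lexx _)) _.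
  apply: le_trans (_ : _ <= (y ^- 2 / y * kappa ^+ n) * m2) _; last first.
    rewrite le_eqVlt; apply/orP; left; apply/eqP.
    have -> : kappa ^+ n.+1 = m2 / y ^+ 2 * kappa ^+ n by rewrite exprS.
    by move: (kappa ^+ n) m2 => u v; field; rewrite gt_eqF.
  apply: Eb_le_sq => //; first exact/bdm_norm/bdmB.
  move=> b /=; have := @cfrac_cvg_rate _ _ _ y0 hb2 _ hB _ sL n (b ^+ 2 / y ^+ 2) M (fun s => g (H b s)).
  move=> h; apply: le_trans (h _ _) _.
  - by move=> s t; rewrite -gB; exact: le_trans (gn _) (Hl _ _ _).
  - by move=> s; exact: le_trans (gn _) (HM _ _).
  - by rewrite le_eqVlt; apply/orP; left; apply/eqP; rewrite -/m2 -/kappa; ring.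
apply: le_trans (normc_le_ReIm _) _; rewrite !raddfB /= mulr2n mulrDl mul1r; apply: lerD.
  apply: part; [exact: le_Re_normc|by move=> *; rewrite raddfB|by case: mH].
by apply: part; [exact: le_Im_normc|by move=> *; rewrite raddfB|by case: mH].
Qed.

(** The shape of a diagonal entry of the resolvent: [t1], [t2] are the adjacent off-diagonal entries
    and [s1], [s2] the continued fractions on either side. *)
Definition two_sided (t1 t2 : R) (s1 s2 : C) : C :=
  (z - (t1 ^+ 2)%:C * proj_lower s1 - (t2 ^+ 2)%:C * proj_lower s2)^-1.

Lemma Im_two_sided_den t1 t2 s1 s2 :
  y <= complex.Im (z - (t1 ^+ 2)%:C * proj_lower s1 - (t2 ^+ 2)%:C * proj_lower s2).
Proof.
apply: le_trans (Im_cfrac_den _ t1 (Im_proj_lower s1)) _.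
exact: Im_cfrac_den (Im_proj_lower s2).
Qed.

Lemma two_sided_sym t1 t2 s1 s2 : two_sided t1 t2 s1 s2 = two_sided t2 t1 s2 s1.
Proof. by rewrite /two_sided addrAC. Qed.

Lemma normc_two_sided t1 t2 s1 s2 : normc (two_sided t1 t2 s1 s2) <= y^-1.
Proof.
rewrite normcV; have h := le_normc_Im (Im_two_sided_den t1 t2 s1 s2).
by rewrite lef_pV2 ?posrE// (lt_le_trans y0).
Qed.

Lemma two_sided_lip t1 t2 s1 s1' s2 :
  normc (two_sided t1 t2 s1 s2 - two_sided t1 t2 s1' s2) <= t1 ^+ 2 / y ^+ 2 * normc (s1 - s1').
Proof.
apply: le_trans (inv_lip y0 (Im_two_sided_den _ _ _ _) (Im_two_sided_den _ _ _ _)) _.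
rewrite mulrAC ler_wpM2r ?invr_ge0 ?sqr_ge0//.
rewrite (_ : _ - _ = - ((t1 ^+ 2)%:C * (proj_lower s1 - proj_lower s1'))); last by ring.
rewrite normcN normcM normc_real ger0_norm ?sqr_ge0// ler_wpM2l ?sqr_ge0//.
exact: proj_lower_lip.
Qed.

Lemma bdmC_two_sided d (T : measurableType d) (t1 t2 : T -> R) (s1 s2 : T -> C) :
  measurable_fun setT t1 -> measurable_fun setT t2 -> mfunC s1 -> mfunC s2 ->
  bdmC (fun x => two_sided (t1 x) (t2 x) (s1 x) (s2 x)).
Proof.
move=> mt1 mt2 ms1 ms2; apply: (bdmCV _ y0) => [|x]; last exact: Im_two_sided_den.
have h (t : T -> R) (s : T -> C) : measurable_fun setT t -> mfunC s -> mfunC (fun x => (t x ^+ 2)%:C * proj_lower (s x)).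
  move=> mt ms; apply: mfunCM; last exact: mfunC_proj_lower.
  by apply: mfunC_real; exact: measurable_funX.
by apply: mfunCB; [apply: mfunCB; [exact: mfunC_cst|exact: h]|exact: h].
Qed.

Let q1 : borelC R * borelC R -> C := fun q => q.1.
Let q2 : borelC R * borelC R -> C := fun q => q.2.

Let mq1 : mfunC q1.
Proof. by apply: (mfunC_comp (mfunC_id R)); exact: measurable_fst. Qed.

Let mq2 : mfunC q2.
Proof. by apply: (mfunC_comp (mfunC_id R)); exact: measurable_snd. Qed.

Let r2 : R * borelC R -> C := fun r => r.2.

Let mr2 : mfunC r2.
Proof. by apply: (mfunC_comp (mfunC_id R)); exact: measurable_snd. Qed.

Let T4 := ((R * R) * (borelC R * borelC R))%type.

Let b4 : bdmC (fun p : T4 => two_sided p.1.1 p.1.2 p.2.1 p.2.2).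
Proof.
apply: bdmC_two_sided.
- by apply: (measurableT_comp (f := fst)); [exact: measurable_fst|exact: measurable_fst].
- by apply: (measurableT_comp (f := snd)); [exact: measurable_snd|exact: measurable_fst].
- by apply: (mfunC_comp mq1); exact: measurable_snd.
- by apply: (mfunC_comp mq2); exact: measurable_snd.
Qed.

Lemma rde_expectation_proj : rde_expectation beta z L =
  Cintegral (iid2 beta \x iid2 L)%E (fun p : T4 => two_sided p.1.1 p.1.2 p.2.1 p.2.2).
Proof.
have hL := rde_supp sL.1.
pose I : set (borelC R) := [set s | 0 < complex.Im s].
have mI : measurable I.
  rewrite (_ : I = setT `&` (fun s : borelC R => complex.Im (s : C)) @^-1` `]0, +oo[%classic).
    by have [_ mIm] := mfunC_id R; exact: mIm.
  by apply/seteqP; split => s /=; rewrite in_itv /= andbT; [split|case].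
pose N2 : set (borelC R * borelC R) := (I `*` setT) `|` (setT `*` I).
have mN2 : measurable N2 by apply: measurableU; exact: measurableX.
have N20 : iid2 L N2 = 0%E.
  apply/eqP; rewrite eq_le measure_ge0 andbT.
  apply: le_trans (measureU2 _ (measurableX mI measurableT) (measurableX measurableT mI)) _.
  rewrite [X in (X + _ <= _)%E](_ : _ = 0%E); last first.
    apply: (etrans (product_measure1E L L mI measurableT)).
    by apply: (etrans (congr1 (fun u => u * L setT)%E hL)); exact: mul0e.
  rewrite [X in (_ + X <= _)%E](_ : _ = 0%E) ?adde0//.
  apply: (etrans (product_measure1E L L measurableT mI)).
  by apply: (etrans (congr1 (fun u => L setT * u)%E hL)); exact: mule0.
pose N : set T4 := setT `*` N2.
have mN : measurable N by exact: measurableX.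
have N0 : (iid2 beta \x iid2 L)%E N = 0%E.
  apply: (etrans (product_measure1E _ _ measurableT mN2)).
  by apply: (etrans (congr1 (fun u => iid2 beta setT * u)%E N20)); exact: mule0.
have mraw : mfunC (fun p : T4 => (z - (p.1.1 ^+ 2)%:C * (p.2.1 : C) - (p.1.2 ^+ 2)%:C * (p.2.2 : C))^-1).
  apply: mfunCV; apply: mfunCB; [apply: mfunCB; first exact: mfunC_cst|]; apply: mfunCM.
  - apply: mfunC_real; apply: measurable_funX.
    by apply: (measurableT_comp (f := fst)); [exact: measurable_fst|exact: measurable_fst].
  - by apply: (mfunC_comp mq1); exact: measurable_snd.
  - apply: mfunC_real; apply: measurable_funX.
    by apply: (measurableT_comp (f := snd)); [exact: measurable_snd|exact: measurable_fst].
  - by apply: (mfunC_comp mq2); exact: measurable_snd.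
have eN (p : T4) : ~ N p -> (z - (p.1.1 ^+ 2)%:C * (p.2.1 : C) - (p.1.2 ^+ 2)%:C * (p.2.2 : C))^-1 =
    two_sided p.1.1 p.1.2 p.2.1 p.2.2.
  move=> nN; rewrite /two_sided !proj_lower_id//; rewrite leNgt; apply/negP => h; apply: nN; split => //.
    by right.
  by left.
have [[m1 _] [mi _]] := (bdmC_re b4, bdmC_im b4).
congr (_ +i* _).
  by apply: (Rintegral_eq_null mN N0 mraw.1 m1) => p /eN ->.
by apply: (Rintegral_eq_null mN N0 mraw.2 mi) => p /eN ->.
Qed.

Lemma bdmC_two_sided_pair : bdmC (fun p : (R * borelC R) * (R * borelC R) => two_sided p.2.1 p.1.1 p.2.2 p.1.2).
Proof.
apply: bdmC_two_sided.
- by apply: (measurableT_comp (f := fst)); [exact: measurable_fst|exact: measurable_snd].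
- by apply: (measurableT_comp (f := fst)); [exact: measurable_fst|exact: measurable_fst].
- by apply: (mfunC_comp mr2); exact: measurable_snd.
- by apply: (mfunC_comp mr2); exact: measurable_fst.
Qed.

(** One side already averaged over the limit law; it is the intermediate term when the two sides are
    replaced in turn. *)
Definition one_side (t2 : R) (s2 : C) : C := Cintegral (beta \x L)%E (fun p => two_sided p.1 t2 p.2 s2).

(** The four independent variables are regrouped into two independent pairs, one for each side. *)
Lemma rde_expectation_iter : rde_expectation beta z L =
  Cintegral (beta \x L)%E (fun r => one_side r.1 r.2).
Proof.
have bp := bdmC_two_sided_pair.
rewrite rde_expectation_proj (CEb_fubini _ _ b4).
rewrite [LHS](CEb_fubini beta beta (bdmC_inner (iid2 beta) (iid2 L) b4)).
rewrite [RHS](CEb_fubini beta L (bdmC_inner (beta \x L)%E (beta \x L)%E bp)).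
apply: eq_Cintegral => t2.
have bL (t1 : R) : bdmC (fun q : borelC R * borelC R => two_sided t2 t1 q.1 q.2).
  by apply: bdmC_two_sided.
have bR (s2 : borelC R) : bdmC (fun p : R * borelC R => two_sided p.1 t2 p.2 s2).
  exact: (bdmC_slice (t2, s2) bp).
have b3 : bdmC (fun p : (R * borelC R) * borelC R => two_sided t2 p.1.1 p.1.2 p.2).
  apply: bdmC_two_sided => //.
  - by apply: (measurableT_comp (f := fst)); [exact: measurable_fst|exact: measurable_fst].
  - by apply: (mfunC_comp mr2); exact: measurable_fst.
  - by apply: (mfunC_comp (mfunC_id R)); exact: measurable_snd.
transitivity (Cintegral beta (fun t1 => Cintegral L (fun s2 => Cintegral L (fun s1 => two_sided t2 t1 s2 s1)))).
  by apply: eq_Cintegral => t1; exact: (CEb_fubini L L (bL t1)).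
rewrite (CEb_fubini_swap beta L (bdmC_inner (beta \x L)%E L b3)).
apply: eq_Cintegral => s2; have E := CEb_fubini beta L (bR s2); apply: (etrans _ (esym E)).
by apply: eq_Cintegral => t1; apply: eq_Cintegral => s1; exact: two_sided_sym.
Qed.

Lemma eq_cfrac (s s' : nat -> R) n : (forall j, (j < n)%N -> s j = s' j) -> cfrac z s n = cfrac z s' n.
Proof.
elim: n s s' => //= n IH s s' h; rewrite h//; congr (_ - _ * _)^-1.
by apply: IH => j jn; exact: h.
Qed.

Definition diag_resolvent (N k : nat) (c : seqS R) : C :=
  (z - ((c k.-1) ^+ 2)%:C * cfrac z (fun j => c (k.-1 - j.+1)%N) k.-1
     - ((c k) ^+ 2)%:C * cfrac z (fun j => c (k + j.+1)%N) (N - k))^-1.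

Lemma diag_resolventE N k c : diag_resolvent N k c =
  two_sided (c k.-1) (c k) (cfrac z (fun j => c (k.-1 - j.+1)%N) k.-1) (cfrac z (fun j => c (k + j.+1)%N) (N - k)).
Proof. by rewrite /two_sided !proj_lower_id//; exact: Im_cfrac. Qed.

Lemma bdmC_diag_resolvent N k : bdmC (diag_resolvent N k).
Proof.
rewrite (_ : diag_resolvent N k = fun c => two_sided (c k.-1) (c k)
  (cfrac z (fun j => c (k.-1 - j.+1)%N) k.-1) (cfrac z (fun j => c (k + j.+1)%N) (N - k))); last first.
  by apply/funext => c; exact: diag_resolventE.
apply: bdmC_two_sided; [exact: measurable_coord|exact: measurable_coord| |].
  by apply: (@mfunC_cfrac _ _ y0 _ _ (fun j (c : seqS R) => c (k.-1 - j.+1)%N)) => j; exact: measurable_coord.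
by apply: (@mfunC_cfrac _ _ y0 _ _ (fun j (c : seqS R) => c (k + j.+1)%N)) => j; exact: measurable_coord.
Qed.

Lemma normc_one_side t2 s2 : normc (one_side t2 s2) <= y^-1.
Proof.
apply: CEb_bound => [|p]; last exact: normc_two_sided.
exact: (bdmC_slice (t2, s2 : borelC R) bdmC_two_sided_pair).
Qed.

Lemma one_side_lip t2 s t : normc (one_side t2 s - one_side t2 t) <= t2 ^+ 2 / y ^+ 2 * normc (s - t).
Proof.
have b (u : C) : bdmC (fun p : R * borelC R => two_sided p.1 t2 p.2 u).
  exact: (bdmC_slice (t2, u : borelC R) bdmC_two_sided_pair).
rewrite /one_side -CEbB//; apply: CEb_bound; first exact: bdmCB.
by move=> p; rewrite !(two_sided_sym p.1); exact: two_sided_lip.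
Qed.

(** The coefficients before [k], read backwards, and those from [k] on form two independent i.i.d.
    sequences. Each side is replaced by the solution of the recursive equation at a cost that is
    geometric in its depth. *)
Lemma diag_resolvent_rate N k : (1 <= k <= N)%N ->
  normc (Cintegral B (diag_resolvent N k) - rde_expectation beta z L) <=
  2 * (y^-1 * kappa ^+ k) + 2 * (y^-1 * kappa ^+ (N - k).+1).
Proof.
move=> /andP[k1 kN].
(* Coordinates below [k] are read backwards from the second sequence, so that coordinate 0 of either
   sequence is adjacent to the diagonal entry. *)
pose g i : nat + nat := if (i < k)%N then inr (k.-1 - i)%N else inl (i - k)%N.
have ig : injective g.
  move=> i j; rewrite /g; case: ifPn => ik; case: ifPn => jk // [] h; lia.
have hl := splice_indlaw ig hB hB.
have hl' : indlaw (fun=> beta) (law (B \x B)%E (measurable_splice g)).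
  by apply: eq_indlaw hl => i; case: (g i).
have bd := bdmC_diag_resolvent N k.
pose F (x t : seqS R) := two_sided (t 0%N) (x 0%N) (cfrac z (sshift 1 t) k.-1) (cfrac z (sshift 1 x) (N - k)).
have FE (x t : seqS R) : diag_resolvent N k (splice g (x, t)) = F x t.
  rewrite diag_resolventE /F; congr (two_sided _ _ _ _).
  - by rewrite /splice /g ltn_predL k1 subnn.
  - by rewrite /splice /g ltnn subnn.
  - apply: eq_cfrac => j jk; rewrite /splice /g /sshift.
    have -> : (k.-1 - j.+1 < k)%N by lia.
    by congr t; lia.
  - apply: eq_cfrac => j jk; rewrite /splice /g /sshift.
    have -> : (k + j.+1 < k)%N = false by lia.
    by congr x; lia.
have bF : bdmC (fun p : seqS R * seqS R => F p.1 p.2).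
  have := bdmC_comp bd (measurable_splice g).
  by congr bdmC; apply/funext => -[x t]; rewrite FE.
have E1 : Cintegral B (diag_resolvent N k) = Cintegral B (fun x => Cintegral B (fun t => F x t)).
  rewrite (CEb_measure_eq (nu := law (B \x B)%E (measurable_splice g))); first last.
  - by move=> A mA; apply/esym; exact: (indlaw_unique hl' hB).
  - by case: bd.
  rewrite CEb_law// -(CEb_fubini B B bF); apply: eq_Cintegral => -[x t]; exact: FE.
have m12 : mfunC (fun p : R * borelC R => one_side p.1 p.2).
  by have [] := bdmC_inner (beta \x L)%E (beta \x L)%E bdmC_two_sided_pair.
have mone : measurable_fun setT (fun x : seqS R => (x 0%N, cfrac z (sshift 1 x) (N - k)) : R * borelC R).
  apply: measurable_fun_pair; first exact: measurable_coord.
  apply: measurable_borelC; apply: (@mfunC_cfrac _ _ y0 _ _ (fun j (x : seqS R) => x (j + 1)%N)) => j.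
  exact: measurable_coord.
have bone : bdmC (fun x : seqS R => one_side (x 0%N) (cfrac z (sshift 1 x) (N - k))).
  have b12 : bdmC (fun p : R * borelC R => one_side p.1 p.2).
    by split => //; exists y^-1 => p; exact: normc_one_side.
  exact: (bdmC_comp b12 mone).
have E2 : normc (Cintegral B (fun x => one_side (x 0%N) (cfrac z (sshift 1 x) (N - k))) -
    rde_expectation beta z L) <= 2 * (y^-1 * kappa ^+ (N - k).+1).
  rewrite rde_expectation_iter; apply: (@avg_rate one_side y^-1) => //.
  - exact: one_side_lip.
  - exact: normc_one_side.
have bFx := bdmC_inner B B bF.
have E3 : normc (Cintegral B (fun x => Cintegral B (fun t => F x t)) -
    Cintegral B (fun x => one_side (x 0%N) (cfrac z (sshift 1 x) (N - k)))) <= 2 * (y^-1 * kappa ^+ k).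
  rewrite -CEbB//; apply: CEb_bound; first exact: bdmCB.
  move=> x; rewrite -{2}(prednK k1).
  apply: (@avg_rate (fun b s => two_sided b (x 0%N) s (cfrac z (sshift 1 x) (N - k))) y^-1).
  - by move=> b s t; exact: two_sided_lip.
  - by move=> b s; exact: normc_two_sided.
  - by have [] := bdmC_slice (x 0%N, cfrac z (sshift 1 x) (N - k) : borelC R) bdmC_two_sided_pair.
rewrite E1; set a := Cintegral _ _ in E3 *; set b := Cintegral _ _ in E2 E3.
have -> : a - rde_expectation beta z L = (a - b) + (b - rde_expectation beta z L) by ring.
by apply: le_trans (le_normcD _ _) _; exact: lerD.
Qed.

Lemma bcont_kernel_part (g : C -> R) : (forall w, `|g w| <= normc w) ->
  (forall w w', g (w - w') = g w - g w') -> bcont (fun x : R => g (z - x%:C)^-1).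
Proof.
move=> gn gB.
have Imz (x : R) : y <= complex.Im (z - x%:C) by rewrite raddfB /= subr0.
split.
  apply: (@lip_continuous _ _ (y ^- 2)) => u v; rewrite -gB; apply: le_trans (gn _) _.
  apply: le_trans (inv_lip y0 (Imz u) (Imz v)) _; rewrite mulrC ler_wpM2l ?invr_ge0 ?sqr_ge0//.
  rewrite (_ : _ - _ = (v - u)%:C); last by rewrite rmorphB /=; ring.
  by rewrite normc_real distrC.
exists y^-1 => x; apply: le_trans (gn _) _; rewrite normcV lef_pV2 ?posrE//.
  exact: le_normc_Im.
exact: lt_le_trans y0 (le_normc_Im (Imz x)).
Qed.

Lemma trace_stsum N (c : seqS R) : \sum_i (z - (eig (tri N (fun=> 0) c) i)%:C)^-1 =
  \sum_(i < N) diag_resolvent N (N - i) c.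
Proof.
have yn : complex.Im z != 0 by rewrite gt_eqF.
have hU := tri_udiag N (fun=> 0) c.
have [G hG] := resolvent_exists yn hU.
rewrite -(trace_resolvent yn hU hG); apply: eq_bigr => i _.
have iN := ltn_ord i.
have h : (N - (N - i) < N)%N by lia.
have -> : i = Ordinal h by apply: val_inj => /=; lia.
rewrite (resolvent_tri_diag h y0 _ hG) /=; last by lia.
rewrite /diag_resolvent; have -> : (N - (N - (N - i)))%N = (N - i)%N by lia.
by [].
Qed.

(** Along the diagonal the error is geometric in the distance to the two ends, so its sum is bounded
    and its average is of order [1 / n]. The same averages converge to the transform of [mu_b] by
    [Tavg_cvg]. *)
Lemma stieltjes_mu_b : stieltjes (mu_b hB) z = rde_expectation beta z L.
Proof.
pose re (x : R) := complex.Re (z - x%:C)^-1; pose im (x : R) := complex.Im (z - x%:C)^-1.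
have bre : bcont re by apply: bcont_kernel_part; [exact: le_Re_normc|by move=> *; rewrite raddfB].
have bim : bcont im by apply: bcont_kernel_part; [exact: le_Im_normc|by move=> *; rewrite raddfB].
have cre := @Tavg_cvg _ _ _ hB _ bre; have cim := @Tavg_cvg _ _ _ hB _ bim.
have kap0 : 0 <= kappa := kappa_ge0 beta z.
have EN N : Etsum B re N +i* Etsum B im N = \sum_(i < N) Cintegral B (diag_resolvent N (N - i)).
  have sE (s : seqS R) : stsum re N s +i* stsum im N s = \sum_(i < N) diag_resolvent N (N - i) s.
    rewrite -trace_stsum /stsum /tsum; apply/eqP; rewrite eq_complex; apply/andP.
    by split; apply/eqP; rewrite /= raddf_sum.
  transitivity (Cintegral B (fun s => \sum_(i < N) diag_resolvent N (N - i) s)).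
    congr (_ +i* _); apply: eq_Rintegral => s _; by rewrite -sE.
  by apply: (CEb_sum B N (F := fun i => diag_resolvent N (N - i)) _).2 => i; exact: bdmC_diag_resolvent.
set RE := rde_expectation beta z L.
have rate n : normc ((Tavg B re n.+1 +i* Tavg B im n.+1) - RE) <= 4 / y * (1 - kappa)^-1 * n.+1%:R^-1.
  have np : 0 < n.+1%:R :> R by rewrite ltr0n.
  have -> : (Tavg B re n.+1 +i* Tavg B im n.+1) - RE =
      (n.+1%:R^-1 : R)%:C * \sum_(i < n.+1) (Cintegral B (diag_resolvent n.+1 (n.+1 - i)) - RE).
    rewrite sumrB sumr_const card_ord -EN mulrBr; congr (_ - _).
      by rewrite /Tavg; apply/eqP; rewrite eq_complex /= !mul0r subr0 addr0 !(mulrC n.+1%:R^-1) !eqxx.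
    rewrite -[RE *+ _]mulr_natl mulrA -(rmorph_nat (real_complex R)) -rmorphM /= mulVf ?gt_eqF//.
    by rewrite mul1r.
  rewrite normcM normc_real ger0_norm ?invr_ge0// mulrC ler_wpM2r ?invr_ge0//.
  have ns m (F : nat -> C) : normc (\sum_(i < m) F i) <= \sum_(i < m) normc (F i).
    elim: m => [|m IH]; first by rewrite !big_ord0 normc0.
    by rewrite !big_ord_recr /=; apply: le_trans (le_normcD _ _) _; rewrite lerD2r.
  apply: le_trans (ns _ (fun i => Cintegral B (diag_resolvent n.+1 (n.+1 - i)) - RE)) _.
  apply: (@le_trans _ _ (\sum_(i < n.+1) (2 / y * kappa ^+ (n.+1 - i) + 2 / y * kappa ^+ i.+1))).
    apply: ler_sum => i _; have iN := ltn_ord i.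
    apply: le_trans (diag_resolvent_rate _) _; first by lia.
    have -> : (n.+1 - (n.+1 - i))%N = i by lia.
    by rewrite !mulrA.
  rewrite big_split /= (reindex_inj rev_ord_inj) /=.
  rewrite (eq_bigr (fun i : 'I_n.+1 => 2 / y * kappa ^+ i.+1)); last first.
    by move=> i _; congr (_ * _ ^+ _); have := ltn_ord i; lia.
  rewrite -mulr_sumr; set S := \sum_(i < n.+1) kappa ^+ i.+1.
  have -> : 2 / y * S + 2 / y * S = 4 / y * S by ring.
  apply: ler_wpM2l; first by rewrite divr_ge0// ltW.
  apply: le_trans (_ : _ <= \sum_(i < n.+1) kappa ^+ i) _.
    apply: ler_sum => i _; rewrite exprS ler_piMl ?exprn_ge0//.
    exact: ltW.
  exact: geometric_sum_le.
have lim : 4 / y * (1 - kappa)^-1 * n.+1%:R^-1 @[n --> \oo] --> (4 / y * (1 - kappa)^-1 * 0 : R).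
  by apply: cvgMr; exact: cvg_harmonic.
rewrite mulr0 in lim.
have conv (u : nat -> R) (l : R) : (forall n, `|u n - l| <= 4 / y * (1 - kappa)^-1 * n.+1%:R^-1) -> u @ \oo --> l.
  move=> h; apply/cvgrPdist_le => e e0; have /cvgrPdist_le/(_ _ e0) := lim.
  apply: filterS => n; rewrite sub0r normrN => hn; rewrite distrC.
  by apply: le_trans (h n) _; exact: le_trans (ler_norm _) hn.
have c1 : (fun n => Tavg B re n.+1) @ \oo --> complex.Re RE.
  apply: conv => n; apply: le_trans (rate n); apply: le_trans (le_Re_normc _).
  by rewrite raddfB.
have c2 : (fun n => Tavg B im n.+1) @ \oo --> complex.Im RE.
  apply: conv => n; apply: le_trans (rate n); apply: le_trans (le_Im_normc _).
  by rewrite raddfB.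
apply/eqP; rewrite eq_complex; apply/andP; split; apply/eqP.
  exact: (cvg_unique (@norm_hausdorff _ R) cre c1).
exact: (cvg_unique (@norm_hausdorff _ R) cim c2).
Qed.

End stieltjes_limit.

(** * Almost sure weak convergence *)

Section data_law.
Context d (Omega : measurableType d) (R : realType) (P : probability Omega R).

Definition seqRV (I : Type) (X : I -> {RV P >-> R}) (g : nat -> I) : Omega -> seqS R :=
  fun w i => X (g i) w.

Lemma measurable_seqRV (I : Type) (X : I -> {RV P >-> R}) g : measurable_fun setT (seqRV X g).
Proof. by apply: measurable_seq => i; exact: measurable_funPT. Qed.

Lemma indep_indlaw (I : choiceType) (D : set I) (X : I -> {RV P >-> R}) (g : nat -> I) :
  mutually_independent D X -> injective g -> (forall i, D (g i)) ->
  indlaw (fun i => distribution P (X (g i))) (law P (measurable_seqRV X g)).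
Proof.
move=> hX ig Dg J A mA; rewrite lawE.
pose ginv x := xget 0%N [set i | g i = x].
have giK i : ginv (g i) = i.
  by rewrite /ginv; case: xgetP => [j _ /= /ig//|/(_ i)/=].
have -> : seqRV X g @^-1` cyl J A =
    \bigcap_(x in [set` (g @` J)%fset]) (X x @^-1` A (ginv x)).
  apply/seteqP; split => w /= h.
    by move=> x /imfsetP[i iJ ->]; rewrite /= giK; exact: h.
  move=> i iJ; have := h (g i); rewrite /= giK; apply.
  by apply/imfsetP; exists i.
rewrite hX; last by move=> x; exact: mA.
  rewrite big_imfset/=; last by move=> x y _ _ /ig.
  by apply: eq_bigr => i _; rewrite giK.
by move=> _ /imfsetP[i _ ->].
Qed.

End data_law.

Lemma tail_summable (R : realType) (u : nat -> \bar R) (c : R) : 0 < c ->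
  (forall n, 0 <= u n)%E -> (forall n, (0 < n)%N -> u n <= (2 * expR (- (n%:R * c)))%:E)%E ->
  (u 0%N <= 1%:E)%E -> (\sum_(n <oo) u n < +oo)%E.
Proof.
move=> c0 u0 hu u01; pose x := expR (- c).
have x1 : x < 1 by rewrite expR_lt1 oppr_lt0.
apply: (@le_lt_trans _ _ (1 + 2 * (1 - x)^-1)%:E); last exact: ltry.
apply: lime_le; first by apply: is_cvg_nneseries => n _ _; exact: u0.
apply: nearW => n; rewrite big_mkord.
have h (i : nat) : (u i <= ((i == 0%N)%:R + 2 * x ^+ i)%:E)%E.
  case: i => [|i].
    by apply: le_trans u01 _; rewrite lee_fin expr0 eqxx mulr1 lerDl.
  apply: le_trans (hu _ _) _ => //; rewrite lee_fin add0r /x -expRM_natl.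
  by rewrite mulrN.
apply: (@le_trans _ _ (\sum_(i < n) ((i == 0%N :> nat)%:R + 2 * x ^+ i))%:E).
  by rewrite -sumEFin; apply: lee_sum => i _; exact: h.
rewrite lee_fin big_split /= -mulr_sumr lerD//.
  case: n => [|n]; first by rewrite big_ord0.
  by rewrite big_ord_recl /= big1 ?addr0// => i _; rewrite eqxx.
by rewrite ler_pM2l// geometric_sum_le ?expR_ge0.
Qed.

(** * Concentration of linear statistics *)

Section concentration.
Context d (Omega : measurableType d) (R : realType) (P : probability Omega R).
Variables (b : nat -> {RV P >-> R}) (a : nat -> nat -> {RV P >-> R}).
Variable sigma : nat -> nat -> R.
Hypothesis indep : mutually_independent coef_index (coef_family b a).

Definition Zavg (f : R -> R) N (w : Omega) : R :=
  N%:R^-1 * tsum f N (fun k => a k N w) (fun k => sigma k N * b k w).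

Lemma bdm_Zavg f N : bcont f -> bdm (Zavg f N).
Proof.
move=> bf; apply: bdmM; first exact: bdm_cst.
apply: (@bdm_tsum_bcont _ _ _ f N (fun k w => a k N w) (fun k w => sigma k N * b k w)) => // k.
by apply: measurable_funM => //; exact: measurable_cst.
Qed.

(** The first [2 N] places hold the variables [b 1 .. b N] and [a 1 N .. a N N]. The remaining
    places are filled with further variables [b], only to have an infinite sequence without
    repetition. *)
Definition data_index N (i : nat) : nat + nat * nat :=
  if (i < N)%N then inl i.+1 else if (i < N + N)%N then inr ((i - N).+1, N) else inl i.+1.

Lemma data_index_inj N : injective (data_index N).
Proof.
move=> i j; rewrite /data_index.
case: (ltnP i N) => iN; case: (ltnP j N) => jN; case: (ltnP i (N + N)) => iN2;
  by case: (ltnP j (N + N)) => jN2 // [] ij; lia.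
Qed.

Lemma data_index_in N i : coef_index (data_index N i).
Proof.
rewrite /coef_index /data_index; case: ltnP => iN //=; case: ltnP => iN2 //=.
by lia.
Qed.

(** With the guard [k <= N] a coordinate acts on the coefficients of one index only, as
    [tsum_change1] requires for all indices. *)
Definition data_avg (f : R -> R) N (s : seqS R) : R :=
  N%:R^-1 * tsum f N (fun k => if (0 < k)%N then s (N + k.-1)%N else 0)
                     (fun k => if (0 < k <= N)%N then sigma k N * s k.-1 else 0).

Lemma Zavg_data f N w : Zavg f N w = data_avg f N (seqRV (coef_family b a) (data_index N) w).
Proof.
congr (_ * _); apply: eq_tsum => k /andP[k1 kN]; rewrite k1 /seqRV /data_index.
  by rewrite ltnNge leq_addr /= ltn_add2l prednK// kN addKn prednK.
by rewrite (ltnW kN) (leq_ltn_trans (leq_pred k) kN) prednK.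
Qed.

Lemma bdm_data_avg f N : bcont f -> bdm (data_avg f N).
Proof.
move=> bf; apply: bdmM; first exact: bdm_cst.
apply: (@bdm_tsum_bcont R _ _ f N (fun k (s : seqS R) => if (0 < k)%N then s (N + k.-1)%N else 0)
  (fun k (s : seqS R) => if (0 < k <= N)%N then sigma k N * s k.-1 else 0)) => // k.
  by case: (0 < k)%N; [exact: measurable_coord|exact: measurable_cst].
case: (0 < k <= N)%N; last exact: measurable_cst.
by apply: measurable_funM => //; exact: measurable_coord.
Qed.

(** The average depends on [2 N] independent coordinates, and each of them moves it by at most
    [1 / N], however unbounded the coordinate, because ramps are monotone with values in
    [[0, 1]]. *)
Lemma Zavg_tail q j m N (e : R) : (0 < N)%N -> 0 < e <= 1 ->
  (P [set w | (e <= `|Zavg (ramp q j m) N w - \int[P]_w Zavg (ramp q j m) N w|)%R] <=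
    (2 * expR (- (N%:R * e ^+ 2 / 8)))%:E)%E.
Proof.
move=> N0 e01; set f := ramp q j m.
have bf : bcont f by exact: bcont_ramp.
have hL := indep_indlaw indep (@data_index_inj N) (@data_index_in N).
have := @bounded_differences_tail R _ _ hL (data_avg f N) (N + N) N%:R^-1 (bdm_data_avg N bf) _ _ e N _ N0 erefl e01.
have -> : \int[law P (measurable_seqRV (coef_family b a) (data_index N))]_t data_avg f N t =
    \int[P]_w Zavg f N w.
  rewrite Eb_law; last exact: bdm_data_avg.
  by apply: eq_Rintegral => w _; rewrite Zavg_data.
rewrite lawE.
have -> : seqRV (coef_family b a) (data_index N) @^-1`
   [set s | e <= `|data_avg f N s - \int[P]_w Zavg f N w|] =
   [set w | e <= `|Zavg f N w - \int[P]_w Zavg f N w|].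
  by apply/seteqP; split => w /=; rewrite Zavg_data.
apply.
- move=> s t st; congr (_ * _); apply: eq_tsum => k /andP[k1 kN]; rewrite k1.
    by rewrite st// ltn_add2l; lia.
  by rewrite (ltnW kN) st//; lia.
- move=> k s t st; rewrite -mulrBr normrM ger0_norm ?invr_ge0// ler_piMr ?invr_ge0//.
  apply: (@tsum_change1 _ f N _ _ _ _ (if (k < N)%N then k.+1 else (k - N).+1)).
  + exact: ramp_noninc.
  + exact: ramp01.
  + move=> i; case: ltnP => kN ik; case: ltnP => // i0; apply: st; apply/eqP => ek.
      by lia.
    by move/eqP: ik; apply; rewrite -ek; lia.
  + move=> i; case: ltnP => kN ik; case: ifP => // /andP[i0 iN]; rewrite st//; apply/eqP => ek.
      by move/eqP: ik; apply; rewrite -ek; lia.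
    by lia.
- by rewrite addnn.
Qed.

(** The tail bound is summable, so Borel-Cantelli applies to each ramp and each threshold
    [1 / (p + 1)]; there are countably many of both. *)
Lemma Zavg_concentration : {ae P, forall w, forall q j m,
  Zavg (ramp q j m) N w - \int[P]_v Zavg (ramp q j m) N v @[N --> \oo] --> 0}.
Proof.
apply/ae_foralln => q; apply/ae_foralln => j; apply/ae_foralln => m.
pose D N w := Zavg (ramp q j m) N w - \int[P]_v Zavg (ramp q j m) N v.
pose F (p N : nat) := [set w | p.+1%:R^-1 <= `|D N w|].
have bD N : bdm (D N) by apply: bdmB; [apply: bdm_Zavg; exact: bcont_ramp|exact: bdm_cst].
have mF p N : measurable (F p N).
  rewrite -[X in measurable X]setTI.
  rewrite (_ : F p N = (fun w => `|D N w|) @^-1` `[p.+1%:R^-1, +oo[%classic).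
    by have [mD _] := bdm_norm (bD N); exact: mD.
  by apply/seteqP; split => w /=; rewrite in_itv /= andbT.
have F0 p : P (lim_sup_set (F p)) = 0%E.
  apply: lim_sup_set_cvg0; first exact: mF.
  have p0 : 0 < p.+1%:R^-1 :> R by rewrite invr_gt0.
  apply: (@tail_summable _ _ (p.+1%:R^-1 ^+ 2 / 8)).
  - by rewrite divr_gt0 ?exprn_gt0.
  - by move=> n; exact: measure_ge0.
  - move=> n n0; rewrite mulrA; apply: Zavg_tail => //.
    by rewrite p0 invf_le1// ler1n.
  - exact: probability_le1.
have : {ae P, forall w, forall p, ~ lim_sup_set (F p) w}.
  apply/ae_foralln => p; exists (lim_sup_set (F p)); split => //.
  - by apply: bigcap_measurable => [|n _]; [exists 0%N|apply: bigcup_measurable].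
  - exact: F0.
  - by move=> w /= h; apply: contrapT.
apply: filterS => w hw; apply/cvgrPdist_le => e e0.
have [[//|p] _ pe] := small_inv e0.
have {hw} := hw p; rewrite /lim_sup_set => /existsNP[n /not_implyP[_ hn]].
exists n => // k /= nk; rewrite sub0r normrN.
apply: le_trans pe; rewrite leNgt; apply/negP => h; apply: hn.
by exists k => //; exact: ltW.
Qed.

End concentration.

Section majorant.
Context d (T : measurableType d) (R : realType) (mu : probability T R).

Lemma Eb_le_integral (g : T -> R) (h : T -> \bar R) : bdm g -> measurable_fun setT h ->
  (forall x, (`|g x|)%:E <= h x)%E -> ((`|\int[mu]_x g x|)%:E <= \int[mu]_x h x)%E.
Proof.
move=> bg mh gh.
apply: (@le_trans _ _ (\int[mu]_x `|g x|)%:E).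
  by rewrite lee_fin; apply: Eb_norm_le => //; exact: bdm_norm.
rewrite /Rintegral fineK; last by apply: integrable_fin_num => //; apply: bdm_integrable; exact: bdm_norm.
apply: ge0_le_integral => //.
by apply/measurable_EFinP; case: (bdm_norm bg).
Qed.

Lemma integral_affine_sq (I : Type) (r : seq I) (X : I -> T -> R) (c0 c1 : R) : 0 <= c0 -> 0 <= c1 ->
  (forall i, measurable_fun setT (X i)) ->
  (\int[mu]_x (c0 + c1 * \sum_(i <- r) X i x ^+ 2)%:E =
   c0%:E + c1%:E * \sum_(i <- r) \int[mu]_x (X i x ^+ 2)%:E)%E.
Proof.
move=> c00 c10 mX.
have mX2 i : measurable_fun setT (fun x => (X i x ^+ 2)%:E).
  by apply/measurable_EFinP; exact: measurable_funX.
have mS : measurable_fun setT (fun x => (\sum_(i <- r) X i x ^+ 2)%:E).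
  by apply/measurable_EFinP; apply: measurable_sum => i; exact: measurable_funX.
have S0 x : 0 <= \sum_(i <- r) X i x ^+ 2 by apply: sumr_ge0 => i _; exact: sqr_ge0.
under eq_integral do rewrite EFinD EFinM.
rewrite ge0_integralD//; first last.
- by apply: emeasurable_funM => //; exact: measurable_cst.
- by move=> x _; rewrite mule_ge0 ?lee_fin.
rewrite integral_cst// [X in (_ * X)%E](_ : _ = 1%E); last exact: probability_setT.
rewrite mule1; congr (_ + _)%E.
rewrite ge0_integralZl_EFin//; last by move=> x _; rewrite lee_fin.
congr (_ * _)%E; under eq_integral do rewrite -sumEFin.
by rewrite ge0_integral_sum// => i x _; rewrite lee_fin sqr_ge0.
Qed.

End majorant.

(** * Expected statistics with deterministic weights: cutting into blocks *)

Section blocks.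
Variables (R : realType) (beta : probability R R) (B : probability (seqS R) R).
Hypothesis hB : indlaw (fun=> beta) B.

Definition Vt (f : R -> R) n (c : nat -> R) : R :=
  \int[B]_s tsum f n (fun=> 0) (fun k => c k * s k).

Lemma bdm_wtsum f n (c : nat -> R) : bcont f ->
  bdm (fun s : seqS R => tsum f n (fun=> 0) (fun k => c k * s k)).
Proof.
move=> bf; apply: (@bdm_tsum_bcont R _ _ f n (fun k (s : seqS R) => 0)
  (fun k (s : seqS R) => c k * s k)) => // k.
by apply: measurable_funM => //; exact: measurable_coord.
Qed.

Section unit_range.
Variable f : R -> R.
Hypothesis bf : bcont f.
Hypothesis f01 : forall x, 0 <= f x <= 1.

Lemma Vt_bound n c : 0 <= Vt f n c <= n%:R.
Proof.
have b0 := bdm_wtsum n c bf; apply/andP; split.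
  apply: Rintegral_ge0 => s _; apply: sumr_ge0 => i _.
  by have /andP[] := f01 (eig (tri n (fun=> 0) (fun k => c k * s k)) i).
rewrite -[leRHS](EbC B); apply: Eb_le => //; first exact: bdm_cst.
move=> s; apply: le_trans (ler_norm _) _; rewrite -[n%:R]mulr1; apply: tsum_bound => x.
by have /andP[? ?] := f01 x; rewrite ger0_norm.
Qed.

Hypothesis fni : {homo f : x y /~ x <= y}.

Lemma Vt_cut m k c : `|Vt f (m + k) c - (Vt f m (fun j => c (j + k)%N) + Vt f k c)| <= 1.
Proof.
have b0 n c' := bdm_wtsum n c' bf.
have bs : bdm (fun s : seqS R => tsum f m (fun=> 0) (fun j => c (j + k)%N * sshift k s j)).
  by apply: (bdm_comp (b0 m (fun j => c (j + k)%N))); exact: measurable_shift.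
have -> : Vt f m (fun j => c (j + k)%N) =
    \int[B]_s tsum f m (fun=> 0) (fun j => c (j + k)%N * sshift k s j).
  by rewrite (shift_law hB k (b0 m (fun j => c (j + k)%N))).
rewrite /Vt -EbD// -EbB//; last exact: bdmD.
apply: Eb_bound; first by apply: bdmB => //; exact: bdmD.
by move=> s; apply: (tsum_cut m k (fun=> 0) (fun j => c j * s j)).
Qed.

Lemma Vt_blocks L M r c :
  `|Vt f (r + M * L) c - \sum_(j < M) Vt f L (fun k => c (k + j * L)%N)| <= M%:R + 1 + r%:R.
Proof.
have mulL m : `|Vt f (m * L) c - \sum_(j < m) Vt f L (fun k => c (k + j * L)%N)| <= m%:R.
  elim: m => [|m IH].
    rewrite mul0n big_ord0 subr0; have /andP[? ?] := Vt_bound 0 c.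
    by rewrite ger0_norm.
  rewrite mulSn big_ord_recr /=; have := Vt_cut L (m * L) c; move: IH.
  rewrite -natr1 !ler_norml => /andP[? ?] /andP[? ?]; apply/andP; split; lra.
have := Vt_cut r (M * L) c; have := mulL M; have := Vt_bound r (fun j => c (j + M * L)%N).
by rewrite !ler_norml => /andP[? ?] /andP[? ?] /andP[? ?]; apply/andP; split; lra.
Qed.

End unit_range.

Hypothesis hb2 : beta.-integrable setT (EFin \o (fun b : R => b ^+ 2)).
Let m2 := \int[beta]_b (b ^+ 2).

Lemma coord_m2 i : (\int[B]_s (s i ^+ 2)%:E = m2%:E)%E.
Proof.
have mc : measurable_fun setT (fun s : seqS R => s i) by exact: measurable_coord.
rewrite -(ge0_law B mc (f := fun x => (x ^+ 2)%:E)); last 2 first.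
- by apply/measurable_EFinP; exact: measurable_funX.
- by move=> y; rewrite lee_fin sqr_ge0.
rewrite /m2 /Rintegral fineK; last exact: integrable_fin_num.
apply: eq_measure_integral => A mA _.
have := hB [fset i]%fset (A := fun=> A) (fun=> mA).
rewrite big_seq_fset1 => h; apply: (etrans _ h); apply: (etrans (lawE B mc A)).
congr (B _); apply/seteqP; split => s /=.
  by move=> As j; rewrite in_fset1 => /eqP ->.
by apply; rewrite in_fset1.
Qed.

(** For [delta >= 1] the trivial bound [L] suffices. Otherwise the weights are within [delta] of
    [t], and the square root in [tsum_lipschitz] is linearized by [sqrt x <= (1 + x) / 2], so that
    only second moments appear. *)
Lemma Vt_block (f : R -> R) (K : R) L c t (delta : R) : bcont f ->
  (forall x, 0 <= f x <= 1) -> 0 <= K -> (forall x y, `|f x - f y| <= K * `|x - y|) ->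
  0 <= delta -> (forall k, (1 <= k < L)%N -> Num.min 1 `|c k - t| <= delta) ->
  `|Vt f L c - Vt f L (fun=> t)| <= (L%:R + K * (1 + 2 * L%:R ^+ 2 * m2) / 2) * delta.
Proof.
move=> bf f01 K0 hf d0 hd.
have m20 : 0 <= m2 by exact: m2_ge0.
have [d1|d1] := leP 1 delta.
  apply: (@le_trans _ _ L%:R).
    have := Vt_bound bf f01 L c; have := Vt_bound bf f01 L (fun=> t).
    by rewrite ler_norml => /andP[? ?] /andP[? ?]; apply/andP; split; lra.
  rewrite mulrDl ler_wpDr ?ler_peMr//.
  by rewrite !mulr_ge0// addr_ge0// !mulr_ge0.
have {hd} hd k : (1 <= k < L)%N -> `|c k - t| <= delta.
  by move=> /hd; rewrite ge_min leNgt d1.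
rewrite /Vt -EbB; [|exact: bdm_wtsum..].
rewrite -lee_fin.
pose c0 := K * delta / 2; pose c1 := K * delta * L%:R.
have c00 : 0 <= c0 by rewrite !mulr_ge0.
have c10 : 0 <= c1 by rewrite !mulr_ge0.
apply: (@le_trans _ _ (\int[B]_s (c0 + c1 * \sum_(k <- index_iota 1 L) s k ^+ 2)%:E)%E).
  apply: Eb_le_integral; first by apply: bdmB; exact: bdm_wtsum.
    apply/measurable_EFinP/measurable_funD => //; apply: measurable_funM => //.
    by apply: measurable_sum => k; apply: measurable_funX; exact: measurable_coord.
  move=> s; rewrite lee_fin.
  apply: le_trans (tsum_lipschitz L _ _ _ _ K0 hf) _.
  have -> : c0 + c1 * \sum_(k <- index_iota 1 L) s k ^+ 2 =
    K * (delta * ((1 + 2 * L%:R * \sum_(1 <= k < L) s k ^+ 2) / 2)) by rewrite /c0 /c1; field.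
  apply: ler_wpM2l => //.
  set Q := \sum_(1 <= k < L) s k ^+ 2.
  have Q0 : 0 <= Q by apply: sumr_ge0 => k _; exact: sqr_ge0.
  have E0 : \sum_(1 <= k < L.+1) ((0 : R) - 0) ^+ 2 = 0 by rewrite big1// => k _; rewrite subrr expr0n.
  rewrite E0 add0r.
  have h : \sum_(1 <= k < L) (c k * s k - t * s k) ^+ 2 <= delta ^+ 2 * Q.
    rewrite mulr_sumr !big_seq; apply: ler_sum => k; rewrite mem_index_iota => kL.
    rewrite -mulrBl exprMn ler_wpM2r ?sqr_ge0//.
    by rewrite -real_normK ?num_real// ler_sqr ?nnegrE// hd.
  have LQ : 0 <= 2 * L%:R * Q by rewrite !mulr_ge0.
  have p0 : 0 <= delta * ((1 + 2 * L%:R * Q) / 2).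
    by apply: mulr_ge0 => //; apply: divr_ge0 => //; exact: addr_ge0.
  rewrite -[leRHS]ger0_norm//.
  rewrite -sqrtr_sqr ler_wsqrtr// exprMn.
  apply: le_trans (_ : _ <= delta ^+ 2 * (2 * L%:R * Q)) _.
    have -> : delta ^+ 2 * (2 * L%:R * Q) = L%:R * (2 * (delta ^+ 2 * Q)) by ring.
    by rewrite !ler_wpM2l.
  rewrite ler_wpM2l ?sqr_ge0//; move: (2 * L%:R * Q) => x; have := sqr_ge0 (x - 1); lra.
rewrite integral_affine_sq//; last by move=> i; exact: measurable_coord.
under eq_bigr do rewrite coord_m2.
rewrite sumEFin -EFinM -EFinD lee_fin sumr_const_nat -[_ *+ _]mulr_natl.
have h : (L - 1)%:R * m2 <= L%:R * m2 by rewrite ler_wpM2r// ler_nat leq_subr.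
have := ler_wpM2l c10 h; rewrite /c0 /c1 => h'.
have : 0 <= L%:R * delta by rewrite mulr_ge0.
by move: h'; move: ((L - 1)%:R * m2) => u; lra.
Qed.

End blocks.

Section empirical.
Context d (T : measurableType d) (R : realType).

Lemma Rintegral_empirical (s : seq T) (f : T -> R) : measurable_fun setT f ->
  \int[empirical_measure R s]_x f x = (size s)%:R^-1 * \sum_(x <- s) f x.
Proof.
move=> mf; rewrite /Rintegral integralE.
have mf' : measurable_fun setT (EFin \o f) by exact/measurable_EFinP.
rewrite !integral_empirical//; last 2 first.
- exact: (measurable_funeneg mf').
- exact: (measurable_funepos mf').
have e1 : (\sum_(x <- s) (fun x => (f x)%:E)^\+ x = (\sum_(x <- s) Num.max (f x) 0)%:E)%E.
  by rewrite -sumEFin; apply: eq_bigr => x _; rewrite funeposE EFin_max.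
have e2 : (\sum_(x <- s) (fun x => (f x)%:E)^\- x = (\sum_(x <- s) Num.max (- f x) 0)%:E)%E.
  by rewrite -sumEFin; apply: eq_bigr => x _; rewrite funenegE -EFinN EFin_max.
rewrite e1 e2 -!EFinM -EFinB /= -mulrBr -sumrB; congr (_ * _); apply: eq_bigr => x _.
by rewrite /Num.max; do 2 case: ifPn => ?; lra.
Qed.

End empirical.

Section averaging.
Variable R : realType.

Lemma sum_blocks (F : nat -> R) L M :
  \sum_(j < M) \sum_(1 <= i < L.+1) F (i + j * L)%N = \sum_(1 <= k < (M * L).+1) F k.
Proof.
elim: M => [|M IH]; first by rewrite big_ord0 mul0n big_geq.
rewrite big_ord_recr IH /= [RHS](big_cat_nat (n := (M * L).+1))//=; last by rewrite ltnS leq_mul2r leqnSn orbT.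
congr (_ + _); have -> : ((M.+1 * L).+1 = L.+1 + M * L)%N by rewrite mulSn.
by have -> : ((M * L).+1 = 1 + M * L)%N by []; rewrite [RHS]big_addn addnK.
Qed.

(** The cap at 1 makes this a bounded continuous function of a pair of weights, so its average over
    consecutive weights is governed by weak convergence. *)
Definition psi (x y : R) : R := Num.min 1 `|x - y|.

Lemma psi_ge0 x y : 0 <= psi x y.
Proof. by rewrite /psi le_min ler01 normr_ge0. Qed.

Lemma psi_le1 x y : psi x y <= 1.
Proof. by rewrite /psi ge_min lexx. Qed.

Lemma psi_triangle x y z : psi x z <= psi x y + psi y z.
Proof.
rewrite /psi; have := ler_normD (x - y) (y - z); rewrite addrA subrK.
have := normr_ge0 (x - y); have := normr_ge0 (y - z).
by rewrite /Num.min; do 3 case: ifPn; rewrite -?leNgt; lra.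
Qed.

Lemma psi_refl x : psi x x = 0.
Proof. by rewrite /psi subrr normr0; apply/min_idPr; exact: ler01. Qed.

Lemma psi_chain (c : nat -> R) i k : (i <= k)%N ->
  psi (c i) (c k) <= \sum_(i <= j < k) psi (c j) (c j.+1).
Proof.
elim: k => [|k IH]; first by rewrite leqn0 => /eqP ->; rewrite big_geq// psi_refl.
rewrite leq_eqVlt => /orP[/eqP ->|ik].
  by rewrite big_geq// psi_refl.
rewrite big_nat_recr//=; apply: le_trans (psi_triangle _ (c k) _) _.
by rewrite lerD2r IH.
Qed.

Lemma psi_block (c : nat -> R) L i k : (1 <= i <= L)%N -> (1 <= k <= L)%N ->
  psi (c i) (c k) <= \sum_(1 <= j < L) psi (c j) (c j.+1).
Proof.
wlog ik : i k / (i <= k)%N.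
  move=> H iL kL; have [ik|/ltnW ki] := leqP i k; first exact: H.
  by rewrite /psi distrC; exact: H.
move=> /andP[i1 iL] /andP[k1 kL]; apply: le_trans (psi_chain c ik) _.
have S0 m n : 0 <= \sum_(m <= j < n) psi (c j) (c j.+1) by apply: sumr_ge0 => j _; exact: psi_ge0.
rewrite [leRHS](big_cat_nat (n := i))//= [X in _ <= _ + X](big_cat_nat (n := k))//=.
have := S0 1%N i; have := S0 k L; lra.
Qed.

Lemma sum_extra (F : nat -> R) M1 m n : (forall k, 0 <= F k <= M1) -> (m <= n)%N ->
  \sum_(1 <= k < m.+1) F k <= \sum_(1 <= k < n.+1) F k <= \sum_(1 <= k < m.+1) F k + (n - m)%:R * M1.
Proof.
move=> hF mn; rewrite (big_cat_nat (n := m.+1) (p := n.+1))//=.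
rewrite lerDl lerD2l; apply/andP; split; first by apply: sumr_ge0 => k _; have /andP[] := hF k.
apply: (@le_trans _ _ (\sum_(m.+1 <= k < n.+1) M1)); first by apply: ler_sum => k _; have /andP[] := hF k.
by rewrite sumr_const_nat subSS -[_ *+ _]mulr_natl.
Qed.

End averaging.

Section expectation.
Variables (R : realType) (beta : probability R R) (B : probability (seqS R) R).
Hypothesis hB : indlaw (fun=> beta) B.
Hypothesis hb2 : beta.-integrable setT (EFin \o (fun b : R => b ^+ 2)).
Let m2 := \int[beta]_b (b ^+ 2).

Section fixed_ramp.
Variable f : R -> R.
Variable K : R.
Hypothesis bf : bcont f.
Hypothesis f01 : forall x, 0 <= f x <= 1.
Hypothesis fni : {homo f : x y /~ x <= y}.
Hypothesis K0 : 0 <= K.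
Hypothesis hf : forall x y, `|f x - f y| <= K * `|x - y|.

Definition hL L t := Vt B f L (fun=> t).

(* hL L t is E sum_i f (t lambda_i) for a block of length L with all the weights equal to t. *)
Lemma hL_lip L : exists2 C : R, 0 <= C &
  forall c t delta, 0 <= delta -> (forall k, (1 <= k < L)%N -> psi (c k) t <= delta) ->
  `|Vt B f L c - hL L t| <= C * delta.
Proof.
exists (L%:R + K * (1 + 2 * L%:R ^+ 2 * m2) / 2).
  rewrite addr_ge0// !mulr_ge0// addr_ge0// !mulr_ge0//; exact: (m2_ge0 beta).
by move=> c t delta d0 hd; exact: (Vt_block hB hb2).
Qed.

(** Every weight of a block serves as its representative in turn, and the [L] comparisons are
    averaged: the full sum over [k] then appears. Inside a block the distances are bounded by the
    sum of [psi] over consecutive weights. The term [N / L] counts the cuts. *)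
Lemma Vt_average (L N : nat) (c : nat -> R) (C : R) : (0 < L)%N -> (0 < N)%N -> 0 <= C ->
  (forall c t delta, 0 <= delta -> (forall k, (1 <= k < L)%N -> psi (c k) t <= delta) ->
    `|Vt B f L c - hL L t| <= C * delta) ->
  `|Vt B f N c - L%:R^-1 * \sum_(1 <= k < N) hL L (c k)| <=
    N%:R / L%:R + (1 + 2 * L%:R + C) + C * \sum_(1 <= k < N) psi (c k) (c k.+1).
Proof.
case: N => // N L0 _ C0 hC; set M := (N.+1 %/ L)%N; set r := (N.+1 %% L)%N.
have Lp : 0 < L%:R :> R by rewrite ltr0n.
have eN : N.+1 = (r + M * L)%N by rewrite addnC -divn_eq.
have rL : (r < L)%N by rewrite ltn_mod.
have h1 := Vt_blocks hB bf f01 fni L M r c; rewrite -eN in h1.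
have hM : M%:R <= N.+1%:R / L%:R :> R.
  by rewrite ler_pdivlMr// -natrM ler_nat leq_trunc_div.
pose D j := \sum_(1 <= i < L.+1) psi (c (i + j * L)%N) (c (i + j * L).+1).
have hD j : `|L%:R * Vt B f L (fun k => c (k + j * L)%N) - \sum_(1 <= i < L.+1) hL L (c (i + j * L)%N)| <= L%:R * (C * D j).
  have -> : L%:R * Vt B f L (fun k => c (k + j * L)%N) = \sum_(1 <= i < L.+1) Vt B f L (fun k => c (k + j * L)%N).
    by rewrite sumr_const_nat subn1 /= mulr_natl.
  have -> : L%:R * (C * D j) = \sum_(1 <= i < L.+1) C * D j.
    by rewrite sumr_const_nat subn1 /= mulr_natl.
  rewrite -sumrB; apply: le_trans (ler_norm_sum _ _ _) _.
  rewrite !big_seq; apply: ler_sum => i; rewrite mem_index_iota => iL.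
  apply: hC; first by apply: sumr_ge0 => k _; exact: psi_ge0.
  move=> k /andP[k1 kL].
  apply: le_trans (@psi_block _ (fun k => c (k + j * L)%N) L k i _ _) _ => //; first by rewrite k1 ltnW.
  by rewrite /D [leRHS]big_nat_recr//= lerDl psi_ge0.
have hS : `|L%:R * \sum_(j < M) Vt B f L (fun k => c (k + j * L)%N) -
    \sum_(1 <= k < (M * L).+1) hL L (c k)| <=
    L%:R * (C * \sum_(1 <= k < (M * L).+1) psi (c k) (c k.+1)).
  rewrite -(sum_blocks (fun k => hL L (c k))) -(sum_blocks (fun k => psi (c k) (c k.+1))).
  rewrite !mulr_sumr -sumrB; apply: le_trans (ler_norm_sum _ _ _) _.
  by apply: ler_sum => j _; exact: hD.
have psib k : 0 <= psi (c k) (c k.+1) <= 1 by rewrite psi_ge0 psi_le1.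
have hb k : 0 <= hL L (c k) <= L%:R by exact: Vt_bound.
have MLN : (M * L <= N.+1)%N by rewrite leq_trunc_div.
have /andP[_ p1] := sum_extra psib (leqnSn N).
have /andP[p2 _] := sum_extra psib MLN.
have /andP[q1 q2] := sum_extra hb (leqnSn N).
have /andP[q3 q4] := sum_extra hb MLN.
have e1 : (N.+1 - N)%N = 1%N by rewrite subSnn.
have e2 : (N.+1 - M * L <= L)%N by rewrite eN addnK ltnW.
rewrite e1 in p1 q2.
have e3 : (N.+1 - M * L)%:R * L%:R <= L%:R * L%:R :> R by rewrite ler_pM2r// ler_nat.
have rL' : r%:R <= L%:R :> R by rewrite ler_nat ltnW.
rewrite -(ler_pM2l Lp) -[X in X * _ <= _](ger0_norm (ltW Lp)) -normrM mulrBr mulrA divff ?gt_eqF// mul1r.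
have -> : L%:R * (N.+1%:R / L%:R + (1 + 2 * L%:R + C) + C * \sum_(1 <= k < N.+1) psi (c k) (c k.+1)) =
  L%:R * (N.+1%:R / L%:R + 1 + L%:R) + L%:R * L%:R + L%:R * (C * (\sum_(1 <= k < N.+1) psi (c k) (c k.+1) + 1)) by ring.
have t1 : `|L%:R * Vt B f N.+1 c - L%:R * \sum_(j < M) Vt B f L (fun k => c (k + j * L)%N)| <=
    L%:R * (N.+1%:R / L%:R + 1 + L%:R).
  rewrite -mulrBr normrM (ger0_norm (ltW Lp)) ler_pM2l//; apply: le_trans h1 _; lra.
have t2 : `|\sum_(1 <= k < (M * L).+1) hL L (c k) - \sum_(1 <= k < N.+1) hL L (c k)| <= L%:R * L%:R.
  have LL : L%:R <= L%:R * L%:R :> R by rewrite ler_peMl// ler1n.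
  rewrite ler_norml; apply/andP; split; lra.
have t3 : L%:R * (C * \sum_(1 <= k < (M * L).+1) psi (c k) (c k.+1)) <=
   L%:R * (C * (\sum_(1 <= k < N.+1) psi (c k) (c k.+1) + 1)).
  by rewrite ler_pM2l//; apply: ler_wpM2l => //; lra.
move: t1 t2 hS t3; rewrite !ler_norml => /andP[? ?] /andP[? ?] /andP[? ?] ?.
by apply/andP; split; lra.
Qed.

End fixed_ramp.
End expectation.

Section pairs.
Variables (R : realType) (sigma : nat -> nat -> R) (mu_T : probability R R).
Hypothesis hw : weak_cvg2 (sigma_pairs sigma) (law_diag mu_T).

Lemma cvg_inv0 : (n%:R^-1 : R) @[n --> \oo] --> (0 : R).
Proof. by rewrite -cvg_shiftS; exact: cvg_harm0. Qed.

Lemma pairs_cvg (phi : R * R -> R) : continuous phi -> (exists M, forall x, `|phi x| <= M) ->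
  N%:R^-1 * \sum_(1 <= k < N) phi (sigma k N, sigma k.+1 N) @[N --> \oo] --> \int[mu_T]_t phi (t, t).
Proof.
move=> cphi bphi; have mphi : measurable_fun setT phi.
  have h := @measurable_comp_continuous R _ (R * R)%type (fun q p => phi (q, p.2)) fst.
  rewrite (_ : phi = fun p => phi (p.1, p.2)); last by apply/funext => -[].
  apply: h => // [q|p].
    apply: (@measurableT_comp _ _ _ _ _ _ (fun y => phi (q, y))) => //.
    apply: continuous_measurable_fun => x.
    by apply: (@continuous2_cvg _ _ _ _ (nbhs x) _ (fun=> q) id (fun u v => phi (u, v)));
      [rewrite /=; under eq_fun do rewrite -surjective_pairing; exact: cphi|exact: cvg_cst|exact: cvg_id].
  move=> x; apply: (@continuous2_cvg _ _ _ _ (nbhs x) _ id (fun=> p.2) (fun u v => phi (u, v)));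
    [rewrite /=; under eq_fun do rewrite -surjective_pairing; exact: cphi|exact: cvg_id|exact: cvg_cst].
(* The empirical measure of the pairs is normalized by [N - 1] and the average by [N]; their ratio
   tends to 1. *)
have -> : \int[mu_T]_t phi (t, t) = (1 - 0) * \int[law_diag mu_T]_p phi p.
  rewrite subr0 mul1r /law_diag (Eb_law mu_T measurable_diagR)//.
apply: (@cvg_trans _ ((fun N : nat => (1 - N%:R^-1) * \int[sigma_pairs sigma N]_p phi p) @ \oo)); last first.
  by apply: cvgM; [apply: cvgB; [exact: cvg_cst|exact: cvg_inv0]|exact: hw].
apply: near_eq_cvg; near=> N; have N0 : (1 < N)%N by near: N; exact: nbhs_infty_gt.
rewrite /sigma_pairs Rintegral_empirical// size_map size_iota big_map mulrA; congr (_ * _).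
rewrite natrB ?(ltnW N0)//; field.
by rewrite pnatr_eq0 -lt0n (ltnW N0) subr_eq0 pnatr_eq1 gtn_eqF.
Unshelve. all: by end_near. Qed.

End pairs.

Section averages.
Variables (R : realType) (beta : probability R R) (B : probability (seqS R) R).
Hypothesis hB : indlaw (fun=> beta) B.
Hypothesis hb2 : beta.-integrable setT (EFin \o (fun b : R => b ^+ 2)).
Let m2 := \int[beta]_b (b ^+ 2).
Variables (sigma : nat -> nat -> R) (mu_T : probability R R).
Hypothesis hw : weak_cvg2 (sigma_pairs sigma) (law_diag mu_T).

Lemma bcont_scale (f : R -> R) t : bcont f -> bcont (fun x => f (t * x)).
Proof.
move=> [cf [M hM]]; split; last by exists M.
move=> x; apply: (@continuous_comp _ _ _ (fun x => t * x) f); last exact: cf.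
by apply: cvgM; [exact: cvg_cst|exact: cvg_id].
Qed.

Lemma hL_Tavg (f : R -> R) L t : L%:R^-1 * hL B f L t = Tavg B (fun x => f (t * x)) L.
Proof.
rewrite /Tavg mulrC; congr (_ / _); apply: eq_Rintegral => s _.
rewrite /stsum -(tsum_scale f L t (fun=> 0) s); congr tsum.
by apply/funext => k; rewrite mulr0.
Qed.

Lemma law_mul_Eb (f : R -> R) : bcont f ->
  \int[law_mul mu_T (mu_b hB)]_x f x = \int[mu_T]_t \int[mu_b hB]_x f (t * x).
Proof.
move=> bf; have bf' := bcont_bdm bf.
rewrite /law_mul (Eb_law (mu_T \x mu_b hB)%E measurable_prodR bf').
by rewrite Eb_fubini//; apply: bdm_comp bf' _; exact: measurable_prodR.
Qed.

Section fixed_ramp.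
Variable f : R -> R.
Variable K : R.
Hypothesis bf : bcont f.
Hypothesis f01 : forall x, 0 <= f x <= 1.
Hypothesis fni : {homo f : x y /~ x <= y}.
Hypothesis K0 : 0 <= K.
Hypothesis hf : forall x y, `|f x - f y| <= K * `|x - y|.

Lemma hL_bound L t : `|hL B f L t| <= L%:R.
Proof. by have /andP[? ?] := @Vt_bound _ B _ bf f01 L (fun=> t); rewrite ger0_norm. Qed.

Lemma hL_continuous L : continuous (hL B f L).
Proof.
have [C C0 hC] := hL_lip hB hb2 bf f01 K0 hf L.
apply: (@lip_continuous _ _ C) => x y.
apply: le_trans (hC (fun=> x) y (psi x y) (psi_ge0 _ _) _) _ => //.
by rewrite ler_wpM2l// /psi ge_min lexx orbT.
Qed.

Lemma hL_limit : L%:R^-1 * \int[mu_T]_t hL B f L t @[L --> \oo] -->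
  \int[law_mul mu_T (mu_b hB)]_x f x.
Proof.
have hb L : bcont (fun t => L%:R^-1 * hL B f L t).
  apply: bcontZ; split; first exact: hL_continuous.
  by exists L%:R => x; exact: hL_bound.
have e L : L%:R^-1 * \int[mu_T]_t hL B f L t = \int[mu_T]_t (L%:R^-1 * hL B f L t).
  rewrite EbZ//; split; last first.
    by exists L%:R => x; exact: hL_bound.
  by apply: continuous_measurable_fun; exact: hL_continuous.
under eq_fun do rewrite e.
rewrite law_mul_Eb//; apply: (@Eb_cvg _ _ _ _ _ _ 1).
- by move=> L; exact: bcont_bdm.
- have := @bdm_inner _ _ _ _ _ mu_T (mu_b hB) (fun p => f (p.1 * p.2)); apply.
  by apply: bdm_comp (bcont_bdm bf) _; exact: measurable_prodR.
- move=> L t; have h1 := hL_bound L t.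
  have [->|L0] := posnP L; first by rewrite invr0 mul0r normr0.
  rewrite normrM ger0_norm ?invr_ge0//.
  by rewrite ler_pdivrMl ?ltr0n// mulr1.
- move=> t; rewrite -cvg_shiftS /=; under eq_fun do rewrite hL_Tavg.
  by apply: Tavg_cvg; exact: bcont_scale.
Qed.

(** First [N] grows with the block length fixed, which leaves an error [1 / L]. The average of [psi]
    over consecutive weights vanishes in the limit because the limit law of the pairs is carried by
    the diagonal. *)
Lemma Vavg_cvg : N%:R^-1 * Vt B f N (sigma ^~ N) @[N --> \oo] -->
  \int[law_mul mu_T (mu_b hB)]_x f x.
Proof.
apply/cvgrPdist_le => e e0.
have e4 : 0 < e / 4 by rewrite divr_gt0.
have /cvgrPdist_le/(_ _ e4)[L1 _ hL1] := hL_limit.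
have [L2 L20 hL2] := small_inv e4.
pose L := (L1 + L2)%N.
have L0 : (0 < L)%N by rewrite /L; lia.
have {}hL1 := hL1 L (leq_addr _ _).
have {}hL2 : L%:R^-1 <= e / 4.
  apply: le_trans hL2; rewrite lef_pV2 ?posrE ?ltr0n// ler_nat /L; lia.
have [C C0 hC] := hL_lip hB hb2 bf f01 K0 hf L.
have c1 := @pairs_cvg _ _ _ hw (fun p => hL B f L p.1).
have c2 := @pairs_cvg _ _ _ hw (fun p => psi p.1 p.2).
have {}c1 : N%:R^-1 * \sum_(1 <= k < N) hL B f L (sigma k N) @[N --> \oo] --> \int[mu_T]_t hL B f L t.
  apply: c1.
    move=> p; apply: (@continuous_comp _ _ _ fst (hL B f L)); last exact: hL_continuous.
    exact: cvg_fst.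
  by exists L%:R => x; exact: hL_bound.
have {}c2 : N%:R^-1 * \sum_(1 <= k < N) psi (sigma k N) (sigma k.+1 N) @[N --> \oo] --> (0 : R).
  have := c2; rewrite (_ : \int[mu_T]_t _ = 0).
    apply; last by exists 1 => p; rewrite ger0_norm ?psi_ge0 ?psi_le1.
    move=> p; apply: (@continuous_min _ _ (fun=> 1) (fun p : R * R => `|p.1 - p.2| : R^o)); first exact: cvg_cst.
    by apply: cvg_norm; apply: cvgB; [exact: cvg_fst|exact: cvg_snd].
  by rewrite -[RHS](EbC mu_T); apply: eq_Rintegral => t _; exact: psi_refl.
have {}c1 : L%:R^-1 * (N%:R^-1 * \sum_(1 <= k < N) hL B f L (sigma k N)) @[N --> \oo] --> L%:R^-1 * \int[mu_T]_t hL B f L t.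
  by apply: cvgMr.
have c3 : (1 + 2 * L%:R + C) * N%:R^-1 + C * (N%:R^-1 * \sum_(1 <= k < N) psi (sigma k N) (sigma k.+1 N)) @[N --> \oo] --> (1 + 2 * L%:R + C) * 0 + C * 0.
  by apply: cvgD; apply: cvgMr => //; exact: cvg_inv0.
rewrite !mulr0 addr0 in c3.
move/cvgrPdist_le/(_ _ e4) : c1 => c1; move/cvgrPdist_le/(_ _ e4) : c3 => c3.
near=> N; have N0 : (0 < N)%N by near: N; exact: nbhs_infty_gt.
have d1 : `|L%:R^-1 * \int[mu_T]_t hL B f L t - L%:R^-1 * (N%:R^-1 * \sum_(1 <= k < N) hL B f L (sigma k N))| <= e / 4 by near: N.
have d3 : `|0 - ((1 + 2 * L%:R + C) * N%:R^-1 + C * (N%:R^-1 * \sum_(1 <= k < N) psi (sigma k N) (sigma k.+1 N)))| <= e / 4 by near: N.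
have := Vt_average hB bf f01 fni (sigma ^~ N) L0 N0 C0 hC.
have Np : 0 < N%:R^-1 :> R by rewrite invr_gt0 ltr0n.
rewrite -(ler_pM2l Np) -[X in X * _ <= _ -> _](ger0_norm (ltW Np)) -normrM mulrBr.
have -> : N%:R^-1 * (N%:R / L%:R + (1 + 2 * L%:R + C) + C * \sum_(1 <= k < N) psi (sigma k N) (sigma k.+1 N)) =
  L%:R^-1 + ((1 + 2 * L%:R + C) * N%:R^-1 + C * (N%:R^-1 * \sum_(1 <= k < N) psi (sigma k N) (sigma k.+1 N))).
  by field; rewrite !pnatr_eq0 -!lt0n N0 L0.
rewrite mulrCA; move: d3; rewrite sub0r normrN => d3 h.
have {}d3 := le_trans (ler_norm _) d3.
move: d1 h hL1 d3 hL2; rewrite /= !ler_norml => /andP[? ?] /andP[? ?] /andP[? ?] ? ?.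
by apply/andP; split; lra.
Unshelve. all: by end_near. Qed.

End fixed_ramp.
End averages.

Lemma cvge0_lt (R : realType) (u : nat -> \bar R) (e : R) : 0 < e -> u @ \oo --> 0%E ->
  \forall n \near \oo, (u n < e%:E)%E.
Proof.
move=> e0 hu; apply: (hu [set y | (y < e%:E)%E]).
by apply: open_nbhs_nbhs; split; [exact: open_ereal_lt_ereal|rewrite /= lte_fin].
Qed.

(** * Removal of the diagonal and almost sure convergence *)

Section weak_limit.
Context d (Omega : measurableType d) (R : realType) (P : probability Omega R).
Variables (b : nat -> {RV P >-> R}) (a : nat -> nat -> {RV P >-> R}).
Variable sigma : nat -> nat -> R.
Variables (beta : probability R R) (B : probability (seqS R) R).
Hypothesis hB : indlaw (fun=> beta) B.
Hypothesis hb2 : beta.-integrable setT (EFin \o (fun b : R => b ^+ 2)).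
Hypothesis indep : mutually_independent coef_index (coef_family b a).
Hypothesis hb : forall k : nat, (1 <= k)%N -> measure_eq (distribution P (b k)) beta.
Hypothesis ha : (fun N : nat => (N%:R^-1)%:E *
  \sum_(1 <= k < N.+1) 'E_P[fun w => (`|a k N w| ^+ 2)%R])%E @ \oo --> 0%E.

Let g (i : nat) : nat + nat * nat := inl i.+1.

Lemma indlaw_b : indlaw (fun=> beta) (law P (measurable_seqRV (coef_family b a) g)).
Proof.
have ig : injective g by move=> i j [].
have Dg i : coef_index (g i) by [].
move=> J A mA; apply: etrans; first exact: (indep_indlaw indep ig Dg).
by apply: eq_bigr => i _; apply: (hb (ltn0Sn i)); exact: mA.
Qed.

Lemma Eb_b (h : seqS R -> R) : bdm h -> \int[P]_w h (fun i => b i.+1 w) = \int[B]_s h s.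
Proof.
move=> bh; rewrite -(Eb_law P (measurable_seqRV (coef_family b a) g) bh).
apply: Eb_measure_eq; first by case: bh.
exact: (indlaw_unique indlaw_b hB).
Qed.

Lemma Eb_tsum_b (f : R -> R) N : bcont f ->
  \int[P]_w tsum f N (fun=> 0) (fun k => sigma k N * b k w) = Vt B f N (sigma ^~ N).
Proof.
move=> bf; have bw := bdm_wtsum N (sigma ^~ N) bf.
have bs : bdm (fun s : seqS R => tsum f N (fun=> 0) (fun k => sigma k N * s k.-1)).
  apply: (@bdm_tsum_bcont R _ _ f N (fun k (s : seqS R) => 0)
    (fun k (s : seqS R) => sigma k N * s k.-1)) => // k.
  by apply: measurable_funM => //; exact: measurable_coord.
rewrite /Vt; transitivity (\int[B]_s tsum f N (fun=> 0) (fun k => sigma k N * s k.-1)).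
  rewrite -(Eb_b bs); apply: eq_Rintegral => w _; apply: eq_tsum => k /andP[k1 _] //.
  by rewrite prednK.
rewrite -(shift_law hB 1 bs); apply: eq_Rintegral => s _; apply: eq_tsum => k /andP[k1 _] //.
by rewrite /sshift addn1 prednK.
Qed.

Lemma a_sq N k : ('E_P[fun w => (`|a k N w| ^+ 2)%R] = \int[P]_w (a k N w ^+ 2)%:E)%E.
Proof.
by rewrite unlock; apply: eq_integral => w _; rewrite real_normK// num_real.
Qed.

Section fixed_ramp.
Variable f : R -> R.
Variable K : R.
Hypothesis bf : bcont f.
Hypothesis f01 : forall x, 0 <= f x <= 1.
Hypothesis fni : {homo f : x y /~ x <= y}.
Hypothesis K0 : 0 <= K.
Hypothesis hf : forall x y, `|f x - f y| <= K * `|x - y|.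

(* AM-GM: [sqrt x <= (e + x / e) / 2] *)
Lemma sqrt_amgm (x e : R) : 0 <= x -> 0 < e -> Num.sqrt x <= e / 2 + (2 * e)^-1 * x.
Proof.
move=> x0 e0; have e2 : 0 < 2 * e by rewrite mulr_gt0.
have hs := sqr_sqrtr x0; have s0 := sqrtr_ge0 x.
rewrite -(ler_pM2l e2).
have -> : 2 * e * (e / 2 + (2 * e)^-1 * x) = e ^+ 2 + Num.sqrt x ^+ 2.
  by rewrite hs; field; rewrite gt_eqF.
have := sqr_ge0 (Num.sqrt x - e); lra.
Qed.

(** The Hilbert-Schmidt cost of deleting the diagonal is the sum of the squares of its entries. With
    the root linearized by [sqrt_amgm], a mean of at most [e^2] contributes [e / 2], and the
    constant term another [e / 2]. *)
Lemma EZ_remove_a N (e : R) : (0 < N)%N -> 0 < e ->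
  ((N%:R^-1)%:E * \sum_(1 <= k < N.+1) 'E_P[fun w => (`|a k N w| ^+ 2)%R] <= (e ^+ 2)%:E)%E ->
  `|\int[P]_w Zavg b a sigma f N w - N%:R^-1 * Vt B f N (sigma ^~ N)| <= K * e.
Proof.
move=> N0 e0 hae; have Np : 0 < N%:R^-1 :> R by rewrite invr_gt0 ltr0n.
have bz : bdm (fun w => N%:R^-1 * tsum f N (fun=> 0) (fun k => sigma k N * b k w)).
  apply: bdmM; first exact: bdm_cst.
  apply: (@bdm_tsum_bcont _ _ _ f N (fun k w => 0) (fun k w => sigma k N * b k w)) => // k.
  by apply: measurable_funM.
have bt : bdm (fun w => tsum f N (fun=> 0) (fun k => sigma k N * b k w)).
  apply: (@bdm_tsum_bcont _ _ _ f N (fun k w => 0) (fun k w => sigma k N * b k w)) => // k.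
  by apply: measurable_funM.
rewrite -(Eb_tsum_b N bf) -EbZ// -EbB//; last exact: bdm_Zavg.
pose c0 := K * (e / 2); pose c1 := K * (2 * e)^-1 * N%:R^-1.
have c00 : 0 <= c0 by rewrite mulr_ge0// divr_ge0// ltW.
have c10 : 0 <= c1 by rewrite !mulr_ge0// ?invr_ge0 ?mulr_ge0// ltW.
rewrite -lee_fin.
apply: (@le_trans _ _ (\int[P]_w (c0 + c1 * \sum_(k <- index_iota 1 N.+1) a k N w ^+ 2)%:E)%E).
  apply: Eb_le_integral; first by apply: bdmB => //; exact: bdm_Zavg.
    apply/measurable_EFinP/measurable_funD => //; apply: measurable_funM => //.
    by apply: measurable_sum => k; exact: measurable_funX.
  move=> w; rewrite lee_fin /Zavg -mulrBr normrM (ger0_norm (ltW Np)).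
  apply: le_trans (ler_wpM2l (ltW Np) (tsum_lipschitz N _ _ _ _ K0 hf)) _.
  set S := \sum_(1 <= k < N.+1) a k N w ^+ 2.
  have S0 : 0 <= S by apply: sumr_ge0 => k _; exact: sqr_ge0.
  have E0 : \sum_(1 <= k < N) (sigma k N * b k w - sigma k N * b k w) ^+ 2 = 0.
    by rewrite big1// => k _; rewrite subrr expr0n.
  have E1 : \sum_(1 <= k < N.+1) (a k N w - 0) ^+ 2 = S by apply: eq_bigr => k _; rewrite subr0.
  rewrite E0 E1 mulr0 addr0 mulrCA.
  have -> : N%:R^-1 * Num.sqrt (N%:R * S) = Num.sqrt (N%:R^-1 * S).
    have n0 : N%:R != 0 :> R by rewrite pnatr_eq0 -lt0n.
    rewrite -[X in X * _](ger0_norm (ltW Np)) -sqrtr_sqr -sqrtrM ?sqr_ge0//.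
    by congr Num.sqrt; field.
  apply: le_trans (ler_wpM2l K0 (sqrt_amgm (mulr_ge0 (ltW Np) S0) e0)) _.
  by rewrite le_eqVlt; apply/orP; left; apply/eqP; rewrite /c0 /c1; ring.
rewrite integral_affine_sq//.
under eq_bigr do rewrite -a_sq.
have -> : (c1%:E = (K * (2 * e)^-1)%:E * (N%:R^-1)%:E)%E by [].
rewrite -muleA.
apply: (@le_trans _ _ (c0%:E + (K * (2 * e)^-1)%:E * (e ^+ 2)%:E)%E).
  by rewrite leeD2l// lee_wpmul2l// lee_fin mulr_ge0// invr_ge0 mulr_ge0// ltW.
rewrite -EFinM -EFinD lee_fin /c0 le_eqVlt; apply/orP; left; apply/eqP; field.
by rewrite gt_eqF.
Qed.

Variable mu_T : probability R R.
Hypothesis hw : weak_cvg2 (sigma_pairs sigma) (law_diag mu_T).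

Lemma EZ_cvg : \int[P]_w Zavg b a sigma f N w @[N --> \oo] --> \int[law_mul mu_T (mu_b hB)]_x f x.
Proof.
apply/cvgrPdist_le => e e0; have e2 : 0 < e / 2 by rewrite divr_gt0.
have /cvgrPdist_le/(_ _ e2) hV := @Vavg_cvg _ _ _ hB hb2 _ _ hw _ _ bf f01 fni K0 hf.
pose e' := e / (2 * (K + 1)).
have K1 : 0 < K + 1 by rewrite ltr_wpDl.
have e'0 : 0 < e' by rewrite divr_gt0// mulr_gt0.
have hK : K * e' <= e / 2.
  have : K * e' <= (K + 1) * e' by rewrite ler_pM2r// lerDl.
  by have -> : (K + 1) * e' = e / 2 by rewrite /e'; field; rewrite gt_eqF.
have haN : \forall N \near \oo, ((N%:R^-1)%:E * \sum_(1 <= k < N.+1) 'E_P[fun w => (`|a k N w| ^+ 2)%R] <= (e' ^+ 2)%:E)%E.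
  have e'2 : 0 < e' ^+ 2 by rewrite exprn_gt0.
  by have := cvge0_lt e'2 ha; apply: filterS => N /ltW.
near=> N; have N0 : (0 < N)%N by near: N; exact: nbhs_infty_gt.
have h1 : `|\int[law_mul mu_T (mu_b hB)]_x f x - N%:R^-1 * Vt B f N (sigma^~ N)| <= e / 2 by near: N.
have h2 := EZ_remove_a N0 e'0.
have {}h2 : `|\int[P]_w Zavg b a sigma f N w - N%:R^-1 * Vt B f N (sigma ^~ N)| <= K * e'.
  by apply: h2; near: N.
move: h1 h2; rewrite !ler_norml => /andP[? ?] /andP[? ?].
by apply/andP; split; lra.
Unshelve. all: by end_near. Qed.

End fixed_ramp.

Lemma esd_integral (f : R -> R) N w : measurable_fun setT f ->
  \int[esd (Xmat b a sigma N w)]_x f x = Zavg b a sigma f N w.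
Proof.
move=> mf; rewrite /esd Rintegral_empirical// size_map size_enum_ord big_map.
by rewrite /Zavg /tsum big_enum.
Qed.

Variable mu_T : probability R R.
Hypothesis hw : weak_cvg2 (sigma_pairs sigma) (law_diag mu_T).

Lemma EZ_ramp_cvg q j m : \int[P]_w Zavg b a sigma (ramp q j m) N w @[N --> \oo] -->
  \int[law_mul mu_T (mu_b hB)]_x ramp q j m x.
Proof.
apply: (@EZ_cvg _ q%:R) => //; [exact: bcont_ramp|exact: ramp01|exact: ramp_noninc|exact: ramp_lip].
Qed.

Lemma Z_ramp_cvg : {ae P, forall w, forall q j m,
  Zavg b a sigma (ramp q j m) N w @[N --> \oo] --> \int[law_mul mu_T (mu_b hB)]_x ramp q j m x}.
Proof.
have := Zavg_concentration sigma indep; apply: filterS => w hw' q j m.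
have := @cvgD _ _ _ \oo _ _ _ _ _ (hw' q j m) (@EZ_ramp_cvg q j m); rewrite add0r.
rewrite (_ : _ + _ = fun N => Zavg b a sigma (ramp q j m) N w); first exact.
by apply/funext => N /=; rewrite [LHS]subrK.
Qed.

Lemma esd_weak_cvg : {ae P, forall w, weak_cvg (fun N => esd (Xmat b a sigma N w))
                                    (law_mul mu_T (mu_b hB))}.
Proof.
have := Z_ramp_cvg; apply: filterS => w hr f cf bf.
have bcf : bcont f by [].
have mf : measurable_fun setT f by case: (bcont_bdm bcf).
rewrite (_ : (fun N => _) = fun N => Zavg b a sigma f N w); last first.
  by apply/funext => N; exact: esd_integral.
(* The functional is normalized only for positive sizes, so the index starts at 1. *)
rewrite -(cvg_shiftS (fun N => Zavg b a sigma f N w)).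
apply: (@weak_of_ramps _ (fun n f => Zavg b a sigma f n.+1 w) (fun f => \int[law_mul mu_T (mu_b hB)]_x f x)) => //.
- move=> n; split=> [f1 g1 bf1 bg1|c f1 bf1||f1 g1 bf1 bg1 fg1]; rewrite /Zavg /tsum.
  + by rewrite -mulrDr -big_split.
  + by rewrite -mulr_sumr mulrCA.
  + by rewrite sumr_const card_ord mulVf// pnatr_eq0.
  + by rewrite ler_pM2l ?invr_gt0 ?ltr0n//; apply: ler_sum.
- exact: posfun_integral.
- exact: tight_integral.
- by move=> q j m; rewrite (cvg_shiftS (fun n => Zavg b a sigma (ramp q j m) n w)); exact: hr.
Qed.

End weak_limit.

Lemma stieltjes_law_mul (R : realType) (mu nu : probability R R) (z : R[i]) :
  0 < complex.Im z ->
  stieltjes (law_mul mu nu) z =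
  Cintegral (mu \x nu)%E (fun p : R * R => (z - (p.1 * p.2)%:C)^-1).
Proof.
move=> z0; rewrite /stieltjes /law_mul.
exact: (CEb_law (mu \x nu)%E measurable_prodR (bdmC_kernel z0)).
Qed.

(** * Convergence in the Wasserstein distance *)

Section measure_lemmas.
Context d (T : measurableType d) (R : realType).

Section total_mass_one.
Variables (m : {measure set T -> \bar R}) (m1 : m setT = 1%E).
(** The alias takes the proof of total mass one as an argument, so that the structure of a
    probability can be attached to it. *)
Definition normed_measure of m setT = 1%E : set T -> \bar R := m.
HB.instance Definition _ := Measure.on (normed_measure m1).
HB.instance Definition _ := Measure_isProbability.Build _ _ _ (normed_measure m1) m1.
Definition mkprob : probability T R := normed_measure m1.
End total_mass_one.

Definition pushm d' (T' : measurableType d') (m : {measure set T -> \bar R}) (f : T -> T')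
  (mf : measurable_fun setT f) : {measure set T' -> \bar R}.
Proof. by refine (pushforward m f : {measure set T' -> \bar R}); exact: mf. Defined.

Lemma ge0_integral_mrestr (mu : {measure set T -> \bar R}) (D : set T) (mD : measurable D) (f : T -> \bar R) :
  measurable_fun setT f -> (forall x, 0 <= f x)%E ->
  (\int[mrestr mu mD]_x f x = \int[mu]_(x in D) f x)%E.
Proof.
move=> mf f0; have mDc : measurable (~` D) by exact: measurableC.
have mfD E : measurable_fun E f by exact: measurable_funTS.
rewrite -{1}(setUv D) ge0_integral_setU//; last first.
- by apply/disj_set2P; rewrite setICr.
rewrite (_ : (\int[_]_(x in ~` D) _)%E = 0%E).
  rewrite adde0; apply: eq_measure_integral => A mA AD.
  by rewrite /= /mrestr (setIidl AD).
apply: null_set_integral => //=.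
by rewrite /mrestr setICl measure0.
Qed.

End measure_lemmas.

(** * Couplings of an empirical measure as splittings of the other marginal *)

Section wasserstein.
Variable R : realType.
Implicit Types (mu nu : {measure set R -> \bar R}).

Definition cost (pi : {measure set (R * R) -> \bar R}) : \bar R :=
  (\int[pi]_p (`|p.1 - p.2| ^+ 2)%:E)%E.

Lemma cost_ge0 pi : (0 <= cost pi)%E.
Proof. by apply: integral_ge0 => p _; rewrite lee_fin sqr_ge0. Qed.

Lemma measurable_cost : measurable_fun setT (fun p : R * R => (`|p.1 - p.2| ^+ 2)%:E).
Proof.
apply/measurable_EFinP; apply: measurable_funX; apply: measurableT_comp => //.
exact: measurable_funB.
Qed.

Lemma root_lee (x : \bar R) (c : R) : (0 <= x)%E -> 0 <= c ->
  (x <= (c ^+ 2)%:E)%E -> (x `^ 2^-1 <= c%:E)%E.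
Proof.
move=> x0 c0 xc.
have -> : c%:E = ((c ^+ 2)%:E `^ 2^-1)%E.
  by rewrite poweR_EFin powR12_sqrt ?sqr_ge0// sqrtr_sqr ger0_norm.
apply: gt0_ler_poweR => //.
- by rewrite in_itv /= x0 leey.
- by rewrite in_itv /= lee_fin sqr_ge0 leey.
Qed.

Lemma root_gee (x : \bar R) (c : R) : 0 <= c ->
  ((c ^+ 2)%:E <= x)%E -> (c%:E <= x `^ 2^-1)%E.
Proof.
move=> c0 xc.
have -> : c%:E = ((c ^+ 2)%:E `^ 2^-1)%E.
  by rewrite poweR_EFin powR12_sqrt ?sqr_ge0// sqrtr_sqr ger0_norm.
have x0 : (0 <= x)%E by apply: le_trans xc; rewrite lee_fin sqr_ge0.
apply: gt0_ler_poweR => //.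
- by rewrite in_itv /= lee_fin sqr_ge0 leey.
- by rewrite in_itv /= x0 leey.
Qed.

Lemma W2_ge0 mu nu : (0 <= W2 mu nu)%E.
Proof. by apply: le_ereal_inf_tmp => _ [pi _ <-]; exact: poweR_ge0. Qed.

Lemma W2_le mu nu pi (c : R) : 0 <= c -> coupling mu nu pi ->
  (cost pi <= (c ^+ 2)%:E)%E -> (W2 mu nu <= c%:E)%E.
Proof.
move=> c0 hpi hc; apply: ge_ereal_inf; exists (cost pi `^ 2^-1)%E; first by exists pi.
exact: root_lee (cost_ge0 pi) c0 hc.
Qed.

Lemma W2_lt mu nu (c : R) : 0 <= c -> (W2 mu nu < c%:E)%E ->
  exists2 pi, coupling mu nu pi & (cost pi < (c ^+ 2)%:E)%E.
Proof.
move=> c0 /ereal_inf_lt[_ [pi hpi <-] hc]; exists pi => //.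
by rewrite ltNge; apply/negP => /(root_gee c0); rewrite leNgt hc.
Qed.

(* A coupling of the empirical measure of x and nu splits nu into parts of mass 1 / n, the i-th
   one being transported to x i. *)
Definition split_of n (nu : {measure set R -> \bar R}) (rho : nat -> {measure set R -> \bar R}) :=
  (forall i, (i < n)%N -> rho i setT = (n%:R^-1)%:E) /\
  forall A, measurable A -> (\sum_(i < n) rho i A = nu A)%E.

Definition split_cost n (x : nat -> R) (rho : nat -> {measure set R -> \bar R}) : \bar R :=
  (\sum_(i < n) \int[rho i]_y ((x i - y) ^+ 2)%:E)%E.

Definition emp n (x : nat -> R) : {measure set R -> \bar R} := empirical_measure R (mkseq x n).

Lemma empE n x A : emp n x A = ((n%:R^-1)%:E * \sum_(i < n) \d_(x i) A)%E.
Proof.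
rewrite /emp /empirical_measure /= /mscale /= /msum size_mkseq; congr (_ * _)%E.
by apply: eq_bigr => i _; rewrite nth_mkseq.
Qed.

Let measurable_graph (u : R) : measurable_fun setT (fun y : R => (u, y)).
Proof. exact: measurable_fun_pair. Qed.

(** The part [rho i] is pushed along [y |-> (x i, y)], and the images are added. *)
Lemma coupling_of_split n (x : nat -> R) nu rho : (0 < n)%N -> nu setT = 1%E -> split_of n nu rho ->
  exists2 pi, coupling (emp n x) nu pi & cost pi = split_cost n x rho.
Proof.
move=> n0 nu1 [rho1 rhoS].
pose m_ (i : nat) : {measure set (R * R) -> \bar R} := pushm (rho i) (measurable_graph (x i)).
pose m : {measure set (R * R) -> \bar R} := msum m_ n.
have m1 : m setT = 1%E.
  rewrite /m /= /msum /= /pushforward /= -nu1 -rhoS//.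
exists (mkprob m1).
  move=> A mA; split.
    rewrite empE /= /normed_measure /m /= /msum ge0_sume_distrr//.
    apply: eq_bigr => i _; rewrite /m_ /= /pushforward diracE.
    case: (boolP (x i \in A)) => xA.
      rewrite mule1 -(rho1 i)//; congr (rho i _); apply/seteqP; split => // y _ /=.
      by split=> //; exact: set_mem.
    rewrite mule0 -(measure0 (rho i)); congr (rho i _); apply/seteqP; split => // y [/= h _].
    by move: xA; rewrite notin_setE.
  rewrite -rhoS//= /normed_measure /m /= /msum; apply: eq_bigr => i _.
  by rewrite /m_ /= /pushforward; congr (rho i _); apply/seteqP; split => y //= [].
rewrite /cost /split_cost.
transitivity (\int[m]_p (`|p.1 - p.2| ^+ 2)%:E)%E; first by [].
rewrite /m ge0_integral_measure_sum//; last exact: measurable_cost.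
apply: eq_bigr => i _; rewrite /m_ ge0_integral_pushforward//.
- by rewrite preimage_setT; apply: eq_integral => y _; rewrite /= real_normK ?num_real.
- exact: measurable_cost.
Qed.

(** The coupling is restricted to the first coordinate being [x i]. Points may coincide, so the mass
    found there is shared equally between the [k i] indices with the same point. *)
Lemma split_of_coupling n (x : nat -> R) nu pi : (0 < n)%N -> coupling (emp n x) nu pi ->
  exists2 rho, split_of n nu rho & (split_cost n x rho <= cost pi)%E.
Proof.
move=> n0 hpi.
pose D i : set (R * R) := [set x i] `*` setT.
have mD i : measurable (D i) by apply: measurableX.
pose k i : nat := (\sum_(j < n) (x j == x i))%N.
have k0 i : (i < n)%N -> (0 < k i)%N.
  by move=> hi; rewrite /k (bigD1 (Ordinal hi))// eqxx.
have kinv i : 0 <= (k i)%:R^-1 :> R by rewrite invr_ge0.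
pose rho i : {measure set R -> \bar R} :=
  mscale (NngNum (kinv i)) (pushm (mrestr pi (mD i)) measurable_snd).
have rhoE i A : rho i A = ((k i)%:R^-1%:E * pi (D i `&` (setT `*` A)))%E.
  rewrite /rho /= /mscale /= /pushforward /mrestr setIC; congr (_ * pi (_ `&` _))%E.
  by apply/seteqP; split => p //= [].
have piD i : pi (D i) = ((n%:R^-1)%:E * (k i)%:R%:E)%E.
  have [-> _] := hpi [set x i] (measurable_set1 _); rewrite empE; congr (_ * _)%E.
  rewrite /k natr_sum -sumEFin; apply: eq_bigr => j _; rewrite diracE.
  by congr (_%:R%:E); rewrite in_set1.
(* The total weight given to a pair with first coordinate [u]: 1 if [u] is one of the points and 0
   otherwise. *)
pose W (u : R) : R := \sum_(i < n) (k i)%:R^-1 * (u == x i)%:R.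
have W1 u : W u <= 1.
  pose kap := (\sum_(j < n) (x j == u))%N.
  have -> : W u = kap%:R^-1 * kap%:R.
    rewrite /kap natr_sum mulr_sumr; apply: eq_bigr => i _; rewrite [u == _]eq_sym.
    by case: (eqVneq (x i) u) => [xu|_]; rewrite ?mulr0// /k xu natr_sum.
  by have [->|k_gt0] := posnP kap; rewrite ?mulr0 ?ler01// mulVf// pnatr_eq0 -lt0n.
have W_le (g : R * R -> \bar R) : measurable_fun setT g -> (forall p, 0 <= g p)%E ->
    (\sum_(i < n) (k i)%:R^-1%:E * \int[pi]_(p in D i) g p <= \int[pi]_p g p)%E.
  move=> mg g0.
  have e i : ((k i)%:R^-1%:E * \int[pi]_(p in D i) g p =
      \int[pi]_p (((k i)%:R^-1 * (p.1 == x i)%:R)%:E * g p))%E.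
    rewrite integral_mkcond -ge0_integralZl_EFin ?invr_ge0//.
    - apply: eq_integral => p _; rewrite EFinM -muleA; congr (_ * _)%E.
      rewrite patchE; case: (eqVneq p.1 (x i)) => h.
        by rewrite mem_set ?mul1e.
      by rewrite memNset ?mul0e// => -[/= /eqP]; rewrite (negbTE h).
    - by move=> p _; rewrite patchE; case: ifP.
    - by apply/(measurable_restrictT _ (mD i)); exact: measurable_funTS.
  have mI i : measurable_fun setT (fun p : R * R => (((k i)%:R^-1 * (p.1 == x i)%:R)%:E * g p)%E).
    apply: emeasurable_funM => //; apply/measurable_EFinP; apply: measurable_funM => //.
    have -> : (fun p : R * R => (p.1 == x i)%:R : R) = \1_(D i).
      apply/funext => p; rewrite indicE; case: (eqVneq p.1 (x i)) => h.
        by rewrite mem_set.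
      by rewrite memNset// => -[/= /eqP]; rewrite (negbTE h).
    exact: measurable_indic.
  under eq_bigr do rewrite e.
  rewrite -ge0_integral_sum//; last by move=> i p _; rewrite mule_ge0// lee_fin mulr_ge0// invr_ge0.
  apply: ge0_le_integral => //.
  - by move=> p _; apply: sume_ge0 => i _; rewrite mule_ge0// lee_fin mulr_ge0// invr_ge0.
  - exact: emeasurable_sum.
  - move=> p _; rewrite -ge0_sume_distrl; last by move=> i _; rewrite lee_fin mulr_ge0// invr_ge0.
    by rewrite sumEFin -[leRHS]mul1e lee_wpmul2r// lee_fin; exact: W1.
have rho1 i : (i < n)%N -> rho i setT = (n%:R^-1)%:E.
  move=> hi; rewrite rhoE setXTT setIT piD muleCA -EFinM mulVf ?mulr1//.
  by rewrite pnatr_eq0 -lt0n k0.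
have rho_le A : measurable A -> (\sum_(i < n) rho i A <= nu A)%E.
  move=> mA; have [_ <-] := hpi _ mA; have mTA : measurable ([set: R] `*` A) by exact: measurableX.
  rewrite -[X in (_ <= pi X)%E]setIT -integral_indic//.
  apply: le_trans (W_le _ _ _).
  - apply: lee_sum => i _; rewrite rhoE lee_wpmul2l//.
    by rewrite integral_indic// setIC.
  - by apply/measurable_EFinP; exact: measurable_indic.
  - by move=> p; rewrite lee_fin.
have nu1 : nu setT = 1%E.
  by have [_ <-] := hpi _ measurableT; rewrite setXTT; exact: probability_setT.
have S1 : (\sum_(i < n) rho i setT = 1)%E.
  rewrite (eq_bigr (fun=> (n%:R^-1)%:E)); last by move=> i _; exact: rho1.
  by rewrite sumEFin sumr_const card_ord -[_ *+ _]mulr_natl divff// pnatr_eq0 -lt0n.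
exists rho; first split => //.
- move=> A mA; apply/eqP; rewrite eq_le rho_le//=.
  have mAc := measurableC mA.
  (* The inequality holds for [A] and for its complement, and the total masses agree, so it is an
     equality. *)
  have eS : (\sum_(i < n) rho i A + \sum_(i < n) rho i (~` A) = nu A + nu (~` A))%E.
    have add (m : {measure set R -> \bar R}) : (m A + m (~` A) = m setT)%E.
      by rewrite -measureU ?setICr// setUv.
    by rewrite add nu1 -S1 -big_split; apply: eq_bigr => i _; exact: add.
  have fin E : measurable E -> nu E \is a fin_num.
    move=> mE; rewrite ge0_fin_numE//; apply: le_lt_trans (ltry 1); rewrite -nu1.
    by apply: le_measure => //; rewrite inE.
  rewrite leNgt; apply/negP => h.
  have : (\sum_(i < n) rho i A + \sum_(i < n) rho i (~` A) < nu A + nu (~` A))%E.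
    have finS : (\sum_(i < n) rho i (~` A) \is a fin_num)%E.
      rewrite ge0_fin_numE; last by apply: sume_ge0 => i _; exact: measure_ge0.
      by apply: le_lt_trans (rho_le _ mAc) _; rewrite ltey_eq fin.
    by apply: (@lt_le_trans _ _ (nu A + \sum_(i < n) rho i (~` A))%E); [rewrite lteD2rE|rewrite leeD2l// rho_le].
  by rewrite eS ltxx.
rewrite /split_cost; apply: le_trans (W_le _ measurable_cost _); last by move=> p; rewrite lee_fin.
apply: lee_sum => i _.
have mc : measurable_fun setT (fun y : R => ((x i - y) ^+ 2)%:E).
  by apply/measurable_EFinP; apply: measurable_funX; exact: measurable_funB.
rewrite /rho ge0_integral_mscale//; last by move=> y _; rewrite lee_fin sqr_ge0.
rewrite lee_wpmul2l//.
rewrite ge0_integral_pushforward//; last by move=> y _; rewrite lee_fin sqr_ge0.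
rewrite preimage_setT ge0_integral_mrestr//; last 2 first.
- exact: measurableT_comp.
- by move=> p; rewrite lee_fin sqr_ge0.
rewrite le_eqVlt; apply/orP; left; apply/eqP; apply: eq_integral => p /set_mem [/= <- _].
by rewrite real_normK ?num_real.
Qed.


Let measurable_sqdist (u : R) : measurable_fun setT (fun y : R => ((u - y) ^+ 2)%:E).
Proof. by apply/measurable_EFinP; apply: measurable_funX; exact: measurable_funB. Qed.

(** A fraction [w i j] of the part sent to [x i] is sent to [x' j] instead; double stochasticity
    keeps the masses. The inequality [(u - v)^2 <= (1 + l) u^2 + (1 + l^-1) v^2] makes this a
    triangle inequality that needs no gluing of couplings. *)
Lemma split_transport n (x x' : nat -> R) (w : nat -> nat -> R) nu rho (l : R) :
  (0 < n)%N -> 0 < l -> (forall i j, 0 <= w i j) ->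
  (forall i, (i < n)%N -> \sum_(j < n) w i j = 1) ->
  (forall j, (j < n)%N -> \sum_(i < n) w i j = 1) ->
  split_of n nu rho -> exists2 rho', split_of n nu rho' &
    (split_cost n x' rho' <= (1 + l)%:E * split_cost n x rho +
      ((1 + l^-1) * (n%:R^-1 * \sum_(i < n) \sum_(j < n) w i j * (x i - x' j) ^+ 2))%:E)%E.
Proof.
move=> n0 l0 w0 wr wc [rho1 rhoS].
pose m_ (j : nat) (i : nat) : {measure set R -> \bar R} := mscale (NngNum (w0 i j)) (rho i).
pose rho' (j : nat) : {measure set R -> \bar R} := msum (m_ j) n.
have rhoE' j A : rho' j A = (\sum_(i < n) (w i j)%:E * rho i A)%E by [].
exists rho'; first split.
- move=> j hj; rewrite rhoE'.
  under eq_bigr => i _ do rewrite rho1// muleC.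
  by rewrite -ge0_sume_distrr ?sumEFin ?wc ?mule1// => i _; rewrite lee_fin.
- move=> A mA; under eq_bigr => j _ do rewrite rhoE'.
  rewrite exchange_big /= -rhoS//; apply: eq_bigr => i _.
  rewrite -ge0_sume_distrl ?sumEFin ?wr ?mul1e// => j _; rewrite lee_fin//.
have -> : split_cost n x' rho' = (\sum_(i < n) \sum_(j < n) (w i j)%:E * \int[rho i]_y ((x' j - y) ^+ 2)%:E)%E.
  rewrite exchange_big; apply: eq_bigr => j _.
  rewrite /rho' ge0_integral_measure_sum//; last by move=> y _; rewrite lee_fin sqr_ge0.
  by apply: eq_bigr => i _; rewrite ge0_integral_mscale// => y _; rewrite lee_fin sqr_ge0.
have l1 : 0 <= 1 + l by rewrite addr_ge0// ltW.
have l2 : 0 <= 1 + l^-1 by rewrite addr_ge0// invr_ge0 ltW.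
have key (i : 'I_n) (j : 'I_n) : (\int[rho i]_y ((x' j - y) ^+ 2)%:E <=
    (1 + l)%:E * \int[rho i]_y ((x i - y) ^+ 2)%:E + ((1 + l^-1) * n%:R^-1 * (x i - x' j) ^+ 2)%:E)%E.
  have -> : (((1 + l^-1) * n%:R^-1 * (x i - x' j) ^+ 2)%:E =
      \int[rho i]_y ((1 + l^-1) * (x i - x' j) ^+ 2)%:E)%E.
    by rewrite integral_cst// rho1// -EFinM; congr (_%:E); ring.
  rewrite -ge0_integralZl_EFin//; last by move=> y _; rewrite lee_fin sqr_ge0.
  rewrite -ge0_integralD//; last 3 first.
  - by move=> y _; rewrite mule_ge0 ?lee_fin ?sqr_ge0.
  - by apply: emeasurable_funM => //; exact: measurable_cst.
  - by move=> y _; rewrite lee_fin mulr_ge0 ?sqr_ge0.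
  apply: ge0_le_integral => //.
  - by move=> y _; rewrite lee_fin sqr_ge0.
  - by apply: emeasurable_funD => //; apply: emeasurable_funM => //; exact: measurable_cst.
  - move=> y _; rewrite -EFinM -EFinD lee_fin.
    have -> : x' j - y = (x i - y) - (x i - x' j) by ring.
    move: (x i - y) (x i - x' j) => u v; have := sqr_ge0 (l * u + v).
    rewrite -subr_ge0 => h.
    have -> : (1 + l) * u ^+ 2 + (1 + l^-1) * v ^+ 2 - (u - v) ^+ 2 = (l * u + v) ^+ 2 / l.
      by field; rewrite gt_eqF.
    by rewrite divr_ge0 ?sqr_ge0// ltW.
apply: (@le_trans _ _ (\sum_(i < n) \sum_(j < n) (w i j)%:E * ((1 + l)%:E * \int[rho i]_y ((x i - y) ^+ 2)%:E +
    ((1 + l^-1) * n%:R^-1 * (x i - x' j) ^+ 2)%:E))%E).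
  by apply: lee_sum => i _; apply: lee_sum => j _; rewrite lee_wpmul2l// lee_fin.
have I0 i : (0 <= \int[rho i]_y ((x i - y) ^+ 2)%:E)%E by apply: integral_ge0 => y _; rewrite lee_fin sqr_ge0.
rewrite le_eqVlt; apply/orP; left; apply/eqP.
rewrite /split_cost ge0_sume_distrr// !mulr_sumr -sumEFin -big_split /=; apply: eq_bigr => i _.
under eq_bigr => j _.
  rewrite ge0_muleDr; first over.
    by rewrite mule_ge0// lee_fin.
  by rewrite lee_fin mulr_ge0 ?sqr_ge0// mulr_ge0// invr_ge0.
have e1 : (\sum_(j < n) (w i j)%:E * ((1 + l)%:E * \int[rho i]_y ((x i - y) ^+ 2)%:E) =
    (1 + l)%:E * \int[rho i]_y ((x i - y) ^+ 2)%:E)%E.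
  by rewrite -ge0_sume_distrl ?sumEFin ?wr ?mul1e// => j _; rewrite lee_fin.
have e2 : (\sum_(j < n) (w i j)%:E * ((1 + l^-1) * n%:R^-1 * (x i - x' j) ^+ 2)%:E =
    ((1 + l^-1) * (n%:R^-1 * \sum_(j < n) w i j * (x i - x' j) ^+ 2))%:E)%E.
  by rewrite !mulr_sumr -sumEFin; apply: eq_bigr => j _; rewrite -EFinM; congr (_%:E); ring.
by rewrite big_split /= e1 e2.
Qed.

End wasserstein.

(** * Perturbation of spectra in the Wasserstein distance *)

Section wasserstein_matrix.
Variable R : realType.
Local Notation C := R[i].
Implicit Types nu : {measure set R -> \bar R}.

Definition eigs n (A : 'M[C]_n) (k : nat) : R := nth 0 (eigenvalues A) k.

Lemma esd_emp n (A : 'M[C]_n) : esd A = emp n (eigs A).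
Proof.
rewrite /esd /emp; congr empirical_measure.
have e : size (eigenvalues A) = n by rewrite size_map size_enum_ord.
by rewrite -[LHS](mkseq_nth 0) e.
Qed.

Lemma eigsE n (A : 'M[C]_n) (i : 'I_n) : eigs A i = eig A i.
Proof.
rewrite /eigs /eigenvalues (nth_map i) ?size_enum_ord//.
by rewrite nth_ord_enum.
Qed.

(** The squared overlaps of the two eigenbases serve as the doubly stochastic matrix, and their cost
    is the Hilbert-Schmidt distance. *)
Lemma W2_esd_perturb n (A A' : 'M[C]_n) nu (c dd : R) : (0 < n)%N ->
  A \is hermsymmx -> A' \is hermsymmx -> nu setT = 1%E -> 0 < c -> 0 < dd ->
  n%:R^-1 * frob2 (A - A') <= dd ^+ 2 -> (W2 (esd A) nu < c%:E)%E ->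
  (W2 (esd A') nu <= (c + dd)%:E)%E.
Proof.
case: n A A' => // n A A' _ hA hA' nu1 c0 d0 hfrob.
move=> /(W2_lt (ltW c0))[pi hpi hcost].
rewrite esd_emp in hpi; have [rho hrho hrc] := split_of_coupling (ltn0Sn n) hpi.
pose w i j := overlap (spectralmx A) (spectralmx A') (inord i) (inord j).
have uA := hermitian_udiag hA; have uA' := hermitian_udiag hA'.
have [UA _] := uA; have [UA' _] := uA'.
(* The value [l = dd / c] is optimal: [(1 + l) c^2 + (1 + l^-1) dd^2 = (c + dd)^2]. *)
have [||||rho' hrho' hrc'] := @split_transport _ n.+1 (eigs A) (eigs A') w nu rho (dd / c) (ltn0Sn n) _ _ _ _ hrho.
- by rewrite divr_gt0.
- by move=> i j; exact: overlap_ge0.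
- move=> i _; rewrite -[RHS](overlap_row (inord i) UA UA').
  by apply: eq_bigr => j _; rewrite /w inord_val.
- move=> j _; rewrite -[RHS](overlap_col (inord j) UA UA').
  by apply: eq_bigr => i _; rewrite /w inord_val.
have [pi' hpi' hc'] := coupling_of_split (eigs A') (ltn0Sn n) nu1 hrho'.
rewrite esd_emp; apply: (W2_le (pi := pi')) => //; first by rewrite addr_ge0// ltW.
rewrite hc'; apply: le_trans hrc' _.
have eF : \sum_(i < n.+1) \sum_(j < n.+1) w i j * (eigs A i - eigs A' j) ^+ 2 = frob2 (A - A').
  rewrite -(overlap_frob2 uA uA'); apply: eq_bigr => i _; apply: eq_bigr => j _.
  by rewrite /w !inord_val !eigsE mulrC.
rewrite eF invf_div.
have l0 : 0 <= 1 + dd / c by rewrite addr_ge0// divr_ge0// ltW.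
have l1 : 0 <= 1 + c / dd by rewrite addr_ge0// divr_ge0// ltW.
apply: (@le_trans _ _ ((1 + dd / c)%:E * (c ^+ 2)%:E + ((1 + c / dd) * dd ^+ 2)%:E)%E).
  apply: leeD; last by rewrite lee_fin ler_wpM2l.
  by rewrite lee_wpmul2l ?lee_fin//; apply: le_trans hrc (ltW hcost).
rewrite -EFinM -EFinD lee_fin le_eqVlt; apply/orP; left; apply/eqP; field.
by rewrite !gt_eqF.
Qed.

(** The independent coupling, with every part equal to [nu / n], has finite cost. *)
Lemma W2_esd_fin n (A : 'M[C]_n) (nu : probability R R) : (0 < n)%N ->
  (\int[nu]_y (y ^+ 2)%:E < +oo)%E -> W2 (esd A) nu \is a fin_num.
Proof.
move=> n0 h2; rewrite ge0_fin_numE ?W2_ge0// esd_emp.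
have nu1 : nu setT = 1%E by exact: probability_setT.
have n0' : 0 <= n%:R^-1 :> R by rewrite invr_ge0.
pose rho (i : nat) : {measure set R -> \bar R} := mscale (NngNum n0') nu.
have nn : n%:R != 0 :> R by rewrite pnatr_eq0 -lt0n.
have hrho : split_of n nu rho.
  split=> [i _|B mB]; rewrite /rho /= /mscale /= ?nu1 ?mule1//.
  rewrite -ge0_sume_distrl; last by move=> i _; rewrite lee_fin.
  by rewrite sumEFin sumr_const card_ord -[_ *+ _]mulr_natl divff// mul1e.
have [pi hpi hc] := coupling_of_split (eigs A) n0 nu1 hrho.
have cfin : (cost pi < +oo)%E.
  rewrite hc /split_cost; apply: lte_sum_pinfty => i _.
  rewrite ge0_integral_mscale//; last 2 first.
  - by apply/measurable_EFinP; apply: measurable_funX; exact: measurable_funB.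
  - by move=> y _; rewrite lee_fin sqr_ge0.
  apply: lte_mul_pinfty; rewrite ?lee_fin//.
  apply: (@le_lt_trans _ _ (\int[nu]_y ((2 * eigs A i ^+ 2)%:E + 2%:E * (y ^+ 2)%:E))%E).
    apply: ge0_le_integral => //.
    - by move=> y _; rewrite lee_fin sqr_ge0.
    - by apply/measurable_EFinP; apply: measurable_funX; exact: measurable_funB.
    - by apply: emeasurable_funD => //; apply: emeasurable_funM => //; apply/measurable_EFinP; exact: measurable_funX.
    - by move=> y _; rewrite -EFinM -EFinD lee_fin; have := sqr_ge0 (eigs A i + y); lra.
  rewrite ge0_integralD//; last 3 first.
  - by move=> y _; rewrite lee_fin mulr_ge0 ?sqr_ge0.
  - by move=> y _; rewrite -EFinM lee_fin mulr_ge0 ?sqr_ge0.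
  - by apply: emeasurable_funM => //; apply/measurable_EFinP; exact: measurable_funX.
  rewrite integral_cst//= nu1 mule1 ge0_integralZl_EFin//; last 2 first.
  - by move=> y _; rewrite lee_fin sqr_ge0.
  - by apply/measurable_EFinP; exact: measurable_funX.
  by apply: lte_add_pinfty; rewrite ?ltry//; apply: lte_mul_pinfty.
pose c := fine (cost pi) + 1.
have f0 : 0 <= fine (cost pi) by rewrite fine_ge0// cost_ge0.
apply: (@le_lt_trans _ _ c%:E); last exact: ltry.
apply: (W2_le _ hpi); first by rewrite addr_ge0.
rewrite -[cost pi]fineK ?ge0_fin_numE ?cost_ge0// lee_fin /c.
by have := sqr_ge0 (fine (cost pi)); lra.
Qed.

Lemma W2_esd_lip n (A A' : 'M[C]_n) (nu : probability R R) (dd : R) : (0 < n)%N ->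
  A \is hermsymmx -> A' \is hermsymmx -> (\int[nu]_y (y ^+ 2)%:E < +oo)%E -> 0 < dd ->
  n%:R^-1 * frob2 (A - A') <= dd ^+ 2 ->
  fine (W2 (esd A') nu) <= fine (W2 (esd A) nu) + dd.
Proof.
move=> n0 hA hA' h2 d0 hf; have nu1 : nu setT = 1%E by exact: probability_setT.
have fA := W2_esd_fin A n0 h2; have fA' := W2_esd_fin A' n0 h2.
apply/ler_addgt0Pr => e e0.
rewrite -addrA [dd + e]addrC addrA -lee_fin fineK//.
apply: (W2_esd_perturb n0 hA hA' nu1 _ d0 hf).
  by rewrite ltr_wpDl// fine_ge0// W2_ge0.
by rewrite EFinD fineK// lteDl// lte_fin.
Qed.

Lemma frob2C n (A A' : 'M[C]_n) : frob2 (A' - A) = frob2 (A - A').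
Proof.
rewrite /frob2; apply: eq_bigr => i _; apply: eq_bigr => j _.
by rewrite !mxE -normcN opprB.
Qed.

(** By [W2_esd_lip] the distance is continuous in each entry, which is what [measurable_coordinates]
    asks for. *)
Lemma measurable_W2_tri d (T : measurableType d) n (a c : nat -> T -> R) (nu : probability R R) :
  (0 < n)%N -> (\int[nu]_y (y ^+ 2)%:E < +oo)%E ->
  (forall k, measurable_fun setT (a k)) -> (forall k, measurable_fun setT (c k)) ->
  measurable_fun setT (fun t => fine (W2 (esd (tri n (a ^~ t) (c ^~ t))) nu)).
Proof.
move=> n0 h2 ma mc.
pose M (v : nat -> R) := tri n (fun k => v k.*2) (fun k => v k.*2.+1).
pose G (v : nat -> R) := fine (W2 (esd (M v)) nu).
pose X (i : nat) t := if odd i then c i./2 t else a i./2 t.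
rewrite (_ : (fun t => _) = fun t => G (fun i => X i t)); last first.
  apply/funext => t; rewrite /G; congr (fine (W2 (esd _) nu)).
  by apply: eq_tri => k _; rewrite /X /= odd_double /= ?uphalf_double ?doubleK.
apply: (@measurable_coordinates _ _ _ G n.*2.+2).
- move=> v v' hv; congr (fine (W2 (esd _) nu)); apply: eq_tri => k /andP[_ kn]; apply: hv; lia.
- move=> v i q; apply: continuous_eps => e e0.
  exists (e / 2); first by rewrite divr_gt0.
  move=> h he.
  have hf : n%:R^-1 * frob2 (M (upd v i (q + h)) - M (upd v i q)) <= e ^+ 2.
    have up k : (upd v i (q + h) k - upd v i q k) ^+ 2 <= (e / 2) ^+ 2.
      rewrite /upd; case: eqP => _; last by rewrite subrr expr0n sqr_ge0.
      rewrite addrAC subrr add0r -real_normK ?num_real// ler_sqr ?nnegrE// ?divr_ge0// ltW//.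
    have n1 : 0 < n%:R :> R by rewrite ltr0n.
    rewrite ler_pdivrMl// tri_sub frob2_tri.
    have S1 : \sum_(1 <= k < n.+1) (upd v i (q + h) k.*2 - upd v i q k.*2) ^+ 2 <= n%:R * (e / 2) ^+ 2.
      apply: (@le_trans _ _ (\sum_(1 <= k < n.+1) (e / 2) ^+ 2)); first by apply: ler_sum.
      by rewrite sumr_const_nat subn1 /= mulr_natl.
    have S2 : \sum_(1 <= k < n) (upd v i (q + h) k.*2.+1 - upd v i q k.*2.+1) ^+ 2 <= n%:R * (e / 2) ^+ 2.
      apply: (@le_trans _ _ (\sum_(1 <= k < n) (e / 2) ^+ 2)); first by apply: ler_sum.
      by rewrite sumr_const_nat -[_ *+ _]mulr_natl ler_wpM2r ?sqr_ge0// ler_nat leq_subr.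
    have n2 : 0 <= n%:R * e ^+ 2 by rewrite mulr_ge0 ?sqr_ge0.
    move: S1 S2; have -> : n%:R * (e / 2) ^+ 2 = n%:R * e ^+ 2 / 4 by field.
    lra.
  have h1 := W2_esd_lip n0 (tri_herm _ _ _) (tri_herm _ _ _) h2 e0 hf.
  rewrite frob2C in hf.
  have h3 := W2_esd_lip n0 (tri_herm _ _ _) (tri_herm _ _ _) h2 e0 hf.
  by rewrite ler_norml; apply/andP; split; rewrite /G; lra.
- by move=> i; rewrite /X; case: odd.
Qed.

End wasserstein_matrix.

(** * The quantile coupling controlled by finitely many ramps *)

Section quantile_coupling.
Variable R : realType.

Definition tailsq (M x : R) : R := if M < `|x| then x ^+ 2 else 0.

Lemma tailsq_ge0 M x : 0 <= tailsq M x.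
Proof. by rewrite /tailsq; case: ifP; rewrite ?sqr_ge0. Qed.

Lemma tailsq_le M x : tailsq M x <= x ^+ 2.
Proof. by rewrite /tailsq; case: ifP; rewrite ?sqr_ge0. Qed.

Lemma measurable_tailsq M : measurable_fun setT (tailsq M).
Proof.
apply: measurable_fun_ifT; [|exact: measurable_funX|exact: measurable_cst].
by apply: measurable_fun_ltr => //; exact: normr_measurable.
Qed.

Lemma tailsq_far (M y y' : R) : 0 <= M -> (M < `|y|) || (M < `|y'|) ->
  (y - y') ^+ 2 <= 4 * tailsq M y + 4 * tailsq M y'.
Proof.
move=> M0 h.
have sq (x : R) : M < `|x| -> M ^+ 2 <= x ^+ 2.
  by move=> hx; rewrite -[x ^+ 2]real_normK ?num_real// ler_sqr ?nnegrE// ltW.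
have sq' (x : R) : `|x| <= M -> x ^+ 2 <= M ^+ 2.
  by move=> hx; rewrite -[x ^+ 2]real_normK ?num_real// ler_sqr ?nnegrE.
have h1 : (y - y') ^+ 2 <= 2 * y ^+ 2 + 2 * y' ^+ 2 by have := sqr_ge0 (y + y'); lra.
have := sqr_ge0 y; have := sqr_ge0 y'.
move: h; rewrite /tailsq; case: (ltP M `|y|) => [/sq hy|/sq' hy]; case: (ltP M `|y'|) => [/sq hy'|/sq' hy'] //= _; lra.
Qed.

(** Two points more than two meshes apart enclose two consecutive nodes; the first one is the node
    that follows the integer part of the rescaled [y]. *)
Lemma quantile_grid (q m : nat) (y y' : R) : (0 < q)%N -> `|y| <= m%:R -> 2 * q%:R^-1 < y' - y ->
  exists2 j : nat, (j < (2 * (m * q)).+2)%N &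
    y <= (j%:R - (m * q)%:R) / q%:R /\ (j.+1%:R - (m * q)%:R) / q%:R < y'.
Proof.
move=> q0; rewrite ler_norml => /andP[y1 y2] yy'.
have qp : 0 < q%:R :> R by rewrite ltr0n.
pose t := q%:R * y + (m * q)%:R.
have t0 : 0 <= t.
  by rewrite /t natrM mulrC -mulrDl mulr_ge0// -lerBlDr sub0r.
have /andP[j1 j2] := truncn_itv t0; set j := Num.truncn t in j1 j2 *.
exists j.+1.
  rewrite !ltnS -(ler_nat R); apply: (le_trans j1).
  rewrite /t mul2n -addnn natrD lerD2r natrM mulrC ler_wpM2r//.
split.
  by rewrite ler_pdivlMr// mulrC; move: j2; rewrite /t; lra.
rewrite ltr_pdivrMr// -[j.+2%:R]natr1 -[j.+1%:R]natr1; move: j1; rewrite /t => j1'.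
have : 2 * q%:R^-1 * q%:R < (y' - y) * q%:R by rewrite ltr_pM2r.
rewrite -mulrA mulVf ?gt_eqF//; lra.
Qed.

Variables (mu nu : probability R R) (q m : nat) (delta : R).
Hypotheses (q0 : (0 < q)%N) (m0 : (0 < m)%N).
Hypothesis hd : forall j, (j < (2 * (m * q)).+2)%N ->
  `|\int[mu]_x ramp q j (m * q) x - \int[nu]_x ramp q j (m * q) x| <= delta.

Let F (beta : probability R R) (x : R) : R := fine (beta `]-oo, x]%classic).
Let grid j : R := (j%:R - (m * q)%:R) / q%:R.

Let F_le_ramp (beta : probability R R) j :
  F beta (grid j) <= \int[beta]_x ramp q j (m * q) x <= F beta (grid j.+1).
Proof.
have qp : 0 < q%:R :> R by rewrite ltr0n.
have bind (x : R) : bdm (fun y => (\1_(`]-oo, x]%classic) y : R)).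
  split; first by apply: measurable_indic.
  by exists 1 => s; rewrite indicE; case: (_ \in _); rewrite ?normr1// normr0.
have FE x : F beta x = \int[beta]_y \1_(`]-oo, x]%classic) y.
  by rewrite /F /Rintegral integral_indic// setIT.
rewrite !FE; apply/andP; split; apply: Eb_le => //; try exact: (bcont_bdm (bcont_ramp _ _ _ _)).
  move=> y; rewrite indicE; case: (boolP (y \in _)) => [|_]; last by have /andP[] := ramp01 q j (m * q) y.
  rewrite inE /= in_itv /= /grid ler_pdivlMr// mulrC => h.
  by rewrite ramp_eq1.
move=> y; rewrite indicE; case: (boolP (y \in _)) => [_|]; first by have /andP[] := ramp01 q j (m * q) y.
rewrite notin_setE /= in_itv /= => /negP; rewrite -ltNge /grid ltr_pdivrMr// => h.
by rewrite ramp_eq0//; move: h; rewrite -natr1; lra.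
Qed.

Let leb01_itv a b c : b - a <= c -> 0 <= c -> (leb01 R `]a, b]%classic <= c%:E)%E.
Proof.
move=> h c0; rewrite leb01E.
apply: (@le_trans _ _ (lebesgue_measure `]a, b]%classic)).
  by apply: le_measure; rewrite ?inE//; exact: measurableI.
by rewrite lebesgue_measure_itv /= lte_fin; case: ifPn; rewrite lee_fin.
Qed.

(** The levels at which the quantile of [mu] is at most node [j] while that of [nu] exceeds node
    [j + 1]. A ramp integral lies between the two distribution functions at these nodes, so the
    length is at most [delta]. *)
Let bad j : set R := `]F nu (grid j.+1), F mu (grid j)]%classic.
Let bad' j : set R := `]F mu (grid j.+1), F nu (grid j)]%classic.

Let delta0 : 0 <= delta.
Proof. by apply: le_trans (hd (ltn0Sn _)). Qed.

Let bad_le j : (j < (2 * (m * q)).+2)%N -> (leb01 R (bad j) <= delta%:E)%E /\ (leb01 R (bad' j) <= delta%:E)%E.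
Proof.
move=> hj; have := hd hj; rewrite ler_norml => /andP[d1 d2].
have /andP[? ?] := F_le_ramp mu j; have /andP[? ?] := F_le_ramp nu j.
by split; apply: leb01_itv => //; lra.
Qed.

Let qm := quantile mu.
Let qn := quantile nu.

(** The first term is [(2 / q)^2], for levels where the quantiles are close. On a bad level,
    quantiles in [[- m, m]] differ by at most [2 m], whence [4 m^2]. *)
Let H (u : R) : R := 4 / q%:R ^+ 2 +
  4 * m%:R ^+ 2 * \sum_(j < (2 * (m * q)).+2) (\1_(bad j) u + \1_(bad' j) u).

Let pointwise u : (qm u - qn u) ^+ 2 <= H u + (4 * tailsq m%:R (qm u) + 4 * tailsq m%:R (qn u)).
Proof.
have qp : 0 < q%:R :> R by rewrite ltr0n.
have S0 : 0 <= \sum_(j < (2 * (m * q)).+2) (\1_(bad j) u + \1_(bad' j) u : R).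
  by apply: sumr_ge0 => j _; rewrite addr_ge0.
have q20 : 0 <= 4 / q%:R ^+ 2 :> R by rewrite divr_ge0// sqr_ge0.
have H0 : 0 <= H u by rewrite /H addr_ge0// !mulr_ge0// sqr_ge0.
have t1 := tailsq_ge0 m%:R (qm u); have t2 := tailsq_ge0 m%:R (qn u).
have [u01|u01] := boolP (0 < u < 1); last first.
  by rewrite /qm /qn /quantile (negbTE u01) subrr expr0n/= in t1 t2 *; lra.
have [far|] := boolP ((m%:R < `|qm u|) || (m%:R < `|qn u|)).
  have := tailsq_far (ler0n _ m) far; lra.
rewrite negb_or -!leNgt => /andP[hm hn].
suff : (qm u - qn u) ^+ 2 <= H u by lra.
have [near|far] := leP (`|qm u - qn u|) (2 * q%:R^-1).
  apply: (@le_trans _ _ (4 / q%:R ^+ 2)).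
    have -> : 4 / q%:R ^+ 2 = (2 * q%:R^-1) ^+ 2 :> R by rewrite exprMn exprVn; congr (_ * _); ring.
    by rewrite -real_normK ?num_real// ler_sqr ?nnegrE// mulr_ge0// invr_ge0.
  by rewrite /H lerDl !mulr_ge0// sqr_ge0.
have sq : (qm u - qn u) ^+ 2 <= 4 * m%:R ^+ 2.
  have -> : 4 * m%:R ^+ 2 = (m%:R + m%:R) ^+ 2 :> R by ring.
  rewrite -real_normK ?num_real// ler_sqr ?nnegrE ?addr_ge0//.
  by apply: le_trans (ler_normB _ _) _; exact: lerD.
suff S1 : 1 <= \sum_(j < (2 * (m * q)).+2) (\1_(bad j) u + \1_(bad' j) u : R).
  apply: (le_trans sq); rewrite /H.
  have : 4 * m%:R ^+ 2 * 1 <= 4 * m%:R ^+ 2 * \sum_(j < (2 * (m * q)).+2) (\1_(bad j) u + \1_(bad' j) u : R).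
    by apply: ler_wpM2l => //; rewrite mulr_ge0// sqr_ge0.
  lra.
have one (E : set R) : E u -> \1_E u = 1 :> R by move=> Eu; rewrite indicE mem_set.
have pick j0 : (j0 < (2 * (m * q)).+2)%N -> (bad j0 u \/ bad' j0 u) ->
    1 <= \sum_(j < (2 * (m * q)).+2) (\1_(bad j) u + \1_(bad' j) u : R).
  move=> hj0 hb; rewrite (bigD1 (Ordinal hj0))//=.
  have S' : 0 <= \sum_(i < (2 * (m * q)).+2 | i != Ordinal hj0) (\1_(bad i) u + \1_(bad' i) u : R).
    by apply: sumr_ge0 => j _; rewrite addr_ge0.
  have i1 : 0 <= \1_(bad j0) u :> R by [].
  have i2 : 0 <= \1_(bad' j0) u :> R by [].
  by case: hb => /one h; move: S' i1 i2; rewrite h; lra.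
have [lt|lt] := ltP (qm u) (qn u).
  have h : 2 * q%:R^-1 < qn u - qm u by rewrite -[ltRHS]gtr0_norm ?subr_gt0// distrC.
  have [j hj [g1 g2]] := quantile_grid q0 hm h.
  apply: (pick j hj); left; rewrite /bad /= in_itv /=; apply/andP; split.
    by rewrite ltNge -(quantile_le nu _ u01) -ltNge.
  by rewrite -(quantile_le mu _ u01).
have h : 2 * q%:R^-1 < qm u - qn u by rewrite -[ltRHS]ger0_norm ?subr_ge0.
have [j hj [g1 g2]] := quantile_grid q0 hn h.
apply: (pick j hj); right; rewrite /bad' /= in_itv /=; apply/andP; split.
  by rewrite ltNge -(quantile_le mu _ u01) -ltNge.
by rewrite -(quantile_le nu _ u01).
Qed.

Let tail (beta : probability R R) : \bar R := (\int[beta]_x (tailsq m%:R x)%:E)%E.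

(* If u is outside the bad intervals and both quantiles lie in [-m, m], they are 2 / q close. *)
Lemma quantile_coupling_cost : exists2 pi, coupling mu nu pi &
  (cost pi <= (4 / q%:R ^+ 2 + 8 * m%:R ^+ 2 * (2 * (m * q)).+2%:R * delta)%:E
     + (4%:E * tail mu + 4%:E * tail nu))%E.
Proof.
have mq (beta : probability R R) : measurable_fun setT (quantile beta) by exact: measurable_quantile.
have mpair : measurable_fun setT (fun u => (qm u, qn u)) by apply: measurable_fun_pair; exact: mq.
exists (law (leb01 R) mpair).
  move=> A mA; split; apply: (etrans (lawE _ _ _)).
    apply: etrans (quantile_law mu mA); congr (leb01 R _).
    by apply/seteqP; split => u //= [].
  apply: etrans (quantile_law nu mA); congr (leb01 R _).
  by apply/seteqP; split => u //= [].
rewrite /cost (ge0_law (leb01 R) mpair); last 2 first.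
- exact: measurable_cost.
- by move=> y; rewrite lee_fin.
have mt : measurable_fun setT (fun x : R => (tailsq m%:R x)%:E).
  by apply/measurable_EFinP; exact: measurable_tailsq.
have tq (beta : probability R R) : tail beta = (\int[leb01 R]_u (tailsq m%:R (quantile beta u))%:E)%E.
  rewrite -(ge0_law (leb01 R) (mq beta) mt); last by move=> y; rewrite lee_fin tailsq_ge0.
  apply: eq_measure_integral => A mA _; apply/esym; apply: (etrans (lawE _ _ _)).
  exact: quantile_law.
have mtq (beta : probability R R) : measurable_fun setT (fun u : R => (4%:E * (tailsq m%:R (quantile beta u))%:E)%E).
  by apply: emeasurable_funM => //; exact: (measurableT_comp mt (mq beta)).
have bI (E : set R) : measurable E -> bdm (fun u => (\1_E u : R)).
  split; first exact: measurable_indic.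
  by exists 1 => s; rewrite indicE; case: (_ \in _); rewrite ?normr1// normr0.
have bS : bdm (fun u => \sum_(j < (2 * (m * q)).+2) (\1_(bad j) u + \1_(bad' j) u : R)).
  by apply: bdm_sum => j; apply: bdmD; apply: bI; exact: measurable_itv.
have bH : bdm H by apply: bdmD; [exact: bdm_cst|apply: bdmM => //; exact: bdm_cst].
have H0 u : 0 <= H u.
  by rewrite /H addr_ge0 ?divr_ge0 ?sqr_ge0// mulr_ge0 ?mulr_ge0 ?sqr_ge0//; apply: sumr_ge0 => j _; rewrite addr_ge0.
have mH : measurable_fun setT (fun u => (H u)%:E) by apply/measurable_EFinP; case: bH.
apply: (@le_trans _ _ (\int[leb01 R]_u ((H u)%:E + (4%:E * (tailsq m%:R (qm u))%:E + 4%:E * (tailsq m%:R (qn u))%:E)))%E).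
  apply: ge0_le_integral => //.
  - apply/measurable_EFinP; apply: measurable_funX; apply: measurableT_comp => //.
    by apply: measurable_funB; exact: mq.
  - by apply: emeasurable_funD => //; apply: emeasurable_funD; exact: mtq.
  - by move=> u _; rewrite -!EFinM -!EFinD lee_fin /= real_normK ?num_real//; exact: pointwise.
have t0 u : (0 <= 4%:E * (tailsq m%:R u)%:E)%E by rewrite -EFinM lee_fin mulr_ge0// tailsq_ge0.
rewrite ge0_integralD//; last 3 first.
- by move=> u _; rewrite lee_fin.
- by move=> u _; exact: adde_ge0.
- by apply: emeasurable_funD; exact: mtq.
rewrite ge0_integralD//; last 2 first.
- exact: mtq.
- exact: mtq.
apply: leeD; last first.
  rewrite !ge0_integralZl_EFin// -?tq//; try (by move=> u _; rewrite lee_fin tailsq_ge0).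
  - exact: (measurableT_comp mt (mq nu)).
  - exact: (measurableT_comp mt (mq mu)).
have -> : (\int[leb01 R]_u (H u)%:E = (\int[leb01 R]_u H u)%:E)%E.
  by rewrite /Rintegral fineK//; apply: integrable_fin_num => //; exact: bdm_integrable.
have EI (E : set R) : measurable E -> \int[leb01 R]_u (\1_E u : R) = fine (leb01 R E).
  by move=> mE; rewrite /Rintegral integral_indic// setIT.
rewrite lee_fin /H EbD//; last by apply: bdmM => //; exact: bdm_cst.
  rewrite EbC EbZ// lerD2l.
  rewrite Eb_sum; last by move=> j; apply: bdmD; apply: bI; exact: measurable_itv.
  have -> : 8 * m%:R ^+ 2 * (2 * (m * q)).+2%:R * delta =
     4 * m%:R ^+ 2 * \sum_(j < (2 * (m * q)).+2) (delta + delta) :> R.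
    by rewrite sumr_const card_ord -[_ *+ _]mulr_natl; ring.
  apply: ler_wpM2l; first by rewrite mulr_ge0// sqr_ge0.
  apply: ler_sum => j _; have [b1 b2] := bad_le (ltn_ord j).
  rewrite EbD; [|by apply: bI; exact: measurable_itv..].
  rewrite !EI; try exact: measurable_itv.
  have fn E : measurable E -> leb01 R E \is a fin_num by move=> mE; exact: fin_num_measure.
  by apply: lerD; rewrite -lee_fin fineK//; apply: fn; exact: measurable_itv.
exact: bdm_cst.
Qed.

End quantile_coupling.

(** * Tails of second moments *)

Section tails.
Variable R : realType.

Lemma tailsq_antimono (M M' x : R) : M <= M' -> tailsq M' x <= tailsq M x.
Proof.
move=> MM; rewrite /tailsq; case: ifPn => [h|_]; first by rewrite (le_lt_trans MM h).
by case: ifP; rewrite ?sqr_ge0.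
Qed.

Lemma measurable_tailsqE (M : R) : measurable_fun setT (fun x : R => (tailsq M x)%:E).
Proof. by apply/measurable_EFinP; exact: measurable_tailsq. Qed.

Let measurable_sqE : measurable_fun setT (fun x : R => (x ^+ 2)%:E).
Proof. by apply/measurable_EFinP; exact: measurable_funX. Qed.

Lemma tailsq_vanish (mu : probability R R) (e : R) : 0 < e ->
  (\int[mu]_x (x ^+ 2)%:E < +oo)%E ->
  \forall S \near \oo, (\int[mu]_x (tailsq S%:R x)%:E <= e%:E)%E.
Proof.
move=> e0 h2.
have hi : mu.-integrable setT (fun x : R => (x ^+ 2)%:E).
  apply/integrableP; split; first exact: measurable_sqE.
  by under eq_integral => x _ do rewrite gee0_abs ?lee_fin ?sqr_ge0//.
have h : (\int[mu]_x (tailsq S%:R x)%:E @[S --> \oo] --> \int[mu]_x (cst 0 x))%E.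
  apply: (@dominated_cvg _ _ _ mu setT measurableT _ _ (fun x : R => (x ^+ 2)%:E)) => //.
  - by move=> S; exact: measurable_tailsqE.
  - move=> x _; apply: cvg_near_cst; near=> S; rewrite /tailsq ltNge.
    by have -> : `|x| <= S%:R by near: S; exact: nbhs_infty_ger.
  - by move=> S x _; rewrite gee0_abs ?lee_fin ?tailsq_ge0// tailsq_le.
rewrite integral_cst// mul0e in h.
by have := cvge0_lt e0 h; apply: filterS => S /ltW.
Unshelve. all: by end_near. Qed.

Lemma coupling_fst (mu nu : {measure set R -> \bar R}) pi (f : R -> \bar R) :
  coupling mu nu pi -> measurable_fun setT f -> (forall x, 0 <= f x)%E ->
  (\int[mu]_x f x = \int[pi]_p f p.1)%E.
Proof.
move=> hpi mf f0; rewrite -(ge0_law pi measurable_fst mf f0).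
apply: eq_measure_integral => A mA _; have [h _] := hpi A mA.
rewrite -h; apply/esym; apply: (etrans (lawE _ _ _)); congr (pi _).
by apply/seteqP; split => p //= [].
Qed.

Lemma coupling_snd (mu nu : {measure set R -> \bar R}) pi (f : R -> \bar R) :
  coupling mu nu pi -> measurable_fun setT f -> (forall x, 0 <= f x)%E ->
  (\int[nu]_x f x = \int[pi]_p f p.2)%E.
Proof.
move=> hpi mf f0; rewrite -(ge0_law pi measurable_snd mf f0).
apply: eq_measure_integral => A mA _; have [_ h] := hpi A mA.
rewrite -h; apply/esym; apply: (etrans (lawE _ _ _)); congr (pi _).
by apply/seteqP; split => p //= [].
Qed.

Lemma coupling_le (mu nu : {measure set R -> \bar R}) pi (f g : R -> R) (c c' : R) :
  coupling mu nu pi -> measurable_fun setT f -> measurable_fun setT g ->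
  (forall x, 0 <= f x) -> (forall x, 0 <= g x) -> 0 <= c -> 0 <= c' ->
  (forall x y, f x <= c * (x - y) ^+ 2 + c' * g y) ->
  (\int[mu]_x (f x)%:E <= c%:E * cost pi + c'%:E * \int[nu]_y (g y)%:E)%E.
Proof.
move=> hpi mf mg f0 g0 c0 c'0 h.
rewrite (coupling_fst hpi); last 2 first.
- exact/measurable_EFinP.
- by move=> x; rewrite lee_fin.
rewrite (coupling_snd hpi (f := fun y => (g y)%:E)); last 2 first.
- exact/measurable_EFinP.
- by move=> x; rewrite lee_fin.
have m2 : measurable_fun setT (fun p : R * R => (g p.2)%:E).
  by apply/measurable_EFinP; exact: measurableT_comp.
rewrite /cost -ge0_integralZl_EFin//; last exact: measurable_cost.
rewrite -ge0_integralZl_EFin//; last by move=> p _; rewrite lee_fin.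
rewrite -ge0_integralD//; last 4 first.
- by move=> p _; rewrite -EFinM lee_fin mulr_ge0.
- by apply: emeasurable_funM => //; exact: measurable_cost.
- by move=> p _; rewrite -EFinM lee_fin mulr_ge0.
- by apply: emeasurable_funM.
apply: ge0_le_integral => //.
- by move=> p _; rewrite lee_fin.
- by apply/measurable_EFinP; exact: measurableT_comp.
- by apply: emeasurable_funD; apply: emeasurable_funM => //; exact: measurable_cost.
- by move=> p _; rewrite -!EFinM -EFinD lee_fin real_normK ?num_real.
Qed.

(** If [|x| > 2 S], then either [|y| <= |x| / 2] and [x^2 <= 4 (x - y)^2], or [|y| > S] and
    [x^2 <= 4 y^2]. Small tails are thus inherited from a measure that is close in Wasserstein
    distance. *)
Lemma coupling_tailsq (mu nu : {measure set R -> \bar R}) pi (S : R) : 0 <= S -> coupling mu nu pi ->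
  (\int[mu]_x (tailsq (2 * S) x)%:E <= 4%:E * cost pi + 4%:E * \int[nu]_y (tailsq S y)%:E)%E.
Proof.
move=> S0 hpi; apply: (coupling_le hpi) => //; try exact: measurable_tailsq; try exact: tailsq_ge0.
move=> x y; have t0 := tailsq_ge0 S y; have d0 := sqr_ge0 (x - y).
rewrite {1}/tailsq; case: ifPn => hx; last by rewrite addr_ge0// mulr_ge0.
have [hy|hy] := leP (2 * `|y|) `|x|.
  have h : `|x| <= 2 * `|x - y| by have := ler_normD (x - y) y; rewrite subrK; lra.
  have : x ^+ 2 <= 4 * (x - y) ^+ 2.
    rewrite -[x ^+ 2]real_normK ?num_real// -[(x - y) ^+ 2]real_normK ?num_real//.
    have := normr_ge0 x; have := normr_ge0 (x - y); move: h; move: (`|x|) (`|x - y|) => u v; nra.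
  lra.
have Sy : S < `|y| by lra.
rewrite /tailsq Sy; have := sqr_ge0 (x - 2 * y); have := sqr_ge0 x; lra.
Qed.

Lemma integral_wsum d (T : measurableType d) (P : probability T R) (I : Type) (r : seq I)
  (c : I -> R) (X : I -> T -> R) : (forall i, 0 <= c i) -> (forall i w, 0 <= X i w) ->
  (forall i, measurable_fun setT (X i)) ->
  (\int[P]_w (\sum_(i <- r) c i * X i w)%:E = \sum_(i <- r) (c i)%:E * \int[P]_w (X i w)%:E)%E.
Proof.
move=> c0 X0 mX; under eq_integral do rewrite -sumEFin.
rewrite ge0_integral_sum//; last 2 first.
- by move=> i; apply/measurable_EFinP; exact: measurable_funM.
- by move=> i w _; rewrite lee_fin mulr_ge0.
apply: eq_bigr => i _; under eq_integral do rewrite EFinM.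
rewrite ge0_integralZl_EFin//; last exact/measurable_EFinP.
by move=> w _; rewrite lee_fin.
Qed.

Lemma markov_ge0 d (T : measurableType d) (P : probability T R) (X : T -> R) (e : R) :
  0 < e -> measurable_fun setT X -> (forall w, 0 <= X w) ->
  (P [set w | (e <= X w)%R] <= (e^-1)%:E * \int[P]_w (X w)%:E)%E.
Proof.
move=> e0 mX X0; rewrite -lee_pdivrMl ?lte_fin//; last by rewrite invr_gt0.
have mE : measurable [set w | e <= X w].
  rewrite (_ : [set w | _] = X @^-1` `[e, +oo[%classic).
    by rewrite -[X in measurable X]setTI; exact: mX.
  by apply/seteqP; split => w /=; rewrite in_itv /= andbT.
rewrite invrK -[X in (_ * P X)%E]setIT -integral_indic// -ge0_integralZl_EFin//; last 2 first.
- by apply/measurable_EFinP; exact: measurable_indic.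
- exact: ltW.
apply: ge0_le_integral => //.
- by move=> w _; rewrite -EFinM lee_fin mulr_ge0// ltW.
- by apply: emeasurable_funM => //; apply/measurable_EFinP; exact: measurable_indic.
- exact/measurable_EFinP.
- move=> w _; rewrite -EFinM lee_fin indicE; case: (boolP (w \in _)) => [|_]; last by rewrite mulr0.
  by rewrite inE /= mulr1.
Qed.

Lemma tri_colsum n (c : nat -> R) (M : R) : (forall k, `|c k| <= M) ->
  forall j, \sum_i normc (tri n (fun=> 0) c i j) <= 2 * M.
Proof.
move=> hc j; have M0 : 0 <= M by apply: le_trans (hc 0%N).
have nr (x : R) : normc (x%:C) = `|x| by exact: normc_real.
apply: (@le_trans _ _ (\sum_(i < n) (M * (i.+1 == j :> nat)%:R + M * (j.+1 == i :> nat)%:R))).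
  apply: ler_sum => i _; rewrite !mxE nr.
  case: eqP => [->|_]; first by rewrite normr0 !gtn_eqF ?mulr0 ?addr0.
  case: eqP => _; first by rewrite mulr1 ler_wpDr ?mulr_ge0//; exact: hc.
  case: eqP => _; first by rewrite mulr1 ler_wpDl ?mulr_ge0//; exact: hc.
  by rewrite normr0 !mulr0 addr0.
rewrite big_split /= -!mulr_sumr -!natr_sum.
have one (Q : pred 'I_n) : (forall i i', Q i -> Q i' -> i = i') -> (\sum_i (Q i : nat))%N%:R <= 1 :> R.
  move=> hQ; rewrite lern1.
  have -> : (\sum_i (Q i : nat) = #|Q|)%N.
    by rewrite -sum1_card [RHS]big_mkcond; apply: eq_bigr => i _; rewrite unfold_in; case: (Q i).
  by apply/card_le1_eqP => i i'; rewrite !unfold_in => /hQ h /h.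
have h1 := one (fun i : 'I_n => i.+1 == j :> nat) _.
have h2 := one (fun i : 'I_n => j.+1 == i :> nat) _.
have {}h1 : (\sum_(i < n) (i.+1 == j :> nat))%N%:R <= 1 :> R.
  by apply: h1 => i i' /eqP e1 /eqP e2; apply/val_inj/succn_inj; rewrite e1 e2.
have {}h2 : (\sum_(i < n) (j.+1 == i :> nat))%N%:R <= 1 :> R.
  by apply: h2 => i i' /eqP e1 /eqP e2; apply: val_inj; rewrite /= -e1 -e2.
have := ler_wpM2l M0 h1; have := ler_wpM2l M0 h2; rewrite !mulr1; lra.
Qed.

(** The truncated matrix has its spectrum in [[- 2 M, 2 M]], so an eigenvalue beyond [4 M] is at
    least half its size away from every eigenvalue that it is coupled with; the cost of the coupling
    is the Hilbert-Schmidt distance. *)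
Lemma eigs_tail n (a c c' : nat -> R) (M : R) : (forall k, `|c' k| <= M) ->
  \sum_(i < n) tailsq (4 * M) (eigs (tri n a c) i) <=
  4 * (\sum_(1 <= k < n.+1) a k ^+ 2 + 2 * \sum_(1 <= k < n) (c k - c' k) ^+ 2).
Proof.
move=> hc'; have M0 : 0 <= M by apply: le_trans (hc' 0%N).
have uA := tri_udiag n a c; have uA' := tri_udiag n (fun=> 0) c'.
have [UA _] := uA; have [UA' _] := uA'.
have bA' := eig_bound uA' (tri_colsum hc').
have -> : \sum_(1 <= k < n.+1) a k ^+ 2 + 2 * \sum_(1 <= k < n) (c k - c' k) ^+ 2 =
    frob2 (tri n a c - tri n (fun=> 0) c').
  by rewrite tri_sub frob2_tri; congr (_ + _); apply: eq_bigr => k _; rewrite subr0.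
rewrite -(overlap_frob2 uA uA') mulr_sumr; apply: ler_sum => i _.
rewrite eigsE; set t := tailsq _ _.
have -> : t = \sum_j t * overlap (spectralmx (tri n a c)) (spectralmx (tri n (fun=> 0) c')) i j.
  by rewrite -mulr_sumr overlap_row// mulr1.
rewrite /t mulr_sumr; apply: ler_sum => j _.
rewrite [leRHS]mulrA; apply: ler_wpM2r; first exact: overlap_ge0.
have := bA' j; move: (eig (tri n a c) i) (eig (tri n _ c') j) => x y hy.
have d0 := sqr_ge0 (x - y).
rewrite /tailsq; case: ifPn => hx; last by rewrite mulr_ge0.
have h : `|x| <= 2 * `|x - y| by have := ler_normD (x - y) y; rewrite subrK; lra.
rewrite -[x ^+ 2]real_normK ?num_real// -[(x - y) ^+ 2]real_normK ?num_real//.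
have := normr_ge0 x; have := normr_ge0 (x - y); move: h; move: (`|x|) (`|x - y|) => u v; nra.
Qed.

End tails.

Section second_moment.
Variables (R : realType) (beta : probability R R) (B : probability (seqS R) R).
Hypothesis hB : indlaw (fun=> beta) B.
Hypothesis hb2 : beta.-integrable setT (EFin \o (fun b : R => b ^+ 2)).
Let m2 := \int[beta]_b (b ^+ 2).

Definition minsq (K : nat) (x : R) : R := Num.min (x ^+ 2) K%:R.

Lemma minsq_ge0 K x : 0 <= minsq K x.
Proof. by rewrite /minsq le_min sqr_ge0 ler0n. Qed.

Lemma bcont_minsq K : bcont (minsq K).
Proof.
split; last by exists K%:R => x; rewrite ger0_norm ?minsq_ge0// ge_min lexx orbT.
move=> x; apply: (@continuous_min _ _ (fun x : R => x ^+ 2 : R^o) (fun=> K%:R : R^o)); last exact: cvg_cst.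
exact: exprn_continuous.
Qed.

(** This is [eigs_tail] with the zero matrix as truncation, which gives the factor [4 * 2]. The
    constant is not sharp; only finiteness of the second moment is needed later. *)
Lemma mu_b_minsq K : \int[mu_b hB]_x minsq K x <= 8 * m2.
Proof.
have m20 : 0 <= m2 by exact: m2_ge0.
have h := @Tavg_cvg _ _ _ hB _ (bcont_minsq K).
apply: (@closed_cvg _ _ _ eventually_filter (fun n => Tavg B (minsq K) n.+1) [set x : R | x <= 8 * m2]) => //.
apply: nearW => n; rewrite /= /Tavg ler_pdivrMr ?ltr0n//.
rewrite -lee_fin; apply: (@le_trans _ _ (\int[B]_s (0 + 8 * \sum_(k <- index_iota 1 n.+1) s k ^+ 2)%:E)%E).
  apply: (@le_trans _ _ (`|\int[B]_s stsum (minsq K) n.+1 s|)%:E); first by rewrite lee_fin ler_norm.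
  apply: Eb_le_integral; first exact: bdm_stsum (bcont_minsq K).
  - apply/measurable_EFinP/measurable_funD => //; apply: measurable_funM => //.
    by apply: measurable_sum => k; apply: measurable_funX; exact: measurable_coord.
  - move=> s; rewrite lee_fin add0r ger0_norm; last by apply: sumr_ge0 => i _; exact: minsq_ge0.
    have := @eigs_tail R n.+1 (fun=> 0) s (fun=> 0) 0 _; rewrite mulr0 => h'.
    have {}h' := h' (fun k => _).
    apply: (@le_trans _ _ (\sum_(i < n.+1) tailsq 0 (eigs (tri n.+1 (fun=> 0) s) i))).
      apply: ler_sum => i _; rewrite eigsE /tailsq normr_gt0; case: eqP => [->|_]; last by rewrite ge_min lexx.
      by rewrite /minsq expr0n /= ge_min lexx.
    apply: le_trans (h' _) _; first by rewrite normr0.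
    rewrite [X in X + _]big1 ?add0r; last by move=> k _; rewrite expr0n.
    under eq_bigr do rewrite subr0.
    rewrite le_eqVlt; apply/orP; left; apply/eqP; ring.
rewrite integral_affine_sq//; last by move=> i; exact: measurable_coord.
under eq_bigr do rewrite (coord_m2 hB hb2).
rewrite sumEFin -EFinM -EFinD lee_fin add0r sumr_const_nat subn1 /=.
rewrite -mulrA ler_pM2l// -/m2.
have -> : m2 *+ n = m2 * n%:R by rewrite mulr_natr.
by rewrite ler_wpM2l// ler_nat.
Qed.

Lemma mu_b_second_moment : (\int[mu_b hB]_x (x ^+ 2)%:E <= (8 * m2)%:E)%E.
Proof.
have lim x : limn (fun K => (minsq K x)%:E) = (x ^+ 2)%:E.
  apply/cvg_lim => //; apply: cvg_near_cst; near=> K; congr (_%:E); apply/min_idPl.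
  by near: K; exact: nbhs_infty_ger.
have mm K : measurable_fun setT (fun x : R => (minsq K x)%:E).
  by apply/measurable_EFinP; case: (bcont_bdm (bcont_minsq K)).
have := @cvg_monotone_convergence _ _ _ (mu_b hB) setT measurableT (fun K x => (minsq K x)%:E) mm.
move=> /(_ _ _)/cvg_lim h.
under eq_integral => x _ do rewrite -lim.
rewrite -h//; last 2 first.
- by move=> K x _; rewrite lee_fin minsq_ge0.
- move=> x _ K K' KK'; rewrite lee_fin /minsq le_min ge_min lexx /= ge_min.
  by rewrite ler_nat KK' orbT.
apply: lime_le.
  apply: ereal_nondecreasing_is_cvgn => K K' KK'; apply: ge0_le_integral => //.
  - by move=> x _; rewrite lee_fin minsq_ge0.
  - move=> x _; rewrite lee_fin /minsq le_min ge_min lexx /= ge_min.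
    by rewrite ler_nat KK' orbT.
apply: nearW => K.
apply: le_trans (_ : ((\int[mu_b hB]_x minsq K x)%:E <= _)%E); last by rewrite lee_fin mu_b_minsq.
rewrite /Rintegral fineK//; apply: integrable_fin_num => //.
exact: bdm_integrable (bcont_bdm (bcont_minsq K)).
Unshelve. all: by end_near. Qed.

Lemma law_mul_second_moment (mu_T : probability R R) : (\int[mu_T]_t (t ^+ 2)%:E < +oo)%E ->
  (\int[law_mul mu_T (mu_b hB)]_y (y ^+ 2)%:E < +oo)%E.
Proof.
move=> hT; have msq : measurable_fun setT (fun y : R => (y ^+ 2)%:E).
  by apply/measurable_EFinP; exact: measurable_funX.
rewrite /law_mul ge0_integral_distribution//; last by move=> y; rewrite lee_fin sqr_ge0.
have mf : measurable_fun setT (fun p : R * R => (prodR p ^+ 2)%:E).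
  by apply: (measurableT_comp msq); exact: measurable_prodR.
rewrite fubini_tonelli1//; last by move=> p; rewrite lee_fin sqr_ge0.
rewrite /fubini_F.
have e (t : R) : (\int[mu_b hB]_y (prodR (t, y) ^+ 2)%:E = \int[mu_b hB]_y (y ^+ 2)%:E * (t ^+ 2)%:E)%E.
  rewrite muleC -ge0_integralZl_EFin ?sqr_ge0//; last by move=> y _; rewrite lee_fin sqr_ge0.
  by apply: eq_integral => y _; rewrite -EFinM /prodR /= exprMn.
under eq_integral do rewrite e.
set c := (\int[mu_b hB]_y (y ^+ 2)%:E)%E.
have cfin : c \is a fin_num.
  rewrite ge0_fin_numE; first by apply: le_lt_trans mu_b_second_moment (ltry _).
  by apply: integral_ge0 => y _; rewrite lee_fin sqr_ge0.
rewrite -(fineK cfin) ge0_integralZl_EFin//; last 2 first.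
- by move=> t _; rewrite lee_fin sqr_ge0.
- by rewrite fine_ge0//; apply: integral_ge0 => y _; rewrite lee_fin sqr_ge0.
by apply: lte_mul_pinfty => //; rewrite lee_fin fine_ge0//; apply: integral_ge0 => y _; rewrite lee_fin sqr_ge0.
Qed.

End second_moment.

Section tail_expectation.
Context d (Omega : measurableType d) (R : realType) (P : probability Omega R).
Variables (b : nat -> {RV P >-> R}) (a : nat -> nat -> {RV P >-> R}).
Variable sigma : nat -> nat -> R.
Variables (beta : probability R R).
Hypothesis hb2 : beta.-integrable setT (EFin \o (fun b : R => b ^+ 2)).
Hypothesis hb : forall k : nat, (1 <= k)%N -> measure_eq (distribution P (b k)) beta.
Hypothesis ha : (fun N : nat => (N%:R^-1)%:E *
  \sum_(1 <= k < N.+1) 'E_P[fun w => (`|a k N w| ^+ 2)%R])%E @ \oo --> 0%E.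
Let m2 := \int[beta]_b (b ^+ 2).

(** A bound for the spectral tail in terms of the entries alone, so that its expectation is
    explicit. It comes from truncating [sigma b] where either factor exceeds [S], and 4 and 8 are
    the constants of [eigs_tail]. *)
Definition tail_majorant (S : R) N (w : Omega) : R :=
  \sum_(1 <= k < N.+1) (4 / N%:R) * a k N w ^+ 2 +
  (\sum_(1 <= k < N) (8 / N%:R * tailsq S (sigma k N)) * b k w ^+ 2 +
   \sum_(1 <= k < N) (8 / N%:R * sigma k N ^+ 2) * tailsq S (b k w)).

Lemma tail_majorant_ge0 S N w : 0 <= tail_majorant S N w.
Proof.
have c8 : 0 <= 8 / N%:R :> R by rewrite divr_ge0.
have c4 : 0 <= 4 / N%:R :> R by rewrite divr_ge0.
rewrite /tail_majorant !addr_ge0//; apply: sumr_ge0 => k _.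
- by rewrite mulr_ge0 ?sqr_ge0.
- by rewrite mulr_ge0 ?sqr_ge0// mulr_ge0 ?tailsq_ge0.
- by rewrite mulr_ge0 ?tailsq_ge0// mulr_ge0 ?sqr_ge0.
Qed.

Lemma measurable_tail_majorant S N : measurable_fun setT (tail_majorant S N).
Proof.
have mt (k : nat) : measurable_fun setT (fun w => tailsq S (b k w)).
  by apply: measurableT_comp => //; exact: measurable_tailsq.
apply: measurable_funD; [|apply: measurable_funD]; apply: measurable_sum => k; apply: measurable_funM => //.
- exact: measurable_funX.
- exact: measurable_funX.
Qed.

Lemma esd_tailsq_le (S : R) N w : 0 <= S ->
  N%:R^-1 * \sum_(i < N) tailsq (4 * (S * S)) (eigs (Xmat b a sigma N w) i) <= tail_majorant S N w.
Proof.
move=> S0.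
(* The truncated entries are at most [S * S], which is why the spectral threshold is
   [4 * (S * S)]. *)
pose c' k : R := if (`|sigma k N| <= S) && (`|b k w| <= S) then sigma k N * b k w else 0.
have hc' k : `|c' k| <= S * S.
  rewrite /c'; case: ifP => [/andP[h1 h2]|_]; last by rewrite normr0 mulr_ge0.
  by rewrite normrM ler_pM.
have h := @eigs_tail R N (fun k => a k N w) (fun k => sigma k N * b k w) c' _ hc'.
have N0 : 0 <= N%:R^-1 :> R by rewrite invr_ge0.
apply: le_trans (ler_wpM2l N0 h) _.
set A := \sum_(1 <= k < N.+1) _; set C := \sum_(1 <= k < N) _.
have -> : N%:R^-1 * (4 * (A + 2 * C)) = 4 / N%:R * A + 8 / N%:R * C by ring.
rewrite /tail_majorant /A /C mulr_sumr lerD2l -big_split /= mulr_sumr; apply: ler_sum => k _.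
rewrite -!mulrA -!mulrDr; apply: ler_wpM2l => //; rewrite ler_wpM2l//.
have := tailsq_ge0 S (sigma k N); have := tailsq_ge0 S (b k w).
have := sqr_ge0 (sigma k N); have := sqr_ge0 (b k w).
rewrite /c' /tailsq !ltNge; case: (leP `|sigma k N| S) => h1; case: (leP `|b k w| S) => h2 /=.
- by rewrite subrr expr0n /= !(mul0r, mulr0) addr0.
- by rewrite subr0 exprMn mul0r add0r mulrA -expr2.
- by rewrite subr0 exprMn !mulr0 addr0.
- by rewrite subr0 exprMn mulrA -expr2 => ? ? ? ?; rewrite lerDl mulr_ge0.
Qed.

Lemma integral_b (f : R -> \bar R) k : (1 <= k)%N -> measurable_fun setT f -> (forall x, 0 <= f x)%E ->
  (\int[P]_w f (b k w) = \int[beta]_x f x)%E.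
Proof.
move=> k1 mf f0; rewrite -(ge0_integral_distribution (b k) mf f0).
by apply: eq_measure_integral => A mA _; exact: hb.
Qed.

Lemma m2E : (\int[beta]_x (x ^+ 2)%:E = m2%:E)%E.
Proof. by rewrite /m2 /Rintegral fineK//; exact: integrable_fin_num. Qed.

Lemma tail_majorant_expectation (S : R) N (t : R) : (\int[beta]_x (tailsq S x)%:E <= t%:E)%E ->
  (\int[P]_w (tail_majorant S N w)%:E <=
    4%:E * ((N%:R^-1)%:E * \sum_(1 <= k < N.+1) 'E_P[fun w => (`|a k N w| ^+ 2)%R]) +
    ((8 * m2 * (N%:R^-1 * \sum_(1 <= k < N) tailsq S (sigma k N)))%:E +
     (8 * t * (N%:R^-1 * \sum_(1 <= k < N) sigma k N ^+ 2))%:E))%E.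
Proof.
move=> ht.
have c8 : 0 <= 8 / N%:R :> R by rewrite divr_ge0.
have c4 : 0 <= 4 / N%:R :> R by rewrite divr_ge0.
have mt (k : nat) : measurable_fun setT (fun w => tailsq S (b k w)).
  by apply: measurableT_comp => //; exact: measurable_tailsq.
have ms1 : measurable_fun setT (fun w => \sum_(1 <= k < N.+1) (4 / N%:R) * a k N w ^+ 2).
  by apply: measurable_sum => k; apply: measurable_funM => //; exact: measurable_funX.
have ms2 : measurable_fun setT (fun w => \sum_(1 <= k < N) (8 / N%:R * tailsq S (sigma k N)) * b k w ^+ 2).
  by apply: measurable_sum => k; apply: measurable_funM => //; exact: measurable_funX.
have ms3 : measurable_fun setT (fun w => \sum_(1 <= k < N) (8 / N%:R * sigma k N ^+ 2) * tailsq S (b k w)).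
  by apply: measurable_sum => k; apply: measurable_funM.
have n1 w : 0 <= \sum_(1 <= k < N.+1) (4 / N%:R) * a k N w ^+ 2.
  by apply: sumr_ge0 => k _; rewrite mulr_ge0 ?sqr_ge0.
have n2 w : 0 <= \sum_(1 <= k < N) (8 / N%:R * tailsq S (sigma k N)) * b k w ^+ 2.
  by apply: sumr_ge0 => k _; rewrite mulr_ge0 ?sqr_ge0// mulr_ge0 ?tailsq_ge0.
have n3 w : 0 <= \sum_(1 <= k < N) (8 / N%:R * sigma k N ^+ 2) * tailsq S (b k w).
  by apply: sumr_ge0 => k _; rewrite mulr_ge0 ?tailsq_ge0// mulr_ge0 ?sqr_ge0.
rewrite /tail_majorant; under eq_integral do rewrite EFinD EFinD.
rewrite ge0_integralD//; last 4 first.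
- by move=> w _; rewrite lee_fin.
- exact/measurable_EFinP.
- by move=> w _; rewrite -EFinD lee_fin addr_ge0.
- by apply: emeasurable_funD; apply/measurable_EFinP.
rewrite ge0_integralD//; last 4 first.
- by move=> w _; rewrite lee_fin.
- exact/measurable_EFinP.
- by move=> w _; rewrite lee_fin.
- exact/measurable_EFinP.
apply: leeD.
  rewrite (integral_wsum _ _ (c := fun=> 4 / N%:R) (X := fun k w => a k N w ^+ 2))//; last 2 first.
  - by move=> k w; exact: sqr_ge0.
  - by move=> k; exact: measurable_funX.
  under eq_bigr do rewrite -a_sq.
  rewrite -ge0_sume_distrr; last by move=> k _; rewrite unlock; apply: integral_ge0 => w _; rewrite lee_fin sqr_ge0.
  by rewrite EFinM -muleA.
apply: leeD.
  rewrite (integral_wsum _ _ (c := fun k => 8 / N%:R * tailsq S (sigma k N)) (X := fun k w => b k w ^+ 2))//; last 3 first.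
  - by move=> k; rewrite mulr_ge0 ?tailsq_ge0.
  - by move=> k w; exact: sqr_ge0.
  - by move=> k; exact: measurable_funX.
  rewrite (eq_big_nat _ _ (F2 := fun k => (8 / N%:R * tailsq S (sigma k N) * m2)%:E)).
    rewrite sumEFin lee_fin !mulr_sumr le_eqVlt; apply/orP; left; apply/eqP.
    by apply: eq_bigr => k _; ring.
  move=> k /andP[k1 _]; rewrite (integral_b (f := fun x => (x ^+ 2)%:E))// ?m2E//.
  - by apply/measurable_EFinP; exact: measurable_funX.
  - by move=> x; rewrite lee_fin sqr_ge0.
rewrite (integral_wsum _ _ (c := fun k => 8 / N%:R * sigma k N ^+ 2) (X := fun k w => tailsq S (b k w)))//; last 2 first.
- by move=> k; rewrite mulr_ge0 ?sqr_ge0.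
- by move=> k w; exact: tailsq_ge0.
apply: (@le_trans _ _ (\sum_(1 <= k < N) (8 / N%:R * sigma k N ^+ 2 * t)%:E)%E).
  rewrite !big_nat; apply: lee_sum => k /andP[k1 _].
  rewrite (integral_b (f := fun x => (tailsq S x)%:E))//; last 2 first.
  - by apply/measurable_EFinP; exact: measurable_tailsq.
  - by move=> x; rewrite lee_fin tailsq_ge0.
  by rewrite [leRHS]EFinM lee_wpmul2l// lee_fin mulr_ge0 ?sqr_ge0.
rewrite sumEFin lee_fin !mulr_sumr le_eqVlt; apply/orP; left; apply/eqP.
by apply: eq_bigr => k _; ring.
Qed.

End tail_expectation.

Lemma cvge0_of (R : realType) (u : nat -> \bar R) : (forall n, 0 <= u n)%E ->
  (forall e : R, 0 < e -> \forall n \near \oo, (u n <= e%:E)%E) -> u @ \oo --> 0%E.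
Proof.
move=> u0 hu; have fin n (e : R) : (u n <= e%:E)%E -> u n \is a fin_num.
  by move=> h; rewrite ge0_fin_numE//; exact: le_lt_trans h (ltry _).
apply/fine_cvgP; split; first by have := hu 1 ltr01; apply: filterS => n; exact: fin.
apply/cvgrPdist_le => e e0; have := hu e e0; apply: filterS => n h.
have fn := fin _ _ h; rewrite /= sub0r normrN ger0_norm ?fine_ge0//.
by rewrite -lee_fin fineK.
Qed.

Lemma near_all_lt J (Q : nat -> nat -> Prop) : (forall j, \forall N \near \oo, Q j N) ->
  \forall N \near \oo, forall j, (j < J)%N -> Q j N.
Proof.
move=> h; elim: J => [|J IH]; first exact: nearW.
apply: filterS2 IH (h J) => N hJ hN j; rewrite ltnS leq_eqVlt => /orP[/eqP ->//|].
exact: hJ.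
Qed.

Lemma finite_union_le d (T : measurableType d) (R : realType) (P : probability T R) J (E : nat -> set T) :
  (forall j, measurable (E j)) ->
  measurable [set w | exists2 j, (j < J)%N & E j w] /\
  (P [set w | exists2 j, (j < J)%N & E j w] <= \sum_(j < J) P (E j))%E.
Proof.
move=> mE; elim: J => [|J [mJ IH]].
  have -> : [set w | exists2 j, (j < 0)%N & E j w] = set0 by apply/seteqP; split => w // -[].
  by rewrite big_ord0 measure0.
have -> : [set w | exists2 j, (j < J.+1)%N & E j w] = [set w | exists2 j, (j < J)%N & E j w] `|` E J.
  apply/seteqP; split => w /=.
    by move=> [j]; rewrite ltnS leq_eqVlt => /orP[/eqP ->|jJ] h; [right|left; exists j].
  by move=> [[j jJ h]|h]; [exists j => //; exact: ltnW|exists J].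
split; first exact: measurableU.
by rewrite big_ord_recr /=; apply: le_trans (measureU2 _ mJ (mE J)) _; exact: leeD.
Qed.

(** * Convergence in probability of the Wasserstein distance *)

Section wasserstein_limit.
Context d (Omega : measurableType d) (R : realType) (P : probability Omega R).
Variables (b : nat -> {RV P >-> R}) (a : nat -> nat -> {RV P >-> R}).
Variable sigma : nat -> nat -> R.
Variables (beta : probability R R) (B : probability (seqS R) R).
Hypothesis hB : indlaw (fun=> beta) B.
Hypothesis hb2 : beta.-integrable setT (EFin \o (fun b : R => b ^+ 2)).
Hypothesis indep : mutually_independent coef_index (coef_family b a).
Hypothesis hb : forall k : nat, (1 <= k)%N -> measure_eq (distribution P (b k)) beta.
Hypothesis ha : (fun N : nat => (N%:R^-1)%:E *
  \sum_(1 <= k < N.+1) 'E_P[fun w => (`|a k N w| ^+ 2)%R])%E @ \oo --> 0%E.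
Variable mu_T : probability R R.
Hypothesis hw : weak_cvg2 (sigma_pairs sigma) (law_diag mu_T).
Hypothesis hT : (\int[mu_T]_t (t ^+ 2)%:E < +oo)%E.
Hypothesis hW : (fun N => W2 (sigma_marginal sigma N) mu_T) @ \oo --> 0%E.
Let m2 := \int[beta]_b (b ^+ 2).
Let nu := law_mul mu_T (mu_b hB).
Let mT := fine (\int[mu_T]_t (t ^+ 2)%:E)%E.

Lemma sigma_average (f : R -> R) N (c : R) : (1 < N)%N -> measurable_fun setT f -> (forall x, 0 <= f x) ->
  (\int[sigma_marginal sigma N]_x (f x)%:E <= c%:E)%E -> N%:R^-1 * \sum_(1 <= k < N) f (sigma k N) <= c.
Proof.
move=> N1 mf f0; rewrite /sigma_marginal integral_empirical; last 2 first.
- exact/measurable_EFinP.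
- by move=> x; rewrite lee_fin.
rewrite size_map size_iota big_map sumEFin -EFinM lee_fin; apply: le_trans.
apply: ler_wpM2r; first by apply: sumr_ge0.
by rewrite lef_pV2 ?posrE ?ltr0n ?subn_gt0// ?ler_nat ?leq_subr// ltnW.
Qed.

(* The weights have uniformly small second-moment tails because they are W2-close to mu_T. *)
Lemma tail_small (kappa : R) : 0 < kappa -> exists2 S : R, 0 <= S &
  \forall N \near \oo, (\int[P]_w (tail_majorant b a sigma S N w)%:E <= kappa%:E)%E.
Proof.
move=> k0; have m20 : 0 <= m2 by exact: m2_ge0.
have mT0 : 0 <= mT by apply: fine_ge0; apply: integral_ge0 => t _; rewrite lee_fin sqr_ge0.
have eT : (\int[mu_T]_t (t ^+ 2)%:E = mT%:E)%E.
  by rewrite /mT fineK// ge0_fin_numE//; apply: integral_ge0 => t _; rewrite lee_fin sqr_ge0.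
(* The three parts of the expected majorant, from the diagonal, the tails of the weights and the
   tails of [beta], are at most [kappa / 4] each. *)
pose e1 := kappa / (256 * (m2 + 1)).
have e10 : 0 < e1 by rewrite divr_gt0// mulr_gt0// ltr_wpDl.
pose e2 := kappa / (64 * (1 + mT)).
have e20 : 0 < e2 by rewrite divr_gt0// mulr_gt0// ltr_pwDl.
have h2beta : (\int[beta]_x (x ^+ 2)%:E < +oo)%E by rewrite (m2E hb2) ltry.
have tT := tailsq_vanish e10 hT; have tb := tailsq_vanish e20 h2beta.
have [S [S1 S2]] : exists S : nat, (\int[mu_T]_x (tailsq S%:R x)%:E <= e1%:E)%E /\
    (\int[beta]_x (tailsq S%:R x)%:E <= e2%:E)%E.
  by have [S _ /(_ S (leqnn S)) hS] := filterI tT tb; exists S.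
exists (2 * S%:R); first by rewrite mulr_ge0.
have {}S2 : (\int[beta]_x (tailsq (2 * S%:R) x)%:E <= e2%:E)%E.
  apply: le_trans S2; apply: ge0_le_integral => //.
  - by move=> x _; rewrite lee_fin tailsq_ge0.
  - exact: measurable_tailsqE.
  - exact: measurable_tailsqE.
  - by move=> x _; rewrite lee_fin; apply: tailsq_antimono; have := ler0n R S; lra.
(* The cost of a coupling of the weights with [mu_T] is to be below [e1], for their tails, and below
   1, for their second moment. *)
pose e3 := Num.min 1 e1.
have e30 : 0 < e3 by rewrite lt_min ltr01.
pose e4 := Num.sqrt e3.
have e40 : 0 < e4 by rewrite sqrtr_gt0.
have e4E : e4 ^+ 2 = e3 by rewrite sqr_sqrtr// ltW.
have nW := cvge0_lt e40 hW.
have k16 : 0 < kappa / 16 by rewrite divr_gt0.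
have nA := cvge0_lt k16 ha.
near=> N; have N1 : (1 < N)%N by near: N; exact: nbhs_infty_gt.
have hWN : (W2 (sigma_marginal sigma N) mu_T < e4%:E)%E by near: N.
have hAN : ((N%:R^-1)%:E * \sum_(1 <= k < N.+1) 'E_P[fun w => (`|a k N w| ^+ 2)%R] < (kappa / 16)%:E)%E by near: N.
have [pi hpi hcost] := W2_lt (ltW e40) hWN; rewrite e4E in hcost.
apply: le_trans (tail_majorant_expectation _ _ hb2 hb _ S2) _.
have A1 : N%:R^-1 * \sum_(1 <= k < N) tailsq (2 * S%:R) (sigma k N) <= 8 * e1.
  apply: sigma_average => //; [exact: measurable_tailsq|exact: tailsq_ge0|].
  apply: le_trans (coupling_tailsq (ler0n R S) hpi) _.
  apply: (@le_trans _ _ (4%:E * e3%:E + 4%:E * e1%:E)%E).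
    by apply: leeD; rewrite lee_wpmul2l// ltW.
  rewrite -!EFinM -EFinD lee_fin; have : e3 <= e1 by rewrite ge_min lexx orbT.
  lra.
have A2 : N%:R^-1 * \sum_(1 <= k < N) sigma k N ^+ 2 <= 2 * (1 + mT).
  have msq : measurable_fun setT (fun x : R => x ^+ 2) by exact: measurable_funX.
  apply: (sigma_average N1 msq (fun x => sqr_ge0 x)).
  apply: le_trans (coupling_le (f := fun x => x ^+ 2) (g := fun x => x ^+ 2) (c := 2) (c' := 2) hpi _ _ _ _ _ _ _) _ => //.
  - by move=> x; exact: sqr_ge0.
  - by move=> x; exact: sqr_ge0.
  - by move=> x y; have := sqr_ge0 (x - 2 * y); lra.
  rewrite eT.
  apply: (@le_trans _ _ (2%:E * e3%:E + 2%:E * mT%:E)%E).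
    by apply: leeD => //; rewrite lee_wpmul2l// ltW.
  rewrite -!EFinM -EFinD lee_fin; have : e3 <= 1 by rewrite ge_min lexx.
  lra.
apply: (@le_trans _ _ (4%:E * (kappa / 16)%:E + ((8 * m2 * (8 * e1))%:E + (8 * e2 * (2 * (1 + mT)))%:E))%E).
  apply: leeD; first by rewrite lee_wpmul2l// ltW.
  apply: leeD; rewrite lee_fin.
    by apply: ler_wpM2l => //; rewrite mulr_ge0.
  by apply: ler_wpM2l => //; rewrite mulr_ge0// ltW.
rewrite -EFinM -!EFinD lee_fin.
have -> : 8 * e2 * (2 * (1 + mT)) = kappa / 4.
  by rewrite /e2; field; rewrite gt_eqF// ltr_pwDl.
have : 256 * ((m2 + 1) * e1) = kappa.
  by rewrite /e1; field; rewrite gt_eqF// ltr_wpDl.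
have : m2 * e1 <= (m2 + 1) * e1 by rewrite ler_pM2r// lerDl.
have : 0 <= m2 * e1 by rewrite mulr_ge0// ltW.
have -> : 8 * m2 * (8 * e1) = 64 * (m2 * e1) by ring.
move: (m2 * e1) ((m2 + 1) * e1) => u v; lra.
Unshelve. all: by end_near. Qed.

Lemma W2_esd_bound (q m N : nat) (delta : R) w : (0 < q)%N -> (0 < N)%N ->
  (forall j, (j < (2 * (m * q)).+2)%N ->
    `|Zavg b a sigma (ramp q j (m * q)) N w - \int[nu]_x ramp q j (m * q) x| <= delta) ->
  forall (eps t1 t2 : R), 0 <= eps ->
  N%:R^-1 * \sum_(i < N) tailsq m%:R (eigs (Xmat b a sigma N w) i) <= t1 ->
  (\int[nu]_x (tailsq m%:R x)%:E <= t2%:E)%E ->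
  4 / q%:R ^+ 2 + 8 * m%:R ^+ 2 * (2 * (m * q)).+2%:R * delta + (4 * t1 + 4 * t2) <= eps ^+ 2 ->
  (W2 (esd (Xmat b a sigma N w)) nu <= eps%:E)%E.
Proof.
move=> q0 N0 hZ eps t1 t2 eps0 h1 h2 he.
set A := Xmat b a sigma N w in h1 *.
have A1 : esd A setT = 1%E.
  rewrite esd_emp empE; under eq_bigr do rewrite diracT.
  by rewrite sumEFin sumr_const card_ord -EFinM mulVf// pnatr_eq0 -lt0n.
have hr j : (j < (2 * (m * q)).+2)%N ->
    `|\int[mkprob A1]_x ramp q j (m * q) x - \int[nu]_x ramp q j (m * q) x| <= delta.
  move=> hj; have := hZ j hj.
  have -> : \int[mkprob A1]_x ramp q j (m * q) x = Zavg b a sigma (ramp q j (m * q)) N w => //.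
  by apply: (@esd_integral _ _ _ P b a sigma); case: (bcont_bdm (bcont_ramp R q j (m * q))).
have [pi hpi hc] := quantile_coupling_cost q0 hr.
have hpi' : coupling (esd A) nu pi by exact: hpi.
apply: (W2_le eps0 hpi'); apply: le_trans hc _.
have T1 : (\int[mkprob A1]_x (tailsq m%:R x)%:E <= t1%:E)%E.
  have -> : (\int[mkprob A1]_x (tailsq m%:R x)%:E = \int[esd A]_x (tailsq m%:R x)%:E)%E by [].
  rewrite esd_emp /emp integral_empirical; last 2 first.
  - exact: measurable_tailsqE.
  - by move=> x; rewrite lee_fin tailsq_ge0.
  rewrite size_mkseq /mkseq big_map (_ : iota 0 N = index_iota 0 N); last by rewrite /index_iota subn0.
  rewrite big_mkord sumEFin -EFinM lee_fin.
  exact: h1.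
apply: (@le_trans _ _ ((4 / q%:R ^+ 2 + 8 * m%:R ^+ 2 * (2 * (m * q)).+2%:R * delta)%:E + (4%:E * t1%:E + 4%:E * t2%:E))%E).
  by apply: leeD => //; apply: leeD; rewrite lee_wpmul2l.
by rewrite -!EFinM -!EFinD lee_fin.
Qed.

(** The mesh [q] comes from [eps], the truncation [S] from [tail_small], the range [m] from [S] and
    the tail of [nu], and [delta] from [q] and [m]. Off finitely many deviation events and one
    Markov event, the four terms of [W2_esd_bound] are at most [eps^2 / 4] each. *)
Lemma W2_esd_cvg : cvg_in_probability0 P (fun N w => W2 (esd (Xmat b a sigma N w)) nu).
Proof.
move=> eps eps0; apply: cvge0_of; first by move=> N; exact: measure_ge0.
move=> eta eta0; have h2nu : (\int[nu]_y (y ^+ 2)%:E < +oo)%E by exact: law_mul_second_moment.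
have [q q0 hq] := small_inv (divr_gt0 eps0 (ltr0n _ 4)).
have eps20 : 0 < eps ^+ 2 / 16 by rewrite divr_gt0// exprn_gt0.
(* Markov's inequality at level [eps^2 / 16] then gives probability at most [eta / 2]; the deviation
   events take the other half. *)
have kap0 : 0 < eta / 2 * (eps ^+ 2 / 16) by rewrite mulr_gt0// divr_gt0.
have [S S0 hS] := tail_small kap0.
have [m [m0 mS hm]] : exists m : nat, [/\ (0 < m)%N, 4 * (S * S) <= m%:R &
    (\int[nu]_x (tailsq m%:R x)%:E <= (eps ^+ 2 / 16)%:E)%E].
  near \oo => m; exists m; split.
  - by near: m; exact: nbhs_infty_gt.
  - by near: m; exact: nbhs_infty_ger.
  - by near: m; exact: tailsq_vanish.
pose J := (2 * (m * q)).+2; pose C : R := 8 * m%:R ^+ 2 * J%:R.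
have C0 : 0 <= C by rewrite /C mulr_ge0// mulr_ge0// sqr_ge0.
pose delta := Num.min 1 (eps ^+ 2 / (4 * (C + 1))).
have delta0 : 0 < delta.
  by rewrite lt_min ltr01 divr_gt0 ?exprn_gt0// mulr_gt0// ltr_wpDl.
have Cdelta : C * delta <= eps ^+ 2 / 4.
  have h1 : C * delta <= (C + 1) * delta by rewrite ler_pM2r// lerDl.
  have h2 : (C + 1) * delta <= (C + 1) * (eps ^+ 2 / (4 * (C + 1))).
    by rewrite ler_pM2l ?ltr_wpDl// ge_min lexx orbT.
  apply: le_trans h1 (le_trans h2 _); rewrite le_eqVlt; apply/orP; left; apply/eqP; field.
  by rewrite gt_eqF// ltr_wpDl.
have d20 : 0 < delta / 2 by rewrite divr_gt0.
have d21 : 0 < delta / 2 <= 1.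
  have : delta <= 1 by rewrite ge_min lexx.
  by rewrite d20 /=; lra.
pose f j := ramp q j (m * q) : R -> R.
pose E N j := [set w | delta / 2 <= `|Zavg b a sigma (f j) N w - \int[P]_w Zavg b a sigma (f j) N w|].
have mE N j : measurable (E N j).
  rewrite -[X in measurable X]setTI.
  pose g w := `|Zavg b a sigma (f j) N w - \int[P]_w Zavg b a sigma (f j) N w|.
  rewrite (_ : E N j = g @^-1` `[delta / 2, +oo[%classic).
    have [mg _] : bdm g.
      by apply: bdm_norm; apply: bdmB; [apply: bdm_Zavg; exact: bcont_ramp|exact: bdm_cst].
    exact: mg.
  by apply/seteqP; split => w /=; rewrite in_itv /= andbT.
pose T N := [set w | eps ^+ 2 / 16 <= tail_majorant b a sigma S N w].
have mT' N : measurable (T N).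
  rewrite -[X in measurable X]setTI.
  rewrite (_ : T N = tail_majorant b a sigma S N @^-1` `[eps ^+ 2 / 16, +oo[%classic).
    exact: measurable_tail_majorant.
  by apply/seteqP; split => w /=; rewrite in_itv /= andbT.
pose x := expR (- ((delta / 2) ^+ 2 / 8)).
have x1 : `|x| < 1.
  by rewrite ger0_norm ?expR_ge0// expR_lt1 oppr_lt0 divr_gt0// exprn_gt0.
have hexp : \forall N \near \oo, J%:R * 2 * x ^+ N <= eta / 2.
  have lim : J%:R * 2 * x ^+ N @[N --> \oo] --> J%:R * 2 * (0 : R) by apply: cvgMr; exact: cvg_expr.
  rewrite mulr0 in lim; have e2 : 0 < eta / 2 by rewrite divr_gt0.
  have /cvgrPdist_le/(_ _ e2) := lim; apply: filterS => N; rewrite sub0r normrN; exact: le_trans (ler_norm _).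
have hEZ : \forall N \near \oo, forall j, (j < J)%N ->
    `|\int[nu]_x f j x - \int[P]_w Zavg b a sigma (f j) N w| <= delta / 2.
  apply: near_all_lt => j.
  by have /cvgrPdist_le/(_ _ d20) := @EZ_ramp_cvg _ _ _ _ _ _ sigma _ _ hB hb2 indep hb ha _ hw q j (m * q)%N.
near=> N; have N0 : (0 < N)%N by near: N; exact: nbhs_infty_gt.
have hSN : (\int[P]_w (tail_majorant b a sigma S N w)%:E <= (eta / 2 * (eps ^+ 2 / 16))%:E)%E by near: N.
have hexpN : J%:R * 2 * x ^+ N <= eta / 2 by near: N.
have hEZN : forall j, (j < J)%N -> `|\int[nu]_x f j x - \int[P]_w Zavg b a sigma (f j) N w| <= delta / 2 by near: N.
have [mU hU] := finite_union_le P J (mE N).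
set U := [set w | exists2 j, (j < J)%N & E N j w] in mU hU.
have PU : (P U <= (eta / 2)%:E)%E.
  apply: le_trans hU _; apply: (@le_trans _ _ (\sum_(j < J) (2 * x ^+ N)%:E)%E).
    apply: lee_sum => j _; have := Zavg_tail sigma indep q j (m * q) N0 d21.
    have -> // : expR (- (N%:R * (delta / 2) ^+ 2 / 8)) = x ^+ N.
    by rewrite /x -expRM_natl; congr expR; ring.
  by rewrite sumEFin lee_fin sumr_const card_ord -[_ *+ _]mulr_natl mulrA.
have PT : (P (T N) <= (eta / 2)%:E)%E.
  apply: le_trans (markov_ge0 P eps20 (measurable_tail_majorant b a sigma S N) (tail_majorant_ge0 b a sigma S N)) _.
  apply: (@le_trans _ _ (((eps ^+ 2 / 16)^-1)%:E * (eta / 2 * (eps ^+ 2 / 16))%:E)%E).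
    by rewrite lee_wpmul2l// lee_fin invr_ge0 ltW.
  by rewrite -EFinM lee_fin mulrCA mulVf ?mulr1// gt_eqF.
(* Comparing probabilities by inclusion requires the event itself to be measurable. *)
have mW : measurable [set w | (eps%:E < `|W2 (esd (Xmat b a sigma N w)) nu|)%E].
  pose g w := fine (W2 (esd (tri N (fun k => a k N w) (fun k => sigma k N * b k w))) nu).
  have mg : measurable_fun setT g.
    apply: (measurable_W2_tri N0 h2nu (a := fun k w => a k N w) (c := fun k w => sigma k N * b k w)) => // k.
    exact: measurable_funM.
  rewrite -[X in measurable X]setTI.
  rewrite (_ : [set w | _] = g @^-1` `]eps, +oo[%classic); first exact: mg.
  apply/seteqP; split => w /=; rewrite in_itv /= andbT gee0_abs ?W2_ge0//.
    by rewrite -lte_fin /g fineK//; exact: W2_esd_fin.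
  by rewrite -lte_fin /g fineK//; exact: W2_esd_fin.
apply: (@le_trans _ _ (P (U `|` T N))).
  apply: le_measure; rewrite ?inE//; first exact: measurableU.
  move=> w /=; rewrite gee0_abs ?W2_ge0// => hw'; apply: contrapT => /not_orP[nU nT].
  move: hw'; apply/negP; rewrite -leNgt.
  have nE j : (j < J)%N -> `|Zavg b a sigma (f j) N w - \int[nu]_x f j x| <= delta.
    move=> jJ; have h1 := hEZN j jJ.
    have h2 : `|Zavg b a sigma (f j) N w - \int[P]_w Zavg b a sigma (f j) N w| < delta / 2.
      by rewrite ltNge; apply/negP => h; apply: nU; exists j.
    move: h1 h2; rewrite !ler_norml ltr_norml => /andP[? ?] /andP[? ?]; apply/andP; split; lra.
  have nT' : tail_majorant b a sigma S N w <= eps ^+ 2 / 16.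
    by rewrite leNgt; apply/negP => h; apply: nT; exact: ltW.
  apply: (W2_esd_bound q0 N0 nE (ltW eps0) _ hm).
    apply: le_trans nT'; apply: le_trans (esd_tailsq_le b a sigma N w S0).
    rewrite ler_wpM2l ?invr_ge0//; apply: ler_sum => i _; exact: tailsq_antimono.
  rewrite -/J -/C.
  have : 4 / q%:R ^+ 2 <= eps ^+ 2 / 4.
    have -> : 4 / q%:R ^+ 2 = 4 * q%:R^-1 ^+ 2 :> R by rewrite exprVn.
    have : q%:R^-1 ^+ 2 <= (eps / 4) ^+ 2.
      by rewrite ler_sqr ?nnegrE ?invr_ge0// divr_ge0// ltW.
    rewrite expr_div_n; move: (_ ^-1 ^+ 2) => u; have -> : (4 : R) ^+ 2 = 16 by ring.
    lra.
  by move: Cdelta; move: (C * delta) (4 / _) => u v; lra.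
apply: le_trans (measureU2 _ mU (mT' N)) _.
have -> : eta = eta / 2 + eta / 2 by rewrite -splitr.
by rewrite EFinD; exact: leeD.
Unshelve. all: by end_near. Qed.

End wasserstein_limit.

(** The quantifier on [mu_b] precedes the one on the probability space: this expresses that it
    depends on [beta] only. The law [L] plays the part of the common law of [S_1(z)] and
    [S_2(z)]. *)
Theorem theorem1p12 (R : realType) (beta : probability R R)
    (beta2 : ('E_beta[fun x : R => (x ^+ 2)%R] < +oo)%E) :
  let beta_std : R := Num.sqrt (fine 'E_beta[fun x : R => (x ^+ 2)%R]%E) in
  exists mu_b : probability R R,
    [/\ forall z : R[i], beta_std < complex.Im z ->
          (exists2 L : probability (borelC R) R, rde_solution beta z L &
             forall L' : probability (borelC R) R,
               rde_solution beta z L' -> measure_eq L' L) /\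
          (forall L : probability (borelC R) R, rde_solution beta z L ->
             stieltjes mu_b z = rde_expectation beta z L),
        forall mu : probability R R,
          (forall (z : R[i]) (L : probability (borelC R) R),
             beta_std < complex.Im z -> rde_solution beta z L ->
             stieltjes mu z = rde_expectation beta z L) ->
          measure_eq mu mu_b,
        analytic_on (@upper_half_plane R) (stieltjes mu_b),
        forall G : R[i] -> R[i], analytic_on (@upper_half_plane R) G ->
          (forall (z : R[i]) (L : probability (borelC R) R),
             beta_std < complex.Im z -> rde_solution beta z L ->
             G z = rde_expectation beta z L) ->
          forall z, upper_half_plane z -> G z = stieltjes mu_b z &
    forall (d : measure_display) (Omega : measurableType d)
      (P : probability Omega R) (b : nat -> {RV P >-> R})
      (a : nat -> nat -> {RV P >-> R}) (sigma : nat -> nat -> R)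
      (mu_T : probability R R),
      mutually_independent coef_index (coef_family b a) ->
      (forall k : nat, (1 <= k)%N -> measure_eq (distribution P (b k)) beta) ->
      (fun N : nat => (N%:R^-1)%:E *
         \sum_(1 <= k < N.+1) 'E_P[fun w => (`|a k N w| ^+ 2)%R])%E @ \oo --> 0%E ->
      weak_cvg2 (sigma_pairs sigma) (law_diag mu_T) ->
      [/\ {ae P, forall w, weak_cvg (fun N => esd (Xmat b a sigma N w))
                                    (law_mul mu_T mu_b)},
          forall z : R[i], upper_half_plane z ->
            stieltjes (law_mul mu_T mu_b) z =
            Cintegral (mu_T \x mu_b)%E
              (fun p : R * R => (z - (p.1 * p.2)%:C)^-1) &
          ('E_mu_T[fun t : R => (t ^+ 2)%R] < +oo)%E ->
          (fun N => W2 (sigma_marginal sigma N) mu_T) @ \oo --> 0%E ->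
          cvg_in_probability0 P
            (fun N w => W2 (esd (Xmat b a sigma N w)) (law_mul mu_T mu_b))]].
Proof.
move=> beta_std.
have [B hB] := iid_exists beta.
have m2E' : ('E_beta[fun x : R => (x ^+ 2)%R] = \int[beta]_x (x ^+ 2)%:E)%E by rewrite unlock.
have hb2 : beta.-integrable setT (EFin \o (fun b : R => b ^+ 2)).
  apply/integrableP; split; first by apply/measurable_EFinP; exact: measurable_funX.
  move: beta2; rewrite m2E'; congr (_ < _)%E; apply: eq_integral => x _ /=.
  by rewrite ger0_norm ?sqr_ge0.
have m20 := m2_ge0 beta.
(* The threshold on [Im z] is the condition [kappa < 1] for the contraction. *)
have below (z : R[i]) : beta_std < complex.Im z ->
    0 < complex.Im z /\ (\int[beta]_b (b ^+ 2)) / (complex.Im z) ^+ 2 < 1.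
  move=> hz; have z0 : 0 < complex.Im z by apply: le_lt_trans hz; exact: sqrtr_ge0.
  split => //; rewrite ltr_pdivrMr ?exprn_gt0// mul1r.
  have -> : \int[beta]_b (b ^+ 2) = beta_std ^+ 2.
    by rewrite /beta_std m2E' sqr_sqrtr.
  by rewrite ltr_sqr ?nnegrE ?sqrtr_ge0// ltW.
have rdeE (z : R[i]) (L : probability (borelC R) R) : beta_std < complex.Im z ->
    rde_solution beta z L -> stieltjes (mu_b hB) z = rde_expectation beta z L.
  by move=> /below[z0 k1] sL; exact: (stieltjes_mu_b z0 hb2 k1 hB sL).
have rde_ex (z : R[i]) : beta_std < complex.Im z ->
    exists L : probability (borelC R) R, rde_solution beta z L.
  by move=> /below[z0 k1]; exact: (rde_exists z0 hb2 k1 hB).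
have anal (mu : probability R R) : analytic_on (@upper_half_plane R) (stieltjes mu).
  exact: stieltjes_analytic.
(* The identity theorem is applied to the difference, which vanishes above height [beta_std]. *)
have uniq (G G' : R[i] -> R[i]) : analytic_on (@upper_half_plane R) G -> analytic_on (@upper_half_plane R) G' ->
    (forall z, beta_std < complex.Im z -> G z = G' z) -> forall z, upper_half_plane z -> G z = G' z.
  move=> aG aG' h z hz; apply/eqP; rewrite -subr_eq0; apply/eqP.
  pose D w := G w - G' w.
  have aD : analytic_on (@upper_half_plane R) D.
    by move=> w hw; apply: derivableB; [exact: aG|exact: aG'].
  have D0 w : beta_std < complex.Im w -> D w = 0 by move=> hw; rewrite /D (h w hw) subrr.
  exact: (identity_theorem aD D0 hz).
exists (mu_b hB); split.
- move=> z hz; split; last by move=> L; exact: rdeE.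
  have [L sL] := rde_ex z hz; exists L => // L' sL' A mA.
  have [z0 k1] := below z hz.
  exact: (rde_unique z0 hb2 hB k1 sL' sL mA).
- move=> mu hmu A mA.
  apply: (@stieltjes_inj R mu (mu_b hB)) => // z z0.
  apply: (uniq _ _ (anal mu) (anal (mu_b hB))) => // w hw.
  by have [L sL] := rde_ex w hw; rewrite (hmu w L)// (rdeE w L).
- exact: anal.
- move=> G aG hG; apply: (uniq _ _ aG (anal (mu_b hB))) => z hz.
  by have [L sL] := rde_ex z hz; rewrite (hG z L)// (rdeE z L).
- move=> d Omega P b a sigma mu_T indep hb ha hw; split.
  + exact: (esd_weak_cvg hB hb2 indep hb ha hw).
  + by move=> z z0; exact: stieltjes_law_mul.
  + rewrite unlock => hT hW.
    exact: (W2_esd_cvg hB hb2 indep hb ha hw hT hW).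
Qed.
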